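(* Fix $n\in\mathbb{N}$, $1<p<\infty$, $\mu\in[0,1]$ and $\Lambda\in[1,\infty)$. Suppose $\mathbf{a}:\mathbb{R}^n\times\mathbb{R}^n\to\mathbb{R}^n$ is a Carathéodory function that is $\mathbb{Z}^n$-periodic in the first variable. Assume that both $\mathbf{b}=\mathbf{a}$ and $\mathbf{b}=\overline{\mathbf{a}}$ (the corresponding homogenized operator, viewed as independent of $x$) satisfy, for all $x,\xi,\xi_1,\xi_2\in\mathbb{R}^n$, $$\Lambda\langle\mathbf{b}(x,\xi_1)-\mathbf{b}(x,\xi_2),\xi_1-\xi_2\rangle\ge\begin{cases}|\xi_1-\xi_2|^p&\text{if }p\ge2,\\(\mu+|\xi_1|+|\xi_2|)^{p-2}|\xi_1-\xi_2|^2&\text{if }p<2,\end{cases}\qquad|\mathbf{b}(x,\xi)|\le\Lambda(\mu+|\xi|)^{p-1},$$ and that $$|\mathbf{a}(x,\xi_1)-\mathbf{a}(x,\xi_2)|+|\overline{\mathbf{a}}(\xi_1)-\overline{\mathbf{a}}(\xi_2)|\le\Lambda\begin{cases}(\mu+|\xi_1|+|\xi_2|)^{p-2}|\xi_1-\xi_2|&\text{if }p\ge2,\\(\mu+|\xi_1-\xi_2|)^{p-2}|\xi_1-\xi_2|&\text{if }p\le2.\end{cases}$$ For every $q\in(p,\infty)$ there exists $C=C(\Lambda,n,p,q)\in[1,\infty)$ such that the following is true. Let $B=B_R(x_0)\subset\mathbb{R}^n$, $\varepsilon>0$, $u\in W^{1,p}(B)$ and $F\in L^{\frac{p}{p-1}}(B)$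 be such that $\nabla\cdot\mathbf{a}(\tfrac{x}{\varepsilon},\nabla u)=\nabla\cdot F$ weakly in $B$. Then $$\|M_\varepsilon(\mathbf{1}_B(\mu+|\nabla u|)^p)\|_{\underline L^{\frac qp}(\frac12B)}\le C\Bigl(\|\mu+|\nabla u|\|_{\underline L^p(B)}^p+\|M_\varepsilon(\mathbf{1}_B|F|^{p'})\|_{\underline L^{\frac qp}(B)}\Bigr).$$
   Context: $p'=p/(p-1)$. $B_R(x_0)$ is the open ball; $\frac12B=B_{R/2}(x_0)$. $\|f\|_{\underline L^s(U)}=\bigl(\frac1{|U|}\int_U|f|^s\,dx\bigr)^{1/s}$. Truncated maximal function: for $f\in L^1(\mathbb{R}^n)$, $f\geq 0$, and $r>0$, $M_r(f)(x):=\sup_{\rho\ge r}\frac{1}{|B_\rho(x)|}\int_{B_\rho(x)}f(y)\,dy$; $\mathbf{1}_B$ is the indicator function of $B$. Homogenized operator: let $Y=(0,1)^n$ and let $W^{1,p}_{\mathrm{per},0}(Y)$ be the space of $Y$-periodic $W^{1,p}$ functions with mean zero over $Y$. For $\xi\in\mathbb{R}^n$ let the corrector $\phi_\xi\in W^{1,p}_{\mathrm{per},0}(Y)$ be the unique function with $\nabla\cdot\mathbf{a}(y,\xi+\nabla\phi_\xi(y))=0$ in $Y$, i.e. $\int_Y\langle\mathbf{a}(y,\xi+\nabla\phi_\xi),\nabla\psi\rangle\,dy=0$ for all $\psi\in W^{1,p}_{\mathrm{per},0}(Y)$. Then $\overline{\mathbf{a}}(\xi):=\int_Y\mathbf{a}(y,\xi+\nabla\phi_\xi)\,dy$.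 Expressions involving negative powers are read as $0$ when all quantities in them vanish. If the right-hand side of an estimate is not well defined it is understood to be $+\infty$. Carathéodory: measurable in the first variable and continuous in the second. *)

(* Defs.v *)
From HB Require Import structures.
From mathcomp Require Import all_boot all_order all_algebra.
From mathcomp Require Import all_classical all_reals all_analysis.

Set Implicit Arguments.
Unset Strict Implicit.
Unset Printing Implicit Defensive.

Import Order.TTheory GRing.Theory Num.Theory.
Import numFieldNormedType.Exports.

Local Open Scope classical_set_scope.
Local Open Scope ring_scope.

Section Euclidean.
Context {R : realType} {n : nat}.
Implicit Types (x y : 'rV[R]_n) (r : R).

Definition dot x y : R := \sum_(i < n) x 0 i * y 0 i.

(* The library norm of a row vector is the sup norm, and [ball] is a cube. *)
Definition enorm x : R := Num.sqrt (dot x x).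

Definition eball x r : set 'rV[R]_n := [set y | enorm (y - x) < r].

Definition unit_cell : set 'rV[R]_n := [set y | forall i, 0 < y 0 i < 1].

Definition Zperiodic (T : Type) (f : 'rV[R]_n -> T) : Prop :=
  forall (x : 'rV[R]_n) (z : 'rV[int]_n), f (x + map_mx intr z) = f x.

End Euclidean.

(* n-fold product of the one-dimensional Lebesgue measure; meaningful on the
   product sigma-algebra of n-tuples. *)
Fixpoint tuple_lebesgue (R : realType) (n : nat) :
    set (n.-tuple R) -> \bar R :=
  match n with
  | 0 => fun A => (\1_A [tuple])%:E
  | m.+1 => fun A => (\int[lebesgue_measure]_x
      tuple_lebesgue [set t : m.-tuple R | A [tuple of x :: t]])%E
  end.

Section LebesgueMeasure.
Context (R : realType) (n : nat).

Definition lebesgue_outer (A : set 'rV[R]_n) : \bar R :=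
  mu_ext (@tuple_lebesgue R n) [set t | A (\row_i tnth t i)].

Lemma tuple_lebesgue_ge0 A : (0 <= @tuple_lebesgue R n A)%E.
Proof.
elim: n A => [|m IH] A /=; first by rewrite lee_fin indicE ler0n.
by apply: integral_ge0 => x _; exact: IH.
Qed.

Lemma tuple_lebesgue0 : @tuple_lebesgue R n set0 = 0%E.
Proof.
elim: n => [|m IH] /=; first by rewrite indic0.
by apply: integral0_eq => x _; exact: IH.
Qed.

Lemma lebesgue_outer0 : lebesgue_outer set0 = 0%E.
Proof. exact: (mu_ext0 tuple_lebesgue0 tuple_lebesgue_ge0). Qed.

Lemma lebesgue_outer_ge0 A : (0 <= lebesgue_outer A)%E.
Proof. exact: (mu_ext_ge0 tuple_lebesgue_ge0). Qed.

Lemma le_lebesgue_outer : {homo lebesgue_outer : A B / A `<=` B >-> (A <= B)%E}.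
Proof. by move=> A B AB; apply: le_mu_ext => t; exact: AB. Qed.

Lemma lebesgue_outer_sigma_subadditive : sigma_subadditive lebesgue_outer.
Proof.
move=> F; exact: (mu_ext_sigma_subadditive tuple_lebesgue_ge0
  (fun k => [set t | F k (\row_i tnth t i)])).
Qed.

HB.instance Definition _ := isOuterMeasure.Build R 'rV[R]_n lebesgue_outer
  lebesgue_outer0 lebesgue_outer_ge0 le_lebesgue_outer
  lebesgue_outer_sigma_subadditive.

(* 'rV[R]_n with its sigma-algebra of Lebesgue (not only Borel) measurable
   sets, by Caratheodory's criterion. *)
Definition lebesgueType := caratheodory_type lebesgue_outer.

Definition lebesgue : set lebesgueType -> \bar R := lebesgue_outer.

HB.instance Definition _ := isMeasure.Build _ lebesgueType R lebesgue
  lebesgue_outer0 lebesgue_outer_ge0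
  (@caratheodory_measure_sigma_additive R 'rV[R]_n lebesgue_outer).

End LebesgueMeasure.

Section Sobolev.
Context {R : realType} {n : nat}.
Local Notation E := 'rV[R]_n.
Local Notation L := (lebesgueType R n).
Local Notation leb := (@lebesgue R n).
Implicit Types (U : set E) (p : R) (u phi : E -> R) (F g : E -> E).

Definition partial (i : 'I_n) (phi : E -> R) : E -> R :=
  fun x => 'D_(delta_mx 0 i) phi x.

Definition grad (phi : E -> R) : E -> E := fun x => \row_i partial i phi x.

Fixpoint Cclass (k : nat) (phi : E -> R) : Prop :=
  continuous phi /\
  match k with
  | 0 => True
  | k'.+1 => forall i, (forall x, derivable phi x (delta_mx 0 i)) /\
                       Cclass k' (partial i phi)
  end.

Definition support (phi : E -> R) : set E := closure [set x | phi x != 0].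

Definition test_function U phi : Prop :=
  [/\ forall k, Cclass k phi, compact (support phi) & support phi `<=` U].

Definition Lp p U u : Prop :=
  measurable_fun (U : set L) (u : L -> R) /\
  (\int[leb]_(x in U) (`|u x| `^ p)%:E < +oo)%E.

Definition Lp_vec p U F : Prop := forall i, Lp p U (fun x => F x 0 i).

Definition loc_integrable U u : Prop :=
  forall K : set E, compact K -> K `<=` U -> leb.-integrable K (EFin \o u).

Definition weak_gradient U u g : Prop :=
  [/\ loc_integrable U u,
      forall i, loc_integrable U (fun x => g x 0 i) &
      forall phi i, test_function U phi ->
        \int[leb]_(x in U) (u x * partial i phi x) =
        - \int[leb]_(x in U) (g x 0 i * phi x)].

(* A representative of the weak gradient (unique up to null sets) when there
   is one. *)
Definition wgrad U u : E -> E := xget (fun=> 0) [set g | weak_gradient U u g].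

Definition W1p p U u : Prop :=
  [/\ Lp p U u, exists g, weak_gradient U u g & Lp_vec p U (wgrad U u)].

(* The weak gradient is taken in the whole space, so that a periodic function
   with jumps across the faces of the cell is not admitted. *)
Definition W1p_per0 p u : Prop :=
  [/\ Zperiodic u,
      \int[leb]_(y in unit_cell) u y = 0,
      Lp p unit_cell u,
      exists g, weak_gradient setT u g &
      Lp_vec p unit_cell (wgrad setT u)].

Definition weak_div_eq U g F : Prop :=
  forall phi, test_function U phi ->
    \int[leb]_(x in U) dot (g x) (grad phi x) =
    \int[leb]_(x in U) dot (F x) (grad phi x).

(* L^s norm normalised by the volume of U. *)
Definition avg_norm (s : R) U (f : E -> \bar R) : \bar R :=
  ((fine (leb U))^-1%:E * \int[leb]_(x in U) (`|f x| `^ s)) `^ s^-1.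

Definition maximal (r : R) (f : E -> R) (x : E) : \bar R :=
  ereal_sup [set ((fine (leb (eball x rho)))^-1%:E *
                  \int[leb]_(y in eball x rho) (f y)%:E)%E
            | rho in [set rho | r <= rho]].

End Sobolev.

Section Operators.
Context {R : realType} {n : nat}.
Local Notation E := 'rV[R]_n.
Local Notation leb := (@lebesgue R n).
Implicit Types (a b : E -> E -> E) (p mu Lam : R).

Definition Caratheodory_fun a : Prop :=
  (forall xi i, measurable_fun [set: lebesgueType R n]
                  (fun x : lebesgueType R n => a x xi 0 i)) /\
  (forall x, continuous (a x)).

Definition is_corrector p a (xi : E) (phi : E -> R) : Prop :=
  W1p_per0 p phi /\
  forall psi, W1p_per0 p psi ->
    \int[leb]_(y in unit_cell)
      dot (a y (xi + wgrad setT phi y)) (wgrad setT psi y) = 0.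

Definition corrector p a (xi : E) : E -> R :=
  xget (fun=> 0) [set phi | is_corrector p a xi phi].

Definition homogenized p a (xi : E) : E :=
  \row_i \int[leb]_(y in unit_cell)
           a y (xi + wgrad setT (corrector p a xi) y) 0 i.

(* In these conditions a negative power of 0 is 0, by the convention of
   [powR]. *)
Definition monotone_growth p mu Lam b : Prop :=
  (forall x xi1 xi2,
     (if 2 <= p then enorm (xi1 - xi2) `^ p
      else (mu + enorm xi1 + enorm xi2) `^ (p - 2) * enorm (xi1 - xi2) ^+ 2)
     <= Lam * dot (b x xi1 - b x xi2) (xi1 - xi2)) /\
  (forall x xi, enorm (b x xi) <= Lam * (mu + enorm xi) `^ (p - 1)).

Definition continuity_bound p mu Lam a (abar : E -> E) : Prop :=
  forall x xi1 xi2,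
    enorm (a x xi1 - a x xi2) + enorm (abar xi1 - abar xi2) <=
    Lam * (if 2 <= p
           then (mu + enorm xi1 + enorm xi2) `^ (p - 2) * enorm (xi1 - xi2)
           else (mu + enorm (xi1 - xi2)) `^ (p - 2) * enorm (xi1 - xi2)).

End Operators.

(* Main.v *)
(** Only the size, coercivity and monotonicity of the flux under lattice
  translations are used; in particular no homogenization is needed. Truncations
  of a mollified solution are tested in a Caccioppoli-type argument, which bounds
  all moments of the mollified gradient at scales far above the period. Testing
  with differences along lattice vectors bounds the oscillation of the gradient
  averaged over periods, and so connects the scales between the period and a
  fixed macroscopic one. This gives, for small forcing, an arbitrarily high power
  decay of the superlevel sets of the truncated maximal function on a unit cube.
  Rescaling and a Calderon-Zygmund argument (stopping at exit radii, a Vitali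
  covering, absorption on shrinking balls) turn this into the moment bound. *)
Require Import Defs.
From HB Require Import structures.
From mathcomp Require Import all_boot all_order all_algebra.
From mathcomp Require Import all_classical all_reals all_analysis.
From mathcomp Require Import measurable_realfun ring lra.
Set Implicit Arguments.
Unset Strict Implicit.
Unset Printing Implicit Defensive.
Import Order.TTheory GRing.Theory Num.Theory.
Import numFieldNormedType.Exports.
Local Open Scope classical_set_scope.
Local Open Scope ring_scope.

(* Small forcing does not make the gradient small, so decay must come from self-improvement. If the
   mollified gradient has bounded [m]-th moments, the energy where a difference quotient with step
   [k] exceeds [t] is of order [t^(p-m)]. Testing the translated equation with a truncation of this
   quotient bounds the integral of the slope of the truncation by [k^(s-1) t^(1-m)],
   [s = sgm p > 0]. Doubling the step therefore costs [k^s t^(1-m)], a geometric series dominated by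
   the largest step [h]. With [h] of order [t^(-1/(2n))] the total is smaller by [t^(-gain)] than
   what the [m]-th moment alone gives, and at step [h] a mollification at scale [h^2] controls the
   quotient. Summing over dyadic [t] yields moments of order [m + gain/2]; then iterate. Constants
   are fixed before the mollification scale, and the scale before the bound [d] on period and
   forcing; what depends on the scale or on slopes of cutoffs goes into an additive error [th], made
   small by [d]. Lattice steps are forced: monotonicity compares the flux only at points that differ
   by a multiple of the period. *)
Create HintDb nneg discriminated.
#[local] Hint Resolve powR_ge0 normr_ge0 ler0n expR_ge0 expR_gt0 ltW sqr_ge0 : nneg.

Ltac nneg := try solve [done | auto 2 with nneg nocore]; lazymatch goal with
| |- forall _, _ => intro; nneg
| |- is_true (0 <= _ * _) => apply: mulr_ge0; nneg
| |- is_true (0 <= _ + _) => apply: addr_ge0; nneg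
| |- is_true (0 <= _^-1) => rewrite invr_ge0; nneg
| |- is_true (0 <= _ ^+ _) => apply: exprn_ge0; nneg
| |- is_true (0 <= \sum_(_ <- _ | _) _) => apply: sumr_ge0 => ? _; nneg
| |- is_true (0 < _ * _) => apply: mulr_gt0; nneg
| |- is_true (0 < _ + _) => apply: addr_gt0; nneg
| |- is_true (0 < _^-1) => rewrite invr_gt0; nneg
| |- is_true (0 < _ ^+ _) => apply: exprn_gt0; nneg
| |- is_true (0 < _ `^ _) => apply: powR_gt0; nneg
| |- is_true (0 < _%:R) => rewrite ltr0n; nneg
| |- is_true (0 <= _%:E)%E => rewrite lee_fin; nneg
| |- is_true (0 < _%:E)%E => rewrite lte_fin; nneg
| |- is_true (0 <= ?x) => first [unfold x; nneg | apply: ltW; nneg]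
| _ => idtac
end.

(** * Elementary inequalities for real powers *)

Section Powers.
Context {R: realType}.
Implicit Types a b c p q r s t k: R.

Lemma le_pow p a b: 0<=p -> 0<=a -> a<=b -> a`^p<=b`^p.
move=> p0 a0 ab; apply: ge0_ler_powR=> //; rewrite nnegrE//. exact: le_trans ab.
Qed.

Lemma pow_add p a b: 0<=p -> 0<=a -> 0<=b -> (a+b)`^p<=2`^p*(a`^p+b`^p).
move=> p0; wlog ab: a b / a<=b.
 move=> h a0 b0; have [ab|/ltW ba] := leP a b; first exact: h. by rewrite addrC [X in _*X]addrC; exact: h.
move=> a0 b0; apply: (@le_trans _ _ ((2*b)`^p)).
 by apply: le_pow; rewrite ?addr_ge0//; lra.
rewrite powRM// ler_wpM2l ?powR_ge0// lerDr powR_ge0//.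
Qed.

(** Compare the sum with [m] times its largest term. The case [m = 0] is split off because the
    inequality fails there for [p = 0], where [0^0 = 1]. *)
Lemma pow_sum m p (a: 'I_m -> R): 0<=p -> (forall i, 0<=a i) ->
 (\sum_i a i)`^p<=m%:R`^p*\sum_i a i`^p \/ m = 0%N.
case: m a=> [|m] a p0 a0; first by right. left; pose i0:= [arg max_(i > ord0) a i]%O.
have le_i0 i : a i<=a i0 by rewrite /i0; case: arg_maxP=> //= j _; apply.
apply: (@le_trans _ _ ((m.+1%:R*a i0)`^p)).
 apply: le_pow=> //; first by apply: sumr_ge0=> i _.
 apply: (@le_trans _ _ (\sum_(i<m.+1) a i0)); first exact: ler_sum. by rewrite sumr_const card_ord mulr_natl.
rewrite powRM// ler_wpM2l ?powR_ge0//. rewrite (bigD1 i0)//= lerDl; apply: sumr_ge0=> i _; exact: powR_ge0.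
Qed.

Lemma conj_pos p: 1<p -> 0<p/(p-1).
Proof. by move=> p1; rewrite divr_gt0//; lra. Qed.

Lemma young p k: 1<p -> 0<k -> exists2 C, 0<C & forall a b, 0<=a -> 0<=b -> a*b<=k*a`^p+C*b`^(p/(p-1)).
move=> p1 k0; have p'0 := conj_pos p1; set p' := p/(p-1) in p'0 *.
(* With [s^p = k], Young's inequality for [s a] and [b / s] puts the prescribed weight on [a^p]; the
   price of a small [k] is the constant [s^(-p')]. *)
pose s:= k`^p^-1; have s0: 0<s by exact: powR_gt0. have p0: 0<p by lra. exists (s`^(- p')); first nneg.
move=> a b a0 b0. have ->: a*b = (s*a)*(s^-1*b) by rewrite mulrACA divff ?gt_eqF// mul1r.
have h : p^-1+p'^-1 = 1.
 by rewrite /p' invf_div -[X in X+_]mul1r -mulrDl addrC subrK divff ?gt_eqF.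
have sa0: 0<=s*a by nneg. have sb0: 0<=s^-1*b by nneg. apply: (le_trans (conjugate_powR sa0 sb0 p0 p'0 h)).
have p'1: 1<=p' by rewrite /p' ler_pdivlMr; lra. apply: lerD.
 rewrite powRM ?(ltW s0)// -powRrM mulVf ?gt_eqF// powRr1 ?(ltW k0)//.
 rewrite ler_pdivrMr// ler_peMr ?(ltW p1)//. by rewrite mulr_ge0 ?powR_ge0// ltW.
rewrite powRM// ?invr_ge0 ?(ltW s0)// -powR_inv1 ?(ltW s0)// -powRrM mulN1r. rewrite ler_pdivrMr// ler_peMr//.
by rewrite mulr_ge0 ?powR_ge0.
Qed.

Lemma powB1_conj p a: 1<p -> 0<=a -> (a`^(p-1))`^(p/(p-1)) = a`^p.
move=> p1 a0; rewrite -powRrM; congr (_ `^ _); rewrite mulrC divfK//. by rewrite gt_eqF//; lra.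
Qed.

Lemma young1 p k: 1<p -> 0<k -> exists2 C, 0<C & forall a b, 0<=a -> 0<=b -> a`^(p-1)*b<=k*a`^p+C*b`^p.
move=> p1 k0; have p'1: 1<p/(p-1) by rewrite ltr_pdivlMr; lra.
have [C C0 h] := young p'1 k0; exists C=> // a b a0 b0. have := h (a`^(p-1)) b (powR_ge0 _ _) b0.
rewrite powB1_conj//; congr (_<=_+_*_ `^ _). by field; lra.
Qed.

Lemma pow_absorb r p k: r<p -> 0<=r -> 0<k -> exists2 C, 0<C & forall a, 0<=a -> a`^r<=k*a`^p+C.
(* [T] solves [T^(r-p) = k]: beyond it [a^r <= k a^p], and below it [T^r] is the constant. *)
move=> rp r0 k0; pose T:= k`^((r-p)^-1). have T0: 0<T by exact: powR_gt0. exists (T`^r); first nneg.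
move=> a a0; have [aT|Ta] := leP a T.
 by rewrite ler_wpDl// ?mulr_ge0 ?powR_ge0 ?(ltW k0)//; exact: le_pow.
rewrite ler_wpDr ?powR_ge0//. have a1: 0<a by exact: lt_trans Ta. have ->: a`^r = a`^(- (p-r))*a`^p.
 by rewrite -powRD ?(gt_eqF a1) ?implybT//; congr (_ `^ _); ring.
rewrite ler_wpM2r ?powR_ge0// powRN. have ->: k = (T`^(p-r))^-1.
 rewrite /T -powRrM -powRN -{1}(@powRr1 _ k) ?(ltW k0)//; congr (_ `^ _). by field; lra.
by rewrite lef_pV2 ?posrE ?powR_gt0//; apply: le_pow; rewrite ?(ltW T0) ?(ltW Ta)//; lra.
Qed.

(** Convexity: the graph of [a -> a^p] lies above its tangent at [s]. The left side is linear in
    [a], so that averaging it gives Jensen's inequality. *)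
Lemma pow_tangent p a s: 1<p -> 0<=a -> 0<=s -> p*(s`^(p-1)*a)<=a`^p+(p-1)*s`^p.
move=> p1 a0 s0; have p0: 0<p by lra. have h : p^-1+(p/(p-1))^-1 = 1 by field; lra.
have := conjugate_powR a0 (powR_ge0 s (p-1)) p0 (conj_pos p1) h.
rewrite powB1_conj// mulrC -(ler_pM2l p0) mulrDr. have ->: p*(a`^p/p) = a`^p by field; lra.
by have ->: p*(s`^p/(p/(p-1))) = (p-1)*s`^p by field; lra.
Qed.

(** The sum is the integer part of [y]. It serves to approximate a function by finitely many
    indicators of superlevel sets. *)
Lemma sum_levels (K: nat) (y: R): 0<=y -> y<(K.+1%:R: R) -> y-1 <= \sum_(j<K) ((j.+1%:R<=y)%R%:R: R)<=y.
move=> y0. have full (k: nat): (k%:R: R)<=y -> \sum_(j<k) ((j.+1%:R<=y)%R%:R: R) = k%:R.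
 move=> ky; rewrite (eq_bigr (fun=> 1)) ?sumr_const ?card_ord// => j _. by rewrite (le_trans _ ky)// ler_nat.
elim: K=> [|K IH].
 by rewrite big_ord0 y0 andbT; lra.
rewrite big_ord_recr/= => yK; have [Ky|yK1] := leP (K.+1%:R: R) y.
 rewrite full; last by apply: le_trans Ky; rewrite ler_nat.
 by move: Ky yK; rewrite -!natr1 /= => Ky yK; apply/andP; split; lra.
by rewrite addr0; exact: IH.
Qed.

End Powers.

(** * Lebesgue measure on tuples and on row vectors *)

Section SigmaFinitePack.
Context d (T: measurableType d) (R: realType).
Variable nu: {measure set T -> \bar R}. Hypothesis snu: sigma_finite setT nu.

(** A copy of [nu] that can carry the sigma-finite structure, which [nu] itself only has as a
    hypothesis. *)
Definition sigma_finite_pack: set T -> \bar R:= nu.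

HB.instance Definition _:= Measure.on sigma_finite_pack.
HB.instance Definition _:= Measure_isSigmaFinite.Build _ _ _ sigma_finite_pack snu.

Lemma measure_sigma_finite_pack : exists nu': {sigma_finite_measure set T -> \bar R}, forall A, nu' A = nu A.
Proof. by exists sigma_finite_pack. Qed.

End SigmaFinitePack.

Section ProductSigmaFinite.
Context d1 d2 (T1: measurableType d1) (T2: measurableType d2) (R: realType).
Variable m1: {sigma_finite_measure set T1 -> \bar R}. Variable m2: {sigma_finite_measure set T2 -> \bar R}.
Lemma product_measure1_sigma_finite: sigma_finite setT (m1 \x m2)%E.
have /sigma_finiteP[F [TF ndF Foo]] := sigma_finiteT m1.
have /sigma_finiteP[G [TG ndG Goo]] := sigma_finiteT m2. exists (fun n=> F n `*` G n).
 rewrite -setXTT TF TG predeqE=> -[x y]; split.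
  move=> [/= [n _ Fnx] [k _ Gky]]; exists (maxn n k)=> //; split.
  - by move: x Fnx; exact/subsetPset/ndF/leq_maxl.
  - by move: y Gky; exact/subsetPset/ndG/leq_maxr.
 by move=> [n _ []/= ? ?]; split; exists n.
move=> k; have [? ?] := Foo k; have [? ?] := Goo k. split; first exact: measurableX.
by rewrite product_measure1E// lte_mul_pinfty// ge0_fin_numE.
Qed.
End ProductSigmaFinite.

Section TupleMeasure.
Context {R: realType}.
Local Open Scope ereal_scope.

(** Inductively, the iterated integral is the image under [(x, t) -> x :: t] of the product of
    one-dimensional Lebesgue measure with the measure on shorter tuples. This supplies countable
    additivity, which the recursive definition does not show. *)
Lemma tuple_lebesgue_measureE n : exists mu: {sigma_finite_measure set (n.-tuple R) -> \bar R},
  forall A, measurable A -> mu A = tuple_lebesgue A.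
elim: n=> [|n [mu IH]].
 by exists (\d_([tuple]: 0.-tuple R)).
pose f (p: R*n.-tuple R): n.+1.-tuple R := [tuple of p.1 :: p.2].
have mf : measurable_fun setT f by apply: measurable_cons.
pose g (t: n.+1.-tuple R): R*n.-tuple R := (thead t, [tuple of behead t]). have mg : measurable_fun setT g.
 by apply/measurable_fun_pairP; split; [exact: measurable_tnth|exact: measurable_behead].
have gf p : g (f p) = p.
 by case: p=> x t; rewrite /g /f /= theadE; congr pair; exact: val_inj.
pose nu0: {measure set (n.+1.-tuple R) -> \bar R} := pushforward (lebesgue_measure \x mu) f. pose nu:= nu0 mf.
have snu : sigma_finite setT nu.
 have [F FT Foo] := product_measure1_sigma_finite lebesgue_measure mu. exists (fun k=> g @^-1` (F k)).
  by rewrite -preimage_bigcup -FT.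
 move=> k; have [mF Flt] := Foo k; split.
  by rewrite -[X in measurable X]setTI; exact: mg.
 rewrite /nu /nu0 /= /pushforward. by rewrite (_: f @^-1` _ = F k)//; apply/seteqP; split=> p /=; rewrite gf.
have [nu' nu'E] := measure_sigma_finite_pack snu. exists nu'=> A mA /=; rewrite nu'E.
rewrite /nu /nu0 /= /pushforward /product_measure1. apply: eq_integral=> x _ /=. rewrite IH; last first.
 have := mf measurableT _ mA; rewrite setTI=> mfA. by have := measurable_xsection x mfA.
by congr (tuple_lebesgue _); apply/seteqP; split=> t /=; rewrite /xsection /= ?inE.
Qed.

Definition tup n (x: 'rV[R]_n): n.-tuple R := [tuple x ord0 i | i<n].
Definition untup n (t: n.-tuple R): 'rV[R]_n := \row_i tnth t i.

Lemma untupK n: cancel (@untup n) (@tup n).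
Proof. by move=> t; apply/eq_from_tnth=> i; rewrite tnth_mktuple mxE. Qed.

Lemma tupK n: cancel (@tup n) (@untup n).
Proof. by move=> x; apply/rowP=> i; rewrite mxE tnth_mktuple. Qed.

(** The covers that define the outer measure consist of measurable sets, and there the two set
    functions agree. *)
Lemma lebesgue_outer_tup n (mu: {sigma_finite_measure set (n.-tuple R) -> \bar R}) :
 (forall A, measurable A -> mu A = tuple_lebesgue A) ->
 forall B, @lebesgue_outer R n B = mu_ext mu [set t | B (untup t)].
move=> muE B; rewrite /lebesgue_outer /mu_ext; congr ereal_inf.
by apply/seteqP; split=> r /= [F [mF BF] <-]; exists F=> //; apply: eq_eseriesr=> k _; rewrite muE.
Qed.

Lemma lebesgue_tup n (A: set (n.-tuple R)): measurable A -> @lebesgue R n (@tup n @^-1` A) = tuple_lebesgue A.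
move=> mA; have [mu muE] := tuple_lebesgue_measureE n. rewrite -muE// /lebesgue (lebesgue_outer_tup muE).
rewrite (_: [set t | _] = A) ?measurable_mu_extE//. by apply/seteqP; split=> t /=; rewrite untupK.
Qed.

Lemma measurable_tup n : measurable_fun (setT: set (lebesgueType R n)) (@tup n).
move=> _ A mA; rewrite setTI. change (caratheodory_measurable (@lebesgue_outer R n) (@tup n @^-1` A)).
have [mu muE] := tuple_lebesgue_measureE n. have cA := caratheodory_measurable_mu_ext mu mA=> X.
rewrite !(lebesgue_outer_tup muE). rewrite (cA [set t | X (untup t)]); congr (_+_); congr mu_ext;
 by apply/seteqP; split=> t /=; rewrite untupK.
Qed.

End TupleMeasure.

(** * Lebesgue measure under affine maps *)

Section Affine.
Context {R: realType}.
Local Open Scope ereal_scope.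

Lemma measurable_affine (c r: R) :
 measurable_fun [set: measurableTypeR R] (fun x: measurableTypeR R=> c+r*x: measurableTypeR R)%R.
Proof. by apply: measurable_funD=> //; exact: measurable_realfun.measurable_funM. Qed.

(** By uniqueness it suffices to compare both sides on intervals []a, b]]; for negative [r] the
    preimage of such an interval is closed on the other side. *)
Lemma lebesgue_measure_affine (c r: R) (A: set (measurableTypeR R)) : r != 0%R -> measurable A ->
 lebesgue_measure ((fun x=> c+r*x)%R @^-1` A) = (`|r|^-1)%:E * lebesgue_measure A.
move=> rn0 mA; have mphi := measurable_affine c r. have r0 : (0<`|r|)%R by rewrite normr_gt0.
pose phi (x: measurableTypeR R): measurableTypeR R := (c+r*x)%R.
pose nu0: {measure set (measurableTypeR R) -> \bar R} := pushforward (@lebesgue_measure R) phi.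
pose nu:= nu0 mphi. pose nu2: {measure set (measurableTypeR R) -> \bar R} := mscale (NngNum (ltW r0)) nu.
have ->: lebesgue_measure A = nu2 A; last first.
 by rewrite /nu2 /= /mscale /= muleA -EFinM mulVf ?gt_eqF// mul1e.
apply: (lebesgue_measure_unique (mu := nu2))=> // X [[a b] _ <-] /=. rewrite /mscale /nu /nu0 /= /pushforward.
have [rp|rn|re] := ltgtP 0%R r; last by rewrite -re eqxx in rn0.
- have ->: phi @^-1` `]a, b] = `](r^-1*(a-c))%R, (r^-1*(b-c))%R]%classic.
  apply/seteqP; split=> x /=; rewrite !in_itv/= /phi=> /andP[h1 h2]; apply/andP; split.
  + by rewrite ltr_pdivrMl// ltrBlDl.
  + by rewrite ler_pdivlMl// lerBrDl.
  + by move: h1; rewrite ltr_pdivrMl// ltrBlDl.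
  + by move: h2; rewrite ler_pdivlMl// lerBrDl.
 rewrite !lebesgue_measure_itv /= !lte_fin ltr_pM2l ?invr_gt0// ltrD2r. case: ifP=> _; last by rewrite mule0.
 by rewrite gtr0_norm// -!EFinD -EFinM; congr EFin; field; rewrite gt_eqF.
- have ->: phi @^-1` `]a, b] = `[(r^-1*(b-c))%R, (r^-1*(a-c))%R[%classic.
  apply/seteqP; split=> x /=; rewrite !in_itv/= /phi=> /andP[h1 h2]; apply/andP; split.
  + by rewrite ler_ndivrMl// lerBrDl.
  + by rewrite ltr_ndivlMl// ltrBlDl.
  + by move: h2; rewrite ltr_ndivlMl// ltrBlDl.
  + by move: h1; rewrite ler_ndivrMl// lerBrDl.
 rewrite !lebesgue_measure_itv /= !lte_fin ltr_nM2l ?invr_lt0// ltrD2r. case: ifP=> _; last by rewrite mule0.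
 by rewrite ltr0_norm// -!EFinD -EFinM; congr EFin; field; rewrite lt_eqF.
Qed.

Lemma ge0_integral_affine (c r: R) (f: R -> \bar R) :
 r != 0%R -> measurable_fun [set: R] f -> (forall x, 0<=f x) -> \int[lebesgue_measure]_x f (c+r*x)%R =
 (`|r|^-1)%:E*\int[lebesgue_measure]_x f x.
move=> r0 mf f0; have mphi := measurable_affine c r. have ri0 : (0<=`|r|^-1)%R by nneg.
have := ge0_integral_pushforward mphi (@lebesgue_measure R) measurableT mf (fun x _=> f0 x).
rewrite preimage_setT=> <-. rewrite (eq_measure_integral (mscale (NngNum ri0) (@lebesgue_measure R))).
 by rewrite ge0_integral_mscale.
move=> A mA _; rewrite /= /mscale /= /pushforward. exact: lebesgue_measure_affine.
Qed.

Definition taff n (c: n.-tuple R) (r: R) (t: n.-tuple R): n.-tuple R := [tuple tnth c i+r*tnth t i | i<n]%R.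

Lemma measurable_taff n (c: n.-tuple R) r: measurable_fun setT (taff c r).
apply/measurable_fun_tnthP=> i. rewrite (_: _ \o _ = fun t=> (tnth c i+r*tnth t i)%R); last first.
 by apply/funext=> t /=; rewrite tnth_mktuple.
by apply: measurable_funD=> //; apply: measurable_realfun.measurable_funM=> //; exact: measurable_tnth.
Qed.

Lemma tuple_lebesgue_affine n (c: n.-tuple R) r A: r != 0%R -> measurable A ->
 tuple_lebesgue (taff c r @^-1` A) = (`|r| ^- n)%:E*tuple_lebesgue A.
move=> r0; elim: n=> [|n IH] in c A *.
 move=> _; rewrite /= expr0 invr1 mul1e. have e : taff c r [tuple] = [tuple] by exact: tuple0.
 rewrite !indicE; congr ((nat_of_bool _)%:R%:E). by apply/idP/idP; rewrite !inE /= e.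
move=> mA /=. pose c' := [tuple of behead c].
pose sec (x: R): set (n.-tuple R) := [set t: n.-tuple R | A [tuple of x :: t]].
have msec x : measurable (sec x).
 have mc : measurable_fun [set: n.-tuple R] (fun t=> [the n.+1.-tuple R of x :: t]).
  by apply: measurable_cons.
 by have := mc measurableT _ mA; rewrite setTI. have e (x: R) (t: n.-tuple R): taff c r [tuple of x :: t] =
   [tuple of (thead c+r*x)%R :: taff c' r t] :> n.+1.-tuple R.
  rewrite (tuple_eta c); apply/eq_from_tnth=> i; rewrite tnth_mktuple.
  case: (unliftP ord0 i)=> [k ->|->]; last by []. by rewrite !tnthS tnth_mktuple.
transitivity (\int[lebesgue_measure]_x ((`|r| ^- n)%:E*tuple_lebesgue (sec (thead c+r*x)%R))).
 apply: eq_integral=> x _; rewrite -(IH c')//; congr tuple_lebesgue.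
 by apply/seteqP; split=> t /=; rewrite /sec /= e.
have mf : measurable_fun setT (fun x: R=> tuple_lebesgue (sec x)).
 have [mu muE] := @tuple_lebesgue_measureE R n.
 pose f (p: R*n.-tuple R): n.+1.-tuple R := [tuple of p.1 :: p.2].
 have mff : measurable_fun setT f by apply: measurable_cons.
 have mfA : measurable (f @^-1` A) by have := mff measurableT _ mA; rewrite setTI.
 rewrite (_: (fun x=> _) = mu \o xsection (f @^-1` A)).
  exact: measurable_fun_xsection.
 apply/funext=> x /=; rewrite -muE//; congr (mu _). by apply/seteqP; split=> t /=; rewrite /xsection /= ?inE.
have rn0 : (0<=`|r| ^- n)%R by nneg. rewrite ge0_integralZl//; first last.
- by move=> x _; exact: tuple_lebesgue_ge0.
- apply: (measurableT_comp mf); exact: measurable_affine.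
rewrite (ge0_integral_affine _ r0 mf); last by move=> x; exact: tuple_lebesgue_ge0.
by rewrite muleA -EFinM -invfM -exprSr.
Qed.

Lemma mu_ext_affine n (c: 'rV[R]_n) r (A: set 'rV[R]_n): r != 0%R ->
 lebesgue_outer ((fun x=> c+r *: x)%R @^-1` A) = (`|r| ^- n)%:E * lebesgue_outer A.
have rn0 (s: R): s != 0%R -> (0<`|s| ^- n)%R.
 by move=> ?; rewrite invr_gt0 exprn_gt0// normr_gt0.
(* One inequality is enough: applied to the inverse map it yields the other one. *)
have key (d: 'rV[R]_n) s B: s != 0%R -> lebesgue_outer ((fun x=> d+s *: x)%R @^-1` B) <=
  (`|s| ^- n)%:E * lebesgue_outer B.
 move=> s0; rewrite muleC -lee_pdivrMr ?rn0// muleC. apply: le_ereal_inf_tmp=> x [F [mF BF] <-].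
 rewrite muleC lee_pdivrMr ?rn0// muleC -nneseriesZl; last first.
  by move=> *; exact: tuple_lebesgue_ge0.
 apply: ereal_inf_lbound. exists (fun k=> taff (tup d) s @^-1` F k).
  split.
   by move=> k; rewrite -[X in measurable X]setTI; exact: measurable_taff.
  move=> t /= Bt; have [k _ Fk]: (\bigcup_k F k) (taff (tup d) s t).
   apply: BF=> /=; move: Bt=> /=; congr B; apply/rowP=> i. by rewrite !mxE !tnth_mktuple.
  by exists k.
 by apply: eq_eseriesr=> k _; rewrite tuple_lebesgue_affine.
move=> r0; apply/eqP; rewrite eq_le key//=. have := key (- r^-1 *: c)%R r^-1%R ((fun x=> c+r *: x)%R @^-1` A).
rewrite invr_eq0=> /(_ r0). have e x : (c+r *: (- r^-1 *: c+r^-1 *: x) = x)%R.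
 rewrite scalerDr !scalerA mulrN divff// scaleN1r scale1r. by rewrite addrA subrr add0r.
have ->: (fun x=> - r^-1 *: c+r^-1 *: x)%R @^-1` ((fun x=> c+r *: x)%R @^-1` A) = A.
 by apply/seteqP; split=> x /=; rewrite e.
move=> h; rewrite lee_pdivrMl ?exprn_gt0 ?normr_gt0//; apply: (le_trans h). by rewrite normfV exprVn invrK.
Qed.

End Affine.

(** * Cubes, open sets and change of variables *)

Section LebesgueRn.
Context {R: realType} {n: nat}.
Notation E := 'rV[R]_n.
Notation L := (lebesgueType R n).
Notation leb := (@lebesgue R n).

Lemma measurable_coord (i: 'I_n) : measurable_fun [set: L] (fun x: L=> (x: E) ord0 i).
rewrite (_: (fun x=> _) = (tnth (T:=R))^~ i \o @tup R n); last first.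
 by apply/funext=> x /=; rewrite tnth_mktuple.
apply: (measurableT_comp (measurable_tnth i)); exact: measurable_tup.
Qed.

Lemma ballE (x: E) r: 0<r -> ball x r = [set y | forall i, `|x ord0 i-y ord0 i|<r].
move=> r0; apply/seteqP; split=> y /=.
 by move=> [_ h] i; exact: h.
by move=> h; split=> // i j; rewrite ord1; exact: h.
Qed.

Definition tbox m (c r: m.-tuple R): set (m.-tuple R) := [set t | forall i, `|tnth c i-tnth t i|<tnth r i].

Lemma measurable_tbox m (c r: m.-tuple R): measurable (tbox c r).
rewrite (_: tbox c r = \bigcap_(i in [set: 'I_m]) [set t | `|tnth c i-tnth t i|<tnth r i]); last first.
 by apply/seteqP; split=> y /= h i; [move=> _|]; exact: h.
apply: fin_bigcap_measurable=> [|i _]; first nneg.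
have := measurable_tnth i measurableT (measurable_ball (tnth c i) (tnth r i)). by rewrite setTI.
Qed.

Lemma tuple_lebesgue_box m (c r: m.-tuple R): (forall i, 0<tnth r i) ->
 tuple_lebesgue (tbox c r) = (\prod_(i<m) (2*tnth r i))%:E.
elim: m c r=> [c r _|m IH c r r0] /=.
 by rewrite big_ord0 indicE mem_set// => -[].
pose P:= \prod_(i<m) (2*tnth [tuple of behead r] i).
have rE i : tnth r (lift ord0 i) = tnth [tuple of behead r] i.
 by rewrite {1}(tuple_eta r) tnthS.
have P0: 0<=P.
 by apply: prodr_ge0=> i _; rewrite mulr_ge0// ltW// -rE.
have rh0: 0<thead r by exact: r0.
transitivity (\int[lebesgue_measure]_x (P%:E*(\1_(ball (thead c) (thead r)) x)%:E))%E.
 apply: eq_integral=> x _; rewrite indicE. have e (y: R) (t: m.-tuple R): tbox c r [tuple of y :: t] <->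
   `|thead c-y|<thead r /\ tbox [tuple of behead c] [tuple of behead r] t.
  split=> [h|[h1 h2] i].
   split; first by have := h ord0; rewrite tnth0.
   by move=> i; have := h (lift ord0 i); rewrite {1}(tuple_eta c) rE !tnthS.
  case: (unliftP ord0 i)=> [k ->|->]; last by []. by rewrite {1}(tuple_eta c) rE !tnthS; exact: h2.
 have [h|h] := pselect (`|thead c-(x: R)|<thead r).
  rewrite mem_set// mule1 -(IH [tuple of behead c]); last first.
   by move=> i; rewrite -rE.
  congr tuple_lebesgue. apply/seteqP; split=> t; first by move=> /(e x t)[]. by move=> ht; apply/(e x t).
 rewrite memNset// mule0 -(@tuple_lebesgue0 R m); congr tuple_lebesgue.
 by apply/seteqP; split=> t //= /(e x t)[].
rewrite ge0_integralZl//; first last.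
- by apply/measurable_EFinP; apply: measurable_indic; exact: measurable_ball.
rewrite integral_indic ?setIT//; last exact: measurable_ball. transitivity (P%:E*(thead r *+ 2)%:E)%E.
 by congr (_*_)%E; exact: (lebesgue_measure_ball (thead c) (ltW rh0)).
rewrite -EFinM big_ord_recl mulrC mulr_natl; congr ((_*_)%:E). by apply: eq_bigr=> i _; rewrite rE.
Qed.

Definition tcube m (c: m.-tuple R) r := tbox c [tuple r | _<m].

Lemma measurable_tcube m (c: m.-tuple R) r: measurable (tcube c r).
Proof. exact: measurable_tbox. Qed.

Lemma tuple_lebesgue_cube m (c: m.-tuple R) r: 0<r -> tuple_lebesgue (tcube c r) = ((2*r)^+m)%:E.
move=> r0; rewrite tuple_lebesgue_box; last by move=> i; rewrite tnth_mktuple.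
under eq_bigr do rewrite tnth_mktuple. by rewrite prodr_const card_ord.
Qed.

Lemma ball_tcube (x: E) r: 0<r -> ball x r = @tup R n @^-1` tcube (tup x) r.
move=> r0; rewrite ballE//; apply/seteqP; split=> y /= h i; have := h i; by rewrite !tnth_mktuple.
Qed.

Lemma mbl_lball (x: E) r: measurable (ball x r: set L).
have [r0|r0] := ltP 0 r; last first.
 rewrite (_: ball x r = set0)//; apply/seteqP; split=> y //= [h _]. by move: (lt_le_trans h r0); rewrite ltxx.
rewrite ball_tcube//. have := measurable_tup measurableT (measurable_tcube (tup x) r). by rewrite setTI.
Qed.

Lemma leb_ball (x: E) r: 0<r -> leb (ball x r) = ((2*r)^+n)%:E.
move=> r0; rewrite ball_tcube// lebesgue_tup ?tuple_lebesgue_cube//. exact: measurable_tcube.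
Qed.

Lemma lebesgue_sigma_finite: sigma_finite setT leb.
exists (fun k=> ball (0: E) k.+1%:R).
 apply/esym/seteqP; split=> // x _. exists (Num.trunc `|x|).+1=> //=.
 rewrite mx_norm_ball /ball_ /= sub0r normrN. by rewrite (lt_le_trans (truncnS_gt _))// ler_nat.
move=> k; split; first exact: mbl_lball. by rewrite leb_ball// ltry.
Qed.

(** Cubes with rational centres and radii [1/(k+1)] suffice. They are countably many, which makes
    open sets measurable. *)
Lemma open_bigcup_ball (U: set E): open U -> exists F: 'rV[rat]_n*nat -> set E, U = \bigcup_qk F qk /\
  forall qk, exists c r, F qk = ball c r.
move=> oU. pose F (qk: 'rV[rat]_n*nat): set E :=
 if asbool (ball (map_mx ratr qk.1: E) ((qk.2.+1%:R)^-1) `<=` U)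
 then ball (map_mx ratr qk.1: E) ((qk.2.+1%:R)^-1) else set0.
exists F; split; last first.
 move=> qk; rewrite /F; case: asboolP=> _; first by eexists; eexists.
 (* The empty ball of radius [0] stands for the indices whose cube is not contained in [U]. *)
 exists 0, 0; apply/seteqP; split=> // y []. by rewrite ltxx.

 apply/seteqP; split=> [x Ux|x [[q k] _]]; last first.
  by rewrite /F; case: asboolP=> // h; exact: h.
 have [e e0 xe]: exists2 e: R, 0<e & ball x e `<=` U.
  by apply/nbhs_ballP; nneg.
 pose k:= Num.trunc (2/e). have k0: 0<(k.+1%:R)^-1 :> R by nneg. have ke : (k.+1%:R)^-1+(k.+1%:R)^-1<e.
  rewrite -mulr2n -[X in X<_]mulr_natl -ltr_pdivlMl// mulrC.
  by rewrite invf_plt ?posrE ?divr_gt0// invf_div truncnS_gt.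
 move Ed: ((k.+1%:R)^-1: R) k0 ke=> d k0 ke.
 have [q qP]: exists q: 'rV[rat]_n, forall i, `|x ord0 i-ratr (q ord0 i)|<d.
  have /choice[f fP]: forall i: 'I_n, exists q: rat, `|x ord0 i-ratr q|<d.
   move=> i; have [|q] := @rat_in_itvoo R (x ord0 i-d) (x ord0 i+d).
    by lra.
   rewrite in_itv/= => /andP[h1 h2]; exists q. by rewrite ltr_norml; apply/andP; split; lra.
  by exists (\row_i f i)=> i; rewrite mxE.
 have xq : ball (map_mx ratr q: E) d x.
  by rewrite ballE// => i; rewrite mxE distrC.
 exists (q, k)=> //; rewrite /F /= Ed; case: asboolP=> //; case=> y qy. apply: xe; apply: (le_ball (ltW ke)).
 by apply: (ball_triangle (ball_sym xq)).
Qed.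

Lemma open_tmeasurable (U: set E): open U -> measurable (@untup R n @^-1` U).
move=> /open_bigcup_ball[F [-> FE]]; rewrite preimage_bigcup. apply: countable_bigcupT_measurable; first nneg.
move=> qk; have [c [r ->]] := FE qk. have [r0|r0] := ltP 0 r; last first.
 rewrite (_: _ @^-1` _ = set0)//; apply/seteqP; split=> y //= [h _].
 by move: (lt_le_trans h r0); rewrite ltxx.
rewrite ball_tcube// (_: _ @^-1` _ = tcube (tup c) r); first exact: measurable_tcube.
by apply/seteqP; split=> t /=; rewrite untupK.
Qed.

Lemma open_lmbl (U: set E): open U -> measurable (U: set L).
move=> /open_tmeasurable mU; have := measurable_tup measurableT mU. rewrite setTI; congr measurable.
by apply/seteqP; split=> x /=; rewrite tupK.
Qed.

Lemma continuous_lmeasurable (f: E -> R): continuous f -> measurable_fun [set: L] (f: L -> R).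
move=> cf; apply: (measurability _ (RGenOInfty.measurableE R))=> //.
move=> /= _ [_ [a ->] <-]; rewrite setTI; apply: open_lmbl. by apply: open_comp=> // x _; exact: cf.
Qed.

Lemma measurable_laff (c: E) r: r != 0 -> measurable_fun [set: L] ((fun x: E=> c+r *: x): L -> L).
move=> r0 _ A mA; rewrite setTI.
change (caratheodory_measurable (@lebesgue_outer R n) ((fun x: E=> c+r *: x) @^-1` A))=> X.
pose psi (y: E) := r^-1 *: (y-c). have ->: X = (fun x: E=> c+r *: x) @^-1` (psi @^-1` X).
 apply/seteqP; split=> x /=; rewrite /psi addrAC subrr add0r scalerA mulVf // scale1r //.
rewrite preimage_setC -!preimage_setI !mu_ext_affine// -muleDr; first last.
- by apply: ge0_adde_def; rewrite inE; exact: lebesgue_outer_ge0.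
- by []. by congr (_*_)%E; exact: mA.
Qed.

Lemma ge0_integral_laff (c: E) r (f: L -> \bar R): r != 0 -> measurable_fun setT f -> (forall x, 0<=f x)%E ->
 (\int[leb]_x f (c+r *: (x: E))%R = (`|r| ^- n)%:E*\int[leb]_x f x)%E.
move=> r0 mf f0; have mphi := measurable_laff c r0. have ri0: 0<=`|r| ^- n by nneg.
have := ge0_integral_pushforward mphi leb measurableT mf (fun x _=> f0 x). rewrite preimage_setT=> <-.
rewrite (eq_measure_integral (mscale (NngNum ri0) leb)).
 by rewrite ge0_integral_mscale.
move=> A mA _; rewrite /= /mscale /= /pushforward. exact: mu_ext_affine.
Qed.

End LebesgueRn.

HB.instance Definition _ (R: realType) n :=
 Measure_isSigmaFinite.Build _ _ _ (@lebesgue R n) (@lebesgue_sigma_finite R n).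

(** * A calculus of integral upper bounds *)

Section IntegralBounds.
Context d (T: measurableType d) {R: realType} (mu: {measure set T -> \bar R}).
Implicit Types f g: T -> R.
Local Open Scope ereal_scope.

Lemma intEF_ge0 f: (forall x, (0<=f x)%R) -> 0 <= \int[mu]_x (f x)%:E.
Proof. by move=> f0; apply: integral_ge0=> x _; rewrite lee_fin. Qed.

Lemma intEF_le f g: measurable_fun setT f -> measurable_fun setT g ->
 (forall x, (0<=f x)%R) -> (forall x, (f x<=g x)%R) -> \int[mu]_x (f x)%:E <= \int[mu]_x (g x)%:E.
move=> mf mg f0 fg; apply: ge0_le_integral=> //.
- by move=> x _; rewrite lee_fin.
- by apply/measurable_EFinP.
- by apply/measurable_EFinP.
- by move=> x _; rewrite lee_fin.
Qed.

Lemma intEFD f g: measurable_fun setT f -> measurable_fun setT g ->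
 (forall x, (0<=f x)%R) -> (forall x, (0<=g x)%R) ->
 \int[mu]_x (f x+g x)%:E = \int[mu]_x (f x)%:E + \int[mu]_x (g x)%:E.
move=> mf mg f0 g0; under eq_integral do rewrite EFinD.
by rewrite ge0_integralD//; try (by move=> x _; rewrite lee_fin); exact/measurable_EFinP.
Qed.

Lemma intEFZ f (k: R): measurable_fun setT f -> (forall x, (0<=f x)%R) -> (0<=k)%R ->
 \int[mu]_x (k*f x)%:E = k%:E*\int[mu]_x (f x)%:E.
move=> mf f0 k0; under eq_integral do rewrite EFinM.
by rewrite ge0_integralZl//; try (by move=> x _; rewrite lee_fin); exact/measurable_EFinP.
Qed.

Lemma intEF_eq0_le f0 f g: mu.-integrable setT (EFin \o f0) ->
 (\int[mu]_x f0 x = 0)%R -> measurable_fun setT f -> (forall x, (0<=f x)%R) ->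
 (forall x, (f x<=f0 x+g x)%R) -> mu.-integrable setT (EFin \o g) ->
 \int[mu]_x (f x)%:E <= \int[mu]_x (g x)%:E.
move=> if0 z mf pf le ig. have ->: \int[mu]_x (g x)%:E = \int[mu]_x ((f0 x)%:E+(g x)%:E).
 rewrite integralD//. have fn: \int[mu]_x (f0 x)%:E \is a fin_num by exact: integrable_fin_num.
 by rewrite -(fineK fn) [fine _]z add0e.
have mf0 : measurable_fun setT f0.
 by apply/measurable_EFinP; case/integrableP: if0.
have mg : measurable_fun setT g.
 by apply/measurable_EFinP; case/integrableP: ig.
under [leRHS]eq_integral do rewrite -EFinD. by apply: intEF_le=> //; exact: measurable_funD.
Qed.

Lemma measurable_superlevel f (t: R): measurable_fun setT f -> measurable [set x | (t<=f x)%R].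
move=> mf; have := mf measurableT _ (measurable_itv `[t, +oo[).
rewrite setTI; congr measurable; apply/seteqP; split=> x /=; by rewrite in_itv/= andbT.
Qed.

Lemma measurable_strict_superlevel f (t: R): measurable_fun setT f -> measurable [set x | (t<f x)%R].
move=> mf; have := mf measurableT _ (measurable_itv `]t, +oo[).
rewrite setTI; congr measurable; apply/seteqP; split=> x /=; by rewrite in_itv/= andbT.
Qed.

End IntegralBounds.

Section UpperBounds.
Context {R: realType} {n: nat}.
Notation E := 'rV[R]_n.
Notation L := (lebesgueType R n).
Notation leb := (@lebesgue R n).
Implicit Types (f g h: E -> R) (c d k: R).

Definition mble f:= measurable_fun [set: L] (f: L -> R).

Lemma mble_cst c: mble (fun=> c).
Proof. exact: measurable_cst. Qed.

Lemma mbleD f g: mble f -> mble g -> mble (fun x=> f x+g x).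
Proof. exact: measurable_funD. Qed.

Lemma mbleB f g: mble f -> mble g -> mble (fun x=> f x-g x).
Proof. exact: measurable_funB. Qed.

Lemma mbleN f: mble f -> mble (fun x=> - f x).
Proof. exact: measurable_funN. Qed.

Lemma mbleM f g: mble f -> mble g -> mble (fun x=> f x*g x).
Proof. exact: measurable_funM. Qed.

Lemma mbleX f m: mble f -> mble (fun x=> f x^+m).
Proof. exact: measurable_funX. Qed.

Lemma mble_norm f: mble f -> mble (fun x=> `|f x|).
Proof. by move=> mf; exact: measurableT_comp. Qed.

Lemma mble_powR f c: mble f -> mble (fun x=> f x`^c).
Proof. move=> mf; exact: (measurableT_comp (measurable_powR c)). Qed.

Lemma mble_max f g: mble f -> mble g -> mble (fun x=> Num.max (f x) (g x)).
Proof. exact: measurable_maxr. Qed.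

Lemma mble_indic (A: set E): measurable (A: set L) -> mble (\1_A).
Proof. by move=> mA; exact: measurable_indic. Qed.

Lemma mble_cont f: continuous f -> mble f.
Proof. exact: continuous_lmeasurable. Qed.

Lemma mble_comp (phi: R -> R) f: measurable_fun setT phi -> mble f -> mble (fun x=> phi (f x)).
Proof. by move=> mphi mf; exact: measurableT_comp. Qed.

Lemma mble_sum (I: Type) (r: seq I) (P: pred I) (F: I -> E -> R) :
 (forall i, mble (F i)) -> mble (fun x=> \sum_(i <- r | P i) F i x).
move=> mF; elim: r=> [|i r IH].
 by under eq_fun do rewrite big_nil; exact: mble_cst.
under eq_fun do rewrite big_cons; case: (P i)=> //. exact: mbleD.
Qed.

Lemma mble_aff f (z: E) c: c != 0 -> mble f -> mble (fun x=> f (z+c *: x)).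
Proof. by move=> c0 mf; exact: (measurableT_comp mf (measurable_laff z c0)). Qed.

Lemma mble_shift f (z: E): mble f -> mble (fun x=> f (x+z)).
move=> mf; have := mble_aff z (oner_neq0 R) mf. by congr mble; apply/funext=> x; rewrite scale1r addrC.
Qed.

Definition mblev (g: E -> E) := forall i, mble (fun x=> g x 0 i).

Lemma mble_dot (g h: E -> E): mblev g -> mblev h -> mble (fun x=> dot (g x) (h x)).
Proof. by move=> mg mh; apply: mble_sum=> i; apply: mbleM. Qed.

Lemma sqrtr_powR (x: R): 0<=x -> Num.sqrt x = x`^2^-1.
Proof. by move=> x0; rewrite powR12_sqrt. Qed.

Lemma dot_ge0 (x: E): 0<=dot x x.
Proof. by apply: sumr_ge0=> i _; rewrite -expr2 sqr_ge0. Qed.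

Lemma mble_enorm (g: E -> E): mblev g -> mble (fun x=> enorm (g x)).
move=> mg; under eq_fun do rewrite /enorm (sqrtr_powR (dot_ge0 _)). by apply: mble_powR; exact: mble_dot.
Qed.

Lemma mblevD (g h: E -> E): mblev g -> mblev h -> mblev (fun x=> g x+h x).
Proof. by move=> mg mh i; under eq_fun do rewrite mxE; exact: mbleD. Qed.

Lemma mblevB (g h: E -> E): mblev g -> mblev h -> mblev (fun x=> g x-h x).
Proof. by move=> mg mh i; under eq_fun do rewrite !mxE; exact: mbleB. Qed.

Lemma mblevZ (f: E -> R) (g: E -> E): mble f -> mblev g -> mblev (fun x=> f x *: g x).
Proof. by move=> mf mg i; under eq_fun do rewrite mxE; exact: mbleM. Qed.

Lemma mblev_shift (g: E -> E) z: mblev g -> mblev (fun x=> g (x+z)).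
Proof. by move=> mg i; exact: (mble_shift z (mg i)). Qed.

(** Measurability, sign and a real bound on the integral in one predicate. Such bounds can be added,
    scaled, translated and compared pointwise without integrability side conditions; nearly all
    estimates below have this form. *)
Definition ub f c:= [/\ mble f, forall x, 0<=f x & (\int[leb]_x (f x)%:E<=c%:E)%E].

Lemma ub_mble f c: ub f c -> mble f. Proof. by case. Qed.
Lemma ub_pos f c: ub f c -> forall x, 0<=f x. Proof. by case. Qed.

Lemma ub_ge0 f c: ub f c -> 0<=c.
case=> _ f0 h; rewrite -lee_fin; apply: le_trans h; exact: intEF_ge0.
Qed.

Lemma ub_le f g c d: mble f -> (forall x, 0<=f x) -> (forall x, f x<=g x) -> c<=d -> ub g c -> ub f d.
move=> mf f0 fg cd [mg g0 gc]; split; [exact: mf|exact: f0|]. apply: (le_trans (intEF_le leb mf mg f0 fg)).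
by apply: (le_trans gc); rewrite lee_fin.
Qed.

Lemma ub_cle f c d: c<=d -> ub f c -> ub f d.
by move=> cd [mf f0 h]; split=> //; apply: (le_trans h); rewrite lee_fin.
Qed.

Lemma ub_fle f g c: mble f -> (forall x, 0<=f x) -> (forall x, f x<=g x) -> ub g c -> ub f c.
Proof. by move=> *; exact: (@ub_le f g c c). Qed.

Lemma ub0: ub (fun=> 0) 0.
by split=> //; [exact: mble_cst|rewrite integral0].
Qed.

Lemma ubD f g c d: ub f c -> ub g d -> ub (fun x=> f x+g x) (c+d).
move=> [mf f0 fc] [mg g0 gd]; split; first exact: mbleD.
 by move=> x; nneg.
by rewrite (intEFD _ mf mg f0 g0) EFinD; exact: leeD.
Qed.

Lemma ubZ f c k: 0<=k -> ub f c -> ub (fun x=> k*f x) (k*c).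
move=> k0 [mf f0 fc]; split.
- by apply: mbleM=> //; exact: mble_cst.
- by move=> x; nneg. rewrite (intEFZ _ mf f0 k0) EFinM. by apply: lee_pmul=> //; exact: intEF_ge0.
Qed.

Lemma ub_sum (I: Type) (r: seq I) (P: pred I) (F: I -> E -> R) (C: I -> R) : (forall i, ub (F i) (C i)) ->
 ub (fun x=> \sum_(i <- r | P i) F i x) (\sum_(i <- r | P i) C i).
move=> uF; elim: r=> [|i r IH].
 by under eq_fun do rewrite big_nil; rewrite big_nil; exact: ub0.
under eq_fun do rewrite big_cons; rewrite big_cons; case: (P i)=> //. exact: ubD.
Qed.

Lemma ub_aff f (z: E) k c: k != 0 -> ub f c -> ub (fun x=> f (z+k *: x)) (`|k| ^- n*c).
move=> k0 [mf f0 fc]; split; first exact: mble_aff.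
 by move=> x.
rewrite (@ge0_integral_laff R n z k (fun x=> (f x)%:E) k0); first last.
- by [].
- exact/measurable_EFinP. rewrite EFinM; apply: lee_pmul=> //. exact: intEF_ge0.
Qed.

Lemma ub_shift f (z: E) c: ub f c -> ub (fun x=> f (x+z)) c.
move=> uf; have := ub_aff z (oner_neq0 R) uf. rewrite normr1 expr1n invr1 mul1r; congr ub.
by apply/funext=> x; rewrite scale1r addrC.
Qed.

Lemma ub_integrable f c: ub f c -> leb.-integrable setT (EFin \o f).
case=> mf f0 fc; apply/integrableP; split; first exact/measurable_EFinP.
rewrite (_: (fun x=> _) = (fun x=> (f x)%:E)).
 by apply: (le_lt_trans fc); rewrite ltry.
by apply/funext=> x /=; rewrite ger0_norm.
Qed.

(* The only place where signed integrals enter: the weak formulation says that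
  [f0] has integral 0, so a pointwise bound [f <= f0 + g] bounds the integral of [f] by that of [g]. *)
Lemma ub_of_eq0 f0 f g c: leb.-integrable setT (EFin \o f0) ->
 \int[leb]_x f0 x = 0 -> mble f -> (forall x, 0<=f x) -> (forall x, f x<=f0 x+g x) -> ub g c -> ub f c.
move=> if0 z mf pf le ug; have [mg g0 gc] := ug. split; [exact: mf|exact: pf|apply: le_trans gc].
exact: (intEF_eq0_le if0 z mf pf le (ub_integrable ug)).
Qed.

Lemma ub_lim f c: (forall d, 0<d -> ub f (c+d)) -> ub f c.
move=> h; have [mf f0 _] := h 1 ltr01; split=> //. apply/lee_addgt0Pr=> e e0; have [_ _] := h e e0; by [].
Qed.

Lemma ub_ball (x: E) r: 0<r -> ub (\1_(ball x r)) ((2*r)^+n).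
move=> r0; split.
- by apply: mble_indic; exact: mbl_lball.
- by []. have m := @mbl_lball R n x r. rewrite (integral_indic leb measurableT m) setIT.
apply: (@le_trans _ _ (@lebesgue R n (ball x r))); first exact: lexx. by rewrite (leb_ball x r0).
Qed.

End UpperBounds.

Create HintDb mble discriminated.
#[local] Hint Resolve mble_cst mble_indic mble_cont mbleX mblevB mblevD mblevZ: mble.

Ltac mbl := try solve [assumption | eauto 4 with mble nocore]; lazymatch goal with
| H: mblev ?g |- mble (fun x=> ?g x _ _)=> exact: H
| |- mble (fun x=> @?f x*@?g x)=> apply: (@mbleM _ _ f g); mbl
| |- mble (fun x=> @?f x - @?g x)=> apply: (@mbleB _ _ f g); mbl
| |- mble (fun x=> @?f x + @?g x)=> apply: (@mbleD _ _ f g); mbl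
| |- mble (fun x=> - @?f x)=> apply: (@mbleN _ _ f); mbl
| |- mble (fun x=> @?f x^+_)=> apply: mbleX; mbl
| |- mble (fun x=> `|@?f x|)=> apply: (@mble_norm _ _ f); mbl
| |- mble (fun x=> @?f x`^_)=> apply: (@mble_powR _ _ f); mbl
| |- mble (fun x=> enorm (@?g x))=> apply: (@mble_enorm _ _ g); mbl
| |- mble (fun x=> dot (@?g x) (@?h x))=> apply: (@mble_dot _ _ g h); mbl
| |- mble (fun x=> \sum_(_ <- _ | _) _)=> apply: mble_sum=> ?; mbl
| |- mble (fun x=> ?f (x + ?z))=> apply: (@mble_shift _ _ f z); mbl
| |- mble ?f=> progress unfold f; mbl
end.

(** * Tonelli for averages, and Borel functions *)

Section IntegralAverage.
Context d (T: measurableType d) {R: realType}.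
Variable mu: {sigma_finite_measure set T -> \bar R}.

(** Tonelli, with [rho] as a density of mass at most [1]. The bound on [K _ y] is asked only where
    [rho y] is nonzero: for a kernel of scale [s] these are the translations of length at most
    [s]. *)
Lemma integral_average_le (K: T -> T -> R) (rho w: T -> R) (c: R) :
 measurable_fun setT (fun p: T*T=> K p.1 p.2) -> (forall x y, 0<=K x y) ->
 measurable_fun setT rho -> (forall x, 0<=rho x) -> (\int[mu]_x (rho x)%:E<=1)%E -> 0<=c ->
 measurable_fun setT w -> (forall x, 0<=w x) -> (forall x, ((w x)%:E <= \int[mu]_y (rho y*K x y)%:E)%E) ->
 (forall y, rho y != 0 -> measurable_fun setT (K ^~ y) /\ (\int[mu]_x (K x y)%:E<=c%:E)%E) ->
 (\int[mu]_x (w x)%:E<=c%:E)%E.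
move=> mK K0 mr r0 r1 c0 mw w0 wK Kc. pose f (p: T*T): \bar R := (rho p.2*K p.1 p.2)%:E.
have mf : measurable_fun setT f.
 apply/measurable_EFinP; apply: measurable_funM; last exact: mK. exact: (measurableT_comp mr).
have f0 p : (0<=f p)%E by rewrite lee_fin mulr_ge0. apply: (@le_trans _ _ (\int[mu]_x \int[mu]_y f (x, y))%E).
 apply: ge0_le_integral=> //.
 - by move=> x _; rewrite lee_fin.
 - exact/measurable_EFinP.
 - exact: measurable_fun_fubini_tonelli_F.
rewrite fubini_tonelli//. apply: (@le_trans _ _ (\int[mu]_y (c*rho y)%:E)%E).
 apply: ge0_le_integral=> //.
 - by move=> y _; apply: integral_ge0.
 - exact: measurable_fun_fubini_tonelli_G.
 - by apply/measurable_EFinP; exact: measurable_funM.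
 - move=> y _; rewrite /f /=; have [->|ry] := eqVneq (rho y) 0.
   by rewrite mulr0; under eq_integral do rewrite mul0r; rewrite integral0.
  have [mKy hK] := Kc _ ry. rewrite (intEFZ _ mKy)// mulrC EFinM.
  by apply: lee_pmul; rewrite ?lee_fin//; exact: intEF_ge0.
rewrite (intEFZ _ mr)// -[leRHS]mule1 lee_pmul//. exact: intEF_ge0.
Qed.

End IntegralAverage.

Section Borel.
Context {R: realType} {n: nat}.
Notation E := 'rV[R]_n.
Notation L := (lebesgueType R n).
Notation leb := (@lebesgue R n).
Implicit Types (f: E -> R) (c k: R).

(** Borel and not merely Lebesgue measurable: [(x, y) -> f (x - y)] is then measurable for the
    product sigma-algebra, as Tonelli requires. For a Lebesgue measurable [f] this can fail. *)
Definition bor f:= measurable_fun [set: n.-tuple R] (f \o @untup R n).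

Lemma bor_mble f: bor f -> mble f.
move=> bf; have := measurableT_comp bf (@measurable_tup R n).
by congr measurable_fun; apply/funext=> x /=; rewrite tupK.
Qed.

Lemma cont_bor f: continuous f -> bor f.
move=> cf; apply: (measurability _ (RGenOInfty.measurableE R))=> //. move=> /= _ [_ [a ->] <-]; rewrite setTI.
have oU : open (f @^-1` `]a, +oo[) by apply: open_comp=> // x _; exact: cf. exact: (open_tmeasurable oU).
Qed.

Definition mble2 (K: E -> E -> R) := measurable_fun [set: L*L] (fun p: L*L=> K p.1 p.2).

Lemma bor_mble2B f: bor f -> mble2 (fun x y=> f (x-y)).
move=> bf. have m : measurable_fun [set: L*L] (fun p: L*L=> tup ((p.1: E)-(p.2: E))).
 apply/measurable_fun_tnthP=> i.
 rewrite (_: _ \o _ = fun p: L*L=> (p.1: E) ord0 i-(p.2: E) ord0 i); last first.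
  by apply/funext=> p /=; rewrite tnth_mktuple !mxE.
 by apply: measurable_funB; apply: (measurableT_comp (measurable_coord i)).
have := measurableT_comp bf m. by congr measurable_fun; apply/funext=> p /=; rewrite tupK.
Qed.

Lemma mble_mble2l f: mble f -> mble2 (fun x y=> f x).
Proof. by move=> mf; apply: (measurableT_comp mf). Qed.

Lemma ub_avg (K: E -> E -> R) (rho w: E -> R) c : mble2 K -> (forall x y, 0<=K x y) -> ub rho 1 -> 0<=c ->
 mble w -> (forall x, 0<=w x) -> (forall x, ((w x)%:E <= \int[leb]_y (rho y*K x y)%:E)%E) ->
 (forall y, rho y != 0 -> ub (K ^~ y) c) -> ub w c.
move=> mK K0 [mr r0 r1] c0 mw w0 wK Kc; split; [exact: mw|exact: w0|].
apply: (integral_average_le mK K0 mr r0 r1 c0 mw w0 wK)=> y ry. by have [mKy _ hK] := Kc y ry.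
Qed.

Lemma borel_cover (A: set E) (t: R): 0<t -> (leb A < +oo)%E ->
 exists B: set (n.-tuple R), [/\ measurable B, A `<=` @tup R n @^-1` B &
  (leb (@tup R n @^-1` B)<=leb A+t%:E)%E].
move=> t0 Aoo. have fA : (leb A \is a fin_num)%E by rewrite ge0_fin_numE.
have [_ [F [mF AF] <-] Fl] := lb_ereal_inf_adherent t0 fA.
have mU : measurable (\bigcup_k F k) by exact: bigcupT_measurable. exists (\bigcup_k F k); split=> //.
 move=> x Ax; have := AF (tup x); rewrite /= -/(untup (tup x)) tupK; exact.
apply: le_trans (ltW Fl). rewrite preimage_bigcup; apply: (le_trans (lebesgue_outer_sigma_subadditive _)).
apply: lee_nneseries=> [k _ _|k _]; first exact: lebesgue_outer_ge0.
by rewrite -(lebesgue_tup (mF k)); exact: lexx.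
Qed.

End Borel.

(** * Continuity of translations in Lebesgue spaces *)

Section Dominated.
Context d (T: measurableType d) {R: realType} (mu: {measure set T -> \bar R}).

Lemma integral_dominated0 (F: nat -> T -> R) (g: T -> R) (t: R) : mu.-integrable setT (EFin \o g) -> 0<t ->
 (forall N, measurable_fun setT (F N)) -> (forall N x, 0<=F N x<=g x) ->
 (forall x, (F ^~ x) @ \oo --> (0: R)) -> exists N0, forall N, (N0<=N)%N -> (\int[mu]_x (F N x)%:E<=t%:E)%E.
move=> ig t0 mF Fg F0. have [] := @dominated_convergence _ _ R mu setT measurableT
 (fun N x=> (F N x)%:E) (cst 0%E) (EFin \o g).
- by move=> N; apply/measurable_EFinP; exact: mF.
- nneg.
- apply: aeW=> x _; apply/fine_cvgP; split; first exact: nearW.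
 exact: F0.
- exact: ig.
- by apply: aeW=> x N _ /=; have /andP[h1 h2] := Fg N x; rewrite lee_fin ger0_norm.
move=> _ _; rewrite integral0=> /fine_cvgP[fin cv]. have /cvgrPdist_lt/(_ t t0) nt := cv.
have [N0 _ hN]: \forall N \near \oo, (\int[mu]_x (F N x)%:E<=t%:E)%E.
 near=> N. have h1 : (\int[mu]_x (F N x)%:E \is a fin_num)%E by near: N.
 have h2 : `|0-fine (\int[mu]_x (F N x)%:E)%E|<t by near: N.
 rewrite -(fineK h1) lee_fin ltW//; move: h2; rewrite sub0r normrN. exact: le_lt_trans (ler_norm _).
by exists N0=> N N0N; exact: hN. Unshelve. all: by end_near. Qed.

End Dominated.

Section LpContinuity.
Context {R: realType} {n: nat}.
Notation E := 'rV[R]_n.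
Implicit Types (f g: E -> R) (c k: R).

Lemma ub_dominated (F: nat -> E -> R) g c t: ub g c -> 0<t ->
 (forall N, mble (F N)) -> (forall N x, 0<=F N x<=g x) ->
 (forall x, (F ^~ x) @ \oo --> (0: R)) -> exists N0, forall N, (N0<=N)%N -> ub (F N) t.
move=> ug t0 mF Fg F0. have [N0 h] := integral_dominated0 (ub_integrable ug) t0 mF Fg F0.
exists N0=> N N0N; split; [exact: mF| |exact: h]. by move=> x; have /andP[] := Fg N x.
Qed.

Lemma ub_tail f c t: ub f c -> 0<t -> exists2 N: nat, (0<N)%N & ub (fun x=> f x*\1_[set y | N%:R<=f y] x) t.
move=> uf t0; have [mf f0 _] := uf. have mi N : mble (\1_[set y | N%:R<=f y]).
 by apply: mble_indic; exact: measurable_superlevel.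
have [|||N0 h] := @ub_dominated (fun N x=> f x*\1_[set y | N%:R<=f y] x) f c t uf t0.
- by move=> N; exact: mbleM.
- move=> N x; rewrite indicE; case: (_ \in _); rewrite ?mulr1 ?mulr0 ?f0 ?lexx//.
- move=> x; apply: cvg_near_cst; near=> N.
 rewrite indicE memNset ?mulr0//= => hN. have: f x<N%:R by near: N; exact: nbhs_infty_gtr.
 by rewrite ltNge hN.
by exists N0.+1=> //; apply: h. Unshelve. all: by end_near. Qed.

(** Locally, a small translation changes [A] only by a set of small measure. The sets with this
    property form a sigma-algebra containing the coordinate half-spaces, so every Borel set has
    it. *)
Definition tcont (A: set (n.-tuple R)) := measurable A /\
 forall M t: R, 0<M -> 0<t -> exists2 k: R, 0<k & forall y: E, `|y|<k ->
  ub (fun x=> \1_(ball 0 M) x * `|\1_A (tup (x+y)) - \1_A (tup x)|) t.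

Lemma mble_indic_tup (A: set (n.-tuple R)): measurable A -> mble (fun x=> \1_A (tup x): R).
move=> mA; have: measurable_fun setT (\1_A: n.-tuple R -> R) by nneg.
move=> h; exact: (measurableT_comp h (@measurable_tup R n)).
Qed.

Lemma mble_ball (z: E) r: mble (\1_(ball z r)).
Proof. by apply: mble_indic; exact: mbl_lball. Qed.

Lemma tcontC A: tcont A -> tcont (~` A).
move=> [mA h]; split; first exact: measurableC.
move=> M t M0 t0; have [k k0 hk] := h M t M0 t0; exists k=> // y yk.
have := hk y yk; congr ub; apply/funext=> x; congr (_*_). have e B u: \1_(~` B) u = 1 - \1_B u :> R.
 rewrite !indicE in_setC; by case: (_ \in _); rewrite ?subrr ?subr0.
rewrite !e distrC; congr (`| _ |); lra.
Qed.

Lemma indic_norm_le1 (T: Type) (A: set T) (x y: T): `|\1_A x - \1_A y|<=(1: R).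
rewrite !indicE; case: (x \in A); case: (y \in A); rewrite ?subrr ?normr0 ?subr0 ?normr1//.
by rewrite sub0r normrN normr1.
Qed.

Lemma tcontU A B: tcont A -> tcont B -> tcont (A `|` B).
move=> [mA hA] [mB hB]; split; first exact: measurableU. move=> M t M0 t0; have t20: 0<t/2 by nneg.
have [k k0 hk] := hA M _ M0 t20; have [l l0 hl] := hB M _ M0 t20.
exists (Num.min k l); first by rewrite lt_min k0. move=> y; rewrite lt_min=> /andP[yk yl].
apply: (ub_le _ _ _ _ (ubD (hk y yk) (hl y yl))).
- apply: mbleM; first exact: mble_ball.
 apply: mble_norm; apply: mbleB; last by apply: mble_indic_tup; exact: measurableU.
 by apply: (mble_shift y (mble_indic_tup _)); exact: measurableU.
- by [].
- move=> x; rewrite -mulrDr ler_wpM2l ?indicE//.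
 rewrite !in_setU. case: (_ \in A); case: (_ \in B); case: (_ \in A); case: (_ \in B)=> /=;
  rewrite ?subrr ?sub0r ?subr0 ?normr0 ?normrN ?normr1 ?addr0 ?add0r ?lexx ?ler01//; by rewrite ler_wpDl.
- by lra.
Qed.

End LpContinuity.

#[local] Hint Resolve mble_ball: mble.

Section TranslationContinuity.
Context {R: realType} {n: nat}.
Notation E := 'rV[R]_n.
Notation L := (lebesgueType R n).
Notation leb := (@lebesgue R n).
Implicit Types (c k: R).

Lemma indic_in (T: Type) (A: set T) x: A x -> \1_A x = 1 :> R.
Proof. by move=> Ax; rewrite indicE mem_set. Qed.

Lemma indic_out (T: Type) (A: set T) x: ~ A x -> \1_A x = 0 :> R.
Proof. by move=> Ax; rewrite indicE memNset. Qed.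

Lemma indic_ge0 (T: Type) (A: set T) x: 0 <= \1_A x :> R.
Proof. by []. Qed.

Lemma indic_le1 (T: Type) (A: set T) x: \1_A x<=1 :> R.
Proof. by []. Qed.

Lemma ball0E (x: E) r: ball (0: E) r x = (`|x|<r) :> Prop.
Proof. by rewrite mx_norm_ball /ball_ /= sub0r normrN. Qed.

Lemma coord_le_norm (x: E) i: `|x ord0 i|<=`|x|.
rewrite [leRHS]mx_normrE. exact: (le_bigmax _ (fun ij=> `|x ij.1 ij.2|) (ord0, i)).
Qed.

Lemma tcont0: tcont (set0: set (n.-tuple R)).
split=> // M t M0 t0; exists 1=> // y _. apply: (ub_le _ _ _ (ltW t0) ub0).
- under eq_fun do rewrite !indic0 subrr normr0 mulr0; exact: mble_cst.
- by [].
- by move=> x; rewrite !indic0 subrr normr0 mulr0.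
Qed.

Lemma tcont_bigcup (F: nat -> set (n.-tuple R)) : (forall i, tcont (F i)) -> tcont (\bigcup_i F i).
move=> hF; set U:= \bigcup_i F i. have mU : measurable U by apply: bigcupT_measurable=> i; exact: (hF i).1.
split=> // M t M0 t0. pose V (k: nat) := \big[setU/set0]_(i<k) F i. have hV (k: nat): tcont (V k).
 rewrite /V; elim: k=> [|k IH]; first by rewrite big_ord0; exact: tcont0.
 by rewrite big_ord_recr; exact: tcontU.
have mV (k: nat): measurable (V k) by exact: (hV k).1. have VU (k: nat): V k `<=` U.
 by rewrite /V=> x; rewrite -bigcup_mkord=> -[i _ Fi]; exists i.
(* What the finite union [V k] misses is measured on the larger cube of radius [M + 1], so that the
   bound also applies at the translated point. *)
pose G (k: nat) x: R := \1_(ball (0: E) (M+1)) x*\1_(U `\` V k) (tup x). have mG (k: nat): mble (G k).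
 by apply: mbleM; [exact: mble_ball|apply: mble_indic_tup; exact: measurableD].
have M10: 0<M+1 by lra. have t30: 0<t/3 by lra. have [||k0 hk0] := ub_dominated (ub_ball (0: E) M10) t30 mG.
- move=> k x; rewrite /G !indicE.
 by case: (_ \in _); case: (_ \in _); rewrite ?mulr0 ?mul0r ?mulr1 ?lexx ?ler01.
- move=> x; apply: cvg_near_cst.
 have [[i _ Fi]|nU] := pselect (U (tup x)); last first.
  by apply: nearW=> k; rewrite /G [X in _*X]indicE memNset ?mulr0// => -[].
 exists i.+1=> // k /= ik; rewrite /G [X in _*X]indicE memNset ?mulr0// => -[_]; apply.
 by rewrite /V -bigcup_mkord; exists i.
have [l l0 hl] := (hV k0).2 M _ M0 t30. exists (Num.min l 1); first by rewrite lt_min l0 ltr01.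
move=> y; rewrite lt_min=> /andP[yl y1]. have uG := hk0 k0 (leqnn _).
apply: (ub_le _ _ _ _ (ubD (ubD (hl y yl) (ub_shift y uG)) uG)).
- apply: mbleM; first mbl.
 apply: mble_norm; apply: mbleB; last exact: mble_indic_tup. by apply: (mble_shift y (mble_indic_tup _)).
- by [].
- move=> x; rewrite /G; have [xM|xM] := pselect (ball (0: E) M x); last first.
  rewrite (indic_out xM) !mul0r add0r. by [].
 have xM1 : ball (0: E) (M+1) x by apply: le_ball xM; lra. have xyM1 : ball (0: E) (M+1) (x+y).
  by move: xM; rewrite !ball0E=> xM; apply: (le_lt_trans (ler_normD _ _)); lra.
 rewrite (indic_in xM) (indic_in xM1) (indic_in xyM1) !mul1r.
 have e u: \1_U u = \1_(V k0) u + \1_(U `\` V k0) u :> R.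
  rewrite !indicE in_setD; have [h|h] := boolP (u \in V k0).
   by rewrite mem_set ?addr0//=; apply: (VU k0); rewrite -inE.
  by rewrite andbT add0r.
 rewrite !e. set a:= \1_(V k0) _; set b:= \1_(V k0) _.
 set a' := \1_(U `\` V k0) _; set b' := \1_(U `\` V k0) _. have a'0: 0<=a' :> R by [].
 have b'0: 0<=b' :> R by []. have h1 := ler_normB a' b'; rewrite (ger0_norm a'0) (ger0_norm b'0) in h1.
 have h2 := ler_normD (a-b) (a' - b'). rewrite (_: a-b+(a' - b') = a+a' - (b+b')) in h2; last by ring.
 rewrite -[leRHS]addrA; apply: (le_trans h2); by rewrite lerD2l.
- by lra.
Qed.

Lemma tcont_ray (i: 'I_n) (a: R): tcont [set t | a<tnth t i].
have mA : measurable [set u: n.-tuple R | a<tnth u i].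
 have := measurable_tnth i measurableT (measurable_itv `]a, +oo[). rewrite setTI; congr measurable.
 by apply/seteqP; split=> u /=; rewrite in_itv/= andbT.
split=> //. move=> M t M0 t0. pose P:= (2*M)^+n.-1. have P0: 0<P by rewrite exprn_gt0// mulr_gt0.
pose k:= Num.min (t/(4*P)) M. have k0: 0<k by rewrite lt_min M0 divr_gt0// mulr_gt0. exists k=> // y yk.
(* [c] and [r] describe a slab around the hyperplane [x_i = a]; off the slab, a translation by less
   than [k] cannot cross the hyperplane. *)
pose c: n.-tuple R := [tuple if j == i then a else 0 | j<n].
pose r: n.-tuple R := [tuple if j == i then 2*k else M | j<n]. pose S:= @tup R n @^-1` tbox c r.
have mS : measurable (S: set L).
 by have := measurable_tup measurableT (measurable_tbox c r); rewrite setTI.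
have lS : leb S = (4*k*P)%:E.
 rewrite (lebesgue_tup (measurable_tbox c r)) tuple_lebesgue_box; last first.
  by move=> j; rewrite tnth_mktuple; case: ifP=> _ //; rewrite mulr_gt0.
 rewrite (bigD1 i)//= tnth_mktuple eqxx; congr (_%:E). rewrite (eq_bigr (fun=> 2*M)); last first.
  by move=> j /negbTE ji; rewrite tnth_mktuple ji.
 rewrite prodr_const cardC1 card_ord /P; ring.
have uS : ub (\1_S) t.
 split; first mbl.
  by [].
 rewrite (integral_indic leb measurableT mS) setIT.
 apply: (@le_trans _ _ (@lebesgue R n S)); first exact: lexx. rewrite [@lebesgue R n S]lS lee_fin.
 have: k<=t/(4*P) by rewrite ge_min lexx. by rewrite ler_pdivlMr ?mulr_gt0//; lra.
apply: (ub_le _ _ _ (lexx t) uS).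
- apply: mbleM; first mbl.
 apply: mble_norm; apply: mbleB; last exact: mble_indic_tup. exact: (mble_shift y (mble_indic_tup mA)).
- by []. move=> x; have [xM|xM] := pselect (ball (0: E) M x); last first.
 by rewrite (indic_out xM) mul0r indic_ge0.
have [xS|xS] := pselect (S x).
 rewrite (indic_in xS) (indic_in xM) mul1r; exact: indic_norm_le1.
rewrite (indic_out xS) (indic_in xM) mul1r. have xi: 2*k<=`|a-x ord0 i|.
 rewrite leNgt; apply/negP=> h; apply: xS=> j; rewrite !tnth_mktuple.
 case: ifP=> [/eqP ->//|_]; rewrite sub0r normrN. apply: le_lt_trans (coord_le_norm x j) _.
 by move: xM; rewrite ball0E.
have yi : `|y ord0 i|<k by apply: le_lt_trans (coord_le_norm y i) yk.
rewrite !indicE (_: (_ \in _) = (tup x \in [set u: n.-tuple R | a<tnth u i])) ?subrr ?normr0//.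
apply/idP/idP; rewrite !inE /= !tnth_mktuple !mxE; move: yi xi;
 rewrite ltr_norml ler_normr=> /andP[y1 y2] /orP[] ? ?; lra.
Qed.

Lemma measurable_tcont (A: set (n.-tuple R)): measurable A -> tcont A.
have sD : sigma_algebra setT (@tcont R n).
 split; first exact: tcont0.
  by move=> B hB; rewrite setTD; exact: tcontC.
 exact: tcont_bigcup.
apply: smallest_sub=> // B. rewrite -bigcup_seq=> -[i _ /= [S mS <-]]; rewrite setTI.
pose D (S: set R) := tcont [set t | S (tnth t i)]. suff: measurable `<=` D by move=> /(_ S mS).
have ->: @measurable _ R = <<s @RGenOInfty.G R >> by exact: RGenOInfty.measurableE. apply: smallest_sub.
 split; first exact: tcont0.
  move=> C hC; rewrite setTD /D; exact: (tcontC hC).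
 by move=> F hF; exact: (tcont_bigcup hF).
move=> C [a ->]; rewrite /D. rewrite (_: [set t | _] = [set t | a<tnth t i]); first exact: tcont_ray.
by apply/seteqP; split=> t /=; rewrite in_itv/= andbT.
Qed.

End TranslationContinuity.

#[local] Hint Resolve indic_ge0: nneg.

Section NullCover.
Context d (T: measurableType d) {R: realType} (mu: {measure set T -> \bar R}).

Lemma measure_shrinking_cover (A: set T) (B: nat -> set T) :
 measurable A -> (mu A < +oo)%E -> (forall j, measurable (B j)) -> (forall j, A `<=` B j) ->
 (forall j, (mu (B j)<=mu A+(j.+1%:R^-1)%:E)%E) -> mu (\bigcap_j B j `\` A) = 0%E.
move=> mA Aoo mB AB h. have mI : measurable (\bigcap_j B j) by exact: bigcapT_measurable.
have fA : mu A \is a fin_num by rewrite ge0_fin_numE. apply/eqP; rewrite eq_le measure_ge0 andbT.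
apply/lee_addgt0Pr=> e e0; rewrite add0e. pose j:= Num.trunc (e^-1). have je : (j.+1%:R^-1<=e)%R.
 by rewrite invf_ple ?posrE//; exact/ltW/truncnS_gt.
apply: (@le_trans _ _ (mu (B j `\` A))).
 apply: le_measure; rewrite ?inE; [exact: measurableD|exact: measurableD|].
 by move=> x [Bx nA]; split=> //; exact: Bx.
rewrite measureD//; last by apply: (le_lt_trans (h j)); rewrite lte_add_pinfty// ltry. rewrite setIidr//.
apply: (@le_trans _ _ (mu A+(j.+1%:R^-1)%:E-mu A)%E); first by apply: leeD2r; exact: h.
by rewrite addeAC subee// add0e lee_fin.
Qed.

End NullCover.

Section BorelVersion.
Context {R: realType} {n: nat}.
Notation E := 'rV[R]_n.
Notation L := (lebesgueType R n).
Notation leb := (@lebesgue R n).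
Notation pre B := (@tup R n @^-1` B).

Lemma measurable_pre (B: set (n.-tuple R)): measurable B -> measurable (pre B: set L).
Proof. by move=> mB; have := measurable_tup measurableT mB; rewrite setTI. Qed.

Lemma borel_hull_fin (A: set L): measurable A -> (leb A < +oo)%E ->
 exists B: set (n.-tuple R), [/\ measurable B, A `<=` pre B & leb (pre B `\` A) = 0%E].
move=> mA Aoo. have /choice[B hB]: forall j: nat, exists B: set (n.-tuple R),
  [/\ measurable B, A `<=` pre B & (leb (pre B)<=leb A+(j.+1%:R^-1)%:E)%E].
 by move=> j; apply: borel_cover; [rewrite invr_gt0 ltr0n|exact: Aoo].
exists (\bigcap_j B j); split.
- by apply: bigcapT_measurable=> j; have [] := hB j.
- by move=> x Ax j _; have [_ h _] := hB j; exact: h.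
- rewrite preimage_bigcap; apply: measure_shrinking_cover=> // j; have [h1 h2 h3] := hB j=> //.
 exact: measurable_pre.
Qed.

Lemma borel_hull (A: set L): measurable A ->
 exists B: set (n.-tuple R), [/\ measurable B, A `<=` pre B & leb (pre B `\` A) = 0%E].
move=> mA. pose Ak (k: nat): set L:= A `&` (ball (0: E) k.+1%:R).
have mAk k : measurable (Ak k) by apply: measurableI=> //; exact: mbl_lball.
have fAk k : (leb (Ak k) < +oo)%E.
 apply: (@le_lt_trans _ _ (leb (ball (0: E) k.+1%:R))).
  by apply: le_lebesgue_outer=> x [].
 by rewrite leb_ball// ltry.
have /choice[B hB] k := borel_hull_fin (mAk k) (fAk k). exists (\bigcup_k B k); split.
- by apply: bigcupT_measurable=> k; have [] := hB k.
- move=> x Ax; exists (Num.trunc `|x: E|)=> //.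
 have [_ h _] := hB (Num.trunc `|x: E|); apply: h; split=> //. by rewrite ball0E truncnS_gt.
- apply/eqP; rewrite eq_le measure_ge0 andbT.
 apply: (@le_trans _ _ (\sum_(k <oo) leb (pre (B k) `\` Ak k))%E).
  apply: le_trans (lebesgue_outer_sigma_subadditive _).
  apply: le_lebesgue_outer=> x [[k _ Bk] nA]; exists k=> //; split=> //. by move=> [].
 by rewrite eseries0// => k _ _; have [] := hB k.
Qed.

(** It suffices to correct the superlevel sets at rational levels. Each differs from its Borel hull
    by a null set, and [Z] is a Borel null set containing all these differences. *)
Lemma borel_version (f: E -> R): mble f -> exists Z: set (n.-tuple R), [/\ measurable Z, leb (pre Z) = 0%E &
   bor (fun x=> f x*\1_(~` Z) (tup x))].
move=> mf. pose r (k: nat): rat := odflt 0 (unpickle k). pose A k: set L:= [set x | ratr (r k)<f x]%R.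
have mA k : measurable (A k) by exact: measurable_strict_superlevel.
have /choice[B hB] k := borel_hull (mA k). have mB k : measurable (B k) by have [] := hB k.
pose N: set L:= \bigcup_k (pre (B k) `\` A k). have mN : measurable N.
 by apply: bigcupT_measurable=> k; apply: measurableD=> //; exact: measurable_pre.
have N0 : leb N = 0%E.
 apply/eqP; rewrite eq_le measure_ge0 andbT. apply: (@le_trans _ _ (\sum_(k <oo) leb (pre (B k) `\` A k))%E).
  exact: lebesgue_outer_sigma_subadditive.
 by rewrite eseries0// => k _ _; have [] := hB k.
have [Z [mZ NZ Z0]] := borel_hull mN. exists Z; split=> //.
 apply/eqP; rewrite eq_le measure_ge0 andbT.
 have ->: pre Z = N `|` (pre Z `\` N) by rewrite setDE setUIr setUv setIT setUidr.
 apply: (@le_trans _ _ (leb N+leb (pre Z `\` N))%E).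
  exact: (outer_measureU2 (@lebesgue_outer R n)).
 have ->: leb (pre Z `\` N) = 0%E by exact: Z0. by rewrite N0 adde0.
apply: (measurability _ (RGenOInfty.measurableE R))=> //. move=> /= _ [_ [a ->] <-]; rewrite setTI.
rewrite (_: _ @^-1` _ = (\bigcup_k (if a<ratr (r k) then B k `\` Z else set0))
  `|` (if a<0 then Z else set0)); last first.
 apply/seteqP; split=> t /=; rewrite in_itv/= andbT untupK.
  have [Zt|nZt] := pselect (Z t).
   by rewrite indic_out ?mulr0=> [a0|]; [right; rewrite a0|apply].
  rewrite indic_in// mulr1=> af. have [|q] := @rat_in_itvoo R a (f (untup t)); first exact: af.
  rewrite in_itv/= => /andP[aq qf]; left; exists (pickle q)=> //. rewrite /r pickleK /= aq; split=> //.
  have [_ h _] := hB (pickle q); have := h (untup t). by rewrite /= untupK; apply; rewrite /A /r pickleK.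
 case=> [[k _]|].
  case: ifP=> // ar [Bt nZt]; rewrite indic_in// mulr1.
  apply: (lt_trans ar); apply: contrapT=> nA; apply: nZt.
  have := NZ (untup t); rewrite /= untupK; apply; exists k=> //. by split; rewrite /= ?untupK.
 by case: ifP=> // a0 Zt; rewrite indic_out ?mulr0//; apply.
apply: measurableU; last by case: ifP. by apply: bigcupT_measurable=> k; case: ifP=> // _; exact: measurableD.
Qed.

Lemma finite_pos (K: nat) (P: nat -> R -> Prop) : (forall j k k', P j k -> k' <= k -> P j k') ->
 (forall j, exists2 k, 0<k & P j k) -> exists2 k, 0<k & forall j, (j<K)%N -> P j k.
move=> Pd hP; elim: K=> [|K [k k0 IH]]; first by exists 1.
have [l l0 Pl] := hP K; exists (Num.min k l); first by rewrite lt_min k0.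
move=> j; rewrite ltnS leq_eqVlt=> /predU1P[->|jK].
 by apply: (Pd _ _ _ Pl); rewrite ge_min lexx orbT.
by apply: (Pd _ _ _ (IH j jK)); rewrite ge_min lexx.
Qed.

(* Truncation and discretisation of [f] reduce the claim to the sets
  [[set t | j.+1%:R <= N%:R * (f (untup t) + T%:R)]]. *)
Lemma lp_translation_continuous (f: E -> R) p c M t :
 bor f -> 1<p -> 0<M -> (forall x, ~ ball (0: E) M x -> f x = 0) -> ub (fun x=> `|f x| `^ p) c -> 0<t ->
 exists2 k: R, 0<k & forall y: E, `|y|<k -> ub (fun x=> `|f (x+y)-f x| `^ p) t.
move=> bf p1 M0 fM uf t0. have mf := bor_mble bf; have p0: 0<p by lra. set V:= (2*(M+2))^+n.
have M20: 0<M+2 by lra. have V0: 0<V by rewrite exprn_gt0// mulr_gt0. pose P:= 2`^p: R; have P1: 1<=P.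
 by apply: (@le_trans _ _ (1`^p)); [rewrite powR1|apply: le_pow; lra].
have P0: 0<P by lra. pose t1:= t/(8*P*P*P). have t10: 0<t1 by rewrite divr_gt0// !mulr_gt0.
have [N0 N00 htail] := ub_tail uf t10. set h:= (fun x=> _: R) in htail.
pose T:= (Num.trunc ((N0%:R: R)`^p^-1)).+1. have T0: 0<T%:R :> R by nneg.
have hT x : T%:R<=`|f x| -> N0%:R<=`|f x| `^ p.
 move=> Tf; have: (N0%:R: R)`^p^-1<=`|f x|.
  by apply: le_trans Tf; exact/ltW/truncnS_gt.
 move=> /(le_pow (ltW p0) (powR_ge0 _ _)). by rewrite -powRrM mulVf ?gt_eqF// powRr1.
pose kap:= (t1/V)`^p^-1. have kap0: 0<kap by rewrite powR_gt0// divr_gt0. pose N:= (Num.trunc kap^-1).+1.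
have NR0: 0<N%:R :> R by nneg. have Nkap : N%:R^-1<=kap by rewrite invf_ple ?posrE//; exact/ltW/truncnS_gt.
have NV : (N%:R^-1)`^p*V<=t1.
 rewrite -ler_pdivlMr//. apply: (le_trans (le_pow (ltW p0) _ Nkap)); first nneg.
 by rewrite /kap -powRrM mulVf ?gt_eqF// powRr1// ltW// divr_gt0.
pose K:= (2*T*N)%N. pose A (j: nat): set (n.-tuple R) := [set u | j.+1%:R<=N%:R*(f (untup u)+T%:R)]%R.
have mA j : measurable (A j).
 apply: measurable_superlevel; apply: measurable_funM=> //. exact: measurable_funD.
(* Where [f] lies between [-T] and [T], this is [f] rounded down to a multiple of [1/N]. *)
pose g x: R := N%:R^-1*(\sum_(j<K) \1_(A j) (tup x))-T%:R.
have AE j x: \1_(A j) (tup x) = (j.+1%:R<=N%:R*(f x+T%:R))%R%:R :> R.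
 by rewrite indicE /A; congr ((nat_of_bool _)%:R); apply/idP/idP; rewrite inE /= tupK.
have gE x : g x = N%:R^-1*(\sum_(j<K) (j.+1%:R<=N%:R*(f x+T%:R))%R%:R)-T%:R.
 by rewrite /g; congr (_*_-_); apply: eq_bigr=> j _; rewrite AE.
have S0K x : (0: R) <= \sum_(j<K) \1_(A j) (tup x)<=(K%:R: R).
 apply/andP; split; first by apply: sumr_ge0=> j _; rewrite indicE ler0n.
 apply: (@le_trans _ _ (\sum_(j<K) 1)); first by apply: ler_sum=> j _; rewrite indicE lern1 leq_b1.
 by rewrite sumr_const card_ord.
have KNT : N%:R^-1*K%:R = 2*T%:R :> R.
 by rewrite /K !natrM; field; rewrite gt_eqF.
have gT x : `|g x|<=T%:R.
 have /andP[h1 h2] := S0K x. rewrite /g ler_norml; apply/andP; split.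
  by rewrite lerBrDr addNr mulr_ge0// invr_ge0 ltW.
 rewrite lerBlDr -mulr2n -[leRHS]mulr_natl -KNT ler_wpM2l// invr_ge0 ltW//.
pose e x:= `|f x-g x|. have eb x : e x`^p<=N%:R^-1`^p+P*h x.
 have [fT|Tf] := ltP `|f x| T%:R.
  have := @sum_levels R K (N%:R*(f x+T%:R)). have /andP[f1 f2]: - T%:R<f x<T%:R by rewrite -ltr_norml.
  rewrite mulr_ge0 ?(ltW NR0)//; last by lra. have ->: N%:R*(f x+T%:R)<K.+1%:R.
   rewrite -natr1 /K !natrM; apply: (@lt_trans _ _ (2*T%:R*N%:R)); last by lra.
   by rewrite mulrC ltr_pM2r//; lra.
  move=> /(_ isT isT) /andP[s1 s2]. have: e x<=N%:R^-1.
   rewrite /e gE; set S:= \sum_(j<K) _ in s1 s2 *. rewrite ler_norml; apply/andP; split.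
    rewrite -(ler_pM2l NR0) mulrN divff ?gt_eqF//. have ->: N%:R*(f x-(N%:R^-1*S-T%:R)) = N%:R*(f x+T%:R)-S.
     by field; rewrite gt_eqF.
    lra.
   rewrite -(ler_pM2l NR0) divff ?gt_eqF//. have ->: N%:R*(f x-(N%:R^-1*S-T%:R)) = N%:R*(f x+T%:R)-S.
    by field; rewrite gt_eqF.
   lra.
  move=> /(le_pow (ltW p0) (normr_ge0 _)) ex; apply: (le_trans ex).
  by rewrite lerDl mulr_ge0 ?(ltW P0)// /h mulr_ge0 ?powR_ge0 ?indic_ge0.
 have ef : e x<=2 * `|f x|.
  by apply: (le_trans (ler_normB _ _)); have := gT x; lra.
 apply: (le_trans (le_pow (ltW p0) (normr_ge0 _) ef)).
 rewrite powRM// -/P /h indic_in ?mulr1 ?lerDr ?powR_ge0//. exact: hT.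
pose U x:= N%:R^-1`^p*\1_(ball (0: E) (M+2)) x+P*h x. have uU : ub U (t1+P*t1).
 apply: ub_cle (ubD (ubZ (powR_ge0 _ _) (ub_ball 0 M20)) (ubZ (ltW P0) htail)). by rewrite lerD2r.
pose t2:= t/(2*P)/(((2*T%:R)`^(p-1)*N%:R^-1)*K%:R). have T20: 0<2*T%:R :> R by nneg.
have K0: 0<K%:R :> R by nneg. have c10: 0<(2*T%:R)`^(p-1)*N%:R^-1 by nneg.
have t20: 0<t2 by rewrite !divr_gt0 ?mulr_gt0 ?powR_gt0 ?invr_gt0. have M10: 0<M+1 by lra.
have [||k k0 hk] := @finite_pos K (fun j k=> forall y: E, `|y|<k ->
  ub (fun x=> \1_(ball 0 (M+1)) x * `|\1_(A j) (tup (x+y)) - \1_(A j) (tup x)|) t2).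
- by move=> j k k' hk kk y yk; apply: hk; exact: lt_le_trans kk.
- by move=> j; have [_ hj] := measurable_tcont (mA j); exact: hj.
exists (Num.min k 1); first by rewrite lt_min k0 ltr01. move=> y; rewrite lt_min=> /andP[yk y1].
have uD := ub_sum (index_enum 'I_K) xpredT (fun j: 'I_K=> hk j (ltn_ord j) y yk).
have uall := ubZ (ltW P0) (ubD (ubZ (ltW c10) uD) (ubZ (ltW P0) (ubD (ub_shift y uU) uU))).
apply: (ub_le _ _ _ _ uall).
- mbl.
- by [].
- move=> x; have [xM|xM] := pselect (ball (0: E) (M+1) x); last first.
  rewrite ball0E in xM. have fx : f x = 0.
   by apply: fM; rewrite ball0E=> h1; apply: xM; lra.
  have fxy : f (x+y) = 0.
   apply: fM; rewrite ball0E=> h1; apply: xM. rewrite (_: x = (x+y)-y); last by rewrite addrK.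
   by apply: le_lt_trans (ler_normB _ _) _; lra.
  rewrite fx fxy subrr normr0 powR0 ?gt_eqF//. apply: mulr_ge0; first exact: ltW. apply: addr_ge0.
   apply: mulr_ge0; first exact: ltW. nneg.
  apply: mulr_ge0; first exact: ltW. by apply: addr_ge0; exact: (ub_pos uU).
 have xM2 : ball (0: E) (M+2) x by apply: le_ball xM; lra. have xyM2 : ball (0: E) (M+2) (x+y).
  by move: xM; rewrite !ball0E=> xM; apply: (le_lt_trans (ler_normD _ _)); lra.
 have h1 : `|f (x+y)-f x|<=`|g (x+y)-g x| + (e (x+y)+e x).
  have ->: f (x+y)-f x = (g (x+y)-g x)+((f (x+y)-g (x+y))-(f x-g x)) by ring.
  by apply: le_trans (ler_normD _ _) _; rewrite lerD2l; exact: ler_normB.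
 apply: (le_trans (le_pow (ltW p0) (normr_ge0 _) h1)). apply: (le_trans (pow_add (ltW p0) (normr_ge0 _) _)).
  by apply: addr_ge0; exact: normr_ge0.
 rewrite -/P ler_wpM2l ?(ltW P0)//; apply: lerD; last first.
  apply: (le_trans (pow_add (ltW p0) (normr_ge0 _) (normr_ge0 _))).
  rewrite -/P ler_wpM2l ?(ltW P0)//; apply: lerD.
   by rewrite /U indic_in// mulr1; exact: eb.
  by rewrite /U indic_in// mulr1; exact: eb.
 have d2T : `|g (x+y)-g x|<=2*T%:R.
  by apply: le_trans (ler_normB _ _) _; have := gT x; have := gT (x+y); lra.
 set D:= `|g (x+y)-g x| in d2T *. have D0: 0<=D by exact: normr_ge0.
 rewrite -(@mulr_powRB1 _ D p)// -mulrA mulrC. apply: (@le_trans _ _ ((2*T%:R)`^(p-1)*D)).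
  by rewrite ler_wpM2r//; apply: le_pow=> //; lra.
 rewrite ler_wpM2l ?powR_ge0//. under eq_bigr do rewrite (indic_in xM) mul1r.
 rewrite /D /g (_: _-_-(_-_) = N%:R^-1 *
  (\sum_(j<K) \1_(A j) (tup (x+y)) - \sum_(j<K) \1_(A j) (tup x))); last by ring.
 rewrite normrM ger0_norm ?invr_ge0 ?(ltW NR0)// ler_wpM2l ?invr_ge0 ?(ltW NR0)//.
 by rewrite -sumrB; exact: ler_norm_sum.
- rewrite sumr_const card_ord -[t2 *+ K]mulr_natl.
 have ->: (2*T%:R)`^(p-1)*N%:R^-1*(K%:R*t2) = t/(2*P).
  by rewrite /t2; field; rewrite !gt_eqF ?powR_gt0.
 have PPt : P*(P*P*t1) = t/8 by rewrite /t1; field; rewrite gt_eqF.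
 have ->: P*(t/(2*P)+P*(t1+P*t1+(t1+P*t1))) = t/2+2*(P*P*t1)+2*(P*(P*P*t1)) by field; rewrite gt_eqF.
 rewrite PPt. have: P*P*t1<=t/8.
  rewrite -PPt ler_peMl//; apply: mulr_ge0; last exact: ltW. by apply: mulr_ge0; exact: ltW.
 lra.
Qed.

End BorelVersion.

(** * Smooth functions and their partial derivatives *)

Section DirectionalDerivative.
Context {R: realType} {V: normedModType R}.
Implicit Types (f: V -> R) (x v: V) (t df: R).

(** Restricting to a line makes the one-dimensional chain rule and mean value theorem available for
    partial derivatives. *)
Lemma is_derive_lineP f x v t df : is_derive (x+t *: v) v f df <-> is_derive t 1 (fun s=> f (x+s *: v)) df.
have e : (fun h: R=> h^-1 *: ((f \o shift (x+t *: v)) (h *: v)-f (x+t *: v))) =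
 (fun h: R=> h^-1 *: (((fun s=> f (x+s *: v)) \o shift t) (h *: 1)-f (x+t *: v))).
 apply/funext=> h /=; congr (_ *: (f _-_)). by rewrite [h *: 1]mulr1 scalerDl addrCA.
by split=> -[h1 h2]; split; move: h1 h2; rewrite /derivable /derive e.
Qed.

Lemma is_derive_chain f (psi: R -> R) x v df dpsi : is_derive x v f df -> is_derive (f x) 1 psi dpsi ->
 is_derive x v (fun y=> psi (f y)) (dpsi*df).
move=> hf hpsi. have x0 : x = x+0 *: v by rewrite scale0r addr0. rewrite x0; apply/is_derive_lineP.
rewrite x0 in hf; move/is_derive_lineP: hf=> [g1 g2].
have hp : is_derive ((fun s=> f (x+s *: v)) 0) 1 psi dpsi.
 by rewrite scale0r addr0.
case: hp=> p1 p2. have d : derivable (psi \o (fun s=> f (x+s *: v))) 0 1.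
 by apply/derivable1_diffP/differentiable_comp; exact/derivable1_diffP.
split; first exact: d. have := derive1_comp g1 p1; rewrite !derive1E=> h. rewrite -p2 -g2; exact: h.
Qed.

End DirectionalDerivative.

Section Smooth.
Context {R: realType} {n: nat}.
Notation E := 'rV[R]_n.
Implicit Types (f g: E -> R) (i: 'I_n) (k: nat).

Definition smooth f:= forall k, Cclass k f.

Notation e_ i := (delta_mx 0 i : E).

Lemma CclassW k f: Cclass k.+1 f -> Cclass k f.
elim: k f=> [|k IH] f /=; first by case. by case=> cf h; split=> // i; have [d /IH] := h i.
Qed.

Lemma smooth_cont f: smooth f -> continuous f.
Proof. by move=> /(_ 0%N) []. Qed.

Lemma smooth_d f i: smooth f -> smooth (partial i f).
Proof. by move=> sf k; have [_ /(_ i) []] := sf k.+1. Qed.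

Lemma smooth_der f i x: smooth f -> is_derive x (e_ i) f (partial i f x).
by move=> /(_ 1%N) [_ /(_ i) [d _]]; nneg.
Qed.

Lemma partial_eq f i (df: E -> R): (forall x, is_derive x (e_ i) f (df x)) -> partial i f = df.
Proof. by move=> h; apply/funext=> x; have [] := h x. Qed.

(* [Cclass] is coinductive in nature: any class of continuous functions with
  partial derivatives in the class consists of smooth functions. *)
Lemma smooth_coind (C: (E -> R) -> Prop) : (forall f, C f -> continuous f) ->
 (forall f i, C f -> exists2 df, C df & forall x, is_derive x (e_ i) f (df x)) -> forall f, C f -> smooth f.
move=> cC dC f Cf k; elim: k f Cf=> [|k IH] f Cf /=; split=> //; try exact: cC.
move=> i; have [df Cdf h] := dC f i Cf. split; first by move=> x; have [] := h x.
by rewrite (partial_eq h); exact: IH.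
Qed.

Lemma CclassD k f g: Cclass k f -> Cclass k g -> Cclass k (fun x=> f x+g x).
elim: k f g=> [|k IH] f g /= [cf hf] [cg hg]; split; try by
 move=> x; apply: (@continuousD R R^o _ f g x); [exact: cf|exact: cg]. by [].
move=> i; have [df Cf] := hf i; have [dg Cg] := hg i.
have h x : is_derive x (e_ i) (fun x=> f x+g x) (partial i f x+partial i g x).
 by apply: is_deriveD; nneg.
split; first by move=> x; have [] := h x. by rewrite (partial_eq h); exact: IH.
Qed.

Lemma CclassM k f g: Cclass k f -> Cclass k g -> Cclass k (fun x=> f x*g x).
elim: k f g=> [|k IH] f g Hf Hg.
 case: Hf Hg=> [cf hf] [cg hg]; split=> // x. by apply: (@continuousM R _ f g x); [exact: cf|exact: cg].
have Kf := CclassW Hf; have Kg := CclassW Hg. case: Hf Hg=> [cf hf] [cg hg]; split.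
 by move=> x; apply: (@continuousM R _ f g x); [exact: cf|exact: cg].
move=> i; have [df Cf] := hf i; have [dg Cg] := hg i.
have h x : is_derive x (e_ i) (fun x=> f x*g x) (f x * partial i g x+g x * partial i f x).
 by apply: is_deriveM; nneg.
split; first by move=> x; have [] := h x. by rewrite (partial_eq h); apply: CclassD; apply: IH.
Qed.

Lemma smoothD f g: smooth f -> smooth g -> smooth (fun x=> f x+g x).
Proof. by move=> sf sg k; apply: CclassD. Qed.

Lemma smoothM f g: smooth f -> smooth g -> smooth (fun x=> f x*g x).
Proof. by move=> sf sg k; apply: CclassM. Qed.

Lemma smooth_cst (c: R): smooth (fun=> c).
apply: (@smooth_coind (fun f=> exists c, f = fun=> c)); last by exists c.
 by move=> _ [d ->]; exact: cst_continuous.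
by move=> _ i [d ->]; exists (fun=> 0); [exists 0|move=> x; exact: is_derive_cst].
Qed.

Lemma smoothZ (c: R) f: smooth f -> smooth (fun x=> c*f x).
Proof. by move=> sf; apply: smoothM=> //; exact: smooth_cst. Qed.

Lemma smoothN f: smooth f -> smooth (fun x=> - f x).
Proof. by move=> sf; have := smoothZ (-1) sf; under eq_fun do rewrite mulN1r. Qed.

Lemma smoothB f g: smooth f -> smooth g -> smooth (fun x=> f x-g x).
Proof. by move=> sf sg; apply: smoothD=> //; exact: smoothN. Qed.

Lemma partialD f g i x: smooth f -> smooth g -> partial i (fun x=> f x+g x) x = partial i f x+partial i g x.
move=> sf sg; have h y : is_derive y (e_ i) (fun x=> f x+g x) (partial i f y+partial i g y).
 by apply: is_deriveD; exact: smooth_der.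
by rewrite (partial_eq h).
Qed.

Lemma partialM f g i x: smooth f -> smooth g ->
 partial i (fun x=> f x*g x) x = f x * partial i g x+g x * partial i f x.
move=> sf sg; have h y : is_derive y (e_ i) (fun x=> f x*g x) (f y * partial i g y+g y * partial i f y).
 by apply: is_deriveM; exact: smooth_der.
by rewrite (partial_eq h).
Qed.

Lemma partial_cst (c: R) i x: partial i (fun=> c) x = 0.
have h y : is_derive y (e_ i) (fun=> c) 0 by exact: is_derive_cst. by rewrite (partial_eq h).
Qed.

Lemma partialZ (c: R) f i x: smooth f -> partial i (fun x=> c*f x) x = c * partial i f x.
move=> sf; rewrite partialM//; last exact: smooth_cst. by rewrite partial_cst mulr0 addr0.
Qed.

Lemma partialB f g i x: smooth f -> smooth g -> partial i (fun x=> f x-g x) x = partial i f x-partial i g x.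
move=> sf sg; have h y : is_derive y (e_ i) (fun x=> f x-g x) (partial i f y-partial i g y).
 by apply: is_deriveB; exact: smooth_der.
by rewrite (partial_eq h).
Qed.

Lemma is_derive_aff f i (z: E) (c: R) x df: is_derive (z+c *: x) (e_ i) f df ->
 is_derive x (e_ i) (fun x=> f (z+c *: x)) (c*df).
move=> h. have x0 : x = x+0 *: e_ i by rewrite scale0r addr0. rewrite x0; apply/is_derive_lineP.
have h1 : is_derive (c*0) 1 (fun s=> f ((z+c *: x)+s *: e_ i)) df.
 have := (@is_derive_lineP R E f (z+c *: x) (e_ i) 0 df).1. by rewrite scale0r addr0 mulr0=> /(_ h).
have h2 : is_derive (0: R) 1 ( *%R c) (c*1) by exact: is_deriveZ. rewrite mulr1 in h2.
have := is_derive_chain h2 h1; rewrite mulrC; congr (is_derive _ _ _ _).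
by apply/funext=> s; rewrite scalerDr scalerA addrA.
Qed.

Lemma Cclass_aff k f (z: E) (c: R): Cclass k f -> Cclass k (fun x=> f (z+c *: x)).
have cc g : continuous g -> continuous (fun x: E=> g (z+c *: x)).
 move=> cg x; apply: (@continuous_comp _ _ _ (fun x: E=> z+c *: x) g); last exact: cg.
 apply: (@continuousD R E _ (fun=> z) (fun x=> c *: x)); first exact: cst_continuous.
 exact: scaler_continuous.
elim: k f=> [|k IH] f Hf.
 by case: Hf=> cf _; split=> //; exact: cc.
case: Hf=> cf hf; split; first exact: cc. move=> i; have [df Cf] := hf i.
have h x : is_derive x (e_ i) (fun x=> f (z+c *: x)) (c * partial i f (z+c *: x)).
 by apply: is_derive_aff; nneg.
split; first by move=> x; have [] := h x. rewrite (partial_eq h); apply: CclassM; first exact: smooth_cst.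
exact: IH.
Qed.

Lemma smooth_aff f (z: E) (c: R): smooth f -> smooth (fun x=> f (z+c *: x)).
Proof. by move=> sf k; exact: Cclass_aff. Qed.

Lemma partial_aff f i (z: E) (c: R) x: smooth f ->
 partial i (fun x=> f (z+c *: x)) x = c * partial i f (z+c *: x).
move=> sf; have h y : is_derive y (e_ i) (fun x=> f (z+c *: x)) (c * partial i f (z+c *: y)).
 by apply: is_derive_aff; exact: smooth_der.
by rewrite (partial_eq h).
Qed.

Lemma smooth_shift f (z: E): smooth f -> smooth (fun x=> f (x+z)).
move=> sf; have := smooth_aff z 1 sf; congr smooth. by apply/funext=> x; rewrite scale1r addrC.
Qed.

Lemma partial_shift f i (z: E) x: smooth f -> partial i (fun x=> f (x+z)) x = partial i f (x+z).
move=> sf; have := partial_aff i z 1 x sf. have ->: (fun x=> f (z+1 *: x)) = (fun x=> f (x+z)).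
 by apply/funext=> y; rewrite scale1r addrC.
by move=> ->; rewrite mul1r scale1r addrC.
Qed.

(** The witness [Psi] lists all derivatives of [psi], so that smoothness of a composition is an
    induction over the list. *)
Definition smooth1 (psi: R -> R) (dpsi: R -> R) :=
 exists Psi: nat -> R -> R, [/\ Psi 0%N = psi, Psi 1%N = dpsi &
  forall k (x: R), is_derive x 1 (Psi k) (Psi k.+1 x)].

Lemma is_derive_cont (psi: R -> R) (dpsi: R -> R) :
 (forall x: R, is_derive x 1 psi (dpsi x)) -> continuous psi.
move=> h x; apply: differentiable_continuous. by apply/derivable1_diffP; have [] := h x.
Qed.

Lemma smooth_comp psi dpsi f: smooth1 psi dpsi -> smooth f -> smooth (fun x=> psi (f x)).
case=> Psi [<- _ dPsi] sf k. suff H: forall k (j: nat), Cclass k (fun x=> Psi j (f x)) by exact: H.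
have cj (j: nat): continuous (fun x=> Psi j (f x)).
 move=> x; exact: (@continuous_comp _ _ _ f (Psi j) x (smooth_cont sf (x := x))
  (is_derive_cont (dPsi j) (x := f x))).
elim=> [|m IH] j; split=> //; try exact: cj. move=> i.
have h x : is_derive x (e_ i) (fun x=> Psi j (f x)) (Psi j.+1 (f x) * partial i f x).
 exact: (is_derive_chain (smooth_der i x sf) (dPsi j (f x))).
split; first by move=> x; have [] := h x. rewrite (partial_eq h); apply: CclassM; first exact: IH.
exact: smooth_d.
Qed.

Lemma partial_comp psi dpsi f i x: smooth1 psi dpsi -> smooth f ->
 partial i (fun x=> psi (f x)) x = dpsi (f x) * partial i f x.
case=> Psi [p0 p1 dPsi] sf. have h y : is_derive y (e_ i) (fun x=> psi (f x)) (dpsi (f y) * partial i f y).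
 apply: (is_derive_chain (smooth_der i y sf)). by rewrite -p0 -p1; exact: dPsi.
by rewrite (partial_eq h).
Qed.

Lemma smooth_coord i: smooth (fun x: E=> x 0 i).
have h j x : is_derive x (e_ j) (fun x: E=> x 0 i) ((j == i)%:R).
 have x0 : x = x+0 *: e_ j by rewrite scale0r addr0. rewrite x0; apply/is_derive_lineP.
 rewrite (_: (fun s=> _) = (fun s=> x 0 i+s*(j == i)%:R)); last first.
  by apply/funext=> s; rewrite !mxE eqxx/= eq_sym.
 rewrite -[X in is_derive _ _ _ X]add0r; apply: is_deriveD. rewrite -[X in is_derive _ _ _ X]mul1r mulrC.
 rewrite (_: (fun s=> _) = (fun s: R=> (j == i)%:R*s)).
  exact: is_deriveZ.
 by apply/funext=> s; rewrite mulrC.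
apply: (@smooth_coind (fun f=> (exists c, f = fun=> c) \/ f = fun x: E=> x 0 i)); last by right.
 move=> f [[c ->]|->]; first exact: cst_continuous. exact: coord_continuous.
move=> f j [[c ->]|->].
 by exists (fun=> 0); [left; exists 0|move=> x; exact: is_derive_cst].
by exists (fun=> (j == i)%:R); [left; eexists|exact: h].
Qed.

Lemma smooth_prod (I: Type) (r: seq I) (F: I -> E -> R) :
 (forall j, smooth (F j)) -> smooth (fun x=> \prod_(j <- r) F j x).
move=> sF; elim: r=> [|j r IH].
 by under eq_fun do rewrite big_nil; exact: smooth_cst.
by under eq_fun do rewrite big_cons; exact: smoothM.
Qed.

Lemma mvt_coord f i x (h: R): smooth f ->
 exists2 c: R, `|c|<=`|h| & f (x+h *: e_ i)-f x = h * partial i f (x+c *: e_ i).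
move=> sf. have dF (t: R): is_derive t 1 (fun s=> f (x+s *: e_ i)) (partial i f (x+t *: e_ i)).
 exact: ((is_derive_lineP f x (e_ i) t _).1 (smooth_der i (x+t *: e_ i) sf)).
have cF := is_derive_cont dF. have F0 : f (x+0 *: e_ i) = f x by rewrite scale0r addr0.
have [h0|h0] := leP 0 h.
 have [|c] := MVT_segment h0 (fun t _=> dF t); first exact: continuous_subspaceT.
 rewrite in_itv/= => /andP[c0 ch] e; exists c; first by rewrite !ger0_norm. by rewrite -F0 e subr0 mulrC.
have [|c] := MVT_segment (ltW h0) (fun t _=> dF t); first exact: continuous_subspaceT.
rewrite in_itv/= => /andP[ch c0] e; exists c.
 by rewrite !ler0_norm ?(ltW h0)// lerN2.
by rewrite -F0 -opprB e sub0r mulrN opprK mulrC.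
Qed.

End Smooth.

#[local] Hint Resolve smooth_cont smooth_d: mble.

(** * Bump functions, smooth positive part and mollification kernels *)

Section ExpBump.
Context {R: realType}.
Implicit Types (P: {poly R}) (x y: R).

(* [expbump P x] is [P(1/x) e^(-1/x)] for [x > 0]; these functions are closed
  under derivation, which makes them smooth at [0]. *)
Definition expbump P x: R := if 0<x then P.[x^-1]*expR (- x^-1) else 0.

Lemma poly_exp_bound P: exists2 C, 0<=C & forall y, 1<=y -> `|P.[y]| * expR (- y)<=C.
pose A:= \sum_(i<size P) `|P`_i|. have A0: 0<=A by exact: sumr_ge0. exists (A*(size P).+1`!%:R); first nneg.
move=> y y1; have y0: 0<y by lra. have h1 : `|P.[y]|<=A*y^+(size P).+1.
 rewrite horner_coef (le_trans (ler_norm_sum _ _ _))// mulr_suml.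
 apply: ler_sum=> i _; rewrite normrM ler_wpM2l// ger0_norm ?exprn_ge0 ?(ltW y0)//.
 by apply: ler_weXn2l=> //; apply: ltnW; rewrite ltnS ltnW.
have h2 : y^+(size P).+1<=(size P).+1`!%:R*expR y.
 rewrite -ler_pdivrMl ?ltr0n ?fact_gt0// mulrC.
 by apply: le_trans (expR_ge1Dxn (size P) (ltW y0)); rewrite lerDr.
apply: (@le_trans _ _ (A*((size P).+1`!%:R*expR y)*expR (- y))).
 rewrite ler_wpM2r ?expR_ge0//; apply: (le_trans h1); exact: ler_wpM2l.
by rewrite -mulrA -[X in A*X]mulrA -expRD subrr expR0 mulr1.
Qed.

Lemma is_derive_expbump P x : is_derive x 1 (expbump P) (expbump ('X^2*(P-P^`())) x).
have [x0|x0|<-] := ltgtP 0 x.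
- have xn0 : x != 0 by rewrite gt_eqF.
 have dV : is_derive x 1 (fun x: R=> x^-1) (- x ^- 2).
  have dd : derivable (fun y: R=> y^-1) x 1 := derivableV (f := id) xn0 (@derivable_id R R x 1).
  apply: (DeriveDef dd). by rewrite (deriveV (f := id) xn0 (@derivable_id R R x 1)) derive_id [_ *: _]mulr1.
 have dN : is_derive x 1 (fun x: R=> - x^-1) (x ^- 2).
  by have := is_deriveN dV; rewrite opprK.
 have d1 := is_derive_chain dV (is_derive_poly P x^-1).
 have d2 := is_derive_chain dN (is_derive_expR (- x^-1)). have d3 := is_deriveM d1 d2.
 have d : is_derive x 1 (fun x: R=> P.[x^-1]*expR (- x^-1)) (expbump ('X^2*(P-P^`())) x).
  apply: (is_derive_eq d3); rewrite /expbump x0 !hornerE/= /GRing.scale/=. by rewrite -exprVn; ring.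
 apply: near_eq_is_derive d; near=> y; rewrite /expbump ifT//. near: y; exact: lt_nbhsr.
- have d : is_derive x 1 (fun=> 0: R) (expbump ('X^2*(P-P^`())) x).
  apply: (is_derive_eq (@is_derive_cst R R R 0 x 1)). by rewrite /expbump ltNge (ltW x0).
 apply: near_eq_is_derive d; near=> y; rewrite /expbump ifF//.
 apply/negbTE; rewrite -leNgt ltW//; near: y; exact: lt_nbhsl.
- rewrite [expbump _ 0]/expbump ltxx.
 (* For [h > 0] the quotient [h^-1 P(1/h) e^(-1/h)] is [h] times [h^-2 P(1/h) e^(-1/h)], and [C]
    bounds the latter. *)
 have [C C0 hC] := poly_exp_bound ('X^2*P).
 have H : (fun h: R=> h^-1 *: ((expbump P \o shift 0) (h *: 1)-expbump P 0)) @ 0^' --> (0: R).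
  apply/cvgrPdist_le=> e e0. have C10: 0<C+1 by lra. exists (Num.min 1 (e/(C+1)))=> /=.
   by rewrite lt_min ltr01 divr_gt0.
  move=> h /=; rewrite sub0r normrN lt_min=> /andP[h1 hC1] hn0.
  rewrite sub0r normrN [h *: 1]mulr1 addr0 /expbump ltxx subr0.
  case: ifPn=> [h0|_]; last by rewrite scaler0 normr0 ltW.
  have hV: 1<=h^-1 by rewrite invf_ge1// ltW// -(gtr0_norm h0).
  have := hC _ hV; rewrite !hornerE normrM ger0_norm ?sqr_ge0// => hh.
  rewrite /GRing.scale/= !normrM gtr0_norm ?invr_gt0// (ger0_norm (expR_ge0 _)). rewrite gtr0_norm// in hC1.
  have ->: h^-1*(`|P.[h^-1]| * expR (- h^-1)) = h*(h^-1^+2 * `|P.[h^-1]| * expR (- h^-1)).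
   by field; rewrite gt_eqF.
  apply: (@le_trans _ _ (h*C)); first by rewrite ler_wpM2l// ltW.
  apply: (@le_trans _ _ (h*(C+1))); first by rewrite ler_wpM2l ?(ltW h0)//; lra.
  by rewrite -ler_pdivlMr// ltW.
 by apply: DeriveDef; [exact: (cvgP _ H)|exact: (cvg_lim _ H)].
Unshelve. all: by end_near. Qed.

Lemma smooth1_expbump P: smooth1 (expbump P) (expbump ('X^2*(P-P^`()))).
exists (fun k=> expbump (iter k (fun Q=> 'X^2*(Q-Q^`())) P)); split=> //.
by move=> k x; exact: is_derive_expbump.
Qed.

Lemma expbump_ge0 x: 0<=expbump 1 x.
Proof. by rewrite /expbump hornerC mul1r; case: ifP=> // _; exact: expR_ge0. Qed.

Lemma expbump_gt0 x: 0<x -> 0<expbump 1 x.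
Proof. by move=> x0; rewrite /expbump x0 hornerC mul1r expR_gt0. Qed.

Lemma expbump_le0 P x: x<=0 -> expbump P x = 0.
Proof. by move=> x0; rewrite /expbump ltNge x0. Qed.

Lemma expbump_le1 x: expbump 1 x<=1.
rewrite /expbump hornerC mul1r; case: ifPn=> // x0. by rewrite -expR0 ler_expR oppr_le0 invr_ge0 ltW.
Qed.

Lemma le_expbump x y: x<=y -> expbump 1 x<=expbump 1 y.
move=> xy; have [x0|x0] := leP x 0; first by rewrite expbump_le0 ?expbump_ge0.
have y0: 0<y by exact: lt_le_trans xy. by rewrite /expbump x0 y0 !hornerC !mul1r ler_expR lerN2 lef_pV2.
Qed.

(** A smooth substitute for the positive part: [x e^(-1/x)] for [x > 0]. It lies between [(x - 1)/e]
    and [max x 0], and its slope stays in [[0, 1]]. *)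
Definition softpos x: R := x*expbump 1 x.
Definition dsoftpos x: R := expbump (1 + 'X) x.

Lemma smooth1_softpos: smooth1 softpos dsoftpos.
exists (fun k=> if k is k'.+1 then expbump (iter k' (fun Q=> 'X^2*(Q-Q^`())) (1 + 'X)) else softpos).
split=> // -[|k] x; last exact: is_derive_expbump.
have := is_deriveM (@is_derive_id R R x 1) (is_derive_expbump 1 x).
move=> h; apply: (is_derive_eq h); rewrite /GRing.scale/= /expbump.
case: ifPn=> x0; last by rewrite mulr0 mul0r addr0. have ->: (1: {poly R})^`() = 0 by rewrite -polyC1 derivC.
by rewrite subr0 !hornerE/=; field; rewrite gt_eqF.
Qed.

Lemma softpos_le x: softpos x<=Num.max x 0.
rewrite /softpos; have [x0|x0] := leP x 0; first by rewrite expbump_le0// mulr0.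
by rewrite -[leRHS]mulr1 ler_wpM2l ?(ltW x0)//; exact: expbump_le1.
Qed.

Lemma softpos_ge0 x: 0<=softpos x.
rewrite /softpos; have [x0|x0] := leP x 0; first by rewrite expbump_le0// mulr0.
by rewrite mulr_ge0 ?(ltW x0)//; exact: expbump_ge0.
Qed.

Lemma softpos_ge x: x-1<=expR 1*softpos x.
have e0 := expR_gt0 (1: R). have [x1|x1] := leP x 1.
 by apply: (@le_trans _ _ 0); [lra|rewrite mulr_ge0 ?softpos_ge0// ltW].
have x0: 0<x by lra. rewrite /softpos /expbump x0 hornerC mul1r mulrCA -expRD.
apply: (@le_trans _ _ x); first lra.
rewrite -[leLHS]mulr1 ler_wpM2l ?(ltW x0)// -[leLHS]expR0 ler_expR subr_ge0. by rewrite invf_le1// ltW.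
Qed.

Lemma le_softpos x y: x<=y -> softpos x<=softpos y.
move=> xy; have [x0|x0] := leP x 0.
 by rewrite {1}/softpos expbump_le0// mulr0 softpos_ge0.
by rewrite /softpos ler_pM ?(ltW x0) ?expbump_ge0//; exact: le_expbump.
Qed.

Lemma dsoftpos_ge0 x: 0<=dsoftpos x.
rewrite /dsoftpos /expbump; case: ifPn=> // x0. by rewrite !hornerE mulr_ge0// addr_ge0// invr_ge0 ltW.
Qed.

Lemma dsoftpos_le1 x: dsoftpos x<=1.
rewrite /dsoftpos /expbump; case: ifPn=> // x0. rewrite !hornerE expRN ler_pdivrMr ?expR_gt0// mul1r.
exact: expR_ge1Dx.
Qed.

Lemma dsoftpos_le0 x: x<=0 -> dsoftpos x = 0.
Proof. exact: expbump_le0. Qed.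

End ExpBump.

#[local] Hint Resolve expbump_ge0 softpos_ge0 dsoftpos_ge0: nneg.

Section Cutoffs.
Context {R: realType} {n: nat}.
Notation E := 'rV[R]_n.
Notation L := (lebesgueType R n).
Notation leb := (@lebesgue R n).
Implicit Types (f v: E -> R) (i: 'I_n) (M r s: R).

Definition vanish M f:= forall x, ~ ball (0: E) M x -> f x = 0.

Lemma vanishW M M' f: M<=M' -> vanish M f -> vanish M' f.
Proof. by move=> h v x nx; apply: v=> b; apply: nx; exact: le_ball b. Qed.

Lemma cont_bounded M f: continuous f -> vanish M f -> exists2 C, 0<=C & forall x, `|f x|<=C.
move=> cf vf. pose A: set E:= [set x | `|x|<=M]. have cA : compact A.
 apply: bounded_closed_compact.
  exists M; split; first exact: num_real. by move=> y My x Ax; apply: (le_trans Ax); exact: ltW.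
 apply: (@closed_comp _ _ (fun x: E=> `|x|) [set y: R | y<=M]).
  by move=> x _; exact: norm_continuous.
 by [].
have cfA : compact (f @` A).
 by apply: continuous_compact=> //; exact: continuous_subspaceT.
have [N [_ hN]] := compact_bounded cfA. exists (Num.max 0 (N+1)); first by rewrite le_max lexx.
move=> x; have [Ax|nA] := pselect (A x).
 apply: (@le_trans _ _ (N+1)); last by rewrite le_max lexx orbT. by apply: hN; [rewrite ltrDl|exists x].
rewrite vf ?normr0 ?le_max ?lexx// => h; apply: nA=> /=. by move: h; rewrite ball0E=> /ltW.
Qed.

Lemma vanish_d M M' f i: M<M' -> vanish M f -> vanish M' (partial i f).
move=> MM' vf x nx.
have xM : M<`|x| by rewrite ball0E in nx; apply: (lt_le_trans MM'); rewrite leNgt; exact/negP.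
rewrite /partial -(near_eq_derive (f := fun=> 0)) ?derive_cst//.
near=> y; rewrite vf// ball0E; apply/negP; rewrite -leNgt ltW//.
near: y; apply: (@cvgr_gt _ _ _ _ (fun y: E=> `|y|)); last exact: xM. exact: norm_continuous.
Unshelve. all: by end_near. Qed.

Lemma fin_bound (I: finType) (P: I -> R -> Prop) : (forall k C C', P k C -> C<=C' -> P k C') ->
 (forall k, exists2 C, 0<=C & P k C) -> exists2 C, 0<=C & forall k, P k C.
move=> mono h; have {}h k: {C: R | 0<=C /\ P k C}.
 by apply: cid; have [C ? ?] := h k; exists C.
have c0 k: 0<=sval (h k) by have [] := svalP (h k). exists (\sum_k sval (h k)); first by apply: sumr_ge0.
move=> k; have [_ hk] := svalP (h k); apply: mono hk _. by rewrite (bigD1 k)//= lerDl sumr_ge0.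
Qed.

Lemma smooth_bounds M f: smooth f -> vanish M f -> exists C, [/\ 0<=C,
 forall x, `|f x|<=C, forall i x, `|partial i f x|<=C & forall i j x, `|partial j (partial i f) x|<=C].
move=> sf vf; have M1 : M<M+1 by lra. have M2 : M+1<M+2 by lra. have v1 i := vanish_d i M1 vf.
have v2 i j := vanish_d j M2 (v1 i). have [C0 p0 h0] := cont_bounded (smooth_cont sf) vf.
have [C1 p1 h1]: exists2 C, 0<=C & forall i x, `|partial i f x|<=C.
 apply: (fin_bound (P := fun i C=> forall x, `|partial i f x|<=C)).
  by move=> i C C' h CC x; exact: le_trans (h x) CC.
 by move=> i; exact: cont_bounded (smooth_cont (smooth_d i sf)) (v1 i).
have [C2 p2 h2]: exists2 C, 0<=C & forall i j x, `|partial j (partial i f) x|<=C.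
 apply: (fin_bound (P := fun i C=> forall j x, `|partial j (partial i f) x|<=C)).
  by move=> i C C' h CC j x; exact: le_trans (h j x) CC.
 move=> i; apply: (fin_bound (P := fun j C=> forall x, `|partial j (partial i f) x|<=C)).
  by move=> j C C' h CC x; exact: le_trans (h x) CC.
 move=> j; exact: cont_bounded (smooth_cont (smooth_d j (smooth_d i sf))) (v2 i j).
exists (C0+C1+C2); split; first by lra.
- by move=> x; apply: (le_trans (h0 x)); lra.
- by move=> i x; apply: (le_trans (h1 i x)); lra.
- by move=> i j x; apply: (le_trans (h2 i j x)); lra.
Qed.

Definition bump r (x: E): R := \prod_(i<n) (expbump 1 (r-x 0 i)*expbump 1 (r+x 0 i)).

Lemma smooth_bump r: smooth (bump r).
apply: smooth_prod=> i; apply: smoothM.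
 apply: (smooth_comp (smooth1_expbump 1)); apply: smoothB; first exact: smooth_cst. exact: smooth_coord.
apply: (smooth_comp (smooth1_expbump 1)); apply: smoothD; first exact: smooth_cst. exact: smooth_coord.
Qed.

Lemma bump_ge0 r x: 0<=bump r x.
Proof. by apply: prodr_ge0=> i _; rewrite mulr_ge0 ?expbump_ge0. Qed.

Lemma bump_le1 r x: bump r x<=1.
apply: prodr_ile1=> i _; rewrite mulr_ge0 ?expbump_ge0//=. by rewrite mulr_ile1 ?expbump_ge0 ?expbump_le1.
Qed.

Lemma norm_lt_coord (x: E) r: 0<r -> (forall i, `|x ord0 i|<r) -> `|x|<r.
move=> r0 h; have: ball (0: E) r x by rewrite (ballE _ r0)=> i; rewrite mxE sub0r normrN. by rewrite ball0E.
Qed.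

Lemma vanish_bump r: 0<r -> vanish r (bump r).
move=> r0 x nx. have [i hi]: exists i, r<=`|x ord0 i|.
 apply: contrapT=> h; apply: nx; rewrite ball0E; apply: norm_lt_coord=> // i.
 by rewrite ltNge; apply/negP=> ?; apply: h; exists i.
rewrite /bump (bigD1 i)//=; move: hi; rewrite ler_normr=> /orP[h|h].
 by rewrite (expbump_le0 1 (x := r-x ord0 i)) ?mul0r ?subr_le0.
by rewrite (expbump_le0 1 (x := r+x ord0 i)) ?mulr0 ?mul0r//; lra.
Qed.

Lemma bump_ge r r' x: r' < r -> ball (0: E) r' x -> (expbump 1 (r-r')*expbump 1 (r-r'))^+n<=bump r x.
move=> rr; rewrite ball0E=> xr.
set c:= (X in X^+n); have ->: c^+n = \prod_(i<n) c by rewrite prodr_const card_ord.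
apply: ler_prod=> i _; rewrite /c. rewrite mulr_ge0 ?expbump_ge0//=.
have := coord_le_norm x i; rewrite ler_norml=> /andP[h1 h2].
by apply: ler_pM; rewrite ?expbump_ge0//; apply: le_expbump; lra.
Qed.

Lemma exists_cutoff r r': 0<r -> r' < r -> exists eta: E -> R, [/\ smooth eta,
 vanish r eta, forall x, 0<=eta x & forall x, ball (0: E) r' x -> 1<=eta x].
move=> r0 rr. set c:= (expbump 1 (r-r')*expbump 1 (r-r'))^+n.
have c0: 0<c by rewrite exprn_gt0// mulr_gt0// expbump_gt0// subr_gt0. exists (fun x=> c^-1*bump r x); split.
- by apply: smoothZ; exact: smooth_bump.
- by move=> x nx; rewrite vanish_bump// mulr0.
- by move=> x; rewrite mulr_ge0 ?bump_ge0// invr_ge0 ltW.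
- by move=> x xr; rewrite mulrC ler_pdivlMr// mul1r; exact: bump_ge.
Qed.

Definition bumpZ: R := fine (\int[leb]_x (bump 1 x)%:E)%E.

Lemma ub_bump1: ub (bump 1) (2^+n).
have := ub_ball (0: E) (@ltr01 R); rewrite mulr1=> h.
apply: ub_fle h; first by apply: mble_cont; exact: smooth_cont (smooth_bump 1).
 exact: bump_ge0.
move=> x; have [b|nb] := pselect (ball (0: E) 1 x).
 by rewrite indic_in// bump_le1.
by rewrite indic_out// vanish_bump.
Qed.

Lemma bumpZE: (\int[leb]_x (bump 1 x)%:E = bumpZ%:E)%E.
rewrite /bumpZ fineK// ge0_fin_numE; last by apply: intEF_ge0=> x; exact: bump_ge0.
by have [_ _ h] := ub_bump1; apply: (le_lt_trans h); rewrite ltry.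
Qed.

Lemma bumpZ_gt0: 0<bumpZ.
rewrite -lte_fin -bumpZE. pose c: R := (expbump 1 (1-2^-1)*expbump 1 (1-2^-1))^+n.
have c0: 0<c by rewrite exprn_gt0// mulr_gt0// expbump_gt0//; lra. have h0: 0<2^-1 :> R by lra.
have mb := mble_ball (0: E) (2^-1: R). have [mbu _ _] := ub_bump1.
apply: (@lt_le_trans _ _ (c%:E*(\int[leb]_x (\1_(ball (0: E) 2^-1) x)%:E))%E).
 rewrite (integral_indic leb measurableT (@mbl_lball R n 0 2^-1)) setIT.
 apply: (@lt_le_trans _ _ (c%:E*((2*2^-1)^+n)%:E)%E).
  by rewrite -EFinM lte_fin mulr_gt0// exprn_gt0//; lra.
 by rewrite -(leb_ball (0: E) h0); exact: lexx.
rewrite -(intEFZ _ mb); [|by move=> x; by []|exact: ltW]. apply: (intEF_le _ _ mbu).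
- by apply: mbleM=> //; exact: mble_cst.
- by move=> x; rewrite mulr_ge0 ?indic_ge0 ?(ltW c0). move=> x; have [b|nb] := pselect (ball (0: E) 2^-1 x).
 by rewrite indic_in// mulr1; apply: bump_ge=> //; lra.
by rewrite indic_out// mulr0 bump_ge0.
Qed.

Definition kern s (x: E): R := (bumpZ*s^+n)^-1*bump 1 (s^-1 *: x).

Lemma smooth_kern s: smooth (kern s).
apply: smoothZ; have := smooth_aff 0 s^-1 (smooth_bump 1); congr smooth. by apply/funext=> x; rewrite add0r.
Qed.

Lemma kern_ge0 s x: 0<s -> 0<=kern s x.
move=> s0; rewrite mulr_ge0 ?bump_ge0// invr_ge0 mulr_ge0 ?exprn_ge0 ?(ltW s0)//. exact: ltW bumpZ_gt0.
Qed.

Lemma vanish_kern s: 0<s -> vanish s (kern s).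
move=> s0 x nx; rewrite /kern vanish_bump ?mulr0// ball0E=> h; apply: nx.
rewrite ball0E; move: h; rewrite normrZ gtr0_norm ?invr_gt0//. by rewrite ltr_pdivrMl// mulr1.
Qed.

Lemma kern_le s x: 0<s -> kern s x<=(bumpZ*s^+n)^-1.
move=> s0; rewrite -[leRHS]mulr1 ler_wpM2l ?bump_le1// invr_ge0.
by rewrite mulr_ge0 ?exprn_ge0 ?(ltW s0)//; exact: ltW bumpZ_gt0.
Qed.

Lemma kern_int1 s: 0<s -> (\int[leb]_x (kern s x)%:E = 1)%E.
move=> s0; have [mbu _ _] := ub_bump1. have Z0 := bumpZ_gt0; have sn0: 0<s^+n by nneg.
have sV : s^-1 != 0 by rewrite invr_neq0// gt_eqF. have ma : mble (fun x=> bump 1 (s^-1 *: x)).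
 have := mble_aff 0 sV mbu; congr mble; apply/funext=> x; by rewrite add0r.
rewrite (intEFZ _ ma); [|by move=> x; exact: bump_ge0|nneg].
have mE : measurable_fun setT (fun x: L=> (bump 1 x)%:E) by exact/measurable_EFinP.
have := @ge0_integral_laff R n 0 s^-1 (fun x=> (bump 1 x)%:E) sV mE
 (fun x=> bump_ge0 1 x: (0<=(bump 1 x)%:E)%E).
move=> h; have ->: (\int[leb]_x (bump 1 (s^-1 *: x))%:E = (`|s^-1| ^- n)%:E*\int[leb]_x (bump 1 x)%:E)%E.
 by rewrite -h; apply: eq_integral=> x _; rewrite add0r.
rewrite bumpZE -!EFinM; congr EFin. rewrite gtr0_norm ?invr_gt0// exprVn invrK; field. by rewrite !gt_eqF.
Qed.

Lemma ub_kern s: 0<s -> ub (kern s) 1.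
move=> s0; split; last by rewrite kern_int1.
 by apply: mble_cont; exact: smooth_cont (smooth_kern s).
by move=> x; exact: kern_ge0.
Qed.

End Cutoffs.

#[local] Hint Resolve bump_ge0 kern_ge0: nneg.

(** * Signed integrals and convolution with smooth kernels *)

Section SignedIntegral.
Context {R: realType} {n: nat}.
Notation E := 'rV[R]_n.
Notation L := (lebesgueType R n).
Notation leb := (@lebesgue R n).
Implicit Types (f g: E -> R) (c d: R).

Definition itg f:= leb.-integrable setT (EFin \o f).

Definition integ f: R := \int[leb]_x f x.

Lemma itg_mble f: itg f -> mble f.
Proof. by move=> /integrableP[h _]; apply/measurable_EFinP. Qed.

Lemma itg_le f g c: mble f -> (forall x, `|f x|<=g x) -> ub g c -> itg f.
move=> mf fg ug; apply: (le_integrable measurableT _ _ (ub_integrable ug)).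
 exact/measurable_EFinP.
by move=> x _ /=; rewrite lee_fin (le_trans (fg x))// ler_norm.
Qed.

Lemma itg_ub f c: ub (fun x=> `|f x|) c -> mble f -> itg f.
Proof. by move=> u mf; apply: itg_le u. Qed.

Lemma itgD f g: itg f -> itg g -> itg (fun x=> f x+g x).
Proof. by move=> h1 h2; apply: (integrableD measurableT h1 h2). Qed.

Lemma itgB f g: itg f -> itg g -> itg (fun x=> f x-g x).
Proof. by move=> h1 h2; apply: (integrableB measurableT h1 h2). Qed.

Lemma itgZ f c: itg f -> itg (fun x=> c*f x).
Proof. by move=> h1; apply: (integrableZl measurableT c h1). Qed.

Lemma integD f g: itg f -> itg g -> integ (fun x=> f x+g x) = integ f+integ g.
Proof. by move=> h1 h2; rewrite /integ RintegralD. Qed.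

Lemma integB f g: itg f -> itg g -> integ (fun x=> f x-g x) = integ f-integ g.
Proof. by move=> h1 h2; rewrite /integ RintegralB. Qed.

Lemma integZ f c: itg f -> integ (fun x=> c*f x) = c * integ f.
Proof. by move=> h1; rewrite /integ RintegralZl. Qed.

Lemma integ_norm f c: mble f -> ub (fun x=> `|f x|) c -> `|integ f|<=c.
move=> mf uf; have itf := itg_ub uf mf. have [_ _ h] := uf.
apply: le_trans (le_normr_Rintegral measurableT itf) _. rewrite -lee_fin; apply: le_trans h; rewrite fineK//.
rewrite ge0_fin_numE; last by apply: intEF_ge0=> x.
by have [_ _ h] := uf; apply: (le_lt_trans h); rewrite ltry.
Qed.

Lemma ub_integ f c: ub f c -> (\int[leb]_x (f x)%:E = (integ f)%:E)%E.
move=> uf; rewrite /integ /Rintegral fineK// ge0_fin_numE; last first.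
 by apply: intEF_ge0=> x; exact: (ub_pos uf).
by have [_ _ h] := uf; apply: (le_lt_trans h); rewrite ltry.
Qed.

Lemma integ_ge0 f: (forall x, 0<=f x) -> 0<=integ f.
Proof. by move=> h; apply: Rintegral_ge0. Qed.

Lemma itg_abs f: itg f -> exists c, ub (fun x=> `|f x|) c.
move=> itf; have mf := itg_mble itf; exists (integ (fun x=> `|f x|)); split=> //.
 mbl.
move/integrableP: itf=> [_ h]. rewrite /integ /Rintegral fineK// ge0_fin_numE//. by apply: intEF_ge0=> x.
Qed.

Lemma integ_eq f g: (forall x, f x = g x) -> integ f = integ g.
Proof. by move=> h; congr (integ _); apply/funext. Qed.

Lemma integ_pm f: itg f -> integ f = integ (fun x=> Num.max (f x) 0)-integ (fun x=> Num.max (- f x) 0).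
move=> itf; have mf := itg_mble itf; have [c uc] := itg_abs itf. rewrite -integB.
- apply: integ_eq=> x; rewrite /Num.max.
 by have [h1|h1] := ltP (f x) 0; have [h2|h2] := ltP (- f x) 0; lra.
- apply: (itg_le _ _ uc); first by apply: mble_max=> //; mbl.
 by move=> x; rewrite /Num.max; case: ltP=> h; rewrite ?normr0.
- apply: (itg_le _ _ uc); first by apply: mble_max; [exact: mbleN|mbl].
 by move=> x; rewrite /Num.max; case: ltP=> h; rewrite ?normr0 ?normrN.
Qed.

Lemma itg_aff f (z: E) c: c != 0 -> itg f -> itg (fun x=> f (z+c *: x)).
move=> c0 itf; have [d ud] := itg_abs itf; apply: (itg_ub (ub_aff z c0 ud)).
by apply: mble_aff=> //; exact: itg_mble.
Qed.

Lemma ub_integ_aff f (z: E) c d: c != 0 -> ub f d -> integ (fun x=> f (z+c *: x)) = `|c| ^- n * integ f.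
move=> c0 uf; rewrite /integ /Rintegral.
have mE : measurable_fun setT (fun x: L=> (f x)%:E) by apply/measurable_EFinP; case: uf.
have -> := @ge0_integral_laff R n z c (fun x=> (f x)%:E) c0 mE (fun x=> ub_pos uf x).
by rewrite (ub_integ uf).
Qed.

Lemma integ_aff f (z: E) c: c != 0 -> itg f -> integ (fun x=> f (z+c *: x)) = `|c| ^- n * integ f.
move=> c0 itf; have mf := itg_mble itf; have [d ud] := itg_abs itf.
rewrite (integ_pm itf) (integ_pm (itg_aff z c0 itf)) mulrBr. have up : ub (fun x=> Num.max (f x) 0) d.
 apply: (ub_fle _ _ _ ud); first by apply: mble_max=> //; mbl.
  by move=> x; rewrite le_max lexx orbT.
 by move=> x; rewrite ge_max ler_norm normr_ge0.
have um : ub (fun x=> Num.max (- f x) 0) d.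
 apply: (ub_fle _ _ _ ud); first by apply: mble_max; [exact: mbleN|mbl].
  by move=> x; rewrite le_max lexx orbT.
 by move=> x; rewrite ge_max -normrN ler_norm normr_ge0.
by rewrite (ub_integ_aff z c0 up) (ub_integ_aff z c0 um).
Qed.

Lemma integ_refl f (z: E): itg f -> integ (fun x=> f (z-x)) = integ f.
move=> itf; have := @integ_aff f z (-1).
rewrite oppr_eq0 oner_eq0 normrN1 expr1n invr1 mul1r=> /(_ isT itf) <-.
by apply: integ_eq=> x; rewrite scaleN1r.
Qed.

Lemma itg_refl f (z: E): itg f -> itg (fun x=> f (z-x)).
move=> itf; have := @itg_aff f z (-1). rewrite oppr_eq0 oner_eq0=> /(_ isT itf); congr itg.
by apply/funext=> x; rewrite scaleN1r.
Qed.

End SignedIntegral.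

Section Convolution.
Context {R: realType} {n: nat}.
Notation E := 'rV[R]_n.
Implicit Types (f g w k: E -> R) (i: 'I_n) (M: R).
Notation e_ i := (delta_mx 0 i : E).

Definition conv w k (x: E): R := integ (fun y=> w y*k (x-y)).

Lemma itg_mulb w k C: itg w -> mble k -> (forall x, `|k x|<=C) -> itg (fun x=> w x*k x).
move=> iw mk kC; have [c uc] := itg_abs iw. have C0: 0<=C by apply: le_trans (kC 0).
apply: (itg_le _ _ (ubZ C0 uc)); first by apply: mbleM=> //; exact: itg_mble.
by move=> x; rewrite normrM mulrC ler_wpM2r.
Qed.

Lemma mble_refl k x: mble k -> mble (fun y=> k (x-y)).
move=> mk; have := @mble_aff R n k x (-1); rewrite oppr_eq0 oner_eq0=> /(_ isT mk).
by congr mble; apply/funext=> y; rewrite scaleN1r.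
Qed.

Lemma conv_itg w k M x: itg w -> smooth k -> vanish M k -> itg (fun y=> w y*k (x-y)).
move=> iw sk vk; have [C [_ kC _ _]] := smooth_bounds sk vk.
apply: (itg_mulb (C := C))=> //; apply: mble_refl; apply: mble_cont. mbl.
Qed.

Lemma conv_sym w k M x: itg w -> smooth k -> vanish M k -> conv w k x = integ (fun y=> k y*w (x-y)).
move=> iw sk vk; rewrite /conv -(integ_refl x (conv_itg x iw sk vk)).
by apply: integ_eq=> y; rewrite subKr mulrC.
Qed.

Lemma taylor1 k i x h C: smooth k -> (forall i j x, `|partial j (partial i k) x|<=C) ->
 `|k (x+h *: e_ i)-k x-h * partial i k x|<=C*(`|h| * `|h|).
move=> sk kC; have C0: 0<=C by apply: le_trans (kC i i 0). have [c ch ->] := mvt_coord i x h sk.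
have [d dc e] := mvt_coord i x c (smooth_d i sk).
rewrite -mulrBr e !normrM mulrC [leRHS]mulrA; apply: ler_pM=> //. by rewrite mulrC ler_pM.
Qed.

(** Change the coordinates one at a time; each change is at most [|z|]. *)
Lemma segment_lipschitz f K: (forall i x h, `|f (x+h *: e_ i)-f x|<=K * `|h|) -> 0<=K ->
 forall x z, `|f (x+z)-f x|<=n%:R*K * `|z|.
move=> fK K0 x z. pose S (m: nat): E := \sum_(i<n | (i<m)%N) z 0 i *: e_ i.
have S0 : S 0%N = 0 by rewrite /S big_pred0. have Sn : S n = z.
 rewrite /S (eq_bigl xpredT); last by move=> i; rewrite ltn_ord. by rewrite -row_sum_delta.
have step m : (m<=n)%N -> `|f (x+S m)-f x|<=m%:R*(K * `|z|).
 elim: m=> [|m IH] mn; first by rewrite S0 addr0 subrr normr0 mul0r.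
 have ->: S m.+1 = S m+z 0 (Ordinal mn) *: e_ (Ordinal mn).
  rewrite /S (bigD1 (Ordinal mn))//= addrC; congr (_+_).
  apply: eq_bigl=> i; rewrite ltnS [in RHS]ltn_neqAle andbC; congr (_ && _).
 rewrite addrA -(subrKA (f (x+S m))) -natr1 mulrDl mul1r [leRHS]addrC.
 apply: (le_trans (ler_normD _ _)); apply: lerD; last exact: (IH (ltnW mn)).
 by apply: (le_trans (fK _ _ _)); rewrite ler_wpM2l//; exact: coord_le_norm.
by have := step n (leqnn n); rewrite Sn mulrA.
Qed.

Lemma conv_segment w k M i x h C c: itg w -> ub (fun x=> `|w x|) c -> smooth k -> vanish M k ->
 (forall i x, `|partial i k x|<=C) -> `|conv w k (x+h *: e_ i)-conv w k x|<=c*C * `|h|.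
move=> iw uw sk vk kC. rewrite /conv -integB; [|exact: conv_itg iw sk vk..].
rewrite (integ_eq (g := fun y=> w y*(k (x-y+h *: e_ i)-k (x-y)))); last first.
 by move=> y; rewrite mulrBr addrAC.
have C0: 0<=C by apply: le_trans (kC i 0). have mw := itg_mble iw.
have mk : mble (fun y=> w y*(k (x-y+h *: e_ i)-k (x-y))).
 apply: mbleM=> //; have mk := mble_cont (smooth_cont sk).
 apply: mbleB; [exact: (mble_refl x (mble_shift (h *: e_ i) mk))|exact: mble_refl].
apply: integ_norm=> //. have Ch: 0<=C * `|h| by nneg.
rewrite -mulrA mulrC; apply: (ub_fle _ _ _ (ubZ Ch uw))=> [|y|y].
- mbl.
- nneg.
- rewrite normrM mulrC ler_wpM2r//.
 by have [d _ ->] := mvt_coord i (x-y) h sk; rewrite normrM mulrC ler_wpM2r.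
Qed.

Lemma conv_cont w k M: itg w -> smooth k -> vanish M k -> continuous (conv w k).
move=> iw sk vk; have [c uw] := itg_abs iw. have [C [C0 _ kC _]] := smooth_bounds sk vk. have c0 := ub_ge0 uw.
have lip := segment_lipschitz (fun i x h=> conv_segment i x h iw uw sk vk kC) (mulr_ge0 c0 C0).
move=> x; apply/(@cvgrPdist_le _ _ _ (nbhs (x: E)))=> /= e e0. pose K:= n%:R*(c*C)+1.
have K0: 0<K by rewrite ltr_wpDl// !mulr_ge0. apply/nbhs_ballP; exists (e/K)=> /=; first nneg.
move=> y; rewrite -ball_normE /= distrC=> /ltW xy. rewrite distrC -(subrK x y) (addrC (y-x)).
apply: (le_trans (lip _ _)); apply: (@le_trans _ _ (K * `|y-x|)).
 by rewrite ler_wpM2r// /K lerDl.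
by rewrite mulrC -ler_pdivlMr.
Qed.

(** By Taylor's formula the kernel differs from its linear part by a multiple of [h^2], uniformly in
    the integration variable. Integrating this error bound replaces differentiation under the
    integral sign. *)
Lemma conv_is_derive w k M i x: itg w -> smooth k -> vanish M k ->
 is_derive x (e_ i) (conv w k) (conv w (partial i k) x).
move=> iw sk vk; have [c uw] := itg_abs iw. have [C [C0 _ _ kC]] := smooth_bounds sk vk. have c0 := ub_ge0 uw.
have v' := vanish_d i (_: M<M+1) vk. have {}v': vanish (M+1) (partial i k) by apply: v'; lra.
have est h : `|conv w k (x+h *: e_ i)-conv w k x-h*conv w (partial i k) x| <= c*C*(`|h| * `|h|).
 have i1 := conv_itg (x+h *: e_ i) iw sk vk. have i2 := conv_itg x iw sk vk.
 have i3 := itgZ h (conv_itg x iw (smooth_d i sk) v').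
 rewrite /conv -(integZ _ (conv_itg x iw (smooth_d i sk) v')) -(integB i1 i2) -integB//; last exact: itgB.
 rewrite (integ_eq (g := fun y=> w y*(k (x-y+h *: e_ i)-k (x-y)
  - h * partial i k (x-y)))); last by move=> y; rewrite (addrAC x); ring.
 have mw := itg_mble iw. have mk := mble_cont (smooth_cont sk).
 have mk' := mble_cont (smooth_cont (smooth_d i sk)).
 have mm : mble (fun y=> w y*(k (x-y+h *: e_ i)-k (x-y)-h * partial i k (x-y))).
  apply: mbleM=> //; apply: mbleB; first apply: mbleB.
  - exact: (mble_refl x (mble_shift (h *: e_ i) mk)).
  - exact: mble_refl.
  - by apply: mbleM; [mbl|exact: (mble_refl x mk')].
 apply: integ_norm=> //. have Ch: 0<=C*(`|h| * `|h|) by nneg.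
 rewrite -mulrA mulrC; apply: (ub_fle _ _ _ (ubZ Ch uw))=> [|y|y].
 - mbl.
 - nneg.
 - by rewrite normrM mulrC ler_wpM2r// taylor1.
have cv : h^-1 *: (conv w k (h *: e_ i+x)-conv w k x) @[h --> 0^'] --> conv w (partial i k) x.
 apply/cvgrPdist_le=> /= e e0. pose K:= c*C+1; have K0: 0<K by rewrite ltr_wpDl// mulr_ge0.
 exists (e/K)=> /=; first nneg. move=> h; rewrite /= sub0r normrN=> /ltW he h0.
 rewrite distrC -[X in _-X](mulKf h0) /GRing.scale/= -mulrBr normrM normfV.
 rewrite ler_pdivrMl ?normr_gt0// (addrC _ x). apply: (le_trans (est h)); rewrite mulrA mulrC ler_wpM2l//.
 apply: (@le_trans _ _ (K * `|h|)); first by rewrite ler_wpM2r// /K lerDl. by rewrite mulrC -ler_pdivlMr.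
by apply: DeriveDef; [apply/cvg_ex; exists (conv w (partial i k) x)|exact: cvg_lim cv].
Qed.

Lemma smooth_conv w k M: itg w -> smooth k -> vanish M k -> smooth (conv w k).
move=> iw sk vk. apply: (@smooth_coind R n (fun f=> exists k M, [/\ smooth k, vanish M k & f = conv w k])).
- by move=> f [k' [M' [sk' vk' ->]]]; exact: conv_cont vk'.
- move=> f i [k' [M' [sk' vk' ->]]]; exists (conv w (partial i k')).
  exists (partial i k'), (M' + 1); split=> //; first mbl. by apply: vanish_d vk'; lra.
 by move=> x; exact: conv_is_derive vk'.
- by exists k, M.
Qed.

Lemma partial_conv w k M i: itg w -> smooth k -> vanish M k -> partial i (conv w k) = conv w (partial i k).
Proof. by move=> iw sk vk; apply: partial_eq=> x; exact: conv_is_derive vk. Qed.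

Lemma vanish_conv w k M M': vanish M' w -> vanish M k -> 0<M -> 0<M' -> vanish (M' + M) (conv w k).
move=> vw vk M0 M'0 x nx; rewrite /conv (integ_eq (g := fun=> 0)) /integ ?Rintegral_ge0.
 by rewrite /Rintegral integral0.
move=> y; have [yM|yM] := pselect (ball (0: E) M' y); last by rewrite vw// mul0r.
rewrite vk ?mulr0// => xy; apply: nx; rewrite !ball0E in yM xy *.
by rewrite -(subrK y x) addrC (le_lt_trans (ler_normD _ _))// ltrD.
Qed.

End Convolution.

(** * Jensen's inequality, translation estimates and mollification errors *)

Section Jensen.
Context {R: realType} {n: nat}.
Notation E := 'rV[R]_n.
Notation leb := (@lebesgue R n).
Implicit Types (k a: E -> R) (p s: R).

Lemma powRB1 p s: 1<p -> 0<=s -> s`^(p-1)*s = s`^p.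
move=> p1 s0; have [->|sn0] := eqVneq s 0; first by rewrite mulr0 powR0//; lra.
by rewrite -[X in _*X](powRr1 s0) -powRD ?subrK// sn0 implybT.
Qed.

Lemma sum_cst N (x: R): \sum_(j<N) x = N%:R*x.
Proof. by rewrite sumr_const card_ord mulr_natl. Qed.

Lemma finite_jensen (N: nat) (a: nat -> R) p: 1<=p -> (0<N)%N -> (forall j, 0<=a j) ->
 (N%:R^-1*\sum_(j<N) a j)`^p<=N%:R^-1*\sum_(j<N) a j`^p.
move=> p1 N0 a0; have NR: 0<N%:R :> R by nneg. have s0: 0<=N%:R^-1*\sum_(j<N) a j by nneg.
move: p1; rewrite le_eqVlt=> /orP[/eqP <-|p1].
 rewrite powRr1//; under [in leRHS]eq_bigr do rewrite powRr1//; exact: lexx.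
set s:= (X in X`^p). have h : p*s`^p<=N%:R^-1*\sum_(j<N) a j`^p+(p-1)*s`^p.
 have ->: p*s`^p = N%:R^-1*\sum_(j<N) (p*(s`^(p-1)*a j)).
  rewrite -!mulr_sumr mulrCA; congr (_*_); rewrite mulrCA -/s. by rewrite powRB1.
 have ->: (p-1)*s`^p = N%:R^-1*\sum_(j<N) ((p-1)*s`^p).
  by rewrite sum_cst (mulrA N%:R^-1) mulVf ?mul1r// gt_eqF.
 rewrite -mulrDr -big_split/= ler_wpM2l ?invr_ge0 ?(ltW NR)//. by apply: ler_sum=> j _; exact: pow_tangent.
by lra.
Qed.

(** Integrate the tangent inequality at the point [s]. Since [s] is only assumed to lie below the
    average, the average itself, which may be infinite, never has to be a real number. *)
Lemma jensen k a p s: 1<p -> ub k 1 -> (\int[leb]_x (k x)%:E = 1)%E -> mble a -> (forall x, 0<=a x) -> 0<=s ->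
 (s%:E <= \int[leb]_x (k x*a x)%:E)%E -> ((s`^p)%:E <= \int[leb]_x (k x*a x`^p)%:E)%E.
move=> p1 uk k1 ma a0 s0 h; have [mk k0 _] := uk.
have ps0: 0<=p*s`^(p-1) by rewrite mulr_ge0 ?powR_ge0//; lra. have mka : mble (fun x=> k x*a x) by mbl.
have mkp : mble (fun x=> k x*a x`^p) by apply: mbleM=> //; mbl.
have q0: 0<=(p-1)*s`^p by rewrite mulr_ge0 ?powR_ge0//; lra. have ka0 x: 0<=k x*a x by nneg.
have kp0 x: 0<=k x*a x`^p by rewrite mulr_ge0 ?powR_ge0.
have mq : mble (fun x=> (p-1)*s`^p*k x) := mbleM (mble_cst _) mk. have q1 x: 0<=(p-1)*s`^p*k x by nneg.
rewrite -(@leeD2rE _ ((p-1)*s`^p)%:E)// -EFinD. have ->: s`^p+(p-1)*s`^p = p*s`^(p-1)*s.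
 by rewrite -mulrA powRB1//; ring.
apply: (@le_trans _ _ (\int[leb]_x (p*s`^(p-1)*(k x*a x))%:E)%E).
 by rewrite (intEFZ _ mka)// EFinM lee_wpmul2l.
have ->: (((p-1)*s`^p)%:E = \int[leb]_x ((p-1)*s`^p*k x)%:E)%E.
 by rewrite (intEFZ _ mk)// k1 mule1.
rewrite -(intEFD _ mkp mq)//. apply: intEF_le.
- exact: (mbleM (mble_cst _) mka).
- exact: mbleD.
- by move=> x; rewrite mulr_ge0. move=> x; have := pow_tangent p1 (a0 x) s0. move=> /(ler_wpM2l (k0 x))=> hx.
by apply: (le_trans _ (le_trans hx _)); lra.
Qed.

End Jensen.

Section Translation.
Context {R: realType} {n: nat}.
Notation E := 'rV[R]_n.
Implicit Types (f: E -> R) (i: 'I_n) (M p r h c: R).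
Notation e_ i := (delta_mx 0 i : E).

(** The derivative is controlled only in a weighted [L^p] sense, separately for each translate along
    the segment. Riemann sums with [N] terms need only finitely many of these bounds and no integral
    over the segment; bounded second derivatives make their error of order [1/N], which disappears
    in the limit. *)
Lemma translate_coord A f i M p h c cA: 1<=p -> smooth f -> vanish M f -> ub A cA -> (forall x, A x<=1) ->
 (forall t, 0<=t<=1 -> ub (fun x=> A x * `|partial i f (x+(t*h) *: e_ i)| `^ p) c) ->
 ub (fun x=> A x * `|f (x+h *: e_ i)-f x| `^ p) (2`^p*(`|h| `^ p*c)).
move=> p1 sf vf uA A1 H. have [C [C0 _ _ kC]] := smooth_bounds sf vf.
have [mA A0 _] := uA; have cA0 := ub_ge0 uA. have p0: 0<=p by lra.
have msf : mble f := mble_cont (smooth_cont sf). have mf : mble (fun x=> A x * `|f (x+h *: e_ i)-f x| `^ p).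
 mbl.
have pos x: 0<=A x * `|f (x+h *: e_ i)-f x| `^ p by nneg.
have c0: 0<=c by have := ub_ge0 (H 0 _); rewrite lexx ler01; exact.
(* Subdivide the segment into [N] pieces and apply the mean value theorem on each. *)
have key (N: nat): (0<N)%N -> ub (fun x=> A x * `|f (x+h *: e_ i)-f x| `^ p)
  (2`^p*(`|h| `^ p*c)+2`^p*(`|h| `^ p*((C * `|h| * N%:R^-1)`^p*cA))).
 move=> N0; have NR: 0<N%:R :> R by nneg. have NV: 0<=N%:R^-1 :> R by [].
 pose a x (j: nat) := `|partial i f (x+(j%:R/N%:R*h) *: e_ i)|. pose er:= C * `|h| * N%:R^-1.
 have er0: 0<=er by rewrite !mulr_ge0.
 have pt x : `|f (x+h *: e_ i)-f x|<=`|h| * (N%:R^-1*\sum_(j<N) a x j+er).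
  have tel m : `|f (x+(m%:R/N%:R*h) *: e_ i)-f x| <= `|h| * (N%:R^-1*(\sum_(j<m) a x j+m%:R*er)).
   elim: m=> [|m IH].
    by rewrite !mul0r scale0r addr0 subrr normr0 big_ord0 add0r !mulr0.
   have ->: x+(m.+1%:R/N%:R*h) *: e_ i = (x+(m%:R/N%:R*h) *: e_ i)+(h/N%:R) *: e_ i.
    rewrite -addrA -scalerDl; congr (_+_ *: _). by rewrite -natr1; ring.
   set y:= x+_. have [e el ee] := mvt_coord i y (h/N%:R) sf.
   have [e' el' ee'] := mvt_coord i y e (smooth_d i sf). rewrite -(subrKA (f y)) big_ord_recr/= -natr1.
   apply: (le_trans (ler_normD _ _)); rewrite [leLHS]addrC.
   have ->: `|h| * (N%:R^-1*(\sum_(i0<m) a x i0+a x m+(m%:R+1)*er)) =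
    `|h| * (N%:R^-1*(\sum_(j<m) a x j+m%:R*er)) + `|h| * (N%:R^-1*(a x m+er)). ring.
   apply: lerD=> //; rewrite ee !normrM (ger0_norm NV) -mulrA. rewrite ler_wpM2l// ler_wpM2l//.
   rewrite -(subrK (partial i f y) (partial i f (y+_))) addrC.
   apply: (le_trans (ler_normD _ _)); apply: lerD=> //. rewrite ee' normrM /er -mulrA mulrC ler_pM//.
   by apply: (le_trans el); rewrite normrM (ger0_norm NV).
  have := tel N; rewrite mulfV ?gt_eqF// mul1r=> /le_trans; apply.
  by rewrite mulrDr mulrA mulVf ?gt_eqF// mul1r.
 have uj : ub (fun x=> 2`^p*(`|h| `^ p*(N%:R^-1*\sum_(j<N) (A x*a x j`^p))) + 2`^p*(`|h| `^ p*(er`^p*A x)))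
   (2`^p*(`|h| `^ p*(N%:R^-1*\sum_(j<N) c))+2`^p*(`|h| `^ p*(er`^p*cA))).
  apply: ubD; do 2 (apply: ubZ; first exact: powR_ge0).
   apply: ubZ=> //; apply: ub_sum=> j; apply: H; apply/andP; split.
    by [].
   by rewrite ler_pdivrMr// mul1r ler_nat ltnW.
  by apply: ubZ=> //; exact: powR_ge0.
 have ->: c = N%:R^-1*\sum_(j<N) c.
  by rewrite sum_cst mulrA mulVf ?mul1r// gt_eqF.
 apply: (ub_fle mf pos _ uj)=> x. have S0: 0<=N%:R^-1*\sum_(j<N) a x j.
  by rewrite mulr_ge0// sumr_ge0// => j _; exact: normr_ge0.
 apply: (@le_trans _ _ (A x*(2`^p*(`|h| `^ p *
   (N%:R^-1*(\sum_(j<N) a x j`^p)))+2`^p*(`|h| `^ p*er`^p)))); last first.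
  rewrite -mulr_sumr; nra.
 rewrite ler_wpM2l//. apply: (le_trans (le_pow p0 (normr_ge0 _) (pt x))). rewrite powRM ?addr_ge0//.
 rewrite -!mulrDr mulrCA ler_wpM2l ?powR_ge0//.
 apply: (le_trans (pow_add p0 S0 er0)); rewrite ler_wpM2l ?powR_ge0// lerD2r.
 by apply: finite_jensen=> // j; exact: normr_ge0.
apply: ub_lim=> d d0. pose W:= 2`^p*(`|h| `^ p*((C * `|h|)*cA)). have W0: 0<=W by rewrite !mulr_ge0.
pose N:= (Num.bound (C * `|h| + W/d)).+1. have NN : C * `|h| + W/d<N%:R.
 have q0: 0<=C * `|h| + W/d by nneg. by apply: (lt_trans (archi_boundP q0)); rewrite ltr_nat.
have NR: 0<N%:R :> R by []. apply: ub_cle (key N (ltn0Sn _)). rewrite lerD2l.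
have z0: 0<=C * `|h| * N%:R^-1 by nneg. have z1 : C * `|h| * N%:R^-1<=1.
 by rewrite ler_pdivrMr// mul1r (le_trans _ (ltW NN))// lerDl divr_ge0// ltW.
apply: (@le_trans _ _ (2`^p*(`|h| `^ p*((C * `|h| * N%:R^-1)*cA)))).
 rewrite !ler_wpM2l ?powR_ge0// ler_wpM2r//.
 have [->|zn] := eqVneq (C * `|h| / N%:R) 0; first by rewrite powR0//; lra.
 by apply: ge1r_powR=> //; rewrite ?z1 lt_neqAle eq_sym zn z0.
have ->: 2`^p*(`|h| `^ p*(C * `|h| / N%:R*cA)) = W/N%:R by rewrite /W; ring.
rewrite ler_pdivrMr//; apply: ltW; rewrite -ltr_pdivrMl// mulrC.
by apply: le_lt_trans NN; rewrite lerDr mulr_ge0.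
Qed.

Lemma ballD M r (x y: E): ball (0: E) M x -> `|y|<=r-M -> ball (0: E) r (x+y).
by rewrite !ball0E=> h1 h2; apply: (le_lt_trans (ler_normD _ _)); lra.
Qed.

Lemma indic_shift_le r r' (x y: E): `|y|<=r' - r -> (\1_(ball (0: E) r) x: R) <= \1_(ball (0: E) r') (x+y).
move=> yr; have [b|b] := pselect (ball (0: E) r x); last by rewrite indic_out// indic_ge0.
by rewrite !indic_in//; exact: ballD b _.
Qed.

Lemma ub_ballD f r r' y c: `|y|<=r' - r -> (forall x, 0<=f x) -> mble f ->
 ub (fun x=> \1_(ball (0: E) r') x*f x) c -> ub (fun x=> \1_(ball (0: E) r) x*f (x+y)) c.
move=> yr f0 mf u; apply: (ub_fle _ _ _ (ub_shift y u))=> [|x|x].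
- mbl.
- nneg.
- by rewrite ler_wpM2r// indic_shift_le.
Qed.

(** The coordinates are changed one at a time. In the sup norm all intermediate translations stay
    within [|y|] ([Sle]), hence in the larger cube. *)
Lemma translate_ball f M p r r' y c: 1<=p -> smooth f -> vanish M f -> 0<r ->
 (forall i, ub (fun x=> \1_(ball (0: E) r') x * `|partial i f x| `^ p) c) -> `|y|<=r' - r ->
 ub (fun x=> \1_(ball (0: E) r) x * `|f (x+y)-f x| `^ p) (n%:R`^p*(n%:R*(2`^p*(`|y| `^ p*c)))).
move=> p1 sf vf r0 H yr; have p0: 0<=p by lra. pose S (m: nat): E := \row_i (if (i<m)%N then y 0 i else 0).
have Sle m (t: R) (i: 'I_n): m = i :> nat -> 0<=t<=1 -> `|S m+(t*y 0 i) *: e_ i|<=`|y|.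
 move=> mi /andP[t0 t1]; rewrite leNgt; apply/negP=> h.
 have: `|S m+(t*y 0 i) *: e_ i|<`|S m+(t*y 0 i) *: e_ i|; last by rewrite ltxx.
 apply: norm_lt_coord; first exact: le_lt_trans h. move=> j; apply: le_lt_trans h; rewrite !mxE eqxx/=.
 have [->|ji] := eqVneq j i.
  rewrite mi ltnn add0r mulr1 normrM (ger0_norm t0) (le_trans _ (coord_le_norm y i))//. by rewrite ler_piMl.
 by rewrite mulr0 addr0; case: ifP=> _; rewrite ?normr0// coord_le_norm.
have SS (i: 'I_n): S i.+1 = S i+y 0 i *: e_ i.
 apply/rowP=> j; rewrite !mxE eqxx/= ltnS leq_eqVlt.
 by have [->|ji] := eqVneq j i; rewrite ?eqxx ?ltnn/= ?add0r ?mulr1// (negbTE (_: val j != val i))// mulr0 addr0.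
have step (i: 'I_n): ub (fun x=> \1_(ball (0: E) r) x * `|f (x+S i.+1)-f (x+S i)| `^ p) (2`^p*(`|y| `^ p*c)).
 have c0: 0<=c by exact: ub_ge0 (H i).
 have := @translate_coord (\1_(ball (0: E) r)) (fun x=> f (x+S i)) i (M + `|S i|) p (y 0 i) c _ p1
   (smooth_shift (S i) sf) _ (ub_ball (0: E) r0).
 have vs : vanish (M + `|S i|) (fun x=> f (x+S i)).
  move=> x nx; apply: vf; rewrite ball0E=> h; apply: nx; rewrite ball0E.
  rewrite -(addrK (S i) x) -(normrN (S i)); apply: (le_lt_trans (ler_normD _ _)). by rewrite ltrD2r.
 move=> /(_ vs (fun x=> indic_le1 _ _)) h.
 have {}h: ub (fun x=> \1_(ball (0: E) r) x * `|f (x+y 0 i *: e_ i+S i)-f (x+S i)| `^ p)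
   (2`^p*(`|y 0 i| `^ p*c)).
  apply: h=> t t01.
  have := @ub_ballD (fun x=> `|partial i f x| `^ p) r r' (S i+(t*y 0 i) *: e_ i) c _ _ _ (H i).
  move=> h; have {}h := h (le_trans (Sle _ _ _ erefl t01) yr) (fun x=> powR_ge0 _ _)
   (mble_powR p (mble_norm (mble_cont (smooth_cont (smooth_d i sf))))).
  suff ->: (fun x=> \1_(ball (0: E) r) x * `|partial i (fun x=> f (x+S i)) (x+(t*y 0 i) *: e_ i)| `^ p) =
   (fun x=> \1_(ball (0: E) r) x * `|partial i f (x+(S i+(t*y 0 i) *: e_ i))| `^ p) by [].
  by apply/funext=> x; rewrite (partial_shift _ _ _ sf) [in RHS]addrA [in RHS]addrAC.
 have mm : mble f := mble_cont (smooth_cont sf). apply: (ub_le _ _ _ _ h)=> [|x|x|].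
 - mbl.
 - by [].
 - by rewrite SS addrA addrAC.
 - by rewrite ler_wpM2l// ler_wpM2r// le_pow// coord_le_norm.
have S0 : S 0%N = 0 by apply/rowP=> j; rewrite !mxE.
have Sn : S n = y by apply/rowP=> j; rewrite !mxE ltn_ord. have mm : mble f := mble_cont (smooth_cont sf).
have u := ubZ (powR_ge0 n%:R p) (ub_sum (index_enum 'I_n) xpredT step). rewrite sum_cst in u.
apply: (ub_fle _ _ _ u)=> [|x|x].
- mbl.
- by [].
- rewrite -mulr_sumr mulrCA ler_wpM2l ?indic_ge0//.
 have ->: f (x+y)-f x = \sum_(i<n) (f (x+S i.+1)-f (x+S i)).
  rewrite -(big_mkord xpredT (fun m: nat=> f (x+S m.+1)-f (x+S m))) telescope_sumr//. by rewrite Sn S0 addr0.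
 have [h|n0] := @pow_sum R n p (fun i=> `|f (x+S i.+1)-f (x+S i)|) p0 (fun i=> normr_ge0 _).
  by apply: le_trans h; apply: le_pow=> //; exact: ler_norm_sum.
 have j0 (j: 'I_n): False by case: j=> m /=; rewrite n0. rewrite big1 ?normr0; last by move=> i; case: (j0 i).
 have p00 : p != 0 by rewrite gt_eqF// (lt_le_trans ltr01 p1).
 by rewrite powR0// mulr_ge0 ?powR_ge0// sumr_ge0// => i _; rewrite powR_ge0.
Qed.

End Translation.

Section Mollification.
Context {R: realType} {n: nat}.
Notation E := 'rV[R]_n.
Notation leb := (@lebesgue R n).
Implicit Types (f v w k: E -> R) (i: 'I_n) (M p s r h c: R).

Definition moll s v:= conv v (kern s).

Lemma mble_kern s: mble (@kern R n s).
Proof. by apply: mble_cont; exact: smooth_cont (smooth_kern s). Qed.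

Lemma smooth_itg v M: 0<M -> smooth v -> vanish M v -> itg v.
move=> M0 sv vv; have [C [C0 vC _ _]] := smooth_bounds sv vv. have mv := mble_cont (smooth_cont sv).
apply: (itg_le mv _ (ubZ C0 (ub_ball (0: E) M0)))=> x.
have [b|b] := pselect (ball (0: E) M x); first by rewrite indic_in// mulr1.
by rewrite vv// normr0 indic_out// mulr0.
Qed.

Lemma smooth_moll s v: 0<s -> itg v -> smooth (moll s v).
Proof. by move=> s0 iv; apply: (smooth_conv iv (smooth_kern s) (vanish_kern s0)). Qed.

Lemma convC v w M M': 0<M -> 0<M' -> smooth v -> vanish M v -> smooth w -> vanish M' w -> conv v w = conv w v.
move=> M0 M'0 sv vv sw vw; apply/funext=> x. by rewrite (conv_sym x (smooth_itg M0 sv vv) sw vw).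
Qed.

Lemma partial_moll s v M i: 0<s -> 0<M -> smooth v -> vanish M v ->
 partial i (moll s v) = moll s (partial i v).
move=> s0 M0 sv vv; have MM : M<M+1 by lra. have M1: 0<M+1 by lra.
have vk := vanish_kern s0 (n := n); have sk := @smooth_kern R n s.
rewrite /moll (convC M0 s0 sv vv sk vk) (partial_conv i (smooth_itg s0 sk vk) sv vv).
by rewrite (convC s0 M1 sk vk (smooth_d i sv) (vanish_d i MM vv)).
Qed.

Lemma vanish_moll s v M: 0<s -> 0<M -> vanish M v -> vanish (M+s) (moll s v).
Proof. by move=> s0 M0 vv; apply: vanish_conv=> //; exact: vanish_kern. Qed.

Lemma integ_abs_EFin f: itg f -> (`|integ f|%:E <= \int[leb]_x (`|f x|)%:E)%E.
move=> itf; have [c uc] := itg_abs itf; rewrite (ub_integ uc) lee_fin.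
exact: le_normr_Rintegral measurableT itf.
Qed.

Lemma integ_kern s: 0<s -> integ (@kern R n s) = 1.
Proof. by move=> s0; rewrite /integ /Rintegral kern_int1. Qed.

Lemma moll_le s w x: 0<s -> itg w -> (`|moll s w x|%:E <= \int[leb]_y (kern s y * `|w (x-y)|)%:E)%E.
move=> s0 iw; rewrite /moll (conv_sym x iw (smooth_kern s) (vanish_kern s0)).
have it : itg (fun y=> kern s y*w (x-y)).
 have := itg_refl x (conv_itg x iw (smooth_kern s) (vanish_kern s0)).
 by congr itg; apply/funext=> y; rewrite subKr mulrC.
apply: (le_trans (integ_abs_EFin it)); apply: intEF_le.
- exact: mble_norm (itg_mble it).
- apply: mbleM; first exact: mble_kern.
 by apply: mble_norm; exact: mble_refl (itg_mble iw).
- by move=> y.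
- by move=> y; rewrite normrM (ger0_norm (kern_ge0 _ s0)).
Qed.

Lemma moll_diff_le s w x: 0<s -> itg w ->
 (`|moll s w x-w x|%:E <= \int[leb]_y (kern s y * `|w (x-y)-w x|)%:E)%E.
move=> s0 iw; rewrite /moll (conv_sym x iw (smooth_kern s) (vanish_kern s0)).
have it : itg (fun y=> kern s y*w (x-y)).
 have := itg_refl x (conv_itg x iw (smooth_kern s) (vanish_kern s0)).
 by congr itg; apply/funext=> y; rewrite subKr mulrC.
have ik : itg (@kern R n s) by exact: smooth_itg s0 (smooth_kern s) (vanish_kern s0).
have ->: integ (fun y=> kern s y*w (x-y))-w x = integ (fun y=> kern s y*w (x-y)-w x*kern s y).
 by rewrite (integB it (itgZ (w x) ik)) (integZ _ ik) integ_kern// mulr1.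
apply: (le_trans (integ_abs_EFin (itgB it (itgZ (w x) ik)))); apply: intEF_le.
- exact: mble_norm (itg_mble (itgB it (itgZ (w x) ik))).
- apply: mbleM; first exact: mble_kern.
 by apply: mble_norm; apply: mbleB; [exact: mble_refl (itg_mble iw)|exact: mble_cst].
- by move=> y.
- by move=> y; rewrite [w x*_]mulrC -mulrBr normrM (ger0_norm (kern_ge0 _ s0)).
Qed.

Lemma moll_powR_le s w p x: 0<s -> 1<p -> itg w ->
 ((`|moll s w x| `^ p)%:E <= \int[leb]_y (kern s y * `|w (x-y)| `^ p)%:E)%E.
move=> s0 p1 iw; apply: (jensen p1 (ub_kern s0) (kern_int1 s0))=> //.
- by apply: mble_norm; exact: mble_refl (itg_mble iw).
- exact: moll_le.
Qed.

Lemma moll_diff_powR_le s w p x: 0<s -> 1<p -> itg w ->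
 ((`|moll s w x-w x| `^ p)%:E <= \int[leb]_y (kern s y * `|w (x-y)-w x| `^ p)%:E)%E.
move=> s0 p1 iw; apply: (jensen p1 (ub_kern s0) (kern_int1 s0))=> //.
- by apply: mble_norm; apply: mbleB; [exact: mble_refl (itg_mble iw)|exact: mble_cst].
- exact: moll_diff_le.
Qed.

Lemma kern_supp s (y: E): 0<s -> kern s y != 0 -> `|y|<=s.
move=> s0 /eqP ky; rewrite leNgt; apply/negP=> ys; apply: ky; apply: vanish_kern=> //.
by rewrite ball0E=> h; move: (lt_trans ys h); rewrite ltxx.
Qed.

Lemma ub_moll s w p r r' c: 0<s -> 1<p -> itg w -> bor w -> s<=r' - r ->
 ub (fun x=> \1_(ball (0: E) r') x * `|w x| `^ p) c ->
 ub (fun x=> \1_(ball (0: E) r) x * `|moll s w x| `^ p) c.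
move=> s0 p1 iw bw sr u; have mw := itg_mble iw.
apply: (@ub_avg R n (fun x y=> \1_(ball (0: E) r) x * `|w (x-y)| `^ p) (kern s)).
- apply: measurable_funM; first exact: mble_mble2l (mble_ball (0: E) r).
 have h : measurable_fun [set: R] (fun x: R=> `|x| `^ p).
  apply: (@measurableT_comp _ _ _ _ _ _ (fun x: R=> x`^p)).
   by [].
  by [].
 exact: (measurableT_comp h (bor_mble2B bw)).
- by [].
- exact: ub_kern.
- exact: ub_ge0 u.
- apply: mbleM; first mbl.
 by apply: mble_powR; apply: mble_norm; apply: mble_cont; exact: smooth_cont (smooth_moll s0 iw).
- by [].
- move=> x; have mk : mble (fun y=> kern s y * `|w (x-y)| `^ p).
  apply: mbleM; first exact: mble_kern. by apply: mble_powR; apply: mble_norm; exact: mble_refl mw.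
 have := moll_powR_le x s0 p1 iw. have k0 y: 0<=kern s y * `|w (x-y)| `^ p by rewrite mulr_ge0// kern_ge0.
 have i0 := indic_ge0 (ball (0: E) r) x: 0<=(_: R).
 under [in X in _ -> (_<=X)%E]eq_integral do rewrite mulrCA.
 by rewrite (intEFZ _ mk)// EFinM=> h; apply: lee_wpmul2l.
- move=> y /(kern_supp s0) ys.
 apply: (@ub_ballD R n (fun x=> `|w x| `^ p) r r' (- y))=> //.
  by rewrite normrN (le_trans ys).
 mbl.
Qed.

Lemma ub_moll_diff s w A p c: 0<s -> 1<p -> itg w -> bor w -> mble A -> (forall x, 0<=A x) ->
 0<=c -> (forall y, `|y|<=s -> ub (fun x=> A x * `|w (x+y)-w x| `^ p) c) ->
 ub (fun x=> A x * `|moll s w x-w x| `^ p) c.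
move=> s0 p1 iw bw mA A0 c0 u; have mw := itg_mble iw.
apply: (@ub_avg R n (fun x y=> A x * `|w (x-y)-w x| `^ p) (kern s)).
- apply: measurable_funM; first exact: mble_mble2l.
 have h : measurable_fun [set: R] (fun x: R=> `|x| `^ p).
  apply: (@measurableT_comp _ _ _ _ _ _ (fun x: R=> x`^p)).
   by [].
  by [].
 apply: (measurableT_comp h); apply: measurable_funB; first exact: bor_mble2B. exact: mble_mble2l.
- by move=> x y; rewrite mulr_ge0 ?powR_ge0.
- exact: ub_kern.
- exact: c0.
- apply: mbleM=> //; apply: mble_powR; apply: mble_norm; apply: mbleB=> //.
 by apply: mble_cont; exact: smooth_cont (smooth_moll s0 iw).
- by move=> x; rewrite mulr_ge0 ?powR_ge0.
- move=> x; have mk : mble (fun y=> kern s y * `|w (x-y)-w x| `^ p).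
  apply: mbleM; first exact: mble_kern.
  by apply: mble_powR; apply: mble_norm; apply: mbleB; [exact: mble_refl mw|exact: mble_cst].
 have := moll_diff_powR_le x s0 p1 iw.
 have k0 y: 0<=kern s y * `|w (x-y)-w x| `^ p by rewrite mulr_ge0// kern_ge0.
 under [in X in _ -> (_<=X)%E]eq_integral do rewrite mulrCA.
 by rewrite (intEFZ _ mk)// EFinM=> h; apply: lee_wpmul2l; rewrite ?lee_fin.
- by move=> y /(kern_supp s0) ys; apply: u; rewrite normrN.
Qed.

(** A mollification is an average of translates by vectors of length at most [s], and each translate
    differs from [v] by [s] times the gradient in [L^p]. *)
Lemma ub_moll_poincare s v M p r r' c: 0<s -> 1<p -> 0<M -> smooth v -> vanish M v ->
 0<r -> s<=r' - r -> 0<=c -> (forall i, ub (fun x=> \1_(ball (0: E) r') x * `|partial i v x| `^ p) c) ->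
 ub (fun x=> \1_(ball (0: E) r) x * `|moll s v x-v x| `^ p) (n%:R`^p*(n%:R*(2`^p*(s`^p*c)))).
move=> s0 p1 M0 sv vv r0 sr c0 H; apply: ub_moll_diff=> //.
- exact: smooth_itg M0 sv vv.
- exact: cont_bor (smooth_cont sv).
- mbl.
- have h1: 0<=s`^p*c by nneg.
 have h2: 0<=2`^p*(s`^p*c) by nneg. have h3: 0<=n%:R*(2`^p*(s`^p*c)) by nneg. nneg.
move=> y ys; have := translate_ball (ltW p1) sv vv r0 H (le_trans ys sr).
apply: ub_cle; rewrite !ler_wpM2l ?powR_ge0// ler_wpM2r// le_pow//; lra.
Qed.

Lemma conv_sup w k C s r r' c x: 0<s -> (forall x, `|k x|<=C) -> mble k -> vanish s k ->
 mble w -> ub (fun x=> \1_(ball (0: E) r') x * `|w x|) c ->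
 ball (0: E) r x -> s<=r' - r -> `|conv w k x|<=C*c.
move=> s0 kC mk vk mw u xr sr; have C0: 0<=C by apply: le_trans (kC 0).
apply: integ_norm; first by apply: mbleM=> //; exact: mble_refl. apply: (ub_fle _ _ _ (ubZ C0 u))=> [|y|y].
- by apply: mble_norm; apply: mbleM=> //; exact: mble_refl.
- by [].
- rewrite normrM mulrC.
 have [b|b] := pselect (ball (0: E) r' y); first by rewrite indic_in// mul1r ler_wpM2r.
 rewrite vk ?normr0 ?mul0r ?mulr_ge0 ?indic_ge0// ball0E=> h; apply: b.
 rewrite -(subrKC x y); apply: (ballD xr); rewrite distrC; lra.
Qed.

End Mollification.

#[local] Hint Resolve mble_kern: mble.

(** * Vector norms and consequences of monotonicity *)

Section VectorBounds.
Context {R: realType} {n: nat}.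
Notation E := 'rV[R]_n.
Implicit Types (x y: E).

Definition l1 x: R := \sum_i `|x 0 i|.

Lemma l1_ge0 x: 0<=l1 x. Proof. exact: sumr_ge0. Qed.

Lemma coord_le_enorm x i: `|x 0 i|<=enorm x.
rewrite -sqrtr_sqr /enorm ler_wsqrtr// /dot (bigD1 i)//= expr2 lerDl.
by apply: sumr_ge0=> j _; rewrite -expr2 sqr_ge0.
Qed.

Lemma enorm_ge0 x: 0<=enorm x. Proof. exact: sqrtr_ge0. Qed.

Lemma enorm_le_l1 x: enorm x<=l1 x.
rewrite -(ger0_norm (l1_ge0 x)) -sqrtr_sqr ler_wsqrtr// /dot expr2 /l1 mulr_suml.
apply: ler_sum=> i _; rewrite -expr2 -real_normK ?num_real// expr2 ler_wpM2l//.
by rewrite (bigD1 i)//= lerDl sumr_ge0.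
Qed.

Lemma l1_le_enorm x: l1 x<=n%:R*enorm x.
by rewrite -sum_cst; apply: ler_sum=> i _; exact: coord_le_enorm.
Qed.

Lemma dot_le x y: `|dot x y|<=enorm x * l1 y.
rewrite /dot; apply: (le_trans (ler_norm_sum _ _ _)).
rewrite /l1 mulr_sumr; apply: ler_sum=> i _; rewrite normrM ler_wpM2r//. exact: coord_le_enorm.
Qed.

Lemma l1D x y: l1 (x+y)<=l1 x+l1 y.
by rewrite /l1 -big_split/=; apply: ler_sum=> i _; rewrite mxE ler_normD.
Qed.

Lemma l1N x: l1 (- x) = l1 x.
Proof. by apply: eq_bigr=> i _; rewrite mxE normrN. Qed.

Lemma l1B x y: l1 (x-y)<=l1 x+l1 y.
Proof. by rewrite -(l1N y); exact: l1D. Qed.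

Lemma dotDl x y z: dot (x+y) z = dot x z+dot y z :> R.
Proof. by rewrite /dot -big_split/=; apply: eq_bigr=> i _; rewrite mxE mulrDl. Qed.

Lemma dotDr x y z: dot x (y+z) = dot x y+dot x z :> R.
Proof. by rewrite /dot -big_split/=; apply: eq_bigr=> i _; rewrite mxE mulrDr. Qed.

Lemma dotNl x y: dot (- x) y = - dot x y.
Proof. by rewrite /dot -sumrN; apply: eq_bigr=> i _; rewrite mxE mulNr. Qed.

Lemma dotNr x y: dot x (- y) = - dot x y.
Proof. by rewrite /dot -sumrN; apply: eq_bigr=> i _; rewrite mxE mulrN. Qed.

Lemma dotBl x y z: dot (x-y) z = dot x z-dot y z :> R.
Proof. by rewrite dotDl dotNl. Qed.

Lemma dotBr x y z: dot x (y-z) = dot x y-dot x z :> R.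
Proof. by rewrite dotDr dotNr. Qed.

Lemma dotZr c x y: dot x (c *: y) = c*dot x y :> R.
Proof. by rewrite /dot mulr_sumr; apply: eq_bigr=> i _; rewrite mxE mulrCA. Qed.

Lemma l1Z (c: R) x: l1 (c *: x) = `|c| * l1 x.
Proof. by rewrite /l1 mulr_sumr; apply: eq_bigr=> i _; rewrite mxE normrM. Qed.

End VectorBounds.

Section Monotonicity.
Context {R: realType}.
Implicit Types (p k t S x: R).

(* [x] stands for [|xi1 - xi2|] and [S] for [mu + |xi1| + |xi2|]. *)
Definition monq p S x: R := if 2<=p then x`^p else S`^(p-2)*x^+2.

Lemma monq_ge0 p S x: 0<=monq p S x.
Proof. by rewrite /monq; case: ifP=> _; rewrite ?powR_ge0// mulr_ge0 ?powR_ge0 ?sqr_ge0. Qed.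

(** The power of the step gained when monotonicity is traded for a bound on the difference itself
    ([monq_bound1]). Comparing with a threshold gives [1/p] for [p >= 2]; the inequality of
    arithmetic and geometric means gives [1/2] otherwise. *)
Definition sgm p: R := if 2<=p then p^-1 else 2^-1.

Lemma sgm_gt0 p: 1<p -> 0<sgm p.
Proof. by rewrite /sgm; case: ifP=> _ p1; rewrite invr_gt0; lra. Qed.

Lemma sgm_le1 p: 1<p -> sgm p<=1.
rewrite /sgm; case: ifP=> _ p1; last by lra. by rewrite invf_le1; lra.
Qed.

(** The second term of the interpolation in [monq_bound1]. For [p < 2] its product with
    [t^(1-p) monq p S x] is exactly [x^2]. *)
Definition monY p S t: R := if 2<=p then t else t`^(p-1)*S`^(2-p).

Lemma monY_ge0 p S t: 0<=t -> 0<=monY p S t.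
Proof. by rewrite /monY; case: ifP=> // _ _; rewrite mulr_ge0 ?powR_ge0. Qed.

Lemma monY_le p S t: 1<p -> 0<=S -> 1<=t -> monY p S t<=t+t`^(1-p)*S`^p.
move=> p1 S0 t1; have t0: 0<t by lra.
rewrite /monY; case: ifP=> p2; first by rewrite lerDl mulr_ge0 ?powR_ge0. have {}p2: p<2 by rewrite ltNge p2.
have [St|tS] := leP S t.
 apply: (@le_trans _ _ t); last by rewrite lerDl mulr_ge0 ?powR_ge0.
 apply: (@le_trans _ _ (t`^(p-1)*t`^(2-p))).
  by rewrite ler_wpM2l ?powR_ge0// le_pow//; lra.
 rewrite -powRD; last by rewrite (gt_eqF t0) implybT. by rewrite (_: p-1+(2-p) = 1) ?powRr1 ?(ltW t0)//; ring.
apply: (@le_trans _ _ (t`^(1-p)*S`^p)); last by rewrite lerDr ltW. have S1: 0<S by lra.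
have e1 : S`^(2-p) = S`^p*S`^(2-2 * p).
 by rewrite -powRD ?(gt_eqF S1) ?implybT//; congr (_ `^ _); ring.
have e2 : t`^(1-p) = t`^(p-1)*t`^(2-2 * p).
 by rewrite -powRD ?(gt_eqF t0) ?implybT//; congr (_ `^ _); ring.
rewrite e1 e2 -mulrA ler_wpM2l ?powR_ge0// mulrC ler_wpM2r ?powR_ge0//.
have ->: 2-2 * p = - (2 * p-2) by ring. rewrite !powRN lef_pV2 ?posrE ?powR_gt0// le_pow//; lra.
Qed.

Lemma monY_absorb p T c: 1<p -> 1<=T -> 0<c -> exists2 C, 0<C &
 forall S t, 0<=S -> 1<=t -> t<=T -> monY p S t<=c*S`^p+C.
move=> p1 T1 c0; rewrite /monY; case: (leP 2 p)=> p2.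
 exists T; first by lra. by move=> S t S0 t1 tT; rewrite (le_trans tT)// lerDr mulr_ge0 ?powR_ge0// ltW.
have T0: 0<T`^(p-1) by rewrite powR_gt0; lra.
have [C C0 hC] := @pow_absorb R (2-p) p (c/T`^(p-1)) (ltac:(lra)) (ltac:(lra)) (divr_gt0 c0 T0).
exists (T`^(p-1)*C); first nneg. move=> S t S0 t1 tT; apply: (@le_trans _ _ (T`^(p-1)*S`^(2-p))).
 by rewrite ler_wpM2r ?powR_ge0// le_pow//; lra.
apply: (le_trans (ler_wpM2l (ltW T0) (hC S S0))). by rewrite mulrDr mulrA mulrCA divff ?gt_eqF// mulr1.
Qed.

(** For [p >= 2] compare [x] with [a = k^(1/p) t]: either [x <= a] or [x <= a^(1-p) x^p]. For
    [p < 2] the product of the two terms on the right is [x^2], so their sum is at least [x]. The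
    condition at [S = 0] is there because [S^(p-2)] is then read as [0]. *)
Lemma monq_bound1 p k t S x: 1<p -> 0<k -> 0<t -> 0<=S -> 0<=x -> (S = 0 -> x = 0) ->
 x<=k`^(sgm p-1)*t`^(1-p) * monq p S x+k`^sgm p * monY p S t.
move=> p1 k0 t0 S0 x0 xS; rewrite /sgm /monq /monY; case: ifP=> p2.
 have [h|h] := leP x (k`^p^-1*t).
  by apply: (le_trans h); rewrite lerDr !mulr_ge0 ?powR_ge0.
 set a:= k`^p^-1*t in h *. have a0: 0<a by rewrite mulr_gt0 ?powR_gt0. have xx: 0<x by lra.
 apply: (@le_trans _ _ (k`^(p^-1-1)*t`^(1-p)*x`^p)); last first.
  by rewrite lerDl mulr_ge0 ?powR_ge0// ltW.
 have ->: k`^(p^-1-1)*t`^(1-p) = a`^(1-p).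
  rewrite /a powRM ?powR_ge0 ?(ltW t0)// -powRrM; congr (_ `^ _*_). by field; rewrite gt_eqF//; lra.
 rewrite -(powRB1 p1 x0) mulrA -{1}(mul1r x) ler_wpM2r//. rewrite (_: 1-p = - (p-1)); last by ring.
 rewrite powRN mulrC ler_pdivlMr ?powR_gt0// mul1r le_pow ?(ltW a0) ?(ltW h)//; lra.
have {}p2: p<2 by rewrite ltNge p2. have [S00|Sn] := eqVneq S 0.
 rewrite (xS S00). by rewrite expr2 !mulr0 add0r !mulr_ge0 ?powR_ge0.
have S1: 0<S by rewrite lt_neqAle eq_sym Sn.
have nz z : z > 0 -> (z == 0 :> R) = false by move=> ?; rewrite gt_eqF. set A:= k`^_*_*_; set B:= k`^_*_.
have A0: 0<=A by rewrite !mulr_ge0 ?powR_ge0. have B0: 0<=B by rewrite !mulr_ge0 ?powR_ge0.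
have AB : A*B = x^+2.
 have e1 : k`^(2^-1-1)*k`^2^-1 = 1.
  by rewrite -powRD ?(nz k k0) ?implybT// (_: 2^-1-1+2^-1 = 0) ?powRr0//; lra.
 have e2 : t`^(1-p)*t`^(p-1) = 1.
  by rewrite -powRD ?(nz t t0) ?implybT// (_: 1-p+(p-1) = 0) ?powRr0//; lra.
 have e3 : S`^(p-2)*S`^(2-p) = 1.
  by rewrite -powRD ?(nz S S1) ?implybT// (_: p-2+(2-p) = 0) ?powRr0//; lra.
 rewrite /A /B (_: _*_ = (k`^(2^-1-1)*k`^2^-1)*(t`^(1-p)*t`^(p-1)) * (S`^(p-2)*S`^(2-p))*x^+2); last by ring.
 by rewrite e1 e2 e3 !mul1r.
rewrite -(@ler_pXn2r _ 2)// ?nnegrE ?addr_ge0// -AB; nra.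
Qed.

(** For [p < 2], either [x] is at most a small multiple of [S], or [S^(p-2)] dominates a multiple of
    [x^(p-2)] because the exponent is negative. *)
Lemma monq_bound2 p c: 1<p -> 0<c -> exists2 C, 0<C &
 forall S x, 0<=S -> 0<=x -> (S = 0 -> x = 0) -> x`^p<=C * monq p S x+c*S`^p.
move=> p1 c0; rewrite /monq; case: (leP 2 p)=> p2.
 by exists 1=> // S x S0 x0 _; rewrite mul1r lerDl mulr_ge0 ?powR_ge0// ltW.
set l:= c`^p^-1; have l0: 0<l by rewrite powR_gt0. have pn : p != 0 by rewrite gt_eqF//; lra.
have lp : l`^p = c by rewrite /l -powRrM mulVf// powRr1// ltW. exists (l`^(p-2)); first nneg.
move=> S x S0 x0 xS. have [xl|lx] := leP x (l*S).
 apply: (@le_trans _ _ (c*S`^p)); last by rewrite lerDr !mulr_ge0 ?powR_ge0.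
 rewrite -lp -powRM ?(ltW l0)// le_pow//; lra.
apply: (@le_trans _ _ (l`^(p-2)*(S`^(p-2)*x^+2))); last first.
 by rewrite lerDl mulr_ge0 ?powR_ge0// ltW.
have Sp: 0<S.
 rewrite lt_neqAle S0 andbT eq_sym; apply/eqP=> S00. by move: lx; rewrite (xS S00) S00 mulr0 ltxx.
have lS: 0<l*S by nneg. have xp: 0<x by lra. rewrite mulrA -powRM ?(ltW l0)//. have ->: x`^p = x`^(p-2)*x^+2.
 rewrite -powR_mulrn ?(ltW xp)// -powRD ?(gt_eqF xp) ?implybT//. by congr (_ `^ _); rewrite subrK.
rewrite ler_wpM2r ?sqr_ge0//. have ->: p-2 = - (2-p) by ring.
by rewrite !powRN lef_pV2 ?posrE ?powR_gt0// le_pow ?(ltW lS) ?(ltW lx)//; lra.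
Qed.

End Monotonicity.

(** * Smooth approximation of functions with a weak gradient *)

Section NullSets.
Context d (T: measurableType d) {R: realType} (mu: {measure set T -> \bar R}).
Local Open Scope ereal_scope.

Lemma intEF_ae_le (f g: T -> R) (Z: set T) : measurable_fun setT f -> measurable_fun setT g ->
 (forall x, (0<=f x)%R) -> (forall x, (0<=g x)%R) ->
 measurable Z -> mu Z = 0 -> (forall x, ~ Z x -> (f x<=g x)%R) -> \int[mu]_x (f x)%:E <= \int[mu]_x (g x)%:E.
move=> mf mg f0 g0 mZ Z0 fg. have mTZ : measurable (setT `\` Z) by exact: measurableD.
have h (k: T -> R): measurable_fun setT k -> measurable_fun (setT `\` Z) (fun x=> (k x)%:E).
 move=> mk; apply: (@measurable_funS _ _ _ _ setT)=> //; exact/measurable_EFinP.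
rewrite (ge0_negligible_integral mZ) //; last 2 first.
 exact/measurable_EFinP. by move=> x _; rewrite lee_fin.
rewrite [leRHS](ge0_negligible_integral mZ) //; last 2 first.
 exact/measurable_EFinP. by move=> x _; rewrite lee_fin.
apply: ge0_le_integral=> //.
- by move=> x _; rewrite lee_fin.
- exact: h.
- exact: h.
- by move=> x [_ nZ]; rewrite lee_fin fg.
Qed.

End NullSets.

Section SmoothApproximation.
Context {R: realType} {n: nat}.
Notation E := 'rV[R]_n.
Notation L := (lebesgueType R n).
Notation leb := (@lebesgue R n).
Implicit Types (f g w k u: E -> R) (i: 'I_n) (M p s r h c: R).

Lemma ub_ae f g c (Z: set L): measurable Z -> leb Z = 0%E -> mble f ->
 (forall x, 0<=f x) -> (forall x, ~ Z x -> f x<=g x) -> ub g c -> ub f c.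
move=> mZ Z0 mf f0 fg [mg g0 gc]; split; [exact: mf|exact: f0|].
exact: (le_trans (intEF_ae_le mf mg f0 g0 mZ Z0 fg) gc).
Qed.

Lemma integ_ae f g (Z: set L): measurable Z -> leb Z = 0%E -> itg f -> itg g ->
 (forall x, ~ Z x -> f x = g x) -> integ f = integ g.
move=> mZ Z0 itf ig fg; apply/eqP; rewrite -subr_eq0 -integB// -normr_le0. have mb := itg_mble (itgB itf ig).
apply: integ_norm=> //; apply: (ub_ae mZ Z0 (mble_norm mb) (fun x=> normr_ge0 _) _ ub0)=> x nZ.
by rewrite fg// subrr normr0.
Qed.

Lemma ub_itg_pow f M p c: 1<p -> 0<M -> mble f -> vanish M f -> ub (fun x=> `|f x| `^ p) c -> itg f.
move=> p1 M0 mf vf uf. have [C C0 hC] := @pow_absorb R 1 p 1 p1 ler01 ltr01.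
apply: (itg_le mf _ (ubD uf (ubZ (ltW C0) (ub_ball (0: E) M0))))=> x. have [b|b] := pselect (ball (0: E) M x).
 by have := hC `|f x| (normr_ge0 _); rewrite powRr1// mul1r indic_in// mulr1.
by rewrite vf// normr0 addr_ge0// mulr_ge0 ?indic_ge0// ltW.
Qed.

Lemma moll_partial_weak u w i s M x r: 0<s -> itg u -> itg w -> (forall phi, smooth phi -> vanish M phi ->
  integ (fun y=> u y * partial i phi y) = - integ (fun y=> w y * phi y)) ->
 ball (0: E) r x -> s<=M-r -> partial i (moll s u) x = moll s w x.
move=> s0 iu iw weak xr sM. have sk := @smooth_kern R n s; have vk := @vanish_kern R n s s0.
rewrite /moll (partial_conv i iu sk vk) /conv. pose phi y:= kern s (x+(-1) *: y).
have sphi : smooth phi by exact: smooth_aff. have vphi : vanish M phi.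
 move=> y ny; apply: vk=> h; apply: ny; rewrite -(subrKC x y). apply: (ballD xr); rewrite distrC.
 by move: h; rewrite ball0E scaleN1r=> h; lra.
have W := weak _ sphi vphi. have ms : s<s+1 by rewrite ltrDl.
have ic := conv_itg x iu (smooth_d i sk) (vanish_d i ms vk). have e1 : integ (fun y=> u y * partial i phi y) =
  - integ (fun y=> u y * partial i (kern s) (x-y)).
 rewrite -mulN1r -(integZ _ ic).
 apply: integ_eq=> y; rewrite (@partial_aff R n (kern s) i x (-1) y sk) scaleN1r. by rewrite !mulN1r mulrN.
have e2 : integ (fun y=> w y * phi y) = integ (fun y=> w y*kern s (x-y)).
 by apply: integ_eq=> y; rewrite /phi scaleN1r.
by apply: oppr_inj; exact: (etrans (esym e1) (etrans W (f_equal -%R e2))).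
Qed.

(** In the smaller cube the derivative of [moll s u] is [moll s w], since the kernel centred at [x]
    is an admissible test function. Continuity of translations in [L^p] makes [moll s w] close to
    [w], once [w] is replaced by a Borel version so that Tonelli applies. *)
Lemma smooth_approx u w i p c M r t: 1<p -> 0<r -> r<M -> itg u ->
 mble w -> vanish M w -> ub (fun x=> `|w x| `^ p) c ->
 (forall phi M', smooth phi -> M' < M -> vanish M' phi ->
  integ (fun y=> u y * partial i phi y) = - integ (fun y=> w y * phi y)) ->
 0<t -> exists2 k0, 0<k0 & forall s, 0<s -> s<k0 ->
  ub (fun x=> \1_(ball (0: E) r) x * `|partial i (moll s u) x-w x| `^ p) t.
move=> p1 r0 rM iu mw vw uw weak t0; have M0: 0<M by lra. have iw := ub_itg_pow p1 M0 mw vw uw.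
have [Z [mZ Z0 bw]] := borel_version mw. set w' := fun x: E=> w x*\1_(~` Z) (tup x) in bw.
have mpZ : measurable (@tup R n @^-1` Z: set L) by exact: measurable_pre.
have w'E x: ~ (@tup R n @^-1` Z) x -> w' x = w x.
 by move=> nz; rewrite /w' indic_in ?mulr1.
have mw' : mble w' := bor_mble bw. have w'w x : `|w' x|<=`|w x|.
 by rewrite /w' normrM ler_piMr// ger0_norm ?indic_ge0 ?indic_le1.
have vw' : vanish M w' by move=> x nx; rewrite /w' vw// mul0r. have uw' : ub (fun x=> `|w' x| `^ p) c.
 apply: (ub_fle _ _ _ uw)=> [|x|x]; first by apply: mble_powR; mbl.
  by [].
 by apply: le_pow=> //; lra.
have iw' : itg w' := ub_itg_pow p1 M0 mw' vw' uw'.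
have [k k0 hk] := lp_translation_continuous bw p1 M0 vw' uw' t0.
exists (Num.min k ((M-r)/2)); first by rewrite lt_min k0/=; lra. move=> s s0; rewrite lt_min=> /andP[sk sM].
have u1 : ub (fun x=> \1_(ball (0: E) r) x * `|moll s w' x-w' x| `^ p) t.
 apply: (ub_moll_diff s0 p1 iw' bw (mble_ball (0: E) r))=> [x||y ys].
 - by [].
 - exact: ltW.
 - apply: (ub_fle _ _ _ (hk y (le_lt_trans ys sk)))=> [|x|x].
  + mbl.
  + by [].
  + by rewrite ler_piMl.
have su := smooth_moll s0 iu. apply: (ub_ae mpZ Z0 _ _ _ u1)=> [|x|x nx].
- mbl.
- by []. have [b|b] := pselect (ball (0: E) r x); last by rewrite indic_out// !mul0r.
have ->: partial i (moll s u) x = moll s w x.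
 apply: (@moll_partial_weak u w i s ((M+r)/2) x r)=> //; last by lra.
 by move=> phi sp vp; apply: (weak phi ((M+r)/2))=> //; lra.
rewrite (w'E x nx). suff ->: moll s w x = moll s w' x by [].
have sk' := @smooth_kern R n s; have vk := @vanish_kern R n s s0.
rewrite /moll /conv; apply: (integ_ae mpZ Z0).
- exact: conv_itg iw sk' vk.
- exact: conv_itg iw' sk' vk.
- by move=> y ny; rewrite w'E.
Qed.

End SmoothApproximation.

#[local] Hint Resolve l1_ge0 enorm_ge0 monq_ge0: nneg.

(** * The rescaled equation and the Caccioppoli inequality *)

Section CellData.
Context {R: realType} {n: nat}.
Notation E := 'rV[R]_n.
Notation leb := (@lebesgue R n).
Notation B0 r := (\1_(ball (0 : E) r) : E -> R).
Implicit Types (f v w: E -> R) (g b F: E -> E) (i: 'I_n) (p La d eps mu t H K c r th: R).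

(** [v] stands in for the solution: smooth, with gradient [L^p]-close to [g]. The radius [17] leaves
    room for mollifying, at a scale at most [1], a function supported in the cube of radius [16]. *)
Definition apx p g t v:= [/\ smooth v, vanish 17 v &
 forall i, ub (fun x=> B0 15 x * `|partial i v x-g x 0 i| `^ p) t].

(* The equation rescaled to unit size on the cube [ball 0 16] (the norm is the
  sup norm), with the oscillation period [eps] and the forcing both at most
  [d]. Only the size, coercivity and monotonicity of the flux [b] under lattice translations are retained. *)
Record cell_data p La d eps mu g b F: Prop := CellData {
 cd_mu: 0<=mu<=1; cd_eps: 0<eps<=d; cd_mg: mblev g; cd_mb: mblev b; cd_mF: mblev F;
 cd_growth: forall x, enorm (b x)<=La*(mu+enorm (g x))`^(p-1); cd_coer: forall x, ball (0: E) 16 x ->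
  (mu+enorm (g x))`^p<=La*(dot (b x) (g x)+mu`^p);
 cd_mono: forall x (z: 'rV[int]_n), let h := eps *: map_mx intr z in
  ball (0: E) 16 x -> ball (0: E) 16 (x+h) -> monq p (mu+enorm (g x)+enorm (g (x+h))) (enorm (g (x+h)-g x)) <=
  La*dot (b (x+h)-b x) (g (x+h)-g x); cd_G: ub (fun x=> B0 16 x*(mu+enorm (g x))`^p) 1;
 cd_FF: ub (fun x=> B0 16 x*enorm (F x)`^(p/(p-1))) d;
 cd_eq: forall phi M, smooth phi -> M<16 -> vanish M phi ->
  integ (fun x=> dot (b x) (grad phi x)-dot (F x) (grad phi x)) = 0;
 cd_apx: forall t, 0<t -> exists v, apx p g t v }.

Lemma ubBW r r' f c: r<=r' -> mble f -> (forall x, 0<=f x) ->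
 ub (fun x=> B0 r' x*f x) c -> ub (fun x=> B0 r x*f x) c.
move=> rr mf f0 u; apply: (ub_fle _ _ _ u)=> [|x|x].
- by apply: mbleM=> //; mbl.
- nneg. rewrite ler_wpM2r//; have := @indic_shift_le R n r r' x 0; rewrite addr0; apply.
by rewrite normr0 subr_ge0.
Qed.

Lemma mble_grad f: smooth f -> mblev (grad f).
move=> sf i; have := mble_cont (smooth_cont (smooth_d i sf)). by congr mble; apply/funext=> x; rewrite mxE.
Qed.

Lemma mble_l1 g: mblev g -> mble (fun x=> l1 (g x)).
Proof. by move=> mg; apply: mble_sum=> i; apply: mble_norm; exact: mg. Qed.

Lemma l1_grad f x: l1 (grad f x) = \sum_i `|partial i f x|.
Proof. by apply: eq_bigr=> i _; rewrite mxE. Qed.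

Hypothesis n0: (0<n)%N.

Lemma sum_pow p (a: 'I_n -> R): 0<=p -> (forall i, 0<=a i) -> (\sum_i a i)`^p<=n%:R`^p*\sum_i a i`^p.
Proof. by move=> p0 a0; have [//|e] := pow_sum p0 a0; move: n0; rewrite {1}e. Qed.

Lemma l1_pow p (x: E): 0<=p -> l1 x`^p<=n%:R`^p*\sum_i `|x 0 i| `^ p.
Proof. by move=> p0; apply: (sum_pow p0)=> i; nneg. Qed.

Lemma small_choice (A t: R): 0<=A -> 0<t -> exists2 d: R, 0<d & d<=2^-1 /\ A*d<=t.
move=> A0 t0; exists (Num.min 2^-1 (t/(A+1))).
 by rewrite lt_min divr_gt0//; [rewrite invr_gt0; lra|lra].
rewrite ge_min lexx; split=> //.
apply: (@le_trans _ _ (A*(t/(A+1)))); first by rewrite ler_wpM2l// ge_min lexx orbT.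
rewrite mulrCA ler_piMr ?(ltW t0)// ler_pdivrMr; lra.
Qed.

Section Data.
Context (p La d eps mu: R) (g b F: E -> E).
Hypotheses (p1: 1<p) (La_ge1: 1<=La). Hypothesis D: cell_data p La d eps mu g b F.

Lemma mbleG: mble (fun x=> mu+enorm (g x)).
Proof. by apply: mbleD; [mbl|exact: mble_enorm (cd_mg D)]. Qed.

Lemma G_ge0 x: 0<=mu+enorm (g x).
Proof. by rewrite addr_ge0 ?enorm_ge0//; have /andP[] := cd_mu D. Qed.

Lemma coordG_le x i: `|g x 0 i|<=mu+enorm (g x).
apply: (le_trans (coord_le_enorm (g x) i)); rewrite lerDr. by have /andP[] := cd_mu D.
Qed.

Lemma data_itg phi M: smooth phi -> M<16 -> vanish M phi ->
 itg (fun x=> dot (b x) (grad phi x)-dot (F x) (grad phi x)).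
move=> sp M16 vp. have [C [C0 _ pC _]] := smooth_bounds sp vp.
have v16 i : vanish 16 (partial i phi) by exact: vanish_d vp. have pm1 : p-1<p by rewrite gtrBl.
have pm2: 0<=p-1 by rewrite subr_ge0 ltW. have [C1 C10 hC1] := @pow_absorb R (p-1) p 1 pm1 pm2 ltr01.
have q1: 1<p/(p-1) by rewrite ltr_pdivlMr ?subr_gt0// mul1r.
have [C2 C20 hC2] := @pow_absorb R 1 (p/(p-1)) 1 q1 ler01 ltr01. have lt016 : (0: R)<16 by lra.
have u1 := ubD (cd_G D) (ubZ (ltW C10) (ub_ball (0: E) lt016)).
have u2 := ubD (cd_FF D) (ubZ (ltW C20) (ub_ball (0: E) lt016)). have nC0: 0<=n%:R*C by nneg.
have La0: 0<=La by exact: le_trans ler01 La_ge1. have u := ubZ nC0 (ubD (ubZ La0 u1) u2).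
have mg := mble_grad sp. apply: (itg_le _ _ u)=> [|x].
 by apply: mbleB; apply: mble_dot=> //; [exact: cd_mb D|exact: cd_mF D].
have l1C : l1 (grad phi x)<=n%:R*C.
 by rewrite l1_grad -sum_cst; apply: ler_sum=> i _.
have [bx|nbx] := pselect (ball (0: E) 16 x); last first.
 have g0 : grad phi x = 0 by apply/rowP=> i; rewrite !mxE v16.
 rewrite g0 /dot !big1; try by move=> i _; rewrite mxE mulr0.
 by rewrite subrr normr0 !indic_out// !(mul0r, mulr0, addr0).
rewrite indic_in// !mul1r !mulr1. apply: (le_trans (ler_normB _ _)); rewrite mulrDr; apply: lerD.
 apply: (le_trans (dot_le _ _)); rewrite mulrC. apply: ler_pM; rewrite ?enorm_ge0 ?l1_ge0//.
 apply: (le_trans (cd_growth D x)); rewrite ler_wpM2l//. by have := hC1 _ (G_ge0 x); rewrite mul1r.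
apply: (le_trans (dot_le _ _)); rewrite mulrC. apply: ler_pM; rewrite ?enorm_ge0 ?l1_ge0//.
by have := hC2 _ (enorm_ge0 (F x)); rewrite mul1r powRr1 ?enorm_ge0.
Qed.

End Data.

Section Apx.
Context (p La d eps mu: R) (g b F: E -> E) (v: E -> R) (t: R).
Hypothesis p1: 1<p.
Context (D: cell_data p La d eps mu g b F) (av: apx p g t v) (t1: t<=1).

Let sv: smooth v. Proof. by case: av. Qed.
Let vv: vanish 17 v. Proof. by case: av. Qed.
Let p0: 0<=p. Proof. exact: ltW (lt_trans ltr01 p1). Qed.
Let lt017: (0: R)<17. Proof. lra. Qed.

Lemma apx_bound i: ub (fun x=> B0 15 x * `|partial i v x| `^ p) (2`^p*2).
have [_ _ /(_ i) h] := av. have uG : ub (fun x=> B0 15 x*(mu+enorm (g x))`^p) 1.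
 apply: (@ubBW 15 16) (cd_G D); [lra|exact: mble_powR (mbleG D)|by move=> x; nneg].
apply: (ub_le _ _ _ _ (ubZ (powR_ge0 2 p) (ubD h uG)))=> [|x|x|].
- by apply: mbleM; [mbl|apply: mble_powR; apply: mble_norm; apply: mble_cont; mbl].
- nneg.
- rewrite -mulrDr mulrCA ler_wpM2l ?indic_ge0//.
 apply: (@le_trans _ _ ((`|partial i v x-g x 0 i| + (mu+enorm (g x)))`^p)).
  apply: le_pow=> //; rewrite -{1}(subrK (g x 0 i) (partial i v x)).
  by apply: (le_trans (ler_normD _ _)); rewrite lerD2l (coordG_le D).
 by apply: pow_add=> //; exact: (G_ge0 D).
- by rewrite ler_wpM2l ?powR_ge0//; exact: (lerD t1 (lexx 1)).
Qed.

Lemma moll_bound i H r: 0<H -> r+H<=15 -> ub (fun x=> B0 r x * `|partial i (moll H v) x| `^ p) (2`^p*2).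
move=> H0 rH; rewrite (partial_moll i H0 lt017 sv vv). have spv := smooth_d i sv.
have v18 : vanish 18 (partial i v) by apply: vanish_d vv; lra. have lt018 : (0: R)<18 by lra.
apply: (@ub_moll R n H _ p r 15)=> //; last exact: apx_bound.
- exact: smooth_itg lt018 spv v18.
- exact: cont_bor (smooth_cont spv).
- lra.
Qed.

Lemma moll_poincare H r: 0<H -> 0<r -> r+H<=15 -> ub (fun x=> B0 r x * `|moll H v x-v x| `^ p)
   (n%:R`^p*(n%:R*(2`^p*(H`^p*(2`^p*2))))).
move=> H0 r0 rH; apply: (@ub_moll_poincare R n H v 17 p r 15)=> //.
- lra.
- exact: apx_bound.
Qed.

End Apx.

Let distrib (B a c k q1 q2 w: R) : a*(c*(B*q1+B*q2)+k*(B*w)) = B*(a*(c*(q1+q2)+k*w)).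
Proof. ring. Qed.

Let cancel_grad (chi gi vi mi w y: R) : chi*(vi-mi)+w*y = chi*(gi-(gi-vi)-mi)+w*y.
Proof. ring. Qed.

Let dot_split (z0 z y1 y2 y3: E) (chi w: R): chi*dot z0 z =
 chi*dot z0 y1+chi*dot z0 y2+dot z0 (chi *: (z-y1-y2)+w *: y3)-w*dot z0 y3.
Proof. by rewrite dotDr !dotZr !dotBr; ring. Qed.

Let double_half (A c th: R): 2*(A/2*c+th/2)<=A*c+th.
Proof. lra. Qed.

Let small_coef (La th Q: R): 0<La -> 0<th -> 0<=Q -> La*(th/(8*La*(Q+1))*Q)<=th/8.
move=> L0 th0 Q0; have ->: La*(th/(8*La*(Q+1))*Q) = th/8*(Q/(Q+1)).
 by field; rewrite !gt_eqF//; lra.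
rewrite ler_piMr//; first nneg. rewrite ler_pdivrMr; lra.
Qed.

Let add_pieces (x1 x2 c th a k Q' b y z: R): a = th/8 -> y<=th/8 -> x2+b+z<=th/4 ->
 x1 = Q'/2*c -> x1+(x2+(a+b+(y+z)))<=Q'/2*c+th/2.
Proof. lra. Qed.

Let absorb (La k3 k4 k5 C2 C3 C4 N nK chi Gp mup S1 S2 wp W FP Q bg b1 b2 b3 Fw: R) :
 0<La -> 0<=chi<=1 -> 0<=C2 -> 0<=N -> 0<=S1 -> 0<=S2 -> 0<=mup -> La*(La*k4) = 4^-1 -> Gp<=La*(bg+mup) ->
 chi*bg = chi*b1+chi*b2+(W+Fw)-b3 -> b1<=La*(k4*Gp+C2*(N*S1)) -> b2<=La*(k4*Gp+C2*(N*S2)) ->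
 - b3<=La*(k3*Gp+C3*(nK*wp)) -> Fw<=k5*Q+C4*FP -> 2^-1*(chi*Gp)<=La*W+((La*La*(C2*N)+La)*(chi*(mup+S2))
  + (La*La*(C2*N)*S1+(La*La*(k3*Gp+C3*nK*wp) + La*(k5*Q+C4*FP)))).
move=> L0 /andP[chi0 chi1] C20 N0 S10 S20 m0 hk4 h1 h2 h3 h4 h5 h6. have c1p: 0<=La*La*(C2*N) by nneg.
have e1 : chi*S1<=S1 by rewrite ler_piMl. have e2: 0<=chi * mup by nneg. have e3: 0<=chi*S2 by nneg.
have f1 : La*(chi*b1)<=4^-1*(chi*Gp)+La*La*(C2*N)*S1.
 have := ler_wpM2l (ltW L0) (ler_wpM2l chi0 h3); rewrite -hk4. have := ler_wpM2l c1p e1; lra.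
have f2 : La*(chi*b2)<=4^-1*(chi*Gp)+La*La*(C2*N)*(chi*S2).
 by have := ler_wpM2l (ltW L0) (ler_wpM2l chi0 h4); rewrite -hk4; lra.
have f5 := ler_wpM2l (ltW L0) h5. have f6 := ler_wpM2l (ltW L0) h6.
have f7 : La*La*(C2*N)*(chi * mup) >= 0 by nneg. have f8 : La*(chi*S2) >= 0 by nneg.
have f9 := ler_wpM2l chi0 h1. have f0 : chi*(La*(bg+mup)) = La*(chi*b1)+La*(chi*b2)
  + La*W+La*Fw+La * - b3+La*(chi * mup).
 by rewrite mulrCA mulrDr h2; ring.
by lra.
Qed.

(** The test function is [chi] times [v - moll H v]. The term with the slope of [chi] carries the
    factor [v - moll H v], of order [H] in [L^p], so the slope bound [K] influences the threshold
    [d0] but not the constant [C]. This is what later admits cutoffs that follow superlevel sets. *)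
Lemma caccioppoli p La: 1<p -> 1<=La -> exists2 C: R, 0<C & forall K th, 0<K -> 0<th -> exists2 d0, 0<d0 &
 forall d eps mu g b F v H chi c, d<=d0 -> cell_data p La d eps mu g b F ->
 apx p g d0 v -> 0<H -> H<=d0 -> smooth chi -> vanish 13 chi ->
 (forall x, 0<=chi x<=1) -> (forall i x, `|partial i chi x|<=K) ->
 ub (fun x=> chi x*(mu`^p + \sum_i `|partial i (moll H v) x| `^ p)) c ->
 ub (fun x=> chi x*(mu+enorm (g x))`^p) (C*c+th).
move=> p1 La1; have p0: 0<=p by lra. have L0: 0<La by lra. have pm0: 0<p-1 by lra. have L2: 0<La*La by nneg.
have k40: 0<(4*(La*La))^-1 by nneg. have [C2 C20 hC2] := @young1 R p (4*(La*La))^-1 p1 k40.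
pose N:= n%:R`^p: R. have N0: 0<=N by exact: powR_ge0. pose C:= 2*(La*La*(C2*N)+La): R.
have C0: 0<C by rewrite mulr_gt0// ltr_wpDl// !mulr_ge0// ltW.
have le1415 : (14: R)<=15 by lra. have le1416 : (14: R)<=16 by lra.
have lt1316 : (13: R)<16 by lra. have lt1314 : (13: R)<14 by lra.
have lt014 : (0: R)<14 by lra. have lt017 : (0: R)<17 by lra. exists C=> // K th K0 th0.
have k30: 0<th/(8*(La*La)) by nneg. have [C3 C30 hC3] := @young1 R p (th/(8*(La*La))) p1 k30.
pose A:= (2`^p*2): R; have A0: 0<A by rewrite mulr_gt0 ?powR_gt0. pose P:= N*(n%:R*(2`^p*A)): R.
have P0: 0<=P by rewrite !mulr_ge0 ?powR_ge0// ltW. pose Q:= N*(n%:R*(2`^p*(2`^p*(A+A)+K`^p*P))): R.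
have Q0: 0<=Q by rewrite !mulr_ge0 ?powR_ge0// addr_ge0// mulr_ge0 ?powR_ge0//; lra.
have k5: 0<th/(8*La*(Q+1)) by rewrite divr_gt0// !mulr_gt0//; lra. have [C4 C40 hC4] := @young R p _ p1 k5.
pose nK:= (n%:R*K)`^p: R; have nK0: 0<=nK by exact: powR_ge0.
(* [X] collects the coefficients of the three errors bounded by [d0]: the approximation of [g], the
   mollification error and the forcing. *)
pose X:= La*La*(C2*(N*n%:R))+La*La*(C3*(nK*P))+La*C4: R. have X0: 0<=X.
 by rewrite !addr_ge0//; do ![apply: mulr_ge0|exact: ltW|done].
have th4: 0<th/4 by nneg. have [d0 d00 [dh dX]] := small_choice X0 th4.
exists d0=> // d eps mu g b F v H chi c dd0 D av H0 Hd schi vchi chi01 chiK uc. have [sv vv apv] := av.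
have d01 : d0<=1 by lra. have iv := smooth_itg lt017 sv vv. have smv : smooth (moll H v) := smooth_moll H0 iv.
pose w x:= v x-moll H v x. have sw : smooth w by exact: smoothB. pose phi x:= chi x*w x.
have sphi : smooth phi by exact: smoothM. have vphi : vanish 13 phi by move=> x nx; rewrite /phi vchi// mul0r.
have E0 := cd_eq D sphi lt1316 vphi. have I0 := data_itg p1 La1 D sphi lt1316 vphi.
have chi0 x: 0<=chi x by have /andP[] := chi01 x. have chi1 x : chi x<=1 by have /andP[] := chi01 x.
pose G x:= mu+enorm (g x). have G0 x: 0<=G x := G_ge0 D x. have mG : mble G := mbleG D.
have mchi : mble chi := mble_cont (smooth_cont schi). have mw : mble w := mble_cont (smooth_cont sw).
have mv i : mble (partial i v) := mble_cont (smooth_cont (smooth_d i sv)).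
have mmv i : mble (partial i (moll H v)) := mble_cont (smooth_cont (smooth_d i smv)).
have mgi i : mble (fun x=> g x 0 i) := cd_mg D i. have r14: 14+H<=15 by lra.
have u_g : ub (fun x=> \sum_i (B0 15 x * `|partial i v x-g x 0 i| `^ p)) (n%:R*d0).
 by rewrite -sum_cst; apply: ub_sum=> i; exact: apv.
have u_w : ub (fun x=> B0 14 x * `|w x| `^ p) (P*d0).
 have := moll_poincare p1 D av d01 H0 lt014 r14. apply: ub_le=> [|x|x|].
 - by apply: mbleM; [mbl|apply: mble_powR; mbl].
 - nneg.
 - by rewrite /w distrC. have ->: n%:R`^p*(n%:R*(2`^p*(H`^p*(2`^p*2)))) = P*H`^p.
  by rewrite /P /N /A; ring.
 rewrite ler_wpM2l//; apply: (le_trans _ Hd); apply: ge1r_powR; last exact: ltW. by rewrite H0; lra.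
have u_w1 : ub (fun x=> B0 14 x * `|w x| `^ p) P.
 by apply: ub_cle u_w; rewrite ler_piMr.
have u_G : ub (fun x=> B0 14 x*G x`^p) 1.
 by apply: (@ubBW 14 16) (cd_G D); [nneg|mbl|move=> x; nneg].
have u_F : ub (fun x=> B0 14 x*enorm (F x)`^(p/(p-1))) d0.
 apply: ub_cle dd0 _; apply: (@ubBW 14 16) (cd_FF D); first nneg.
  by apply: mble_powR; exact: mble_enorm (cd_mF D).
 by move=> x; nneg.
have u_v i : ub (fun x=> B0 14 x * `|partial i v x| `^ p) A.
 apply: (@ubBW 14 15) (apx_bound p1 D av d01 i); first nneg.
  by apply: mble_powR; mbl.
 by move=> x; nneg.
have u_m i : ub (fun x=> B0 14 x * `|partial i (moll H v) x| `^ p) A := moll_bound p1 D av d01 i H0 r14.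
pose gp x:= \sum_i (2`^p*(2`^p*(B0 14 x * `|partial i v x| `^ p+B0 14 x * `|partial i (moll H v) x| `^ p)
  + K`^p*(B0 14 x * `|w x| `^ p))).
have u_phi : ub (fun x=> N*gp x) Q.
 rewrite /Q -sum_cst; apply: ubZ=> //; apply: ub_sum=> i; apply: ubZ; first nneg.
 by apply: ubD; [apply: ubZ; [nneg|exact: ubD]|apply: ubZ; [nneg|]].
have phiE i x : partial i phi x = chi x*(partial i v x-partial i (moll H v) x)+w x * partial i chi x.
 by rewrite /phi (partialM i x schi sw) /w (partialB i x sv smv).
have phib x : B0 14 x*(l1 (grad phi x))`^p<=N*gp x.
 apply: (@le_trans _ _ (B0 14 x*(N*\sum_i `|partial i phi x| `^ p))).
  rewrite ler_wpM2l ?indic_ge0// l1_grad; exact: sum_pow.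
 rewrite mulrCA ler_wpM2l// mulr_sumr; apply: ler_sum=> i _. rewrite (distrib (B0 14 x)).
 rewrite ler_wpM2l ?indic_ge0// phiE.
 apply: (@le_trans _ _ (((`|partial i v x| + `|partial i (moll H v) x|)+K * `|w x|)`^p)).
  apply: le_pow=> //; apply: (le_trans (ler_normD _ _)); apply: lerD.
   rewrite normrM (ger0_norm (chi0 x)). by apply: (le_trans _ (ler_normB _ _)); rewrite ler_piMl.
  by rewrite normrM mulrC ler_wpM2r.
 apply: (le_trans (pow_add p0 _ _)); rewrite ?addr_ge0 ?mulr_ge0 ?(ltW K0)//.
 rewrite ler_wpM2l ?powR_ge0// powRM ?(ltW K0)// lerD2r; exact: pow_add.
pose W x:= dot (b x) (grad phi x)-dot (F x) (grad phi x). have gp0 x: 0<=N*gp x.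
 rewrite mulr_ge0// sumr_ge0// => i _. nneg.
pose k3:= th/(8*(La*La)); pose k5' := th/(8*La*(Q+1)).
pose rest x:= (La*La*(C2*N)+La)*(chi x*(mu`^p + \sum_i `|partial i (moll H v) x| `^ p))
 + (La*La*(C2*N)*(\sum_i (B0 15 x * `|partial i v x-g x 0 i| `^ p))
 + (La*La*(k3*(B0 14 x*G x`^p)+C3*nK*(B0 14 x * `|w x| `^ p))
 + La*(k5'*(N*gp x)+C4*(B0 14 x*enorm (F x)`^(p/(p-1)))))).
have c1p: 0<=La*La*(C2*N) by nneg. have pt x: 2^-1*(chi x*G x`^p)<=La*W x+rest x.
 have S20: 0 <= \sum_i `|partial i (moll H v) x| `^ p by rewrite sumr_ge0// => i _; exact: powR_ge0.
 have m0: 0<=mu`^p by nneg. have [b14|nb] := pselect (ball (0: E) 14 x); last first.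
  have c0' : chi x = 0 by rewrite vchi// => h; apply: nb; apply: le_ball h; exact: ltW.
  have gphi0 : grad phi x = 0.
   by apply/rowP=> i; rewrite !mxE (vanish_d i lt1314 vphi).
  rewrite /W gphi0 /dot !big1; try by move=> i _; rewrite mxE mulr0. have i14 : (0: R)<=B0 14 x by nneg.
  have z1: 2^-1*(chi x*G x`^p) = 0 by rewrite c0' mul0r mulr0.
  rewrite z1 subr0 mulr0 add0r /rest c0' mul0r mulr0 add0r. apply: addr_ge0.
   by rewrite mulr_ge0// sumr_ge0// => i _; rewrite mulr_ge0 ?indic_ge0 ?powR_ge0.
  apply: addr_ge0; apply: mulr_ge0; rewrite ?(ltW L2) ?(ltW L0)//; apply: addr_ge0.
  - by rewrite mulr_ge0 ?(ltW k30)// mulr_ge0 ?powR_ge0.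
  - by rewrite mulr_ge0 ?(mulr_ge0 (ltW C30))// mulr_ge0 ?powR_ge0.
  - nneg.
  - by rewrite mulr_ge0 ?(ltW C40)// mulr_ge0 ?powR_ge0.
 have b15 : ball (0: E) 15 x by apply: le_ball b14; nneg.
 have b16 : ball (0: E) 16 x by apply: le_ball b14; nneg. have B14 : B0 14 x = 1 by rewrite indic_in.
 set S2:= \sum_i `|partial i (moll H v) x| `^ p in S20 *. set S1:= \sum_i `|partial i v x-g x 0 i| `^ p.
 have S10: 0<=S1 by rewrite sumr_ge0// => i _; exact: powR_ge0.
 have ->: rest x = (La*La*(C2*N)+La)*(chi x*(mu`^p+S2))
  + (La*La*(C2*N)*S1+(La*La*(k3*G x`^p+C3*nK * `|w x| `^ p) + La*(k5'*(N*gp x)+C4*enorm (F x)`^(p/(p-1))))).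
  rewrite /rest B14 !mul1r; congr (_+(_*_+_)). by apply: eq_bigr=> i _; rewrite indic_in// mul1r.
 (* The gradient of the test function splits into [g], the approximation error [y1], the mollified
    gradient [y2], which stays on the right-hand side, and the slope [y3] of the cutoff. *)
 pose y1:= g x-grad v x; pose y2:= grad (moll H v) x; pose y3:= grad chi x.
 have gphiE : grad phi x = chi x *: (g x-y1-y2)+w x *: y3.
  apply/rowP=> i; rewrite !mxE phiE; nneg.
 have h2 : chi x*dot (b x) (g x) = chi x*dot (b x) y1+chi x*dot (b x) y2
   + (W x+dot (F x) (grad phi x))-w x*dot (b x) y3.
  by rewrite /W subrK gphiE; nneg.
 have dotb y : dot (b x) y<=La*(G x`^(p-1) * l1 y).
  apply: (le_trans (ler_norm _)); apply: (le_trans (dot_le _ _)).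
  by rewrite mulrA ler_wpM2r ?l1_ge0//; exact: cd_growth D x.
 have l1p y : l1 y`^p<=N*\sum_i `|y 0 i| `^ p := l1_pow y p0. pose k4:= (4*(La*La))^-1.
 have b1 (y: E) S: \sum_i `|y 0 i| `^ p = S -> dot (b x) y<=La*(k4*G x`^p+C2*(N*S)).
  move=> <-; apply: (le_trans (dotb y)); rewrite ler_wpM2l ?(ltW L0)//.
  apply: (le_trans (hC2 _ _ (G0 x) (l1_ge0 y))); by rewrite lerD2l; exact: (ler_wpM2l (ltW C20) (l1p y)).
 have hk4 : La*(La*k4) = 4^-1 by rewrite /k4; field; rewrite gt_eqF.
 apply: (absorb L0 (chi01 x) (ltW C20) N0 S10 S20 m0 hk4 (cd_coer D b16) h2).
 - by apply: b1; apply: eq_bigr=> i _; rewrite !mxE distrC.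
 - by apply: b1; apply: eq_bigr=> i _; rewrite mxE.
 - apply: (le_trans (ler_norm _)); rewrite normrN normrM.
  apply: (@le_trans _ _ (La*(G x`^(p-1)*(n%:R*K * `|w x|)))).
   rewrite mulrC; apply: (@le_trans _ _ (La*G x`^(p-1)*(n%:R*K) * `|w x|)); last by rewrite -!mulrA.
   rewrite ler_wpM2r//; apply: (le_trans (dot_le _ _)).
   apply: ler_pM; rewrite ?enorm_ge0 ?l1_ge0//; first exact: cd_growth D x.
   by rewrite /y3 l1_grad -sum_cst; apply: ler_sum=> i _.
  rewrite ler_wpM2l ?(ltW L0)//. have nKw: 0<=n%:R*K * `|w x| by nneg. have nKp: 0<=n%:R*K by nneg.
  have := hC3 _ _ (G0 x) nKw. by rewrite powRM.
 apply: (le_trans (ler_norm _)); apply: (le_trans (dot_le _ _)); rewrite mulrC.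
 apply: (le_trans (hC4 _ _ (l1_ge0 _) (enorm_ge0 _))); rewrite lerD2r ler_wpM2l ?(ltW k5)//.
 by have := phib x; rewrite B14 mul1r.
have u_rest : ub rest (C/2*c+th/2).
 have u1 := ubZ (addr_ge0 c1p (ltW L0)) uc. have u2 := ubZ c1p u_g.
 have u3 := ubZ (ltW L2) (ubD (ubZ (ltW k30) u_G) (ubZ (mulr_ge0 (ltW C30) nK0) u_w)).
 have u4 := ubZ (ltW L0) (ubD (ubZ (ltW k5) u_phi) (ubZ (ltW C40) u_F)).
 apply: ub_cle (ubD u1 (ubD u2 (ubD u3 u4))). have e3 : La*La*k3 = th/8 by rewrite /k3; field; rewrite gt_eqF.
 have e5 : La*(k5'*Q)<=th/8 by mbl. have e3' : La*La*(k3*1) = th/8 by rewrite mulr1.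
 rewrite [La*La*(k3*1+_)]mulrDr [La*(k5'*Q+_)]mulrDr. apply: add_pieces=> //.
 - by apply: le_trans dX; rewrite /X !mulrDl -!mulrA lexx.
 - by rewrite /C [2*_]mulrC mulfK// gt_eqF.
have LaW0: \int[leb]_x (La*W x) = 0.
 by have := integZ La I0; rewrite /integ=> ->; rewrite -/(integ _) E0 mulr0.
have mL : mble (fun x=> 2^-1*(chi x*G x`^p)).
 mbl.
have uf := ub_of_eq0 (itgZ La I0) LaW0 mL _ pt u_rest.
have {}uf: ub (fun x=> 2^-1*(chi x*G x`^p)) (C/2*c+th/2).
 by apply: uf=> x; rewrite !mulr_ge0 ?powR_ge0// invr_ge0.
have two: 0<=2 :> R by lra. apply: (ub_le _ _ _ _ (ubZ two uf))=> [|x|x|].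
- by apply: mbleM=> //; mbl.
- by rewrite mulr_ge0 ?powR_ge0.
- by rewrite mulrA mulfV ?mul1r// gt_eqF.
- nneg.
Qed.

End CellData.

#[local] Hint Resolve cd_mg mble_grad: mble.

(** * Energy on superlevel sets of difference quotients *)

Section Superlevels.
Context {R: realType}.
Implicit Types (a m p t x: R).

Lemma powRB_split p m t: 0<t -> t`^p = t`^(p-m)*t`^m.
Proof. by move=> t0; rewrite -powRD ?subrK// (gt_eqF t0) implybT. Qed.

Lemma pow_above p m t a: p<=m -> 0<t -> t<=a -> a`^p<=t`^(p-m)*a`^m.
move=> pm t0 ta; have a0: 0<a by lra. rewrite (powRB_split p m a0) ler_wpM2r ?powR_ge0//.
have ->: p-m = - (m-p) by ring. by rewrite !powRN lef_pV2 ?posrE ?powR_gt0// le_pow ?subr_ge0// ltW.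
Qed.

Lemma pow_above_or p m t a: 0<=p -> p<=m -> 0<t -> 0<=a -> a`^p<=t`^p+t`^(p-m)*a`^m.
move=> p0 pm t0 a0; have [ta|at_] := leP t a.
 by apply: (le_trans (pow_above pm t0 ta)); rewrite lerDr powR_ge0.
by apply: (le_trans (le_pow p0 a0 (ltW at_))); rewrite lerDl mulr_ge0 ?powR_ge0.
Qed.

Lemma pow_half_above p m t a: p<=m -> 0<=m -> 0<t -> t<=2*a -> t`^p<=2`^m*(t`^(p-m)*a`^m).
move=> pm m0 t0 ta; rewrite (powRB_split p m t0) mulrCA ler_wpM2l ?powR_ge0//. rewrite -powRM; [|lra..].
by apply: le_pow=> //; exact: ltW.
Qed.

(** With [y = 1/x] this is [y^2 <= 4 e^y], the square of [1 + y/2 <= e^(y/2)]. It bounds the slope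
    of the cutoff in the values of a function. *)
Lemma dexpbump_bound x: `|expbump ('X^2*(1-1^`())) x|<=4.
rewrite /expbump derivC subr0 mulr1; case: ltP=> x0; last by rewrite normr0; lra.
set y:= x^-1; have y0: 0<y by rewrite invr_gt0.
rewrite hornerXn normrM !ger0_norm ?expR_ge0 ?exprn_ge0 ?(ltW y0)//. rewrite expRN ler_pdivrMr ?expR_gt0//.
have h: 1+y/2<=expR (y/2) by exact: expR_ge1Dx.
have ->: expR y = expR (y/2)^+2 by rewrite expr2 -expRD; congr expR; lra. have h2 : (1+y/2)^+2<=expR (y/2)^+2.
 by rewrite ler_pXn2r// ?nnegrE ?expR_ge0//; lra.
have h3 : y^+2<=4*(1+y/2)^+2 by rewrite !expr2; nra. lra.
Qed.

End Superlevels.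

Section DifferenceQuotients.
Context {R: realType} {n: nat}.
Notation E := 'rV[R]_n.
Notation B0 r := (\1_(ball (0 : E) r) : E -> R).
Notation e_ i := (delta_mx 0 i : E).
Implicit Types (f v: E -> R) (i j: 'I_n) (p m k r M c t: R).

Lemma ub_eq f f' c: (forall x, f x = f' x) -> ub f c -> ub f' c.
Proof. by move=> /funext ->. Qed.

Definition fdiff i k f (x: E): R := k^-1*(f (x+k *: e_ i)-f x).

Lemma norm_delta i: `|e_ i|<=1.
rewrite leNgt; apply/negP=> h. suff: `|e_ i|<`|e_ i| by rewrite ltxx.
apply: norm_lt_coord; first exact: lt_trans h. move=> j; rewrite mxE eqxx/=; apply: le_lt_trans h.
by case: (j == i); rewrite /= ?normr1 ?normr0.
Qed.

Lemma norm_scale_delta i k: 0<=k -> `|k *: e_ i|<=k.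
Proof. by move=> k0; rewrite normrZ ger0_norm// ler_piMr// norm_delta. Qed.

Lemma smooth_fdiff i k f: smooth f -> smooth (fdiff i k f).
Proof. by move=> sf; apply: smoothZ; apply: smoothB=> //; exact: smooth_shift. Qed.

Lemma partial_fdiff i j k f x: smooth f -> partial j (fdiff i k f) x = fdiff i k (partial j f) x.
move=> sf; have sh := smooth_shift (k *: e_ i) sf.
by rewrite /fdiff (partialZ _ _ _ (smoothB sh sf)) (partialB _ _ sh sf) (partial_shift _ _ _ sf).
Qed.

Definition Ktr m: R := n%:R`^m*(n%:R*2`^m).

Lemma Ktr_ge0 m: 0<=Ktr m.
Proof. by rewrite mulr_ge0// mulr_ge0 ?powR_ge0. Qed.

Lemma ub_fdiff i k f M m r r' c: 1<=m -> smooth f -> vanish M f -> 0<r -> 0<k ->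
 r+k<=r' -> (forall j, ub (fun x=> B0 r' x * `|partial j f x| `^ m) c) ->
 ub (fun x=> B0 r x * `|fdiff i k f x| `^ m) (Ktr m*c).
move=> m1 sf vf r0 k0 rk H; have m0: 0<=m by lra.
have hk : `|k *: e_ i|<=r' - r by apply: (le_trans (norm_scale_delta i (ltW k0))); lra.
have kV0: 0<=k^-1 by nneg. have u := ubZ (powR_ge0 k^-1 m) (translate_ball m1 sf vf r0 H hk).
have mf := mble_cont (smooth_cont (smooth_fdiff i k sf)). apply: (ub_le _ _ _ _ u)=> [|x|x|].
- mbl.
- nneg.
- by rewrite /fdiff normrM (ger0_norm kV0) powRM// mulrCA. have c0: 0<=c by exact: ub_ge0 (H i).
apply: (@le_trans _ _ (k^-1`^m*(n%:R`^m*(n%:R*(2`^m*(k`^m*c)))))).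
 by rewrite !ler_wpM2l ?powR_ge0// ler_wpM2r// le_pow// norm_scale_delta// ltW.
have e1 : k^-1`^m*k`^m = 1.
 by rewrite -powRM ?(ltW k0)// mulVf ?gt_eqF// powR1.
rewrite /Ktr (_: _*_ = (k^-1`^m*k`^m)*(n%:R`^m*(n%:R*2`^m)*c)); last by ring. by rewrite e1 mul1r.
Qed.

Lemma ub_fdiff_diff i k f g p r r' c: 0<=p -> mble f -> mble g -> 0<k -> r+k<=r' ->
 ub (fun x=> B0 r' x * `|f x-g x| `^ p) c ->
 ub (fun x=> B0 r x * `|fdiff i k f x-fdiff i k g x| `^ p) (k^-1`^p*(2`^p*(c+c))).
move=> p0 mf mg k0 rk u; have kV0: 0<=k^-1 by nneg.
have hk : `|k *: e_ i|<=r' - r by apply: (le_trans (norm_scale_delta i (ltW k0))); lra.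
have md : mble (fun x=> f x-g x) by mbl. have mp : mble (fun x=> `|f x-g x| `^ p) by apply: mble_powR; mbl.
have p1 x: 0<=`|f x-g x| `^ p by nneg. have u1 := ub_ballD hk p1 mp u. have rr : r<=r' by lra.
have u2 := ubBW rr mp p1 u.
apply: (ub_fle _ _ _ (ubZ (powR_ge0 _ p) (ubZ (powR_ge0 2 p) (ubD u1 u2))))=> [|x|x].
- apply: mbleM; [mbl|apply: mble_powR; apply: mble_norm; apply: mbleB].
  by apply: mbleM; [mbl|apply: mbleB=> //; mbl].
 by apply: mbleM; [mbl|apply: mbleB=> //; mbl].
- nneg.
rewrite -mulrDr (mulrCA (2`^p)) (mulrCA (k^-1`^p)) ler_wpM2l ?indic_ge0// /fdiff -mulrBr normrM (ger0_norm kV0) powRM//.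
rewrite ler_wpM2l ?powR_ge0//; apply: le_trans (pow_add p0 (normr_ge0 _) (normr_ge0 _)). apply: le_pow=> //.
have alg (a1 a2 a3 a4: R): a1-a2-(a3-a4) = (a1-a3)-(a2-a4) by ring. rewrite alg; exact: ler_normB.
Qed.

Lemma apx_mono p (g: E -> E) t t' v: t<=t' -> apx p g t v -> apx p g t' v.
Proof. by move=> tt [sv vv h]; split=> // i; exact: ub_cle (h i). Qed.

End DifferenceQuotients.

Section Stage.
Context {R: realType} {n: nat} (n0: (0<n)%N) (p La: R) (p1: 1<p) (La1: 1<=La).
Notation E := 'rV[R]_n.
Notation B0 r := (\1_(ball (0 : E) r) : E -> R).
Notation e_ i := (delta_mx 0 i : E).
Implicit Types (v: E -> R) (g b F: E -> E) (i: 'I_n) (d eps mu t H K c r th k m: R).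

(* The mollified gradient has a locally bounded [m]-th moment, uniformly as the
  mollification scale [H] tends to 0, once [d] is small depending on [H]. *)
Definition moment m:= forall r, 0<r -> r<13 -> exists2 C: R, 0<C &
 forall H, 0<H -> r+50*H<=13 -> exists2 d0: R, 0<d0 &
 forall d eps mu g b F v, d<=d0 -> cell_data p La d eps mu g b F -> apx p g d v ->
 forall i, ub (fun x=> B0 r x * `|partial i (moll H v) x| `^ m) C.

Lemma moment_base: moment p.
move=> r r0 r13; exists (2`^p*2); first nneg. move=> H H0 H1; exists 1=> // d eps mu g b F v d1 D av i.
have rH : r+H<=15 by lra. exact: (moll_bound p1 D av d1 i H0 rH).
Qed.

(** The bound deteriorates as [H] tends to [0]; it enters only thresholds and the number of levels,
    never the constants in the moment bounds. *)
Lemma grad_sup r H: 0<H -> r+H<=15 -> exists2 S: R, 0<=S &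
 forall d eps mu g b F v, d<=1 -> cell_data p La d eps mu g b F -> apx p g d v ->
 forall i x, ball (0: E) r x -> `|partial i (moll H v) x|<=S.
move=> H0 rH. have p1' := p1. have [C C0 hC] := @pow_absorb R 1 p 1 p1 ler01 ltr01.
have lt015 : (0: R)<15 by lra. have lt017 : (0: R)<17 by lra. have Hr : H<=15-r by lra.
pose c:= 2`^p*2+C*(2*15)^+n: R. have c0: 0<=c.
 by rewrite addr_ge0 ?mulr_ge0 ?powR_ge0 ?(ltW C0)// exprn_ge0// mulr_ge0// ltW.
exists ((bumpZ (R:=R) (n:=n)*H^+n)^-1*c).
 by rewrite mulr_ge0// invr_ge0 mulr_ge0 ?exprn_ge0// ltW// bumpZ_gt0.
move=> d eps mu g b F v d1 D av i x xr; have [sv vv _] := av. rewrite (partial_moll i H0 lt017 sv vv).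
have spv := smooth_d i sv. have mpv := mble_cont (smooth_cont spv).
apply: (@conv_sup R n (partial i v) (kern H) _ H r 15 c x H0)=> //.
- by move=> y; rewrite ger0_norm ?kern_ge0// kern_le.
- mbl.
- exact: vanish_kern.
apply: (ub_fle _ _ _ (ubD (apx_bound p1 D av d1 i) (ubZ (ltW C0) (ub_ball (0: E) lt015))))=> [|y|y].
- mbl.
- nneg. rewrite [C*_]mulrC -mulrDr ler_wpM2l ?indic_ge0//.
by have := hC _ (normr_ge0 (partial i v y)); rewrite powRr1// mul1r.
Qed.

(** Difference quotients [A] of the mollification inherit the [m]-th moment. The energy of [g]
    itself on [{A >= t}] comes from the Caccioppoli inequality with a cutoff supported in
    [{A > t/2}], where Chebyshev's inequality gives [t^p] a total mass of order [t^(p-m)]. Steps are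
    bounded below by [kap] so that [H] can be chosen with [A] close to the quotient of [v]. *)
Lemma superlevel_energy m r h0: p<=m -> moment m -> 0<r -> 0<h0 -> r+6*h0<13 -> h0<=1 -> exists2 C: R, 0<C &
 forall kap th, 0<kap -> 0<th -> exists2 H: R, 0<H /\ H<=h0 & exists2 d0: R, 0<d0 /\ d0<=1 &
 forall d eps mu g b F v, d<=d0 -> cell_data p La d eps mu g b F -> apx p g d v ->
 forall i k t, kap<=k -> k<=h0 -> 1<=t -> let A := fdiff i k (moll H v) in
 let I := \1_[set x | t<=A x]: E -> R in let G x := (mu+enorm (g x))`^p in
 [/\ ub (fun x=> B0 r x*(I x*(G x+G (x+k *: e_ i)))) (C*t`^(p-m)+th),
   ub (fun x=> B0 r x*(I x*(`|A x| `^ p+t`^p))) (C*t`^(p-m)), ub (fun x=> B0 (r+4*h0) x * `|A x| `^ m) C &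
   ub (fun x=> B0 (r+4*h0) x * `|A x-fdiff i k v x| `^ p) th].
have p1' := p1. move=> pm Pm r0 h00 r13 h01; have p0: 0<=p by lra. have m1: 1<=m by lra. have m0: 0<=m by lra.
pose r2:= r+2*h0; pose r3:= r+4*h0; pose r4:= r+6*h0.
have r20: 0<r2 by rewrite /r2; lra. have r30: 0<r3 by rewrite /r3; lra. have r40: 0<r4 by rewrite /r4; lra.
have rr2 : r<r2 by rewrite /r2; lra. have r23 : r2+h0<=r3 by rewrite /r2 /r3; lra.
have r34 : r3+h0<=r4 by rewrite /r3 /r4; lra. have r4_13 : r4<13 by [].
have r4_13' : r4<=13 by nneg. have r3_4 : r3<=r4 by lra. have r2_3 : r2<=r3 by lra.
have r2_13 : r2<=13 by lra. have r3_13 : r3<=13 by lra. have r_3 : r<=r3 by lra.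
have r4h : r4+h0<=15 by lra. have r3h : r3+h0<=15 by lra. have lt017 : (0: R)<17 by lra.
have [CP CP0 hP] := Pm r4 r40 r4_13. have [C0 C00 hcac] := caccioppoli n0 p1 La1.
pose CA:= Ktr (R:=R) (n:=n) m*CP; have CA0: 0<=CA by rewrite mulr_ge0 ?Ktr_ge0// ltW.
pose e1:= expbump 1 (1: R); have e10: 0<e1 by rewrite expbump_gt0.
pose cb:= (expbump 1 (r2-r)*expbump 1 (r2-r))^+n: R.
have cb0: 0<cb by rewrite exprn_gt0// mulr_gt0// expbump_gt0// subr_gt0.
pose q:= (cb*e1)^-1; have q0: 0<q by rewrite invr_gt0 mulr_gt0. pose c1:= 2`^m*CA+n%:R*(2`^m*CA+CP): R.
have c10: 0<=c1.
 have z: 0<=2`^m*CA by nneg. by rewrite addr_ge0// mulr_ge0// addr_ge0// ltW.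
pose CQ:= q*(2*(C0*c1)); pose c2:= 2`^m*CA. have CQ0: 0<=CQ by do ![apply: mulr_ge0|exact: ltW|done].
have c20: 0<=c2 by rewrite mulr_ge0. pose C:= CQ+(CA+c2)+CA+1.
have C0C: 0<C by rewrite /C; lra. have CQC : CQ<=C by rewrite /C; lra.
have C2C : CA+c2<=C by rewrite /C; lra. have CAC : CA<=C by rewrite /C; lra. exists C=> //.
move=> kap th kap0 th0. have kV0: 0<=kap^-1`^p by nneg. pose PC:= n%:R`^p*(n%:R*(2`^p*(2`^p*2))): R.
have PC0: 0<=PC by do ![apply: mulr_ge0|nneg|done]. have X0: 0<=kap^-1`^p*(2`^p*(PC+PC)).
 nneg.
(* [A] differs from [fdiff i k v] by a mollification error of order [H], divided by a step of at
   least [kap]. *)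
have [H1 H10 [H1h H1x]] := small_choice X0 th0. pose hb:= Num.min h0 ((13-r4)/50).
have hb0: 0<hb by rewrite lt_min h00 divr_gt0// subr_gt0. have hbh : hb<=h0 by rewrite ge_min lexx.
have hb50 H' : H' <= hb -> r4+50*H' <= 13.
 rewrite le_min=> /andP[_ h]; rewrite -lerBrDl mulrC -ler_pdivlMr//.
pose H:= Num.min H1 hb. have H0: 0<H by rewrite lt_min H10. have Hhb : H<=hb by rewrite ge_min lexx orbT.
have Hh : H<=h0 by exact: le_trans hbh. have H_1 : H<=H1 by rewrite ge_min lexx.
have Hle1 : H<=1 by exact: le_trans h01. have Hp : H`^p<=H1.
 by apply: (le_trans _ H_1); apply: ge1r_powR; [rewrite H0|exact: ltW].
have r4H : r4+H<=15 by lra. have r3H : r4+H<=15 by lra. exists H; first by split.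
have [S S0 hS] := grad_sup H0 r4H.
have [Kb [Kb0 _ hKb _]] := smooth_bounds (smooth_bump (n:=n) r2) (vanish_bump r20).
pose K:= 4*(2*(2*S/kap))+Kb+1. have K0: 0<K.
 rewrite ltr_wpDl// addr_ge0// !mulr_ge0// ?invr_ge0 ?(ltW kap0)//.
pose th' := th/(2*q); have th'0: 0<th' by rewrite divr_gt0// mulr_gt0. have [dc dc0 hc] := hcac K th' K0 th'0.
(* A second, finer scale: the slope [K] of the cutoff depends on [H] through [S], while the
   Caccioppoli inequality needs a mollification scale that is small in terms of [K]. The moment
   constant is the same at both scales. *)
pose H2:= Num.min dc hb; have H20: 0<H2 by rewrite lt_min dc0. have H2c : H2<=dc by rewrite ge_min lexx.
have H21 : H2<=hb by rewrite ge_min lexx orbT. have [d1 d10 hP1] := hP H H0 (hb50 _ Hhb).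
have [d2 d20 hP2] := hP H2 H20 (hb50 _ H21). exists (Num.min (Num.min 1 dc) (Num.min d1 d2)).
 by rewrite !lt_min ltr01 dc0 d10 d20 !ge_min lexx.
move=> d eps mu g b F v; rewrite !le_min=> /andP[/andP[dle1 ddc] /andP[dd1 dd2]] D av i k t kk kh t1 A I G.
have [sv vv apv] := av. have t0: 0<t by exact: lt_le_trans ltr01 t1. have k0: 0<k by exact: lt_le_trans kk.
have iv := smooth_itg lt017 sv vv. have smv : smooth (moll H v) := smooth_moll H0 iv.
have vmv : vanish (17+H) (moll H v) := vanish_moll H0 lt017 vv. have sA : smooth A := smooth_fdiff i k smv.
have mA : mble A := mble_cont (smooth_cont sA).
have mI : mble I by apply: mble_indic; exact: measurable_superlevel mA.
have r3k : r3+k<=r4 by rewrite (le_trans _ r34)// lerD2l.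
have r2k : r2+k<=r3 by rewrite (le_trans _ r23)// lerD2l. have uA : ub (fun x=> B0 r3 x * `|A x| `^ m) CA.
 exact: (ub_fdiff i m1 smv vmv r30 k0 r3k (hP1 _ _ _ _ _ _ _ dd1 D av)).
have tpm0: 0<=t`^(p-m) by nneg. have mG : mble G by apply: mble_powR; mbl.
have G0 x: 0<=G x by exact: powR_ge0. have I0 x: 0<=I x by nneg.
have mAp a : mble (fun x=> `|A x| `^ a) by apply: mble_powR; mbl. have Imp x a : I x*a<=I x*a by [].
have Iabove x : I x = 0 \/ I x = 1 /\ t<=A x.
 have [h|h] := pselect (t<=A x); [right|left].
  by split=> //; exact: indic_in.
 exact: indic_out.
(* The argument [2A/t - 1] is at most [0] where [A <= t/2] and at least [1] where [A >= t]. *)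
pose ex x:= expbump 1 (2/t*A x + - 1). pose chi x:= bump r2 x*ex x. have sex : smooth ex.
 apply: (smooth_comp (smooth1_expbump 1)); apply: smoothD; last exact: smooth_cst. exact: smoothZ.
have schi : smooth chi by apply: smoothM=> //; exact: smooth_bump. have ex0 x: 0<=ex x by exact: expbump_ge0.
have ex1 x : ex x<=1 by exact: expbump_le1. have chi01 x: 0<=chi x<=1.
 by rewrite mulr_ge0 ?bump_ge0//= mulr_ile1 ?bump_ge0 ?bump_le1.
have vchi : vanish r2 chi by move=> x nx; rewrite /chi vanish_bump ?mul0r. have t2V: 0<=2/t by nneg.
have t2: 2/t<=2 by rewrite ler_pdivrMr// ler_peMr. have chiK j x : `|partial j chi x|<=K.
 rewrite /chi (partialM j x (smooth_bump r2) sex).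
 have ->: partial j ex x = expbump ('X^2*(1-1^`())) (2/t*A x + - 1)*(2/t*fdiff i k (partial j (moll H v)) x).
  rewrite (partial_comp _ _ (smooth1_expbump 1)); last by apply: smoothD; [exact: smoothZ|exact: smooth_cst].
  rewrite (partialD _ _ (smoothZ _ sA) (smooth_cst _)) partial_cst addr0 (partialZ _ _ _ sA).
  by rewrite (partial_fdiff _ _ _ _ smv).
 apply: (le_trans (ler_normD _ _)); rewrite /K -addrA; apply: lerD; last first.
  apply: (@le_trans _ _ Kb); last by rewrite lerDl.
  by rewrite normrM (ger0_norm (ex0 x)); apply: (le_trans (ler_piMl _ (ex1 x))).
 have [xr|xr] := pselect (ball (0: E) r2 x); last first.
  by rewrite vanish_bump// mul0r normr0 !mulr_ge0// invr_ge0 ltW.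
 rewrite normrM (ger0_norm (bump_ge0 r2 x)); apply: (le_trans (ler_piMl _ (bump_le1 r2 x)))=> //.
 rewrite normrM; apply: ler_pM=> //; first exact: dexpbump_bound.
 rewrite normrM (ger0_norm t2V); apply: ler_pM=> //.
 rewrite /fdiff normrM (ger0_norm (_: 0<=k^-1)) ?invr_ge0 ?(ltW k0)// mulrC.
 apply: ler_pM; rewrite ?invr_ge0 ?(ltW k0)//.
  apply: (le_trans (ler_normB _ _)); rewrite mulr_natl mulr2n; apply: lerD.
   apply: (hS _ _ _ _ _ _ _ dle1 D av); apply: (ballD xr).
   apply: (le_trans (norm_scale_delta i (ltW k0))); clear -r2k r3_4; lra.
  by apply: (hS _ _ _ _ _ _ _ dle1 D av); apply: le_ball xr; exact: le_trans r2_3 r3_4.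
 by rewrite lef_pV2 ?posrE.
have apc : apx p g dc v by exact: apx_mono ddc av.
(* Stated for a general cutoff because it is used twice: for [chi], and for its translate, which
   yields the energy at [x + k e_i]. *)
have claim chi' : smooth chi' -> vanish r3 chi' -> (forall x, 0<=chi' x<=1) ->
  (forall j x, `|partial j chi' x|<=K) -> ub (fun x=> chi' x*t`^p) (2`^m*CA*t`^(p-m)) ->
  ub (fun x=> chi' x*G x) (C0*(c1*t`^(p-m))+th').
 move=> s' v' c' K' u'. have m' : mble chi' := mble_cont (smooth_cont s').
 have mm j : mble (partial j (moll H2 v)).
  by apply: mble_cont; exact: smooth_cont (smooth_d j (smooth_moll H20 iv)).
 apply: (hc _ _ _ _ _ _ _ _ _ _ ddc D apc H20 H2c s' (vanishW r3_13 v') c' K').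
 have u2 j : ub (fun x=> chi' x*t`^p+t`^(p-m)*(B0 r4 x * `|partial j (moll H2 v) x| `^ m))
   (2`^m*CA*t`^(p-m)+t`^(p-m)*CP).
  by apply: ubD=> //; apply: ubZ=> //; exact: (hP2 _ _ _ _ _ _ _ dd2 D av).
 have := ubD u' (ub_sum (index_enum 'I_n) xpredT u2). rewrite sum_cst=> u3.
 apply: (ub_le _ _ _ _ u3)=> [|x|x|].
 - apply: mbleM=> //; apply: mbleD; first exact: mble_cst.
  by apply: mble_sum=> j; apply: mble_powR; exact: mble_norm.
 - have /andP[c'0 _] := c' x.
  by rewrite mulr_ge0// addr_ge0 ?powR_ge0// sumr_ge0// => j _; rewrite powR_ge0.
 - have /andP[c'0 c'1] := c' x.
  rewrite mulrDr; apply: lerD.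
   rewrite ler_wpM2l// le_pow//; first by have /andP[] := cd_mu D.
   by have /andP[_ h] := cd_mu D; exact: le_trans h t1.
  rewrite mulr_sumr; apply: ler_sum=> j _.
  apply: (le_trans (ler_wpM2l c'0 (pow_above_or p0 pm t0 (normr_ge0 _)))).
  rewrite mulrDr lerD2l mulrCA ler_wpM2l// ler_wpM2r ?powR_ge0//.
  have [xr|xr] := pselect (ball (0: E) r4 x); first by rewrite indic_in.
  by rewrite v' ?indic_ge0// => h; apply: xr; apply: le_ball h.
 - by rewrite /c1 le_eqVlt; apply/orP; left; apply/eqP; ring.
have uchi : ub (fun x=> chi x*t`^p) (2`^m*CA*t`^(p-m)).
 rewrite -mulrA [CA*_]mulrC mulrA. have zz: 0<=2`^m*t`^(p-m) by rewrite mulr_ge0 ?powR_ge0.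
 apply: (ub_fle _ _ _ (ubZ zz uA))=> [|x|x].
 - by apply: mbleM; [exact: mble_cont (smooth_cont schi)|exact: mble_cst].
 - by rewrite mulr_ge0 ?powR_ge0//; have /andP[] := chi01 x.
 have RHS0: 0<=2`^m*t`^(p-m)*(B0 r3 x * `|A x| `^ m).
  by rewrite mulr_ge0// mulr_ge0 ?indic_ge0 ?powR_ge0.
 have [xr|xr] := pselect (ball (0: E) r2 x); last by rewrite vchi// mul0r.
 have [ta|ta] := leP (2/t*A x + - 1) 0.
  by rewrite /chi /ex (expbump_le0 1 ta) mulr0 mul0r.
 have xr3 : ball (0: E) r3 x by apply: le_ball xr. have {}ta: t<=2*A x.
  by move: ta; rewrite subr_gt0 mulrAC ltr_pdivlMr// mul1r=> /ltW.
 have A0: 0<=A x by clear -ta t0; lra. rewrite indic_in// mul1r (ger0_norm A0) -mulrA.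
 have /andP[_ c1'] := chi01 x. apply: le_trans (pow_half_above pm m0 t0 ta). by rewrite ler_piMl ?powR_ge0.
have uC1 := claim chi schi (vanishW r2_3 vchi) chi01 chiK uchi. pose h:= k *: e_ i.
pose chi' x:= chi (x + - h). have hk : `|h|<=k by exact: norm_scale_delta (ltW k0).
have uC2 : ub (fun x=> chi' x*G x) (C0*(c1*t`^(p-m))+th').
 apply: claim.
 - exact: smooth_shift.
 - move=> x nx; apply: vchi=> hx; apply: nx; rewrite -(subrK h x).
  apply: (ballD hx); clear -hk r2k; lra.
 - by move=> x; exact: chi01.
 - by move=> j x; rewrite /chi' (partial_shift _ _ _ schi).
 - exact: (ub_shift (- h) uchi).
have {}uC2: ub (fun x=> chi x*G (x+h)) (C0*(c1*t`^(p-m))+th').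
 by apply: (ub_eq _ (ub_shift h uC2))=> x; rewrite /chi' addrK.
have Ichi x : B0 r x*I x<=q*chi x.
 have cx: 0<=chi x by have /andP[] := chi01 x. have qc: 0<=q*chi x by rewrite mulr_ge0// ltW.
 have [xr|xr] := pselect (ball (0: E) r x); last by rewrite indic_out// mul0r.
 have [->|[-> tA]] := Iabove x; first by rewrite mulr0.
 rewrite indic_in// mulr1 /q mulrC ler_pdivlMr ?mulr_gt0// mul1r.
 apply: ler_pM; rewrite ?(ltW cb0) ?(ltW e10)//; first exact: bump_ge.
 apply: le_expbump; rewrite lerBrDr mulrAC ler_pdivlMr//. by rewrite (_: 1+1 = 2)// ler_wpM2l.
split.
- apply: (ub_le _ _ _ _ (ubZ (ltW q0) (ubD uC1 uC2)))=> [|x|x|].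
 + exact: (mbleM (mble_ball _ _) (mbleM mI (mbleD mG (mble_shift h mG)))).
 + by rewrite mulr_ge0 ?indic_ge0// mulr_ge0// addr_ge0.
 + by rewrite mulrA -mulrDr mulrA ler_wpM2r// addr_ge0.
 + have ->: q*(C0*(c1*t`^(p-m))+th' + (C0*(c1*t`^(p-m))+th')) =
   q*(2*(C0*c1))*t`^(p-m)+th by rewrite /th'; field; rewrite gt_eqF.
  by rewrite lerD2r; exact: (ler_wpM2r tpm0 CQC).
- have zz: 0<=1+2`^m by rewrite addr_ge0 ?powR_ge0.
 have zA : ub (fun x=> B0 r x * `|A x| `^ m) CA.
  apply: (ubBW r_3 _ _ uA)=> //; by move=> x; exact: powR_ge0.
 apply: (ub_le _ _ _ _ (ubZ zz (ubZ tpm0 zA)))=> [|x|x|].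
 + exact: (mbleM (mble_ball _ _) (mbleM mI (mbleD (mAp p) (mble_cst _)))).
 + by rewrite mulr_ge0 ?indic_ge0// mulr_ge0// addr_ge0 ?powR_ge0.
 + rewrite (mulrCA (t`^(p-m))) (mulrCA (1+2`^m)) ler_wpM2l ?indic_ge0//.
  have [->|[-> tA]] := Iabove x; first by rewrite mul0r !mulr_ge0 ?powR_ge0.
  have A0: 0<=A x by exact: le_trans (ltW t0) tA.
  rewrite mul1r (ger0_norm A0) mulrDl mul1r; apply: lerD; first exact: pow_above.
  by apply: pow_half_above=> //; clear -tA t0; lra.
 + rewrite (_: (1+2`^m)*(t`^(p-m)*CA) = (CA+2`^m*CA)*t`^(p-m)); last by ring.
  exact: (ler_wpM2r tpm0 C2C).
- exact: ub_cle CAC uA.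
- have u := moll_poincare p1 D av dle1 H0 r40 r4H.
 have {}u := ub_fdiff_diff i p0 (mble_cont (smooth_cont smv)) (mble_cont (smooth_cont sv)) k0 r3k u.
 apply: ub_cle u. have ->: n%:R`^p*(n%:R*(2`^p*(H`^p*(2`^p*2)))) = PC*H`^p.
  by rewrite /PC; ring.
 apply: (le_trans _ H1x). have ->: kap^-1`^p*(2`^p*(PC+PC))*H1 = kap^-1`^p*(2`^p*(PC*H1+PC*H1)) by ring.
 apply: ler_pM; rewrite ?powR_ge0//.
 + by rewrite mulr_ge0 ?powR_ge0// addr_ge0 ?mulr_ge0 ?powR_ge0.
 + by apply: le_pow; rewrite ?invr_ge0 ?(ltW k0)// lef_pV2.
 + by rewrite ler_wpM2l ?powR_ge0// lerD// ler_wpM2l.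
Qed.

End Stage.

#[local] Hint Resolve smooth_fdiff: mble.

(** * Truncated difference quotients as test functions *)

Section SmoothTruncation.
Context {R: realType}.
Implicit Types (t s x y: R).

Lemma lipschitz_of_derive (f df: R -> R) (K: R): (forall x, is_derive x 1 f (df x)) ->
 (forall x, `|df x|<=K) -> forall x y, `|f x-f y|<=K * `|x-y|.
move=> fd fK x y; wlog xy: x y / y<=x.
 move=> h; have [yx|xy] := leP y x; first exact: h. by rewrite distrC (distrC x); apply: h; exact: ltW.
have cf := is_derive_cont fd.
have [|c _ ->] := MVT_segment xy (fun t _=> fd t); first exact: continuous_subspaceT.
by rewrite normrM ler_wpM2r.
Qed.

(** A smooth substitute for the positive part of [s - t], scaled so that its slope stays in [[0, 1]]
    for every [t]. *)
Definition trunc t s: R := t*softpos (t^-1*s + - 1).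
Definition dtrunc t s: R := dsoftpos (t^-1*s + - 1).

Lemma trunc_ge0 t s: 0<t -> 0<=trunc t s.
Proof. by move=> t0; rewrite mulr_ge0 ?softpos_ge0 ?ltW. Qed.

Lemma dtrunc_ge0 t s: 0<=dtrunc t s. Proof. exact: dsoftpos_ge0. Qed.
Lemma dtrunc_le1 t s: dtrunc t s<=1. Proof. exact: dsoftpos_le1. Qed.

Lemma trunc_arg t s: 0<t -> (0<t^-1*s + - 1) = (t<s).
Proof. by move=> t0; rewrite subr_gt0 ltr_pdivlMl// mulr1. Qed.

Lemma dtrunc_below t s: 0<t -> s<=t -> dtrunc t s = 0.
Proof. by move=> t0 st; apply: dsoftpos_le0; rewrite leNgt trunc_arg// -leNgt. Qed.

Lemma trunc_le t s: 0<t -> trunc t s<=Num.max (s-t) 0.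
move=> t0; apply: (le_trans (ler_wpM2l (ltW t0) (softpos_le _))).
rewrite maxr_pMr ?(ltW t0)// mulr0 mulrDr mulrA mulfV ?gt_eqF// mul1r mulrN1 lexx//.
Qed.

Lemma trunc_below t s: 0<t -> s<=t -> trunc t s = 0.
move=> t0 st; apply/eqP; rewrite eq_le trunc_ge0// andbT.
by apply: (le_trans (trunc_le s t0)); rewrite ge_max lexx andbT subr_le0.
Qed.

Lemma trunc_le_norm t s: 0<t -> trunc t s<=`|s|.
move=> t0; apply: (le_trans (trunc_le s t0)); rewrite ge_max normr_ge0 andbT.
by apply: (le_trans _ (ler_norm s)); rewrite gerBl ltW.
Qed.

Lemma trunc_ge t s: 0<t -> s-2*t<=expR 1*trunc t s.
move=> t0; have := ler_wpM2l (ltW t0) (softpos_ge (t^-1*s + - 1)).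
rewrite mulrCA=> /(le_trans _); apply; rewrite mulrBr mulrDr mulrA mulfV ?gt_eqF// mul1r; lra.
Qed.

Lemma le_trunc t x y: 0<t -> x<=y -> trunc t x<=trunc t y.
move=> t0 xy; rewrite ler_wpM2l ?(ltW t0)// le_softpos// lerD2r ler_wpM2l// invr_ge0 ltW//.
Qed.

Lemma is_derive_softpos x: is_derive x 1 (@softpos R) (dsoftpos x).
Proof. by have [Psi [<- <- h]] := @smooth1_softpos R. Qed.

Lemma trunc_lipschitz t x y: 0<t -> `|trunc t x-trunc t y|<=`|x-y|.
move=> t0; rewrite /trunc -mulrBr normrM (gtr0_norm t0).
have h z : `|dsoftpos z|<=(1: R) by rewrite ger0_norm ?dsoftpos_ge0 ?dsoftpos_le1.
apply: (le_trans (ler_wpM2l (ltW t0) (lipschitz_of_derive is_derive_softpos h _ _))).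
rewrite mul1r (_: _-_ = t^-1*(x-y)); last by ring.
by rewrite normrM gtr0_norm ?invr_gt0// mulrA mulfV ?gt_eqF// mul1r.
Qed.

(** The derivative is [y^3 e^(-y)] with [y = 1/x], and [y^3 <= 27 e^y] is the cube of
    [y/3 <= e^(y/3)]. *)
Lemma ddsoftpos_bound x: `|expbump ('X^2*((1 + 'X)-(1 + 'X)^`())) x|<=27.
rewrite /expbump; case: ltP=> x0; last by rewrite normr0; lra. set y:= x^-1; have y0: 0<y by rewrite invr_gt0.
have ->: ('X^2*((1 + 'X)-(1 + 'X)^`())).[y] = y^+3 :> R.
 rewrite derivD derivC derivX add0r (addrC 1) addrK hornerM hornerXn hornerX; ring.
rewrite normrM !ger0_norm ?expR_ge0 ?exprn_ge0 ?(ltW y0)//. rewrite expRN ler_pdivrMr ?expR_gt0//.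
have h : y/3<=expR (y/3) by apply: le_trans (expR_ge1Dx _); lra.
have ->: expR y = expR (y/3)^+3 by rewrite -expRM_natl; congr expR; field. have h2 : (y/3)^+3<=expR (y/3)^+3.
 by rewrite ler_pXn2r// ?nnegrE ?expR_ge0//; lra.
have ->: y^+3 = 27*(y/3)^+3 by field. by rewrite ler_wpM2l.
Qed.

Lemma dtrunc_lipschitz t x y: 1<=t -> `|dtrunc t x-dtrunc t y|<=27 * `|x-y|.
move=> t1; have t0: 0<t by lra.
apply: (le_trans (lipschitz_of_derive (@is_derive_expbump R (1 + 'X)) ddsoftpos_bound _ _)).
rewrite (_: _-_ = t^-1*(x-y)); last by ring.
rewrite ler_wpM2l// normrM gtr0_norm ?invr_gt0// ler_piMl// invf_le1//.
Qed.

End SmoothTruncation.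

Section TruncSmooth.
Context {R: realType} {n: nat}.
Notation E := 'rV[R]_n.
Implicit Types (f: E -> R) (i: 'I_n) (t: R).

Lemma smooth_trunc_arg t f: smooth f -> smooth (fun x=> t^-1*f x + - 1).
Proof. by move=> sf; apply: smoothD; [exact: smoothZ|exact: smooth_cst]. Qed.

Lemma smooth_trunc t f: smooth f -> smooth (fun x=> trunc t (f x)).
move=> sf; apply: smoothZ; apply: (smooth_comp (@smooth1_softpos R)). exact: smooth_trunc_arg.
Qed.

Lemma partial_trunc t f i x: 0<t -> smooth f ->
 partial i (fun x=> trunc t (f x)) x = dtrunc t (f x) * partial i f x.
move=> t0 sf; have sa := smooth_trunc_arg t sf.
rewrite /trunc (partialZ _ _ _ (smooth_comp (@smooth1_softpos R) sa)).
rewrite (partial_comp _ _ (@smooth1_softpos R) sa).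
rewrite (partialD _ _ (smoothZ _ sf) (smooth_cst _)) partial_cst addr0 (partialZ _ _ _ sf).
by rewrite /dtrunc (mulrCA t) (mulrA t) mulfV ?gt_eqF// mul1r.
Qed.

Lemma integ_shift f (z: E): itg f -> integ (fun x=> f (x+z)) = integ f.
move=> itf; have := @integ_aff R n f z 1 (oner_neq0 _) itf. rewrite normr1 expr1n invr1 mul1r=> <-.
by apply: integ_eq=> x; rewrite scale1r addrC.
Qed.

Lemma itg_shift f (z: E): itg f -> itg (fun x=> f (x+z)).
move=> itf; have := @itg_aff R n f z 1 (oner_neq0 _) itf.
by congr itg; apply/funext=> x; rewrite scale1r addrC.
Qed.

Lemma lattice_delta (eps: R) (N: nat) i :
 (eps*N%:R) *: (delta_mx 0 i: E) = eps *: map_mx intr (\row_j (if j == i then N%:Z else 0)).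
apply/rowP=> j; rewrite !mxE eqxx/= -mulrA; congr (_*_). by case: (j == i); rewrite ?mulr1 ?mulr0.
Qed.

End TruncSmooth.

Section SlopeAlgebra.
Context {R: realType}.

Lemma slope_alg (La eta P k mq D D1 D2 Dphi Deta psi f0 DF T1 T2 T3: R) : 0<=eta -> 0<=P -> 0<=k -> 0<La ->
 mq<=La*D -> D = D1+D2 -> Dphi = psi*Deta+eta*(P*(k*D1)) ->
 Dphi = f0+DF -> DF<=T1 -> - (psi*Deta)<=T2 -> eta*(P*(k*D2))<=T3 -> eta*(P*(k * mq))<=La*f0+La*(T1+T2+T3).
move=> e0 P0 k0 L0 h hD h2 h3 b1 b2 b3; rewrite hD in h. have := ler_wpM2l e0 (ler_wpM2l P0 (ler_wpM2l k0 h)).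
have ->: eta*(P*(k*(La*(D1+D2)))) = La*(eta*(P*(k*D1))+eta*(P*(k*D2))) by ring. move=> /le_trans; apply.
have ->: La*f0+La*(T1+T2+T3) = La*(f0+(T1+T2+T3)) by ring. by rewrite ler_wpM2l ?(ltW L0)//; lra.
Qed.

End SlopeAlgebra.

Section Slope.
Context {R: realType} {n: nat} (n0: (0<n)%N) (p La: R) (p1: 1<p) (La1: 1<=La).
Notation E := 'rV[R]_n.
Notation leb := (@lebesgue R n).
Notation B0 r := (\1_(ball (0 : E) r) : E -> R).
Notation e_ i := (delta_mx 0 i : E).
Implicit Types (f v w: E -> R) (g b F: E -> E) (i: 'I_n) (d eps mu t H K c r th k m: R).

Lemma ub_fdiff0 i k f r r' c: mble f -> 0<k -> r+k<=r' -> ub (fun x=> B0 r' x * `|f x| `^ p) c ->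
 ub (fun x=> B0 r x * `|fdiff i k f x| `^ p) (k^-1`^p*(2`^p*(c+c))).
move=> mf k0 rk u; have p0: 0<=p by exact: ltW (lt_trans ltr01 p1).
have u' : ub (fun x=> B0 r' x * `|f x-(fun=> 0) x| `^ p) c.
 by apply: (ub_eq _ u)=> x; rewrite subr0.
have := ub_fdiff_diff i p0 mf (mble_cst 0) k0 rk u'.
by apply: ub_eq=> x; rewrite [X in _-X]/fdiff subr0 mulr0 subr0.
Qed.

Lemma mble_dtrunc t f: mble f -> mble (fun x=> dtrunc t (f x)).
move=> mf; apply: (@mble_comp R n (@dsoftpos R) (fun x=> t^-1*f x + - 1)).
 apply: continuous_measurable_fun. exact: is_derive_cont (@is_derive_expbump R (1 + 'X)).
exact: (mbleD (mbleM (mble_cst _) mf) (mble_cst _)).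
Qed.

Lemma mble_monq (S x: E -> R): mble S -> mble x -> mble (fun y=> monq p (S y) (x y)).
move=> mS mx; rewrite /monq; case: (leP 2 p)=> _; first exact: mble_powR.
exact: (mbleM (mble_powR _ mS) (mbleX 2 mx)).
Qed.

Lemma flux_le d eps mu g b F: cell_data p La d eps mu g b F -> forall x y,
 `|dot (b x) y|<=La*((mu+enorm (g x))`^(p-1) * l1 y).
move=> D x y; apply: (le_trans (dot_le _ _)). by rewrite mulrA ler_wpM2r ?l1_ge0//; exact: cd_growth D x.
Qed.

Let frac (A th: R): 0<=A -> 0<th -> A*(th/(A+1))<=th.
move=> A0 t0; rewrite mulrCA ler_piMr ?(ltW t0)// ler_pdivrMr; lra.
Qed.

Let sum_bound (l0 k1 Q Cf d d1 c2 C1 C2 c3 k2 k3 C3 NN nn Cs T ths th: R) :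
 l0*2*Q*k1<=th/8 -> c2*2*k2<=th/8 -> c3*4*k3<=th/8 -> (c2*(1+2*C1)+c2*(2*C2))*ths<=th/8 ->
 (l0*(Cf*2)+c3*(2*(C3*(NN*(2*nn)))))*d1<=th/8 -> d<=d1 ->
 0<=l0*(Cf*2)+c3*(2*(C3*(NN*(2*nn)))) -> 0<th -> 0<=T -> l0*(2*k1)*Q+(l0*Cf*(d+d)+(c2*(1+2*C1)*(2*Cs*T+ths) +
  (c2*k2*(1+1)+(c2*(2*C2)*ths+(c3*(2*k3)*(1+1) + c3*(2*C3*NN)*(nn*(d+d)))))))<=(c2*(1+2*C1)*(2*Cs)+1)*T+th.
move=> h1 h2 h3 h4 h5 dd X0 t0 T0. have h6 := ler_wpM2l X0 dd; lra.
Qed.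

Let absorb_mid (psi I Aa e a a' G G' Ap AB tp k2 C1 C2: R): 0<=I -> 0<=a -> 0<=a' ->
 psi<=I*Aa+e -> a*Aa<=1*G+C1*Ap -> a'*Aa<=1*G' + C1*Ap ->
 a*e<=k2*G+C2*AB -> a'*e<=k2*G' + C2*AB -> 0<=G -> 0<=G' -> 0<=Ap -> 0<=tp -> 0<=C1 ->
 psi*(a' + a)<=(1+2*C1)*(I*(G+G')+I*(Ap+tp))+(k2*(G+G')+2*C2*AB).
move=> I0 a0 a0' hp h1 h2 h3 h4 G0 G0' Ap0 tp0 C10. have := ler_wpM2r (addr_ge0 a0' a0) hp.
have g1 := ler_wpM2l I0 h1; have g2 := ler_wpM2l I0 h2.
have z1: 0<=C1*(I*(G+G')) by rewrite !mulr_ge0// addr_ge0.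
have z2: 0<=(1+2*C1)*(I*tp) by rewrite !mulr_ge0// addr_ge0// mulr_ge0. have z3: 0<=I*Ap by rewrite mulr_ge0.
lra.
Qed.

Let distr2 (a0 B a K w: R): a0*(B*a+K*(B*w)) = B*(a0*(a+K*w)).
Proof. ring. Qed.

Let absorb_err (a1 a0 z1 z0 G G' k3 C3 q1 q0 ee: R) : a1*z1<=k3*G' + C3*q1 -> a1*z0<=k3*G' + C3*q0 ->
 a0*z1<=k3*G+C3*q1 -> a0*z0<=k3*G+C3*q0 -> C3*(q1+q0)<=C3*ee -> (a1+a0)*(z1+z0)<=2*k3*(G+G')+2*C3*ee.
Proof. lra. Qed.

Lemma slope_energy m r h0: p<=m -> moment (n:=n) p La m -> 0<r -> 0<h0 -> h0<=1 -> r+8*h0<13 ->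
 exists2 C: R, 0<C & forall kap th, 0<kap -> 0<th -> exists2 d0: R, 0<d0 /\ d0<=1 &
 forall d eps mu g b F v, d<=d0 -> cell_data p La d eps mu g b F -> apx p g d v ->
 forall i k t (N: nat), kap<=k -> k<=h0 -> 1<=t -> k = eps*N%:R ->
 ub (fun x=> bump r x*(dtrunc t (fdiff i k v x)*(k^-1 *
   monq p (mu+enorm (g x)+enorm (g (x+k *: e_ i))) (enorm (g (x+k *: e_ i)-g x))))) (C*t`^(p-m)+th).
have p1' := p1; have La1' := La1. move=> pm Pm r0 h00 h01 r13; have p0: 0<=p by lra. have L0: 0<La by lra.
pose ra:= r+2*h0. have ra0: 0<ra by rewrite /ra; lra. have rra : r<ra by rewrite /ra; lra.
have ra13 : ra+6*h0<13 by rewrite /ra; lra.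
have ra15 : ra+h0<=15 by lra. have ra15' : ra<=15 by lra. have ra16 : ra+h0<=16 by lra.
have ra16' : ra<=16 by lra. have ra4 : ra<=ra+4*h0 by lra. have r16 : r<16 by lra. have rh16 : r+h0<16 by lra.
have lt017 : (0: R)<17 by lra. have [Cs Cs0 hs] := superlevel_energy n0 p1 La1 pm Pm ra0 h00 ra13 h01.
have [K [K0 _ etaK _]] := smooth_bounds (smooth_bump (n:=n) r) (vanish_bump r0).
have [C1 C10 hC1] := @young1 R p 1 p1 ltr01. pose c2:= La*(La*(n%:R*K)): R.
have c20: 0<=c2 by do ![apply: mulr_ge0|exact: ltW|done]. pose C:= c2*(1+2*C1)*(2*Cs)+1.
have c2C: 0<=c2*(1+2*C1) by rewrite mulr_ge0// addr_ge0// mulr_ge0// ltW.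
have CC0: 0<C by rewrite /C ltr_wpDl// mulr_ge0// mulr_ge0// ltW. exists C=> // kap th kap0 th0.
have th8: 0<th/8 by rewrite divr_gt0. pose Ab:= (2`^p*2): R; have Ab0: 0<=Ab by rewrite mulr_ge0 ?powR_ge0.
pose NN:= n%:R`^p: R; have NN0: 0<=NN by exact: powR_ge0.
pose Q:= NN*(n%:R*(2`^p*(kap^-1`^p*(2`^p*(Ab+Ab))+K`^p*(Ktr (R:=R) (n:=n) p*Ab)))): R. have Q0: 0<=Q.
 by do ![apply: mulr_ge0|apply: addr_ge0|exact: powR_ge0|exact: Ktr_ge0|done].
have q10: 0<=La*2*Q by nneg. pose k1:= th/8/(La*2*Q+1). have k10: 0<k1 by rewrite divr_gt0// ltr_wpDl.
have [Cf Cf0 hCf] := @young R p k1 p1 k10. have q20: 0<=c2*2 by nneg. pose k2:= th/8/(c2*2+1).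
have k20: 0<k2 by rewrite divr_gt0// ltr_wpDl. have [C2 C20 hC2] := @young1 R p k2 p1 k20.
pose c3:= La*(kap^-1*La). have c30: 0<c3 by rewrite !mulr_gt0// invr_gt0. have q30: 0<=c3*4 by nneg.
pose k3:= th/8/(c3*4+1). have k30: 0<k3 by rewrite divr_gt0// ltr_wpDl.
have [C3 C30 hC3] := @young1 R p k3 p1 k30. pose ths:= th/8/(c2*(1+2*C1)+c2*(2*C2)+1).
have q40: 0<=c2*(1+2*C1)+c2*(2*C2).
 by rewrite addr_ge0// mulr_ge0// mulr_ge0// ltW.
have ths0: 0<ths by rewrite divr_gt0// ltr_wpDl. have [H [H0 Hh] [ds [ds0 ds1] hS]] := hs kap ths kap0 ths0.
pose X:= La*(Cf*2)+c3*(2*(C3*(NN*(2*n%:R)))). have X0: 0<=X.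
 by nneg.
have [d1 d10 [d1h d1X]] := small_choice X0 th8. exists (Num.min ds d1).
 by rewrite lt_min ds0 d10 ge_min ds1.
move=> d eps mu g b F v; rewrite le_min=> /andP[dds dd1] D av i k t N kk kh t1 kN.
have dle1 : d<=1 by exact: le_trans ds1. have [sv vv apv] := av. have t0: 0<t by exact: lt_le_trans ltr01 t1.
have k0: 0<k by exact: lt_le_trans kk. have kV0: 0<=k^-1 by rewrite invr_ge0 ltW.
have kVle : k^-1<=kap^-1 by rewrite lef_pV2. set h:= k *: e_ i.
have hk : `|h|<=k by exact: norm_scale_delta (ltW k0).
have hlat : exists z: 'rV[int]_n, h = eps *: map_mx intr z.
 by rewrite /h kN lattice_delta; eexists.
have [uII0 uA uAm uAB] := hS _ _ _ _ _ _ _ dds D av i k t kk kh t1.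
set A:= fdiff i k (moll H v) in uII0 uA uAm uAB. set I:= (\1_[set x | t<=A x]: E -> R) in uII0 uA.
pose G x:= (mu+enorm (g x))`^p. rewrite -/h in uII0. pose Dv:= fdiff i k v.
have sDv : smooth Dv := smooth_fdiff i k sv. pose psi x:= trunc t (Dv x).
have spsi : smooth psi := smooth_trunc t sDv. pose phi x:= bump r x * psi x.
have sphi : smooth phi := smoothM (smooth_bump r) spsi.
(* The equation is used with [phi] and with its translate [phi']; shifting the integral of [W'] back
   leaves [phi] tested against [b (x+h) - b x]. *)
have vphi : vanish r phi by move=> x nx; rewrite /phi vanish_bump// mul0r. pose phi' x:= phi (x + - h).
have sphi' : smooth phi' := smooth_shift (- h) sphi. have vphi' : vanish (r+h0) phi'.
 move=> x nx; apply: vphi=> hx; apply: nx; rewrite -(subrK h x).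
 by apply: (ballD hx); rewrite addrAC subrr add0r; exact: le_trans hk kh.
pose W x:= dot (b x) (grad phi x)-dot (F x) (grad phi x).
pose W' x:= dot (b x) (grad phi' x)-dot (F x) (grad phi' x).
have iW : itg W := data_itg p1 La1 D sphi r16 vphi. have iW' : itg W' := data_itg p1 La1 D sphi' rh16 vphi'.
have iWh : itg (fun x=> W' (x+h)) := itg_shift h iW'. pose f0 x:= W' (x+h)-W x.
have if0 : itg f0 := itgB iWh iW. have zf0 : integ f0 = 0.
 have e1 : integ f0 = integ (fun x=> W' (x+h))-integ W := integB iWh iW.
 have e2 : integ (fun x=> W' (x+h)) = integ W' := integ_shift h iW'.
 have e3 : integ W' = 0 := cd_eq D sphi' rh16 vphi'. have e4 : integ W = 0 := cd_eq D sphi r16 vphi.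
 exact: (etrans e1 (etrans (f_equal2 (fun a1 a2=> a1-a2) (etrans e2 e3) e4) (subr0 (0: R)))).
have gphi' x : grad phi' (x+h) = grad phi x.
 by apply/rowP=> j; rewrite !mxE (partial_shift _ _ _ sphi) addrK.
have f0E x : dot (b (x+h)-b x) (grad phi x) = f0 x+dot (F (x+h)-F x) (grad phi x).
 rewrite /f0 /W /W' gphi' !dotBl; set z1:= dot _ _; set z2:= dot _ _; set z3:= dot _ _; set z4:= dot _ _.
 by ring.
have gphiE j x : partial j phi x = psi x * partial j (bump r) x+bump r x*(dtrunc t (Dv x)*fdiff i k (partial j v) x).
 rewrite /phi (partialM j x (smooth_bump r) spsi) addrC /psi (partial_trunc _ _ t0 sDv).
 by rewrite (partial_fdiff _ _ _ _ sv).
have mG : mble G by apply: mble_powR; exact: mbleG D. have G0 x: 0<=G x by exact: powR_ge0.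
have mGh : mble (fun x=> G (x+h)) := mble_shift h mG.
pose EE x:= \sum_j (`|partial j v x-g x 0 j| `^ p + `|partial j v (x+h)-g (x+h) 0 j| `^ p).
have mvg j : mble (fun x=> `|partial j v x-g x 0 j| `^ p).
 apply: mble_powR; apply: mble_norm; apply: mbleB; last exact: cd_mg D j.
 by apply: mble_cont; exact: smooth_cont (smooth_d j sv).
have vg0 j x: 0<=`|partial j v x-g x 0 j| `^ p by exact: powR_ge0.
have hr : `|h|<=(ra+h0)-ra by apply: (le_trans hk); rewrite addrAC subrr add0r.
have uEE : ub (fun x=> B0 ra x*EE x) (n%:R*(d+d)).
 rewrite -sum_cst; apply: (@ub_eq _ _ (fun x=> \sum_j (B0 ra x * `|partial j v x-g x 0 j| `^ p +
   B0 ra x * `|partial j v (x+h)-g (x+h) 0 j| `^ p))).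
  by move=> x; rewrite /EE mulr_sumr; apply: eq_bigr=> j _; rewrite mulrDr.
 apply: ub_sum=> j; apply: ubD; first exact: (ubBW ra15' (mvg j) (vg0 j) (apv j)).
 exact: (ub_ballD hr (vg0 j) (mvg j) (ubBW ra15 (mvg j) (vg0 j) (apv j))).
have EE0 x: 0<=EE x by rewrite sumr_ge0// => j _; rewrite addr_ge0.
have uGG : ub (fun x=> B0 ra x*(G x+G (x+h))) (1+1).
 apply: (@ub_eq _ _ (fun x=> B0 ra x*G x+B0 ra x*G (x+h))); first by move=> x; rewrite mulrDr.
 apply: ubD; first exact: (ubBW ra16' mG G0 (cd_G D)). exact: (ub_ballD hr G0 mG (ubBW ra16 mG G0 (cd_G D))).
pose FF x:= enorm (F x)`^(p/(p-1)). have mFF : mble FF by apply: mble_powR; exact: mble_enorm (cd_mF D).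
have FF0 x: 0<=FF x by exact: powR_ge0. have uFF : ub (fun x=> B0 ra x*(FF x+FF (x+h))) (d+d).
 apply: (@ub_eq _ _ (fun x=> B0 ra x*FF x+B0 ra x*FF (x+h))); first by move=> x; rewrite mulrDr.
 apply: ubD; first exact: (ubBW ra16' mFF FF0 (cd_FF D)).
 exact: (ub_ballD hr FF0 mFF (ubBW ra16 mFF FF0 (cd_FF D))).
have mA : mble A.
 by apply: mble_cont; apply: smooth_cont; apply: smooth_fdiff; exact: smooth_moll (smooth_itg lt017 sv vv).
have mDv : mble Dv := mble_cont (smooth_cont sDv). pose AB x:= `|A x-Dv x| `^ p.
have mAB : mble AB by apply: mble_powR; apply: mble_norm; exact: mbleB.
have AB0 x: 0<=AB x by exact: powR_ge0. have {}uAB: ub (fun x=> B0 ra x*AB x) ths := ubBW ra4 mAB AB0 uAB.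
pose VV x:= \sum_j (2`^p*(`|fdiff i k (partial j v) x| `^ p+K`^p * `|Dv x| `^ p)). have VV0 x: 0<=VV x.
 by rewrite sumr_ge0// => j _; rewrite mulr_ge0 ?powR_ge0// addr_ge0 ?mulr_ge0 ?powR_ge0.
have rk15 : ra+k<=15 by apply: (le_trans _ ra15); rewrite lerD2l. have uVV : ub (fun x=> NN*(B0 ra x*VV x)) Q.
 apply: (ubZ NN0); apply: (@ub_eq _ _ (fun x=> \sum_j (2`^p*(B0 ra x * `|fdiff i k (partial j v) x| `^ p +
   K`^p*(B0 ra x * `|Dv x| `^ p))))).
  move=> x; rewrite /VV mulr_sumr; apply: eq_bigr=> j _. exact: distr2.
 rewrite -sum_cst; apply: ub_sum=> j; apply: (ubZ (powR_ge0 2 p)); apply: ubD.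
  have mpv : mble (partial j v) := mble_cont (smooth_cont (smooth_d j sv)).
  apply: (ub_cle _ (ub_fdiff0 i mpv k0 rk15 (apx_bound p1 D av dle1 j))).
  rewrite -/Ab; apply: ler_wpM2r; first by nneg. by apply: le_pow.
 apply: (ubZ (powR_ge0 K p)). exact: (ub_fdiff i (ltW p1) sv vv ra0 k0 rk15 (apx_bound p1 D av dle1)).
pose II x:= I x*(G x+G (x+h))+I x*(`|A x| `^ p+t`^p).
have uII : ub (fun x=> B0 ra x*II x) (2*Cs*t`^(p-m)+ths).
 have ->: 2*Cs*t`^(p-m)+ths = Cs*t`^(p-m)+ths+Cs*t`^(p-m).
  by ring.
 by apply: (@ub_eq _ _ _ _ _ _ (ubD uII0 uA))=> x; rewrite -mulrDr.
have I0 x: 0<=I x by exact: indic_ge0. have I1 x : I x<=1 by exact: indic_le1.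
have II0 x: 0<=II x by rewrite addr_ge0// mulr_ge0// ?addr_ge0 ?powR_ge0.
pose rest x:= B0 ra x*(La*((2*k1*(NN*VV x)+Cf*(FF x+FF (x+h)))
 + c2/La*((1+2*C1)*II x+(k2*(G x+G (x+h))+2*C2*AB x)) + c3/La*(2*k3*(G x+G (x+h))+2*C3*(NN*EE x)))).
have ubrest : ub rest (C*t`^(p-m)+th).
 have u1 := ubZ (mulr_ge0 (ltW L0) (mulr_ge0 (ler0n _ 2) (ltW k10))) uVV.
 have u2 := ubZ (mulr_ge0 (ltW L0) (ltW Cf0)) uFF. have u3 := ubZ c2C uII.
 have u4 := ubZ (mulr_ge0 c20 (ltW k20)) uGG.
 have u5 := ubZ (mulr_ge0 c20 (mulr_ge0 (ler0n _ 2) (ltW C20))) uAB.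
 have u6 := ubZ (mulr_ge0 (ltW c30) (mulr_ge0 (ler0n _ 2) (ltW k30))) uGG.
 have u7 := ubZ (mulr_ge0 (ltW c30) (mulr_ge0 (mulr_ge0 (ler0n _ 2) (ltW C30)) NN0)) uEE.
 have u := ubD u1 (ubD u2 (ubD u3 (ubD u4 (ubD u5 (ubD u6 u7))))). have Ln0 : La != 0 by rewrite gt_eqF.
 apply: (ub_cle _ (ub_eq _ u))=> [|x]; last first.
  rewrite /rest; move: (B0 ra x) (VV x) (FF x) (FF (x+h)) (II x) (G x) (G (x+h)) (AB x) (EE x)=> z1 z2 z3 z4 z5 z6 z7 z8 z9.
  by field.
 exact: (sum_bound _ (frac q10 th8) (frac q20 th8) (frac q30 th8) (frac q40 th8) d1X dd1 X0 th0 (powR_ge0 _ _)).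
have pt x : bump r x*(dtrunc t (Dv x)*(k^-1 *
   monq p (mu+enorm (g x)+enorm (g (x+h))) (enorm (g (x+h)-g x))))<=La*f0 x+rest x.
 have [xa|xa] := pselect (ball (0: E) ra x); last first.
  have b0 : bump r x = 0.
   by rewrite vanish_bump// => hb; apply: xa; apply: le_ball hb; exact: ltW.
  have z0 (z: E): dot z 0 = 0 :> R by rewrite /dot big1// => j _; rewrite mxE mulr0.
  have gz : grad phi x = 0 by apply/rowP=> j; rewrite !mxE (vanish_d j rra vphi).
  have f00 : f0 x = 0 by have := f0E x; rewrite gz !z0 addr0.
  by rewrite b0 mul0r f00 mulr0 add0r /rest indic_out// mul0r.
 have xk : ball (0: E) 16 (x+h).
  by apply: (ballD xa); apply: (le_trans hk); apply: (le_trans kh); rewrite lerBrDl.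
 have x16 : ball (0: E) 16 x by apply: le_ball xa. rewrite /rest indic_in// mul1r. have [z hz] := hlat.
 have := cd_mono D (x := x) (z := z); rewrite -hz=> mono. pose db:= b (x+h)-b x.
 (* The test function contains the difference of [grad v] and monotonicity that of [g]; [y1 - y0] is
    the discrepancy. *)
 pose yv:= grad v (x+h)-grad v x. pose y1:= g (x+h)-grad v (x+h); pose y0:= g x-grad v x.
 have DE : dot db (g (x+h)-g x) = dot db yv+dot db (y1-y0).
  rewrite -dotDr; congr dot; rewrite /yv /y1 /y0.
  move: (g (x+h)) (g x) (grad v (x+h)) (grad v x)=> z1 z2 z3 z4. by apply/rowP=> j; rewrite !mxE; ring.
 have DphiE : dot db (grad phi x) = psi x*dot db (grad (bump r) x) +
   bump r x*(dtrunc t (Dv x)*(k^-1*dot db yv)).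
  rewrite -!dotZr -dotDr; congr dot; apply/rowP=> j. by rewrite !mxE gphiE /fdiff.
 have dtv0 := dtrunc_ge0 t (Dv x). pose a1:= (mu+enorm (g (x+h)))`^(p-1); pose a0:= (mu+enorm (g x))`^(p-1).
 have a10: 0<=a1 by exact: powR_ge0. have a00: 0<=a0 by exact: powR_ge0.
 have dbl y : `|dot db y|<=La*((a1+a0) * l1 y).
  rewrite dotBl; apply: (le_trans (ler_normB _ _)); rewrite mulrDl mulrDr. by apply: lerD; exact: (flux_le D).
 have psi0: 0<=psi x by exact: trunc_ge0. have G1 z1 := hC1 _ z1 (G_ge0 D x).
 apply: (slope_alg (bump_ge0 r x) dtv0 kV0 L0 (mono x16 xk) DE DphiE (f0E x)).
 - rewrite dotBl.
  have l1phi : l1 (grad phi x)`^p<=NN*VV x.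
   rewrite l1_grad; apply: (le_trans (sum_pow n0 p0 (fun j=> normr_ge0 _))).
   rewrite ler_wpM2l//; apply: ler_sum=> j _.
   apply: (@le_trans _ _ ((`|fdiff i k (partial j v) x| + K * `|Dv x|)`^p)).
    apply: le_pow=> //; rewrite gphiE addrC; apply: (le_trans (ler_normD _ _)); apply: lerD.
     rewrite normrM (ger0_norm (bump_ge0 r x)) normrM (ger0_norm dtv0).
     rewrite mulrA ler_piMl// mulr_ile1 ?bump_ge0 ?bump_le1 ?dtrunc_le1//.
    rewrite normrM (ger0_norm psi0) mulrC ler_pM//; exact: trunc_le_norm.
   apply: (le_trans (pow_add p0 _ _))=> //; first by rewrite mulr_ge0. by rewrite powRM.
  have fl y : `|dot (F y) (grad phi x)|<=k1*(NN*VV x)+Cf*FF y.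
   apply: (le_trans (dot_le _ _)); rewrite mulrC.
   apply: (le_trans (hCf _ _ (l1_ge0 _) (enorm_ge0 _))); rewrite lerD2r. exact: (ler_wpM2l (ltW k10) l1phi).
  have := fl (x+h); have := fl x. move: (dot (F x) _) (dot (F (x+h)) _)=> z1 z2 f1 f2.
  apply: (le_trans (ler_norm _)); apply: (le_trans (ler_normB _ _)).
  apply: (le_trans (lerD f2 f1)); rewrite le_eqVlt; apply/orP; left; apply/eqP.
  by move: (VV x) (FF x) (FF (x+h))=> w1 w2 w3; ring.
 - apply: (le_trans (ler_norm _)); rewrite normrN normrM (ger0_norm psi0).
  have e1 : c2/La = La*(n%:R*K) by rewrite /c2; field; rewrite gt_eqF.
  rewrite e1; apply: (@le_trans _ _ (psi x*(La*((a1+a0)*(n%:R*K))))).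
   rewrite ler_wpM2l//; apply: (le_trans (dbl _)); rewrite ler_wpM2l ?(ltW L0)//.
   rewrite ler_wpM2l ?addr_ge0// l1_grad -sum_cst; apply: ler_sum=> j _; exact: etaK.
  have ->: psi x*(La*((a1+a0)*(n%:R*K))) = La*(n%:R*K)*(psi x*(a1+a0)).
   by move: (psi x)=> z1; ring.
  (* [trunc] is 1-Lipschitz, so [psi] exceeds [trunc t (A x)], which vanishes off [{A >= t}], by at
     most [|A - Dv|]. *)
  rewrite ler_wpM2l ?mulr_ge0 ?(ltW L0)//. pose e:= `|A x-Dv x|. have psile : psi x<=I x * `|A x| + e.
   have lip := trunc_lipschitz (Dv x) (A x) t0. have tA : trunc t (A x)<=I x * `|A x|.
    have [ta|ta] := leP t (A x); first by rewrite /I indic_in// mul1r; exact: trunc_le_norm.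
    by rewrite (trunc_below t0 (ltW ta)) mulr_ge0.
   rewrite -(subrK (trunc t (A x)) (psi x)) addrC; apply: lerD=> //.
   by apply: (le_trans (ler_norm _)); rewrite /e (distrC (A x)).
  exact: (absorb_mid (I0 x) a00 a10 psile (hC1 _ _ (G_ge0 D x) (normr_ge0 _))
   (hC1 _ _ (G_ge0 D (x+h)) (normr_ge0 _)) (hC2 _ _ (G_ge0 D x) (normr_ge0 _))
   (hC2 _ _ (G_ge0 D (x+h)) (normr_ge0 _)) (G0 x) (G0 (x+h)) (powR_ge0 _ _) (powR_ge0 _ _) (ltW C10)).
 - apply: (le_trans (ler_norm _)); rewrite normrM (ger0_norm (bump_ge0 r x)).
  rewrite normrM (ger0_norm dtv0) normrM (ger0_norm kV0) mulrA.
  have e1 : c3/La = kap^-1*La by rewrite /c3; field; rewrite !gt_eqF. rewrite e1.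
  apply: (@le_trans _ _ (1*(kap^-1*(La*((a1+a0)*(l1 y1+l1 y0)))))).
   apply: ler_pM; rewrite ?mulr_ge0 ?bump_ge0 ?normr_ge0//.
    by rewrite mulr_ile1 ?bump_ge0 ?bump_le1 ?dtrunc_le1.
   apply: ler_pM=> //; apply: (le_trans (dbl _)); rewrite ler_wpM2l ?(ltW L0)//.
   by rewrite ler_wpM2l ?addr_ge0// l1B.
  rewrite mul1r (mulrA kap^-1 La); apply: ler_wpM2l.
   by rewrite mulr_ge0 ?invr_ge0 ?(ltW kap0) ?(ltW L0).
  have l1p : l1 y1`^p+l1 y0`^p<=NN*EE x.
   have sw: \sum_j `|partial j v x-g x 0 j| `^ p + \sum_j `|partial j v (x+h)-g (x+h) 0 j| `^ p = EE x.
    by rewrite -big_split.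
   rewrite -sw mulrDr addrC; apply: lerD.
    apply: (le_trans (l1_pow n0 _ p0)); rewrite ler_wpM2l//; apply: ler_sum=> j _. by rewrite !mxE distrC.
   apply: (le_trans (l1_pow n0 _ p0)); rewrite ler_wpM2l//; apply: ler_sum=> j _. by rewrite !mxE distrC.
  have y11 := hC3 _ _ (G_ge0 D (x+h)) (l1_ge0 y1). have y10 := hC3 _ _ (G_ge0 D (x+h)) (l1_ge0 y0).
  have y01 := hC3 _ _ (G_ge0 D x) (l1_ge0 y1). have y00 := hC3 _ _ (G_ge0 D x) (l1_ge0 y0).
  have lC := ler_wpM2l (ltW C30) l1p. move: y11 y10 y01 y00 lC; rewrite -/(G x) -/(G (x+h)) -/a1 -/a0.
  exact: absorb_err.
have mg := cd_mg D. have mmq : mble (fun x=> monq p (mu+enorm (g x)+enorm (g (x+h))) (enorm (g (x+h)-g x))).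
 exact: mble_monq (mbleD (mbleD (mble_cst _) (mble_enorm mg)) (mble_shift h (mble_enorm mg)))
  (mble_enorm (mblevB (mblev_shift h mg) mg)).
have mlhs := mbleM (mble_cont (smooth_cont (smooth_bump (n:=n) r)))
 (mbleM (mble_dtrunc t mDv) (mbleM (mble_cst k^-1) mmq)).
have LaW0: \int[leb]_x (La*f0 x) = 0.
 by have := integZ La if0; rewrite zf0 mulr0.
apply: (ub_of_eq0 (itgZ La if0) LaW0 mlhs _ pt ubrest)=> x.
by rewrite mulr_ge0 ?bump_ge0// mulr_ge0 ?dtrunc_ge0// mulr_ge0// monq_ge0.
Qed.

End Slope.

#[local] Hint Resolve trunc_ge0 dtrunc_ge0: nneg.
#[local] Hint Resolve mble_dtrunc: mble.

Section SlopeBounds.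
Context {R: realType}.

Lemma slope_sum_bound (K a b T kV cq Ce th1 w Cs ths k5 C5 k6 V k6p k7 k7p d d1 th: R) :
 a*b<=K -> a<=K -> kV<=K -> 0<=w*ths -> 0<=cq*th1 -> 0<=w*2*k5 ->
 0<=27*C5*V*k6 -> 0<=27*C5*k6p*ths -> 0<=2*V*k7 -> 0<=k7p*2*d -> 0<=K*(k7p*2) -> d<=d1 ->
 K*cq*th1<=th/8 -> K*(w+27*C5*k6p)*ths<=th/8 -> K*(w*2)*k5<=th/8 ->
 K*(27*C5*V)*k6<=th/8 -> K*(2*V)*k7<=th/8 -> K*(k7p*2)*d1<=th/8 -> 0<th ->
 a*b*(cq*(Ce*T+th1))+(a*b*(w*(2*Cs*T+ths))+(a*(k5*(w*(1+1))) +
  (a*(27*C5*(k6*V+k6p*ths))+kV*(2*k7*V+k7p*(d+d))))) <= (cq*Ce+w*(2*Cs))*(a*(b*T))+th.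
move=> h1 h2 h3 p1' p2' p3' p4' p5' p6' p7' p8' dd e1 e2 e3 e4 e5 e6 t0.
have f1 := ler_wpM2r p2' h1; have f2 := ler_wpM2r p1' h1; have f3 := ler_wpM2r p3' h2.
have f4 := ler_wpM2r p4' h2; have f5 := ler_wpM2r p5' h2; have f6 := ler_wpM2r p6' h3.
have f7 := ler_wpM2r p7' h3; have f8 := ler_wpM2l p8' dd. lra.
Qed.

(** [P] stands for the slope of the truncation. It is split as [I + q] into the superlevel set of
    [A] and an error controlled by [e = |A - Dv|]; [Y], which is [monY], is estimated sharply on the
    first part and crudely on the second. *)
Lemma slope_pointwise (U P kV X S m Y a b I q II Sp w GG k5 C5 e k6 k6p ep e1 e2 k7 k7p ep1 ep2 bm cq: R) :
 0<=U -> U<=cq*bm -> 0<=P -> P<=1 -> 0<=kV -> 0<=a -> 0<=b -> 0<=m ->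
 kV*S<=a*b*(kV * m)+a*Y -> 0<=Y -> P<=I+q -> 0<=I -> 0<=q -> q<=1 ->
 I*Y<=b*(w*II) -> Y<=k5*Sp+C5 -> Sp<=w*GG -> 0<=k5 -> 0<=C5 -> q<=27*e -> 0<=w*GG ->
 e<=k6+k6p*ep -> e1<=k7+k7p*ep1 -> e2<=k7+k7p*ep2 -> X<=S+(e1+e2) -> 0<=k7+k7p*ep1 -> 0<=k7+k7p*ep2 ->
 U*(P*(kV*X))<=a*b*(cq*(bm*(P*(kV * m))))+(a*b*(w*(U*II))+(a*(k5*(w*(U*GG))) +
  (a*(27*C5*(k6*U+k6p*(U*ep)))+kV*(2*k7*U+k7p*(U*(ep1+ep2)))))).
move=> U0 Ub P0 P1 kV0 a0 b0 m0 hS Y0 PI I0 q0 q1 IY Y5 Sw k50 C50 q27 wG he h1 h2 hX z1 z2.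
have A1 : P*(kV*X)<=a*b*(P*(kV * m))+a*(P*Y)+kV*(k7+k7p*ep1+(k7+k7p*ep2)).
 have g1 := ler_wpM2l P0 hS. have g2 := ler_wpM2l P0 (ler_wpM2l kV0 hX).
 have g3 : P*(kV*(e1+e2))<=kV*(k7+k7p*ep1+(k7+k7p*ep2)).
  apply: (@le_trans _ _ (P*(kV*(k7+k7p*ep1+(k7+k7p*ep2))))).
   by rewrite !ler_wpM2l// lerD.
  by rewrite ler_piMl// mulr_ge0// addr_ge0.
 lra.
have A2 : P*Y<=b*(w*II)+(k5*(w*GG)+27*C5*(k6+k6p*ep)).
 have g1 := ler_wpM2r Y0 PI. have g2 : q*Y<=q*(k5*Sp)+q*C5 by rewrite -mulrDr ler_wpM2l.
 have g3 : q*(k5*Sp)<=k5*(w*GG).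
  apply: (@le_trans _ _ (q*(k5*(w*GG)))); first by rewrite !ler_wpM2l. by rewrite ler_piMl// mulr_ge0.
 have g4 : q*C5<=27*C5*(k6+k6p*ep).
  rewrite mulrAC ler_wpM2r//; apply: (le_trans q27); rewrite ler_wpM2l//.
 lra.
have A3 := ler_wpM2l U0 A1; have A4 := ler_wpM2l U0 (ler_wpM2l a0 A2).
have A5 : a*b*(U*(P*(kV * m)))<=a*b*(cq*(bm*(P*(kV * m)))).
 rewrite ler_wpM2l ?mulr_ge0// (mulrA cq bm); apply: ler_wpM2r=> //. nneg.
lra.
Qed.

Lemma slope_comb (s GG Ap tp w: R): s<=w*GG -> tp<=w*tp -> 0<=w*Ap -> tp+s<=w*(GG+(Ap+tp)).
Proof. lra. Qed.

Lemma le_add_pow p k e: 1<p -> 0<k -> 0<=e -> e<=k+k`^(1-p)*e`^p :> R.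
move=> p1 k0 e0; have := pow_above_or ler01 (ltW p1) k0 e0. by rewrite !powRr1// ltW.
Qed.

Lemma one_le_pow c t: 0<=c -> 1<=t -> 1<=t`^c :> R.
Proof. by move=> c0 t1; have := le_pow c0 ler01 t1; rewrite powR1. Qed.

Lemma frac_le (A th: R): 0<=A -> 0<th -> A*(th/(A+1))<=th.
move=> A0 t0; rewrite mulrCA ler_piMr ?(ltW t0)// ler_pdivrMr; lra.
Qed.

Lemma frac_gt0 (A th: R): 0<=A -> 0<th -> 0<th/(A+1).
Proof. by move=> A0 t0; rewrite divr_gt0// ltr_wpDl. Qed.

End SlopeBounds.

Section GradientSlope.
Context {R: realType} {n: nat} (n0: (0<n)%N) (p La: R) (p1: 1<p) (La1: 1<=La).
Notation E := 'rV[R]_n.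
Notation B0 r := (\1_(ball (0 : E) r) : E -> R).
Notation e_ i := (delta_mx 0 i : E).
Implicit Types (v w: E -> R) (g b F: E -> E) (i: 'I_n) (d eps mu t H K r th k m: R).

(** [monq_bound1] converts energy into an [L^1] bound. Its first term is controlled by
    [slope_energy], its second by [monY_le] and [superlevel_energy], and both come out of order
    [k^(sgm p - 1) t^(1-m)]. The upper bound [T] on [t] is for absorbing [monY] where [A] and the
    quotient of [v] disagree. *)
Lemma gradient_slope m r h0: p<=m -> moment (n:=n) p La m -> 0<r -> 0<h0 -> h0<=1 -> r+9*h0<13 ->
 exists2 C: R, 0<C & forall kap T th, 0<kap -> 1<=T -> 0<th -> exists2 d0: R, 0<d0 /\ d0<=1 &
 forall d eps mu g b F v, d<=d0 -> cell_data p La d eps mu g b F -> apx p g d v ->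
 forall i k t (N: nat), kap<=k -> k<=h0 -> 1<=t -> t<=T -> k = eps*N%:R ->
 ub (fun x=> B0 r x * `|partial i (fun x=> trunc t (fdiff i k v x)) x|) (C*(k`^(sgm p-1)*t`^(1-m))+th).
have p1' := p1; have La1' := La1. move=> pm Pm r0 h00 h01 r13; have p0: 0<=p by lra. pose rb:= r+h0.
have rb0: 0<rb by rewrite /rb; lra. have rrb : r<rb by rewrite /rb; lra.
have rb13 : rb+8*h0<13 by rewrite /rb; lra. have rb13' : rb+6*h0<13 by rewrite /rb; lra.
have r15 : r<=15 by lra. have r16 : r<=16 by lra. have rh16 : r+h0<=16 by lra.
have rh15 : r+h0<=15 by lra. have r_rb : r<=rb by nneg. have r_rb4 : r<=rb+4*h0 by rewrite /rb; lra.
have lt017 : (0: R)<17 by lra. have [Ce Ce0 he] := slope_energy n0 p1 La1 pm Pm rb0 h00 h01 rb13.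
have [Cs Cs0 hs] := superlevel_energy n0 p1 La1 pm Pm rb0 h00 rb13' h01.
pose cb:= (expbump 1 (rb-r)*expbump 1 (rb-r))^+n: R.
have cb0: 0<cb by rewrite exprn_gt0// mulr_gt0// expbump_gt0// subr_gt0.
pose cq:= cb^-1; have cq0: 0<cq by rewrite invr_gt0. pose w:= 2`^p: R; have w0: 0<=w by exact: powR_ge0.
exists (cq*Ce+w*(2*Cs)); first by rewrite ltr_pwDl ?mulr_gt0// !mulr_ge0// ltW.
move=> kap T th kap0 T1 th0; have th8: 0<th/8 by nneg. pose K:= kap^-1; have K0: 0<K by rewrite invr_gt0.
pose V:= (2*r)^+n: R; have V0: 0<=V by rewrite exprn_ge0// mulr_ge0// ltW. have q5: 0<=K*(w*2) by nneg.
pose k5:= th/8/(K*(w*2)+1); have k50: 0<k5 := frac_gt0 q5 th8. have [C5 C50 hC5] := monY_absorb p1 T1 k50.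
have q6: 0<=K*(27*C5*V) by nneg. pose k6:= th/8/(K*(27*C5*V)+1); have k60: 0<k6 := frac_gt0 q6 th8.
pose k6p:= k6`^(1-p); have k6p0: 0<=k6p by exact: powR_ge0. have q7: 0<=K*(2*V) by nneg.
pose k7:= th/8/(K*(2*V)+1); have k70: 0<k7 := frac_gt0 q7 th8.
pose k7p:= k7`^(1-p); have k7p0: 0<=k7p by exact: powR_ge0. have q1: 0<=K*cq by nneg.
pose th1:= th/8/(K*cq+1); have th10: 0<th1 := frac_gt0 q1 th8. have qs: 0<=K*(w+27*C5*k6p) by nneg.
pose ths:= th/8/(K*(w+27*C5*k6p)+1); have ths0: 0<ths := frac_gt0 qs th8. have qd: 0<=K*(k7p*2) by nneg.
pose dd1:= th/8/(K*(k7p*2)+1); have dd10: 0<dd1 := frac_gt0 qd th8.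
have [de [de0 de1] hE] := he kap th1 kap0 th10. have [H [H0 Hh] [ds [ds0 ds1] hS]] := hs kap ths kap0 ths0.
exists (Num.min (Num.min de ds) dd1).
 by rewrite !lt_min de0 ds0 dd10 !ge_min de1.
move=> d eps mu g b F v; rewrite !le_min=> /andP[/andP[dde dds] ddd] D av i k t N kk kh t1 tT kN.
have dle1 : d<=1 by exact: le_trans ds1.
have d0': 0<=d by have /andP[h1 h2] := cd_eps D; exact: ltW (lt_le_trans h1 h2). have [sv vv apv] := av.
have t0: 0<t by exact: lt_le_trans ltr01 t1. have k0: 0<k by exact: lt_le_trans kk. have kV0: 0<=k^-1 by nneg.
have kVle : k^-1<=K by rewrite lef_pV2. have := hE _ _ _ _ _ _ _ dde D av i k t N kk kh t1 kN.
have [] := hS _ _ _ _ _ _ _ dds D av i k t kk kh t1. set h:= k *: e_ i. set A:= fdiff i k (moll H v).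
set I:= (\1_[set x | t<=A x]: E -> R). pose G x:= (mu+enorm (g x))`^p. pose Dv:= fdiff i k v.
pose S x:= mu+enorm (g x)+enorm (g (x+h)). pose mq x:= monq p (S x) (enorm (g (x+h)-g x)).
move=> uI1 uI2 _ uAB uE. have hk : `|h|<=k by exact: norm_scale_delta (ltW k0).
have sDv : smooth Dv := smooth_fdiff i k sv. have mDv : mble Dv := mble_cont (smooth_cont sDv).
have mA : mble A.
 by apply: mble_cont; apply: smooth_cont; apply: smooth_fdiff; exact: smooth_moll (smooth_itg lt017 sv vv).
have mI : mble I by apply: mble_indic; exact: measurable_superlevel mA.
have mG : mble G by apply: mble_powR; mbl. have G0 x: 0<=G x by exact: powR_ge0.
have mGh : mble (fun x=> G (x+h)) := mble_shift h mG. have I0 x: 0<=I x by [].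
pose II x:= I x*(G x+G (x+h))+I x*(`|A x| `^ p+t`^p).
have II0 x: 0<=II x by rewrite addr_ge0// mulr_ge0 ?addr_ge0 ?powR_ge0. have mII : mble II.
 exact: (mbleD (mbleM mI (mbleD mG mGh)) (mbleM mI (mbleD (mble_powR p (mble_norm mA)) (mble_cst _)))).
have uII : ub (fun x=> B0 r x*II x) (2*Cs*t`^(p-m)+ths).
 apply: (ubBW r_rb mII II0). have ->: 2*Cs*t`^(p-m)+ths = Cs*t`^(p-m)+ths+Cs*t`^(p-m) by ring.
 by apply: (@ub_eq _ _ _ _ _ _ (ubD uI1 uI2))=> x; rewrite -mulrDr.
have hr : `|h|<=(r+h0)-r by rewrite addrAC subrr add0r; exact: le_trans hk kh.
have mvg j : mble (fun x=> `|partial j v x-g x 0 j| `^ p).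
 apply: mble_powR; apply: mble_norm; apply: mbleB; last exact: cd_mg D j. mbl.
have vg0 j x: 0<=`|partial j v x-g x 0 j| `^ p by []. pose ep1 x:= `|partial i v x-g x 0 i| `^ p.
have uEE : ub (fun x=> B0 r x*(ep1 (x+h)+ep1 x)) (d+d).
 apply: (@ub_eq _ _ (fun x=> B0 r x*ep1 (x+h)+B0 r x*ep1 x)); first by move=> x; rewrite mulrDr.
 apply: ubD; last exact: (ubBW r15 (mvg i) (vg0 i) (apv i)).
 exact: (ub_ballD hr (vg0 i) (mvg i) (ubBW rh15 (mvg i) (vg0 i) (apv i))).
have uGG : ub (fun x=> B0 r x*(G x+G (x+h))) (1+1).
 apply: (@ub_eq _ _ (fun x=> B0 r x*G x+B0 r x*G (x+h))); first by move=> x; rewrite mulrDr.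
 apply: ubD; first exact: (ubBW r16 mG G0 (cd_G D)). exact: (ub_ballD hr G0 mG (ubBW rh16 mG G0 (cd_G D))).
pose AB x:= `|A x-Dv x| `^ p. have mAB : mble AB by apply: mble_powR; apply: mble_norm; exact: mbleB.
have AB0 x: 0<=AB x by exact: powR_ge0. have {}uAB: ub (fun x=> B0 r x*AB x) ths := ubBW r_rb4 mAB AB0 uAB.
have uV := ub_ball (0: E) r0. pose a:= k`^(sgm p-1); pose b' := t`^(1-p).
have a0: 0<=a by exact: powR_ge0. have b0: 0<=b' by exact: powR_ge0. have s0 := sgm_gt0 p1. have aK : a<=K.
 apply: le_trans kVle; rewrite /a -powR_inv1 ?(ltW k0)//. rewrite -[leLHS]mulr1.
 have e : k`^(-1) = k`^(sgm p-1)*k`^(- sgm p).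
  by rewrite -powRD ?(gt_eqF k0) ?implybT//; congr (_ `^ _); ring.
 rewrite e ler_wpM2l ?powR_ge0// powRN invf_ge1 ?powR_gt0//. rewrite -(powRr0 k).
 have k1 : k<=1 by exact: le_trans h01. by apply: ger_powR; rewrite ?k0// ltW.
have b1 : b' <= 1.
 rewrite /b' (_: 1-p = - (p-1)); last by ring. have pm0: 0<=p-1 by rewrite subr_ge0; exact: ltW.
 have t1p: 1<=t`^(p-1) by exact: one_le_pow. by rewrite powRN invf_le1 ?powR_gt0.
have bT : b'*t`^(p-m) = t`^(1-m).
 by rewrite -powRD ?(gt_eqF t0) ?implybT//; congr (_ `^ _); ring.
have abK : a*b' <= K by apply: le_trans aK; rewrite ler_piMr. rewrite -bT. have ab0: 0<=a*b' by nneg.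
have u1 := ubZ ab0 (ubZ (ltW cq0) uE). have u2 := ubZ ab0 (ubZ w0 uII).
have u3 := ubZ a0 (ubZ (ltW k50) (ubZ w0 uGG)). have c27: 0<=27*C5 by nneg.
have u4 := ubZ a0 (ubZ c27 (ubD (ubZ (ltW k60) uV) (ubZ k6p0 uAB))). have k72: 0<=2*k7 by nneg.
have u5 := ubZ kV0 (ubD (ubZ k72 uV) (ubZ k7p0 uEE)). have u := ubD u1 (ubD u2 (ubD u3 (ubD u4 u5))).
have pE x : partial i (fun x=> trunc t (fdiff i k v x)) x = dtrunc t (Dv x)*fdiff i k (partial i v) x.
 by rewrite (partial_trunc _ _ t0 sDv) (partial_fdiff _ _ _ _ sv).
have nz x : S x = 0 -> enorm (g (x+h)-g x) = 0.
 move=> Sx; have /andP[mu0 _] := cd_mu D. have g1 : enorm (g x)<=0.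
  by rewrite -Sx /S -addrA addrCA lerDl addr_ge0// enorm_ge0.
 have g2 : enorm (g (x+h))<=0 by rewrite -Sx /S lerDr addr_ge0// enorm_ge0.
 have gz y : enorm (g y)<=0 -> g y = 0.
  move=> gy; apply/rowP=> j; rewrite mxE; apply/eqP; rewrite -normr_le0.
  exact: le_trans (coord_le_enorm _ _) gy.
 by rewrite (gz _ g1) (gz _ g2) subrr /enorm /dot big1 ?sqrtr0// => j _; rewrite mxE mul0r.
have mq0 x: 0<=mq x by exact: monq_ge0. apply: (ub_le _ _ _ _ u)=> [|x|x|].
- apply: mbleM; first mbl.
 apply: mble_norm; apply: mble_cont; exact: smooth_cont (smooth_d i (smooth_trunc t sDv)).
- by [].
- have kk1 : k*k^-1 = 1 by rewrite mulfV// gt_eqF.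
 rewrite pE normrM (ger0_norm (dtrunc_ge0 t (Dv x))) /fdiff normrM (ger0_norm kV0).
 have S0: 0<=S x by rewrite !addr_ge0 ?enorm_ge0//; have /andP[] := cd_mu D.
 pose e:= `|A x-Dv x|; have e0: 0<=e by exact: normr_ge0. have e27: 0<=27*e by nneg.
 have Dq : dtrunc t (Dv x)<=I x+Num.min 1 (27*e).
  have lip := dtrunc_lipschitz (Dv x) (A x) t1. have [tA|tA] := leP t (A x).
   rewrite /I indic_in//; apply: (le_trans (dtrunc_le1 _ _)); rewrite lerDl le_min ler01 /=. exact: e27.
  rewrite /I indic_out ?add0r; last by apply/negP; rewrite -ltNge.
  rewrite le_min dtrunc_le1 /=; move: lip; rewrite (dtrunc_below t0 (ltW tA)) subr0 distrC.
  by apply: le_trans; exact: ler_norm.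
 apply: (slope_pointwise (m := mq x) (S := enorm (g (x+h)-g x)) (Y := monY p (S x) t) (I := I x)
  (q := Num.min 1 (27*e)) (Sp := S x`^p) (e := e) (C5 := C5)
  (e1 := `|partial i v (x+h)-g (x+h) 0 i|) (e2 := `|partial i v x-g x 0 i|)
  (P := dtrunc t (Dv x)) (kV := k^-1))=> //.
 + have [xr|xr] := pselect (ball (0: E) r x); last first.
   by rewrite indic_out// mulr_ge0 ?bump_ge0// ltW.
  by rewrite indic_in// /cq mulrC ler_pdivlMr// mul1r; exact: bump_ge.
 + nneg.
 + exact: dtrunc_le1.
 + have := ler_wpM2l kV0 (monq_bound1 p1 k0 t0 S0 (enorm_ge0 _) (nz x)).
  move=> /le_trans; apply; rewrite mulrDr; apply: lerD; first by rewrite mulrCA.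
  rewrite mulrA ler_wpM2r ?monY_ge0 ?(ltW t0)// /a.
  rewrite -powR_inv1 ?(ltW k0)// -powRD ?(gt_eqF k0) ?implybT//. by rewrite addrC lexx.
 + by rewrite monY_ge0// ltW.
 + by rewrite le_min ler01.
 + by rewrite ge_min lexx.
 + have Sp : S x`^p<=w*(G x+G (x+h)).
   apply: le_trans (pow_add p0 (G_ge0 D x) (G_ge0 D (x+h))).
   apply: le_pow=> //; rewrite /S -!addrA lerD2l lerD2l lerDr; by have /andP[] := cd_mu D.
  apply: (@le_trans _ _ (I x*(t+b'*S x`^p))).
   by rewrite ler_wpM2l// monY_le.
  have tb : t = b'*t`^p.
   by rewrite -powRD ?(gt_eqF t0) ?implybT// subrK powRr1// ltW.
  rewrite {1}tb -mulrDr mulrCA ler_wpM2l// /II -mulrDr mulrCA ler_wpM2l//. have w1: 1<=w.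
   by apply: one_le_pow; rewrite ?ler1n.
  have tp0: 0<=t`^p by nneg. have tpw : t`^p<=w*t`^p by rewrite ler_peMl.
  have wA: 0<=w * `|A x| `^ p by rewrite mulr_ge0. exact: slope_comb.
 + exact: hC5.
 + apply: le_trans (pow_add p0 (G_ge0 D x) (G_ge0 D (x+h))).
  apply: le_pow=> //; rewrite /S -!addrA lerD2l lerD2l lerDr; by have /andP[] := cd_mu D.
 + exact: ltW.
 + exact: ltW.
 + by rewrite ge_min lexx orbT.
 + by rewrite mulr_ge0// addr_ge0.
 + exact: le_add_pow.
 + exact: le_add_pow.
 + exact: le_add_pow.
 + move: (ler_normD (partial i v (x+h)-g (x+h) 0 i) (- (partial i v x-g x 0 i)))=> tri.
  rewrite normrN in tri. have := coord_le_enorm (g (x+h)-g x) i; rewrite !mxE=> ce.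
  have alg (z1 z2 z3 z4: R): z1-z2 = (z3-z4)+(z1-z3-(z2-z4)) by ring.
  rewrite (alg _ _ (g (x+h) 0 i) (g x 0 i)); apply: (le_trans (ler_normD _ _)). exact: lerD.
 + by rewrite addr_ge0 ?(ltW k70)// mulr_ge0 ?powR_ge0.
 + by rewrite addr_ge0 ?(ltW k70)// mulr_ge0 ?powR_ge0.
- have F1 : K*cq*th1<=th/8 := frac_le q1 th8.
 have F2 : K*(w+27*C5*k6p)*ths<=th/8 := frac_le qs th8. have F3 : K*(w*2)*k5<=th/8 := frac_le q5 th8.
 have F4 : K*(27*C5*V)*k6<=th/8 := frac_le q6 th8. have F5 : K*(2*V)*k7<=th/8 := frac_le q7 th8.
 have F6 : K*(k7p*2)*dd1<=th/8 := frac_le qd th8.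
 apply: (@slope_sum_bound R K a b' (t`^(p-m)) k^-1 cq Ce th1 w Cs ths k5 C5 k6 V k6p k7 k7p d dd1 th)=> //; nneg.
Qed.

End GradientSlope.

(** * Tails of difference quotients by doubling the step *)

Section Telescoping.
Context {R: realType} {n: nat}.
Notation E := 'rV[R]_n.
Notation B0 r := (\1_(ball (0 : E) r) : E -> R).
Notation e_ i := (delta_mx 0 i : E).
Implicit Types (f v: E -> R) (i: 'I_n) (k r c t M: R).

Lemma vanish_fdiff i k M v: 0<=k -> vanish M v -> vanish (M+k) (fdiff i k v).
move=> k0 vv x nx; rewrite /fdiff !vv ?subrr ?mulr0// => h; apply: nx.
 by apply: le_ball h; rewrite lerDl.
rewrite -(addrK (k *: e_ i) x); apply: (ballD h).
by rewrite normrN (le_trans (norm_scale_delta i k0))// addrAC subrr add0r.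
Qed.

Lemma fdiff_double i k v x: 0<k -> fdiff i (2*k) v x = 2^-1*(fdiff i k v x+fdiff i k v (x+k *: e_ i)).
move=> k0; rewrite /fdiff. have ->: x+(2*k) *: e_ i = x+k *: e_ i+k *: e_ i.
 by rewrite -addrA -scalerDl; congr (_+_ *: _); ring.
by move: (v _) (v _) (v x)=> z1 z2 z3; field; rewrite gt_eqF.
Qed.

(* [fdiff (2 k)] averages two values of [fdiff k]; monotonicity of [trunc]
  bounds its value at either of them by the value at the average plus the difference. *)
Lemma trunc_double i k t v M r c c1: 0<t -> 0<k -> 0<r -> smooth v -> vanish M v ->
 ub (fun x=> B0 r x*trunc t (fdiff i (2*k) v x)) c ->
 ub (fun x=> B0 (r+k) x * `|partial i (fun x=> trunc t (fdiff i k v x)) x|) c1 ->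
 ub (fun x=> B0 r x*trunc t (fdiff i k v x)) (c+2*(k*c1)).
move=> t0 k0 r0 sv vv uc u1. pose f x:= trunc t (fdiff i k v x).
have sf : smooth f := smooth_trunc t (smooth_fdiff i k sv). have vf : vanish (M+k) f.
 by move=> x nx; rewrite /f (vanish_fdiff i (ltW k0) vv nx) trunc_below// ltW.
have mpf : mble (partial i f) := mble_cont (smooth_cont (smooth_d i sf)).
have mf : mble f := mble_cont (smooth_cont sf).
have u2 : ub (fun x=> B0 r x * `|f (x+k *: e_ i)-f x| `^ 1) (2`^1*(`|k| `^ 1*c1)).
 apply: (translate_coord (lexx 1) sf vf (ub_ball (0: E) r0))=> [x|s s01].
  nneg.
 apply: (@ub_eq _ _ (fun x=> B0 r x * `|partial i f (x+(s*k) *: e_ i)|)).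
  by move=> x; rewrite powRr1.
 apply: (@ub_ballD R n (fun x=> `|partial i f x|) r (r+k))=> //.
  move/andP: s01=> [s0 s1]. rewrite addrAC subrr add0r; apply: (le_trans (norm_scale_delta i _)).
   nneg.
  by rewrite ler_piMl// ltW.
 mbl.
rewrite !powRr1// gtr0_norm// in u2. apply: (ub_fle _ _ _ (ubD uc u2))=> [|x|x].
- mbl.
- by rewrite mulr_ge0 ?indic_ge0 ?trunc_ge0. rewrite -mulrDr ler_wpM2l ?indic_ge0// powRr1// fdiff_double//.
set A:= fdiff i k v x; set B:= fdiff i k v (x+_). have ->: f (x+k *: e_ i) = trunc t B by [].
have ->: f x = trunc t A by []. have [AB|BA] := leP A B.
 apply: (@le_trans _ _ (trunc t (2^-1*(A+B)))); last by rewrite lerDl. by apply: le_trunc=> //; lra.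
have h1 : trunc t B<=trunc t (2^-1*(A+B)) by apply: le_trunc=> //; lra.
have h2 := ler_norm (trunc t A-trunc t B); rewrite distrC in h2. lra.
Qed.

End Telescoping.

Section Tail.
Context {R: realType} {n: nat} (n0: (0<n)%N) (p La: R) (p1: 1<p) (La1: 1<=La).
Notation E := 'rV[R]_n.
Notation B0 r := (\1_(ball (0 : E) r) : E -> R).
Implicit Types (v w: E -> R) (g b F: E -> E) (i: 'I_n) (d eps mu t H c r th k m T: R).

(** The decay exponent in [t] of the [sgm p]-th power of [hscale c t]. *)
Definition gain: R := sgm p/(2*n%:R).

Let nR: 0<(n%:R: R). Proof. nneg. Qed.
Let nR2: 0<(2*n%:R: R). Proof. nneg. Qed.

Lemma gain_gt0: 0<gain.
Proof. by rewrite divr_gt0// sgm_gt0. Qed.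

(** Chosen so that [(h^2)^n] is of order [1/t]: mollified at scale [h^2], a gradient is bounded by
    its [L^1] norm times a multiple of [h^(-2n)], hence by [t/2] for suitable [c]. *)
Definition hscale (c t: R): R := c*t`^(- (2*n%:R)^-1).

Lemma hscale_gt0 c t: 0<c -> 0<t -> 0<hscale c t.
Proof. by move=> c0 t0; rewrite mulr_gt0 ?powR_gt0. Qed.

Lemma hscale_X c t: 0<c -> 0<t -> (hscale c t*hscale c t)^+n = c^+(2*n)/t.
move=> c0 t0; rewrite -expr2 -exprM exprMn; congr (_*_).
rewrite -powR_mulrn ?powR_ge0// -powRrM natrM mulNr mulVf ?gt_eqF// powR_inv1// ltW//.
Qed.

Lemma hscale_pow c t (a a': R): 0<c -> 1<=t -> a' <= a -> hscale c t`^a<=c`^a*t`^(- (a'/(2*n%:R))).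
move=> c0 t1 ba; rewrite powRM ?powR_ge0 ?(ltW c0)// ler_wpM2l ?powR_ge0//.
rewrite -powRrM ler_powR// mulNr lerN2 mulrC ler_wpM2l// invr_ge0 ltW//.
Qed.

Let tail_alg (A Ms w t: R): A<=`|Ms| + w -> `|Ms|<=t/2 -> t<=A -> A<=2*w.
Proof. lra. Qed.

(** The largest steps, between [h/2] and [h = hscale c0 t]. Mollifying [vb = moll H v] again at
    scale [s = h^2] leaves quotients of size at most [t/2]. Where the quotient of [vb] exceeds [t]
    it is thus at most twice the error [w], whose [m]-th moment is of order [(s/k)^m], that is
    [h^m]. *)
Lemma tail_end m r h1: p<=m -> moment (n:=n) p La m -> 0<r -> 0<h1 -> h1<=1 -> r+10*h1<13 ->
 exists C c0 T0: R, [/\ 0<C, 0<c0, 1<=T0, (forall t, T0<=t -> hscale c0 t<=h1) &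
 forall T th, T0<=T -> 0<th -> exists2 d0: R, 0<d0 /\ d0<=1 &
 forall d eps mu g b F v, d<=d0 -> cell_data p La d eps mu g b F -> apx p g d v ->
 forall i k t, T0<=t -> t<=T -> hscale c0 t<=2*k -> k<=hscale c0 t ->
 ub (fun x=> B0 r x*trunc t (fdiff i k v x)) (C*t`^(1-m-gain)+th)].
have p1' := p1. move=> pm Pm r0 h10 h11 r13; have p0: 0<=p by lra. have m1: 1<m by lra. have m0: 0<=m by lra.
have m1': 1<=m by nneg. pose r1:= r+2*h1; pose r2:= r+4*h1.
have r10: 0<r1 by rewrite /r1; lra. have r20: 0<r2 by rewrite /r2; lra. have r2_13 : r2<13 by rewrite /r2; lra.
have rr1 : r+h1<=r1 by rewrite /r1; lra. have r12 : r1+h1<=r2 by rewrite /r1 /r2; lra.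
have r12' : h1<=r2-r1 by rewrite lerBrDl. have lt017 : (0: R)<17 by lra. have [CP CP0 hP] := Pm r2 r20 r2_13.
have [C1 C10 hC1] := @pow_absorb R 1 p 1 p1 ler01 ltr01. pose c1:= 2`^p*2+C1*(2*r2)^+n: R. have c10: 0<=c1.
 have q2: 0<=(2*r2)^+n by nneg. by rewrite /c1; nneg.
(* The sup bound on the mollified gradient is [c1 / (Z s^n)] with [s^n = c0^(2n) / t];
   [c0 >= 2 c1 / Z] and [c0 >= 1] make it at most [t/2]. *)
pose Z:= bumpZ (R:=R) (n:=n); have Z0: 0<Z := bumpZ_gt0. pose c0:= 2*c1/Z+1. have z0: 0<=2*c1/Z by nneg.
have c01: 1<=c0 by rewrite /c0 lerDr. have c00: 0<c0 by exact: lt_le_trans c01.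
pose PC:= n%:R`^m*(n%:R*(2`^m*CP)): R. have PC0: 0<=PC by nneg. pose C:= 2`^m*(2`^m*(2`^m*(PC+PC))*c0`^m)+1.
have CC0: 0<C by rewrite ltr_wpDl//; nneg. have ch1: 1<=c0/h1 by rewrite ler_pdivlMr// mul1r (le_trans h11).
pose T0:= (c0/h1)`^(2*n%:R). have T01: 1<=T0 by apply: one_le_pow=> //; exact: ltW.
have hbound t : T0<=t -> hscale c0 t<=h1.
 move=> tT; have t0: 0<t by exact: lt_le_trans (lt_le_trans ltr01 T01) tT. have ta : c0/h1<=t`^(2*n%:R)^-1.
  have ->: c0/h1 = T0`^(2*n%:R)^-1.
   by rewrite /T0 -powRrM mulfV ?powRr1 ?gt_eqF// (le_trans ler01).
  by apply: le_pow=> //; rewrite ?invr_ge0 ?(ltW nR2)// powR_ge0.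
 rewrite /hscale powRN; apply: (@le_trans _ _ (c0*(c0/h1)^-1)).
  by rewrite ler_wpM2l ?(ltW c00)// lef_pV2 ?posrE ?powR_gt0 ?divr_gt0.
 by rewrite invf_div mulrCA mulfV ?mulr1// gt_eqF.
exists C, c0, T0; split=> //. move=> T th T0T th0.
pose hT:= hscale c0 T; have T_0: 0<T by exact: lt_le_trans (lt_le_trans ltr01 T01) T0T.
have hT0: 0<hT := hscale_gt0 c00 T_0. pose kap:= hT/2; have kap0: 0<kap by rewrite divr_gt0.
pose V:= (2*r)^+n: R; have V0: 0<=V by rewrite exprn_ge0// mulr_ge0// ltW.
have th2: 0<th/2 by rewrite divr_gt0. pose ka:= th/2/(V+1); have ka0: 0<ka := frac_gt0 V0 th2.
pose PP:= n%:R`^p*(n%:R*(2`^p*(2`^p*2))): R. have PP0: 0<=PP by nneg.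
have X0: 0<=ka`^(1-p)*(kap^-1`^p*(2`^p*(PP+PP))) by nneg. have [H1 H10 [H1h H1x]] := small_choice X0 th2.
pose H:= Num.min H1 (Num.min h1 ((13-r2)/50)). have H0: 0<H by rewrite !lt_min H10 h10 divr_gt0// subr_gt0.
have HH1 : H<=H1 by rewrite ge_min lexx. have Hh1 : H<=h1 by rewrite !ge_min lexx orbT.
have H50 : r2+50*H<=13.
 rewrite -lerBrDl mulrC -ler_pdivlMr//; by rewrite !ge_min lexx !orbT.
have Hp : H`^p<=H1.
 by apply: (le_trans _ HH1); apply: ge1r_powR; [rewrite H0 (le_trans Hh1)|exact: ltW].
have [d1 d10 hP1] := hP H H0 H50. exists (Num.min 1 d1); first by rewrite lt_min ltr01 d10 ge_min lexx.
move=> d eps mu g b F v; rewrite le_min=> /andP[dle1 dd1] D av i k t T0t tT kh hk. have [sv vv apv] := av.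
have iv := smooth_itg lt017 sv vv. have t0: 0<t by exact: lt_le_trans (lt_le_trans ltr01 T01) T0t.
have t1: 1<=t by exact: le_trans T01 T0t. set h:= hscale c0 t in kh hk. have h0: 0<h := hscale_gt0 c00 t0.
have hTh : hT<=h.
 rewrite /hT /h /hscale ler_wpM2l ?(ltW c00)// !powRN lef_pV2 ?posrE ?powR_gt0//.
 by apply: le_pow; rewrite ?invr_ge0 ?(ltW nR2) ?(ltW t0).
have hh1 : h<=h1 by exact: hbound. have k0: 0<k by have := lt_le_trans h0 kh; rewrite pmulr_rgt0.
have kk : kap<=k by rewrite /kap ler_pdivrMr// mulrC (le_trans hTh). have kh1 : k<=h1 by exact: le_trans hh1.
have rk1 : r+k<=r1 by apply: le_trans rr1; rewrite lerD2l. pose s:= h*h; have s0: 0<s by rewrite mulr_gt0.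
have sh1 : s<=h1 by apply: (le_trans _ hh1); rewrite ler_piMl ?(ltW h0)// (le_trans hh1).
have sr12 : s<=r2-r1 by exact: le_trans r12'. have smv : smooth (moll H v) := smooth_moll H0 iv.
have vmv : vanish (17+H) (moll H v) := vanish_moll H0 lt017 vv. have M0: 0<17+H by rewrite addr_gt0.
have imv := smooth_itg M0 smv vmv. set vb:= moll H v in smv vmv imv.
have uP j : ub (fun x=> B0 r2 x * `|partial j vb x| `^ m) CP := hP1 _ _ _ _ _ _ _ dd1 D av j.
have sms : smooth (moll s vb) := smooth_moll s0 imv.
have mvb := mble_cont (smooth_cont smv). have mms := mble_cont (smooth_cont sms).
have mv := mble_cont (smooth_cont sv). have r2H : r2+H<=15.
 apply: (@le_trans _ _ (r2+50*H)); last by apply: (le_trans H50); rewrite ler_nat.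
 by rewrite lerD2l ler_peMl ?(ltW H0)// ler1n.
have r1H : r1+H<=15 by apply: le_trans r2H; rewrite lerD2r (le_trans _ r12)// lerDl ltW.
have uL : ub (fun x=> B0 r2 x * `|partial i vb x|) c1.
 apply: (ub_fle _ _ _ (ubD (moll_bound p1 D av dle1 i H0 r2H) (ubZ (ltW C10) (ub_ball (0: E) r20))))=> [|x|x].
 - apply: mbleM; first exact: mble_ball.
  by apply: mble_norm; apply: mble_cont; exact: smooth_cont (smooth_d i smv).
 - by rewrite mulr_ge0 ?indic_ge0. rewrite [C1*_]mulrC -mulrDr ler_wpM2l ?indic_ge0//.
 by have := hC1 _ (normr_ge0 (partial i vb x)); rewrite powRr1// mul1r.
have sup y : ball (0: E) r1 y -> `|partial i (moll s vb) y|<=t/2.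
 move=> yr; rewrite (partial_moll i s0 M0 smv vmv). apply: (@le_trans _ _ ((Z*s^+n)^-1*c1)).
  apply: (@conv_sup R n (partial i vb) (kern s) _ s r1 r2 c1 y s0)=> //.
  - by move=> x; rewrite ger0_norm ?kern_ge0// kern_le.
  - exact: mble_kern.
  - exact: vanish_kern.
  - by apply: mble_cont; exact: smooth_cont (smooth_d i smv).
 rewrite /s hscale_X//. have cX : c0<=c0^+(2*n).
  by rewrite -{1}[c0]expr1; apply: ler_weXn2l=> //; rewrite muln_gt0.
 have cX0: 0<c0^+(2*n) by rewrite exprn_gt0. have ->: (Z*(c0^+(2*n)/t))^-1*c1 = t/2*(2*c1/Z/c0^+(2*n)).
  by move: (c0^+(2*n)) cX0=> z1 z10; field; rewrite !gt_eqF.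
 rewrite ler_piMr ?divr_ge0 ?(ltW t0)// ler_pdivrMr// mul1r. by apply: le_trans cX; rewrite /c0 lerDl.
have supD x : ball (0: E) r x -> `|fdiff i k (moll s vb) x|<=t/2.
 move=> xr; rewrite /fdiff; have [e ek ->] := mvt_coord i x k sms.
 rewrite mulKf ?gt_eqF//; apply: sup; apply: (ballD xr).
 rewrite normrZ (le_trans (ler_piMr _ (norm_delta i)))// (le_trans ek)// gtr0_norm//. by rewrite lerBrDl.
pose w x:= `|fdiff i k (moll s vb) x-fdiff i k vb x|.
have uw : ub (fun x=> B0 r x*w x`^m) (k^-1`^m*(2`^m*(PC*s`^m+PC*s`^m))).
 have u := ub_moll_poincare s0 m1 M0 smv vmv r10 sr12 (ltW CP0) uP.
 have ->: PC*s`^m = n%:R`^m*(n%:R*(2`^m*(s`^m*CP))) by rewrite /PC; ring.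
 exact: (ub_fdiff_diff i m0 mms mvb k0 rk1 u).
have {}uw: ub (fun x=> B0 r x*w x`^m) (2`^m*(2`^m*(PC+PC))*c0`^m*t`^(- gain)).
 apply: ub_cle uw. have sm : s`^m = h`^m*h`^m by rewrite /s powRM ?(ltW h0). have kV : k^-1`^m<=2`^m*h^-1`^m.
  rewrite -powRM ?invr_ge0 ?(ltW h0)//; apply: le_pow=> //; first by rewrite invr_ge0 ltW.
  by rewrite ler_pdivlMr// mulrC ler_pdivrMr.
 have hh : h^-1`^m*h`^m = 1 by rewrite -powRM ?invr_ge0 ?(ltW h0)// mulVf ?gt_eqF// powR1.
 (* The power [m] of [h] is at least what the gain asks for, since [sgm p <= 1 <= m]. *)
 have hg : h`^m<=c0`^m*t`^(- gain).
  by apply: hscale_pow=> //; exact: le_trans (sgm_le1 p1) m1'.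
 have q0: 0<=2`^m*(PC*s`^m+PC*s`^m) by nneg. apply: (le_trans (ler_wpM2r q0 kV)).
 have ->: 2`^m*h^-1`^m*(2`^m*(PC*s`^m+PC*s`^m)) =
   (h^-1`^m*h`^m)*(2`^m*(2`^m*(PC+PC))*h`^m) by rewrite sm; ring.
 by rewrite hh mul1r -[leRHS]mulrA; apply: ler_wpM2l hg; nneg.
pose e x:= `|fdiff i k vb x-fdiff i k v x|.
have ue : ub (fun x=> B0 r x*e x`^p) (kap^-1`^p*(2`^p*(PP+PP))*H1).
 have u := moll_poincare p1 D av dle1 H0 r10 r1H. have {}u := ub_fdiff_diff i p0 mvb mv k0 rk1 u.
 apply: ub_cle u. have ->: n%:R`^p*(n%:R*(2`^p*(H`^p*(2`^p*2)))) = PP*H`^p.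
  by rewrite /PP; ring.
 have ->: kap^-1`^p*(2`^p*(PP+PP))*H1 = kap^-1`^p*(2`^p*(PP*H1+PP*H1)) by ring.
 apply: ler_pM; rewrite ?powR_ge0//.
 + by rewrite mulr_ge0 ?powR_ge0// addr_ge0 ?mulr_ge0 ?powR_ge0.
 + by apply: le_pow; rewrite ?invr_ge0 ?(ltW k0)// lef_pV2.
 + by rewrite ler_wpM2l ?powR_ge0// lerD// ler_wpM2l.
have cm0: 0<=2`^m*t`^(1-m) by nneg.
have u := ubD (ubZ cm0 uw) (ubD (ubZ (ltW ka0) (ub_ball (0: E) r0)) (ubZ (powR_ge0 ka (1-p)) ue)).
apply: (ub_le _ _ _ _ u)=> [|x|x|].
- exact: mbleM (mble_ball _ _) (mble_cont (smooth_cont (smooth_trunc t (smooth_fdiff i k sv)))).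
- by rewrite mulr_ge0 ?indic_ge0 ?trunc_ge0.
- have [xr|xr] := pselect (ball (0: E) r x); last first.
  by rewrite indic_out// !mul0r !mulr0 !addr0.
 rewrite indic_in// !mul1r mulr1. set A:= fdiff i k vb x; set Bv:= fdiff i k v x.
 have lip := trunc_lipschitz Bv A t0.
 have e1 : e x<=ka+ka`^(1-p)*e x`^p by exact: (le_add_pow p1 ka0 (normr_ge0 _)).
 have e2 : trunc t A<=2`^m*t`^(1-m)*w x`^m.
  have [At|tA] := leP A t; first by rewrite trunc_below// !mulr_ge0 ?powR_ge0. have wx : A<=2*w x.
   have := supD _ xr; set Ms:= fdiff _ _ _ _=> hs. have e3 : A<=`|Ms| + w x.
    rewrite -(subrK Ms A) addrC; apply: lerD; first exact: ler_norm. by rewrite /w distrC; exact: ler_norm.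
   exact: tail_alg e3 hs (ltW tA).
  apply: (le_trans (trunc_le_norm _ t0)); rewrite gtr0_norm ?(lt_trans t0)//.
  apply: (le_trans wx); have := pow_above m1' t0 (le_trans (ltW tA) wx).
  rewrite powRr1 ?(le_trans (ltW (lt_trans t0 tA)))// => /le_trans; apply.
  by rewrite powRM ?normr_ge0// mulrA [t`^_*_]mulrC.
 rewrite -(subrK (trunc t A) (trunc t Bv)) addrC; apply: lerD=> //.
 apply: (le_trans (ler_norm _)); apply: (le_trans lip); apply: le_trans e1. by rewrite /e distrC.
have tg : t`^(1-m-gain) = t`^(1-m)*t`^(- gain).
 by rewrite -powRD ?(gt_eqF t0) ?implybT.
have F1 : ka*V<=th/2 by rewrite mulrC; exact: frac_le V0 th2.
have q: 2`^m*t`^(1-m)*(2`^m*(2`^m*(PC+PC))*c0`^m*t`^(- gain))<=C*t`^(1-m-gain).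
 rewrite tg /C. have ->: 2`^m*t`^(1-m)*(2`^m*(2`^m*(PC+PC))*c0`^m*t`^(- gain)) =
  2`^m*(2`^m*(2`^m*(PC+PC))*c0`^m)*(t`^(1-m)*t`^(- gain)) by ring.
 by apply: ler_wpM2r; [nneg|rewrite lerDl].
apply: lerD=> //; rewrite (splitr th); apply: lerD; first exact: F1. by apply: le_trans H1x; rewrite mulrA.
Qed.

End Tail.

Section TailTelescoped.
Context {R: realType} {n: nat} (n0: (0<n)%N) (p La: R) (p1: 1<p) (La1: 1<=La).
Notation E := 'rV[R]_n.
Notation B0 r := (\1_(ball (0 : E) r) : E -> R).
Implicit Types (v: E -> R) (g b F: E -> E) (i: 'I_n) (d eps mu t c r th k m T: R).

Let tele_alg (Ee C' h k k2 t1 th hh Cg ks: R): k2-ks = 2*Cg/C'*ks -> 0<C' ->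
 Ee+(C'*((h-k2)*t1)+2*th*(hh-2*k))+2*(Cg*(ks*t1)+th*k) = Ee+(C'*((h-ks)*t1)+2*th*(hh-k)).
move=> e C0; have ->: h-k2 = h-ks-2*Cg/C'*ks by rewrite -e; ring. by field; rewrite gt_eqF.
Qed.

Let tail_sum (Ce C' tg t1 h ks th hh k c: R): 0<=C' -> 0<=t1 -> 0<=ks -> h*t1<=c*tg ->
 hh<=1 -> 0<=k -> 0<th -> Ce*tg+th/4+(C'*((h-ks)*t1)+2*(th/4)*(hh-k))<=(Ce+C'*c)*tg+th.
move=> C0 t0 k0 hc h1 kk th0. have a1 := ler_wpM2l C0 hc; have a2: 0<=C'*(ks*t1) by nneg.
have a3: 2*(th/4)*(hh-k)<=2*(th/4)*1.
 by rewrite ler_wpM2l//; lra.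
lra.
Qed.

(** Double the step until it exceeds [h/2], then use [tail_end]. One doubling costs a multiple of
    [k^(sgm p) t^(1-m)], and these costs sum to a multiple of [h^(sgm p) t^(1-m)]. Writing the bound
    with [h^sg - k^sg] makes the induction telescope. *)
Lemma tail_bound m r h1: p<=m -> moment (n:=n) p La m -> 0<r -> 0<h1 -> h1<=1 -> r+10*h1<13 ->
 exists C c0 T0: R, [/\ 0<C, 0<c0, 1<=T0, (forall t, T0<=t -> hscale (n:=n) c0 t<=h1) &
 forall T kap th, T0<=T -> 0<kap -> 0<th -> exists2 d0: R, 0<d0 /\ d0<=1 &
 forall d eps mu g b F v, d<=d0 -> cell_data p La d eps mu g b F -> apx p g d v ->
 forall i k t (N: nat), T0<=t -> t<=T -> kap<=k -> k<=hscale (n:=n) c0 t -> k = eps*N%:R ->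
 ub (fun x=> B0 r x*trunc t (fdiff i k v x)) (C*t`^(1-m-gain (n:=n) p)+th)].
have p1' := p1. move=> pm Pm r0 h10 h11 r13; have m1: 1<m by lra.
have [Ce [c0 [T0 [Ce0 c00 T01 hb hend]]]] := tail_end n0 p1 pm Pm r0 h10 h11 r13.
pose ra:= r+h1; have ra0: 0<ra by rewrite addr_gt0. have ra13 : ra+9*h1<13 by rewrite /ra; lra.
have [Cg Cg0 hg] := gradient_slope n0 p1 La1 pm Pm ra0 h10 h11 ra13.
pose sg:= sgm p; have sg0: 0<sg := sgm_gt0 p1. have two: 0<2`^sg-1 :> R.
 have hs: 1`^sg<2`^sg :> R by apply: gt0_ltr_powR; rewrite ?nnegrE ?ltr1n.
 by rewrite subr_gt0; move: hs; rewrite powR1.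
(* Then [C'] times the increment of [k^sg] from [k] to [2k] equals [2 Cg k^sg], the cost of one
   doubling. *)
pose C' := 2*Cg/(2`^sg-1); have C'0: 0<C' by rewrite divr_gt0// mulr_gt0.
exists (Ce+C'*c0`^sg), c0, T0; split=> //.
 nneg.
move=> T kap th T0T kap0 th0; have th4: 0<th/4 by nneg. have [d1 [d10 d11] h_end] := hend T (th/4) T0T th4.
have [d2 [d20 d21] h_g] := hg kap T (th/4) kap0 (le_trans T01 T0T) th4.
exists (Num.min d1 d2); first by rewrite lt_min d10 d20 ge_min d11.
move=> d eps mu g b F v; rewrite le_min=> /andP[dd1 dd2] D av i k t N T0t tT kk kh kN. have [sv vv apv] := av.
have t1: 1<=t by exact: le_trans T01 T0t. have t0: 0<t by exact: lt_le_trans t1. set h:= hscale c0 t in kh.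
have h0: 0<h := hscale_gt0 c00 t0. have hh1 : h<=h1 by exact: hb.
pose tg:= t`^(1-m-gain (n:=n) p); pose t1m:= t`^(1-m). have t1m0: 0<=t1m by exact: powR_ge0.
pose Ee:= Ce*tg+th/4. have claim j : forall k N, h<=2^+j*k -> kap<=k -> k<=h -> k = eps*N%:R ->
  ub (fun x=> B0 r x*trunc t (fdiff i k v x)) (Ee+(C'*((h`^sg-k`^sg)*t1m)+2*(th/4)*(h-k))).
 have base k' : h<=2*k' -> kap<=k' -> k' <= h -> ub (fun x=> B0 r x*trunc t (fdiff i k' v x))
    (Ee+(C'*((h`^sg-k'`^sg)*t1m)+2*(th/4)*(h-k'))).
  move=> hk' kk' kh'; apply: ub_cle (h_end _ _ _ _ _ _ _ dd1 D av i k' t T0t tT hk' kh').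
  have k'0: 0<=k' by exact: le_trans (ltW kap0) kk'.
  have s1: 0<=h`^sg-k'`^sg by rewrite subr_ge0; apply: le_pow=> //; exact: ltW.
  rewrite lerDl; apply: addr_ge0; first nneg.
  by apply: mulr_ge0; [apply: mulr_ge0=> //; exact: ltW | rewrite subr_ge0].
 elim: j=> [|j IH] k' N' hk' kk' kh' kN'.
  apply: base=> //; move: hk'; rewrite expr0 mul1r=> /le_trans; apply.
  by rewrite ler_peMl ?ler1n// (le_trans (ltW kap0) kk').
 have [h2|h2] := leP h (2*k'); first exact: base. have k'0: 0<k' by exact: lt_le_trans kk'.
 have k'h1 : k' <= h1 by exact: le_trans hh1. have u1 := IH (2*k') (2*N')%N.
 have {}u1: ub (fun x=> B0 r x*trunc t (fdiff i (2*k') v x))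
    (Ee+(C'*((h`^sg-(2*k')`^sg)*t1m)+2*(th/4)*(h-2*k'))).
  apply: u1; first by rewrite mulrA -exprSr.
  - by apply: (le_trans kk'); rewrite ler_peMl ?ler1n// ltW.
  - exact: ltW.
  - by rewrite kN' natrM; ring.
 have u2 := h_g _ _ _ _ _ _ _ dd2 D av i k' t N' kk' k'h1 t1 tT kN'.
 have {}u2: ub (fun x=> B0 (r+k') x * `|partial i (fun x=> trunc t (fdiff i k' v x)) x|)
   (Cg*(k'`^(sg-1)*t1m)+th/4).
  apply: (ubBW _ _ _ u2); first by rewrite lerD2l.
   by apply: mble_norm; apply: mble_cont; exact: smooth_cont (smooth_d i (smooth_trunc t (smooth_fdiff i k' sv))).
  by [].
 have := trunc_double t0 k'0 r0 sv vv u1 u2. have kks : k'*k'`^(sg-1) = k'`^sg.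
  by rewrite -[X in X*_](powRr1 (ltW k'0)) -powRD ?(gt_eqF k'0) ?implybT// addrC subrK.
 have ->: k'*(Cg*(k'`^(sg-1)*t1m)+th/4) = Cg*(k'`^sg*t1m)+th/4*k'.
  by rewrite -kks; ring.
 rewrite tele_alg//. rewrite powRM ?(ltW k'0)// /C'; field; apply/andP; split; rewrite gt_eqF//.
have k0: 0<k by exact: lt_le_trans kk. have [j hj]: exists j, h<=2^+j*k.
 exists (Num.bound (h/k)); rewrite -ler_pdivrMr//. apply: (le_trans (ltW (archi_boundP _))); first nneg.
 by rewrite -natrX ler_nat ltnW// ltn_expl.
apply: ub_cle (claim j k N hj kk kh kN). have hc : h`^sg*t1m<=c0`^sg*tg.
 have ->: tg = t`^(- gain (n:=n) p)*t1m.
  by rewrite /tg /t1m -powRD ?(gt_eqF t0) ?implybT//; congr (_ `^ _); ring.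
 by rewrite mulrA; apply: ler_wpM2r=> //; apply: hscale_pow.
exact: (tail_sum _ (ltW C'0) t1m0 (powR_ge0 _ _) hc (le_trans hh1 h11) (ltW k0) th0).
Qed.

End TailTelescoped.

(** * Improvement of moments *)

Section Negation.
Context {R: realType} {n: nat}.
Notation E := 'rV[R]_n.
Implicit Types (v: E -> R) (g b F: E -> E) (i: 'I_n) (d eps mu t s p La M: R).

Lemma enormN (x: E): enorm (- x) = enorm x.
Proof. by rewrite /enorm dotNl dotNr opprK. Qed.

Lemma mblevN g: mblev g -> mblev (fun x=> - g x).
move=> mg i; have := mbleN (mg i); congr mble; apply/funext=> x; by rewrite mxE.
Qed.

Lemma apx_neg p g t v: apx p g t v -> apx p (fun x=> - g x) t (fun x=> - v x).
move=> [sv vv h]; split; first exact: smoothN.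
 by move=> x nx; rewrite vv ?oppr0.
move=> i; apply: (ub_eq _ (h i))=> x. have ->: partial i (fun x=> - v x) x = - partial i v x.
 have := partialZ (-1) i x sv; rewrite mulN1r=> <-; congr partial. by apply/funext=> y; rewrite mulN1r.
by rewrite mxE -opprD normrN.
Qed.

Lemma cell_data_neg p La d eps mu g b F: 1<p -> 1<=La -> cell_data p La d eps mu g b F ->
 cell_data p La d eps mu (fun x=> - g x) (fun x=> - b x) (fun x=> - F x).
move=> p1 La1 D; split.
- exact: cd_mu D.
- exact: cd_eps D.
- exact: mblevN (cd_mg D).
- exact: mblevN (cd_mb D).
- exact: mblevN (cd_mF D).
- by move=> x; rewrite !enormN; exact: (cd_growth D x).
- by move=> x hx; rewrite enormN dotNl dotNr opprK; exact: (cd_coer D hx).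
- move=> x z h hx hxh; rewrite !enormN -!opprD enormN dotNl dotNr opprK.
 exact: (cd_mono D hx hxh).
- by apply: (ub_eq _ (cd_G D))=> x; rewrite enormN.
- by apply: (ub_eq _ (cd_FF D))=> x; rewrite enormN.
- move=> phi M sp M16 vp.
 have e1 := integZ (-1) (data_itg p1 La1 D sp M16 vp). rewrite (cd_eq D sp M16 vp) mulr0 in e1; rewrite -e1.
 by apply: integ_eq=> x; rewrite !dotNl mulN1r opprB opprK addrC.
- move=> t t0; have [v hv] := cd_apx D t0.
 by exists (fun x=> - v x); exact: apx_neg.
Qed.

Lemma moll_neg s v: 0<s -> itg v -> moll s (fun x=> - v x) = (fun x=> - moll s v x).
move=> s0 iv; apply/funext=> x. have ic := conv_itg x iv (smooth_kern s) (vanish_kern s0).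
rewrite -mulN1r /moll /conv -(integZ _ ic). by apply: integ_eq=> y; rewrite mulN1r mulNr.
Qed.

End Negation.

Section MollifiedTruncation.
Context {R: realType} {n: nat}.
Notation E := 'rV[R]_n.
Notation B0 r := (\1_(ball (0 : E) r) : E -> R).
Implicit Types (f v w: E -> R) (i: 'I_n) (t c r s k M: R).

Lemma integ_le f g: itg f -> itg g -> (forall x, f x<=g x) -> integ f<=integ g.
move=> itf ig fg; rewrite -subr_ge0 -integB//; apply: integ_ge0=> x. by rewrite subr_ge0.
Qed.

Lemma itg_kernl s w x: 0<s -> itg w -> itg (fun y=> kern s y*w (x-y)).
move=> s0 iw. have := itg_refl x (conv_itg x iw (smooth_kern s) (vanish_kern s0)).
by congr itg; apply/funext=> y; rewrite subKr mulrC.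
Qed.

Lemma mollE s w x: 0<s -> itg w -> moll s w x = integ (fun y=> kern s y*w (x-y)).
Proof. by move=> s0 iw; exact: conv_sym iw (smooth_kern s) (vanish_kern s0). Qed.

Lemma moll_fdiff s v M i k x: 0<s -> 0<M -> 0<=k -> smooth v -> vanish M v ->
 fdiff i k (moll s v) x = moll s (fdiff i k v) x.
move=> s0 M0 k0 sv vv; have iv := smooth_itg M0 sv vv. have Mk: 0<M+k by rewrite ltr_pwDl.
have iD := smooth_itg Mk (smooth_fdiff i k sv) (vanish_fdiff i k0 vv). rewrite {1}/fdiff !mollE//.
rewrite -(integB (itg_kernl _ s0 iv) (itg_kernl _ s0 iv)).
rewrite -(integZ _ (itgB (itg_kernl _ s0 iv) (itg_kernl _ s0 iv))).
apply: integ_eq=> y; rewrite /fdiff [x+_-y]addrAC. by rewrite -mulrBr mulrCA.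
Qed.

(** The pointwise inequality [trunc_ge], averaged with the kernel. It turns an integral bound on the
    tail into a bound on values of the mollified quotient. *)
Lemma moll_trunc s v M i k t x: 0<s -> 0<M -> 0<=k -> 0<t -> smooth v -> vanish M v ->
 fdiff i k (moll s v) x<=2*t+expR 1 * moll s (fun x=> trunc t (fdiff i k v x)) x.
move=> s0 M0 k0 t0 sv vv. have Mk: 0<M+k by rewrite ltr_pwDl. have vD := vanish_fdiff i k0 vv.
have iD := smooth_itg Mk (smooth_fdiff i k sv) vD. have vT : vanish (M+k) (fun x=> trunc t (fdiff i k v x)).
 by move=> y ny; rewrite vD// trunc_below// ltW.
have iT := smooth_itg Mk (smooth_trunc t (smooth_fdiff i k sv)) vT.
rewrite (moll_fdiff _ _ s0 M0 k0 sv vv) !mollE//.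
have iK : itg (fun y=> 2*t*@kern R n s y) := itgZ _ (smooth_itg s0 (smooth_kern s) (vanish_kern s0)).
have eK : integ (fun y=> 2*t*@kern R n s y) = 2*t.
 by rewrite (integZ _ (smooth_itg s0 (smooth_kern s) (vanish_kern s0))) integ_kern// mulr1.
have iE := itgZ (expR 1) (itg_kernl x s0 iT).
rewrite -(integZ _ (itg_kernl x s0 iT)) -[X in _<=X+_]eK -(integD iK iE).
apply: (integ_le (itg_kernl x s0 iD) (itgD iK iE))=> y.
rewrite [2*t*_]mulrC [expR 1*_]mulrCA -mulrDr ler_wpM2l ?kern_ge0//. by rewrite -lerBlDl; exact: trunc_ge.
Qed.

Lemma moll_ge0 s w x: 0<s -> (forall x, 0<=w x) -> 0<=moll s w x.
Proof. by move=> s0 w0; apply: integ_ge0=> y; rewrite mulr_ge0 ?kern_ge0. Qed.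

Lemma ub_moll1 s w r r' c: 0<s -> itg w -> bor w -> (forall x, 0<=w x) -> s<=r' - r ->
 ub (fun x=> B0 r' x*w x) c -> ub (fun x=> B0 r x * moll s w x) c.
move=> s0 iw bw w0 sr u; have mw := itg_mble iw. have mm0 x := moll_ge0 x s0 w0.
apply: (@ub_avg R n (fun x y=> B0 r x*w (x-y)) (kern s)).
- apply: measurable_funM; first exact: mble_mble2l (mble_ball (0: E) r).
 exact: bor_mble2B.
- by move=> x y; rewrite mulr_ge0 ?indic_ge0.
- exact: ub_kern.
- exact: ub_ge0 u.
- apply: mbleM; first mbl.
 by apply: mble_cont; exact: smooth_cont (smooth_moll s0 iw).
- by move=> x; rewrite mulr_ge0 ?indic_ge0.
- move=> x; have mk : mble (fun y=> kern s y*w (x-y)).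
  by apply: mbleM; [mbl|exact: mble_refl].
 have k0 y: 0<=kern s y*w (x-y) by rewrite mulr_ge0// kern_ge0.
 have i0 := indic_ge0 (ball (0: E) r) x: 0<=(_: R). under [in X in (_<=X)%E]eq_integral do rewrite mulrCA.
 rewrite (intEFZ _ mk)// EFinM; apply: lee_wpmul2l=> //.
 have := moll_le x s0 iw; rewrite ger0_norm// => /le_trans; apply.
 have mk' : mble (fun y=> kern s y * `|w (x-y)|).
  by apply: mbleM; [mbl|apply: mble_norm; exact: mble_refl].
 have k0' y: 0<=kern s y * `|w (x-y)| by rewrite mulr_ge0 ?kern_ge0.
 apply: (intEF_le (@lebesgue R n) mk' mk k0')=> y. by rewrite ger0_norm.
- move=> y /(kern_supp s0) ys.
 apply: (@ub_ballD R n w r r' (- y))=> //. by rewrite normrN (le_trans ys).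
Qed.

End MollifiedTruncation.

Section MomentStepReal.
Context {R: realType}.
Implicit Types (a q m T: R) (J: nat).

Lemma geometric_sum_le q J: 0<=q -> q<1 -> \sum_(j<J) q^+j<=(1-q)^-1.
move=> q0 q1; have q2: 0<1-q by rewrite subr_gt0. suff ->: \sum_(j<J) q^+j = (1-q)^-1*(1-q^+J).
 by rewrite ler_piMr ?invr_ge0 ?(ltW q2)// gerBl exprn_ge0.
elim: J=> [|J IH]; first by rewrite big_ord0 expr0 subrr mulr0.
rewrite big_ord_recr /= IH exprS; field; exact: lt0r_neq0.
Qed.

(** A dyadic layer-cake bound. If [a] lies between [4 y] and [8 y] with [y = 2^j T], the hypothesis
    at level [j] forces [a <= 4 e Z_j], and the other [m - 1] factors of [a] are at most [8 y]. The
    induction takes the last level that [a] exceeds. *)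
Lemma level_sum m T a (Z: nat -> R) J: 1<=m -> 1<=T -> 0<=a -> (forall j, 0<=Z j) -> a<=4*(2^+J*T) ->
 (forall j, (j<J)%N -> a<=1+2*(2^+j*T)+expR 1*Z j) ->
 a`^m<=(4*T)`^m + \sum_(j<J) 4*expR 1*(8*(2^+j*T))`^(m-1)*Z j.
move=> m1 T1 a0 Z0; have m0: 0<=m by lra. have T0: 0<=T by lra. elim: J=> [|J IH] aJ hZ.
 rewrite big_ord0 addr0; apply: le_pow=> //; move: aJ; rewrite expr0 mul1r; exact.
have tJ: 1<=2^+J*T by rewrite mulr_ege1// exprn_ege1// ler1n. have e0: 0<=expR 1 :> R := expR_ge0 _.
rewrite big_ord_recr /=. have pos j: 0<=4*expR 1*(8*(2^+j*T))`^(m-1)*Z j.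
 by apply: mulr_ge0=> //; apply: mulr_ge0; [apply: mulr_ge0|exact: powR_ge0].
have [h|h] := leP a (4*(2^+J*T)).
 apply: (le_trans (IH h (fun j jJ=> hZ j (ltnW jJ)))). by rewrite addrA lerDl.
have hJ := hZ J (ltnSn J). have az : a<=4*expR 1*Z J.
 move: hJ h tJ; set y:= 2^+J*T; set z:= expR 1*Z J=> hJ h tJ. rewrite -mulrA -/z; lra.
have apos: 0<a by apply: lt_trans h; rewrite mulr_gt0// (lt_le_trans ltr01 tJ). have a8 : a<=8*(2^+J*T).
 by move: aJ; rewrite exprS; set y:= 2^+J*T; rewrite -(mulrA 2) -/y=> aJ; lra.
apply: (@le_trans _ _ (4*expR 1*(8*(2^+J*T))`^(m-1)*Z J)); last first.
 rewrite addrA lerDr addr_ge0 ?powR_ge0//; apply: sumr_ge0=> j _; exact: pos.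
have ->: a`^m = a`^(m-1)*a.
 by rewrite -[X in _*X](powRr1 a0) -powRD ?(gt_eqF apos) ?implybT// subrK.
rewrite [leRHS]mulrAC [leRHS]mulrC. apply: ler_pM=> //; first nneg. by apply: le_pow; [lra|exact: ltW|].
Qed.

Lemma lattice_scale (eps k: R): 0<eps -> eps<=k -> exists2 N: nat, (0<N)%N & k<=eps*N%:R /\ eps*N%:R<=2*k.
move=> e0 ek; have x0: 0<=k/eps by rewrite divr_ge0 ?(ltW e0)// (le_trans (ltW e0)).
have /andP[l1 l2] := truncn_itv x0. exists (Num.truncn (k/eps)).+1=> //; split.
 by rewrite mulrC -ler_pdivrMr// ltW.
move: l1; rewrite ler_pdivlMr// => l1; rewrite -natr1; lra.
Qed.

Lemma powR_exprn c j: (2`^c)^+j = (2^+j)`^c :> R.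
Proof. by rewrite -powR_mulrn// -powRrM mulrC powRrM powR_mulrn. Qed.

Lemma le_pow_neg (c t t': R): 0<=c -> 0<t -> t<=t' -> t'`^(- c)<=t`^(- c).
move=> c0 t0 tt; rewrite !powRN lef_pV2 ?posrE ?powR_gt0// ?(lt_le_trans t0)//.
by apply: le_pow=> //; exact: ltW.
Qed.

End MomentStepReal.

Section MomentStep.
Context {R: realType} {n: nat} (n0: (0<n)%N) (p La: R) (p1: 1<p) (La1: 1<=La).
Notation E := 'rV[R]_n.
Notation B0 r := (\1_(ball (0 : E) r) : E -> R).
Notation e_ i := (delta_mx 0 i : E).
Implicit Types (f v: E -> R) (g b F: E -> E) (i: 'I_n) (d eps mu H c r th k m T: R).

Lemma hess_sup r H: 0<H -> r+2*H<=15 -> exists2 S: R, 0<=S &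
 forall d eps mu g b F v, d<=1 -> cell_data p La d eps mu g b F -> apx p g d v ->
 forall i j x, ball (0: E) r x -> `|partial j (partial i (moll H v)) x|<=S.
move=> H0 rH. have p1' := p1. have [C C0 hC] := @pow_absorb R 1 p 1 p1 ler01 ltr01.
have lt015 : (0: R)<15 by lra. have lt017 : (0: R)<17 by lra. have H2: 0<2*H by nneg.
have Hr: 2*H<=15-r by lra. have HH : H<2*H by lra. pose c:= 2`^p*2+C*(2*15)^+n: R. have c0: 0<=c.
 by rewrite addr_ge0 ?mulr_ge0 ?powR_ge0 ?(ltW C0)// exprn_ge0// mulr_ge0// ltW.
have [CK [CK0 _ hK _]] := smooth_bounds (@smooth_kern R n H) (vanish_kern H0). exists (CK*c); first nneg.
move=> d eps mu g b F v d1 D av i j x xr; have [sv vv _] := av. have spv := smooth_d i sv.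
have mpv := mble_cont (smooth_cont spv). have vpv : vanish 18 (partial i v) by apply: vanish_d vv; lra.
have lt018 : (0: R)<18 by lra. have ipv : itg (partial i v) := smooth_itg lt018 spv vpv.
rewrite (partial_moll i H0 lt017 sv vv) (partial_conv j ipv (@smooth_kern R n H) (vanish_kern H0)).
apply: (@conv_sup R n (partial i v) (partial j (kern H)) _ (2*H) r 15 c x H2)=> //.
- exact: mble_cont (smooth_cont (smooth_d j (@smooth_kern R n H))).
- exact: vanish_d HH (vanish_kern H0).
apply: (ub_fle _ _ _ (ubD (apx_bound p1 D av d1 i) (ubZ (ltW C0) (ub_ball (0: E) lt015))))=> [|y|y].
- mbl.
- nneg. rewrite [C*_]mulrC -mulrDr ler_wpM2l ?indic_ge0//.
by have := hC _ (normr_ge0 (partial i v y)); rewrite powRr1// mul1r.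
Qed.

Lemma partial_le_fdiff r k S f i x: smooth f -> 0<k -> ball (0: E) r x ->
 (forall x, ball (0: E) (r+k) x -> `|partial i (partial i f) x|<=S) -> partial i f x<=fdiff i k f x+S*k.
move=> sf k0 xr hS. have [c ck ->]: exists2 c, `|c|<=k & fdiff i k f x = partial i f (x+c *: e_ i).
 have [c] := mvt_coord i x k sf; rewrite (ger0_norm (ltW k0))=> ck e.
 by exists c=> //; rewrite /fdiff e mulrA mulVf ?mul1r ?gt_eqF.
have [c' cc' e] := mvt_coord i x c (smooth_d i sf). have S0 : `|partial i (partial i f) (x+c' *: e_ i)|<=S.
 apply: hS; apply: (ballD xr); rewrite addrAC subrr add0r normrZ.
 apply: (@le_trans _ _ (`|c'| * 1)); first by rewrite ler_wpM2l// norm_delta. by rewrite mulr1 (le_trans cc').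
rewrite -lerBlDl; apply: (le_trans (ler_norm _)). rewrite distrC e normrM mulrC; apply: ler_pM=> //.
Qed.

Let sum_split (A C th Q: R) (a b: nat -> R) J: 0<=C -> 0<=th ->
 (forall j, (j<J)%N -> a j*b j<=C*Q^+j) -> (forall j, (j<J)%N -> a j<=A) -> 0<=Q -> Q<1 -> J%:R*A*th<=1 ->
 \sum_(j<J) a j*(b j+th)<=C*(1-Q)^-1+1.
move=> C0 th0 hab ha Q0 Q1 hA. apply: (@le_trans _ _ (\sum_(j<J) (C*Q^+j+A*th))).
 apply: ler_sum=> j _; rewrite mulrDr lerD ?hab//; exact: ler_wpM2r (ha _ _).
rewrite big_split /= sum_cst mulrA -mulr_sumr lerD//. by apply: ler_wpM2l=> //; exact: geometric_sum_le.
Qed.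

(** At level [tj = 2^j T0] the weight [tj^(m'-1)] meets the tail [tj^(1-m-gm)]; the product
    [tj^(-gm/2)] sums geometrically. The sup bound [S] makes the number [J] of levels finite. [J]
    depends on [H], but the sum of the main terms does not, and the error [th] is chosen after
    [J]. *)
Lemma moment_pos m r: p<=m -> moment (n:=n) p La m -> 0<r -> r<13 -> exists2 C: R, 0<C &
 forall H, 0<H -> r+50*H<=13 -> exists2 d0: R, 0<d0 &
 forall d eps mu g b F v, d<=d0 -> cell_data p La d eps mu g b F -> apx p g d v ->
 forall i, ub (fun x=> B0 r x*(Num.max (partial i (moll H v) x) 0)`^(m+gain (n:=n) p/2)) C.
move=> pm Pm r0 r13; have p1' := p1. pose h1:= (13-r)/40. have h10: 0<h1 by rewrite divr_gt0// subr_gt0.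
have h11 : h1<=1 by rewrite /h1; lra. pose ra:= r+2*h1. have ra0: 0<ra by rewrite addr_gt0// mulr_gt0.
have ra13 : ra+10*h1<13 by rewrite /ra /h1; lra.
have [Ct [c0 [T0 [Ct0 c00 T01 hb ht]]]] := tail_bound n0 p1 La1 pm Pm ra0 h10 h11 ra13.
pose gm:= gain (n:=n) p; have gm0: 0<gm := gain_gt0 n0 p1.
pose m' := m+gm/2; have m'1: 1<=m' by rewrite /m'; lra. have T00: 0<T0 by lra. pose Q: R := 2`^(- (gm/2)).
have Q0: 0<=Q by exact: powR_ge0. have Q1 : Q<1.
 have hs: 1`^(gm/2)<2`^(gm/2) :> R by apply: gt0_ltr_powR; rewrite ?nnegrE ?ltr1n// divr_gt0.
 by move: hs; rewrite /Q powRN invf_lt1 ?powR_gt0// powR1.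
pose Cs:= 4*expR 1*(8`^(m' - 1)*Ct). have e0: 0<4*expR 1 :> R by nneg.
have Cs0: 0<=Cs by rewrite /Cs; apply: mulr_ge0 (ltW e0) _; apply: mulr_ge0 (powR_ge0 _ _) (ltW Ct0).
exists ((4*T0)`^m'*(2*r)^+n+(Cs*(1-Q)^-1+1)).
 have r2: 0<=2*r by lra. have x0 := mulr_ge0 (powR_ge0 (4*T0) m') (exprn_ge0 n r2).
 have y0: 0<=Cs*(1-Q)^-1 by rewrite mulr_ge0// invr_ge0 subr_ge0 ltW.
 by apply: (lt_le_trans ltr01); rewrite addrA lerDr addr_ge0.
move=> H H0 rH. have H15 : r+H<=15 by lra. have [S S0 hS] := grad_sup (n:=n) La p1 H0 H15.
have H15' : r+h1+2*H<=15 by rewrite /h1; lra. have [S2 S20 hS2] := hess_sup H0 H15'.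
have [J hJ]: exists J: nat, S<=4*(2^+J*T0).
 exists (Num.bound S); apply: (le_trans (ltW (archi_boundP S0))).
 apply: (@le_trans _ _ (2^+Num.bound S)); first by rewrite -natrX ler_nat ltnW// ltn_expl.
 have y0: 0<=2^+Num.bound S :> R by nneg.
 apply: (@le_trans _ _ (2^+Num.bound S*T0)); first by rewrite ler_peMr.
 by rewrite ler_peMl ?ler1n// mulr_ge0// ltW.
pose T:= 2^+J*T0. have T0T : T0<=T by rewrite /T ler_peMl ?exprn_ege1 ?ler1n ?(ltW T00). have T0': 0<T by lra.
(* Steps up to [2 kap] are admissible in the tail bound at every level up to [T], and so short that
   second derivatives, bounded by [S2], separate the derivative from the quotient by at most [1]. *)
pose kap:= Num.min (hscale (n:=n) c0 T/2) (2*(S2+1))^-1. have kap0: 0<kap.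
 by rewrite lt_min divr_gt0 ?hscale_gt0// invr_gt0 mulr_gt0// ltr_wpDl.
pose A:= 4*expR 1*(8*T)`^(m' - 1). have A0: 0<=A by apply: mulr_ge0 (ltW e0) (powR_ge0 _ _).
pose th:= 1/(J%:R*A+1). have JA: 0<=J%:R*A by nneg. have th0: 0<th by exact: frac_gt0.
have hth : J%:R*A*th<=1 by exact: frac_le. have [d1 [d10 d11] hd] := ht T kap th T0T kap0 th0.
exists (Num.min d1 kap); first by rewrite lt_min d10.
move=> d eps mu g b F v; rewrite le_min=> /andP[dd1 dk] D av i. have d1' : d<=1 by exact: le_trans d11.
have [sv vv _] := av. have /andP[ep0 ed] := cd_eps D.
(* A multiple of the period between [kap] and [2 kap]; it exists because [eps <= d <= kap]. *)
have [N N0 [Nk1 Nk2]] := lattice_scale ep0 (le_trans ed dk). set k:= eps*N%:R in Nk1 Nk2.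
have k0: 0<k by exact: lt_le_trans Nk1. have kT : k<=hscale (n:=n) c0 T.
 apply: (le_trans Nk2); rewrite mulrC -ler_pdivlMr//; by rewrite /kap ge_min lexx.
have kS : S2*k<=1.
 have: k<=2*(2*(S2+1))^-1.
  by apply: (le_trans Nk2); rewrite ler_pM2l// /kap ge_min lexx orbT.
 rewrite invfM mulrA divff ?mul1r// => kk.
 apply: (le_trans (ler_wpM2l S20 kk)); rewrite ler_pdivrMr ?mul1r ?lerDl//. by rewrite ltr_wpDl.
have kh1 : k<=h1 by exact: le_trans kT (hb _ T0T). have lt017 : (0: R)<17 by lra.
have iv : itg v := smooth_itg lt017 sv vv. have sm : smooth (moll H v) := smooth_moll H0 iv.
pose tj j:= 2^+j*T0. have tj1 j : T0<=tj j by rewrite /tj ler_peMl ?exprn_ege1 ?ler1n ?(ltW T00).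
have tj0 j: 0<tj j by exact: lt_le_trans (tj1 j). have tjT j : (j<J)%N -> tj j<=T.
 move=> jJ; apply: (ler_wpM2r (ltW T00)); apply: ler_weXn2l; last exact: ltnW. by rewrite ler1n.
pose W j:= fun x=> trunc (tj j) (fdiff i k v x). pose Z j:= moll H (W j).
have sW j : smooth (W j) by exact: smooth_trunc (smooth_fdiff i k sv).
have W0 j x: 0<=W j x by exact: trunc_ge0. have vW j : vanish (17+k) (W j).
 move=> x hx; rewrite /W (vanish_fdiff i (ltW k0) vv hx) trunc_below// ltW//.
have iW j : itg (W j) by apply: (smooth_itg _ (sW j) (vW j)); rewrite addr_gt0.
have Z0 j x: 0<=Z j x by exact: moll_ge0.
have uZ j : (j<J)%N -> ub (fun x=> B0 r x*Z j x) (Ct*tj j`^(1-m-gm)+th).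
 move=> jJ; apply: (@ub_moll1 _ _ H (W j) r ra)=> //.
 - exact: cont_bor (smooth_cont (sW j)).
 - by rewrite /ra /h1; lra. apply: (hd d eps mu g b F v dd1 D av i k (tj j) N)=> //; first exact: tjT.
 apply: (le_trans kT); rewrite /hscale ler_pM2l//; apply: le_pow_neg (tj0 j) (tjT j jJ).
 nneg; apply: mulr_ge0; exact: ler0n.
have mZ j : mble (Z j) by apply: mble_cont; apply: smooth_cont; exact: smooth_moll.
pose a j:= 4*expR 1*(8*tj j)`^(m' - 1). have a0 j: 0<=a j by apply: mulr_ge0 (ltW e0) (powR_ge0 _ _).
have uS : ub (fun x=> \sum_(j<J) a j*(B0 r x*Z j x)) (\sum_(j<J) a j*(Ct*tj j`^(1-m-gm)+th)).
 by apply: ub_sum=> j; apply: ubZ=> //; exact: uZ.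
have uA := ubD (ubZ (powR_ge0 (4*T0) m') (ub_ball (0: E) r0)) uS.
apply: (ub_cle _ (ub_fle _ _ _ uA))=> [||x|x].
- rewrite lerD2l; apply: (@sum_split A Cs th Q a (fun j=> Ct*tj j`^(1-m-gm)))=> //.
 + exact: ltW.
 + move=> j _; rewrite /a /Cs -!(mulrA (4*expR 1)); apply: ler_wpM2l; first exact: ltW.
  rewrite powRM ?(ltW (tj0 j))// -!mulrA; apply: ler_wpM2l; first nneg.
  rewrite mulrCA; apply: ler_wpM2l; first exact: ltW. rewrite -powRD ?(gt_eqF (tj0 j)) ?implybT//.
  have ->: m' - 1+(1-m-gm) = - (gm/2) by rewrite /m'; field. rewrite /Q powR_exprn.
  apply: le_pow_neg; [nneg|nneg|]. by rewrite /tj ler_peMr// exprn_ge0.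
 + move=> j jJ; rewrite /a /A ler_wpM2l ?(ltW e0)//; apply: le_pow.
  * lra. * by nneg. * by rewrite ler_pM2l// tjT.
- apply: mbleM; first mbl.
 by apply: mble_powR; apply: mble_max (mble_cst _); apply: mble_cont; mbl.
- by rewrite mulr_ge0 ?powR_ge0. have [xr|xr] := pselect (ball (0: E) r x); last first.
 rewrite indic_out// !mul0r mulr0 add0r sumr_ge0// => j _. nneg.
rewrite indic_in// !mul1r mulr1. under eq_bigr=> j _ do rewrite mul1r.
apply: (@level_sum _ m' T0 _ (fun j=> Z j x) J)=> //.
- by rewrite le_max lexx orbT.
- rewrite ge_max; apply/andP; split; last nneg.
 apply: le_trans hJ; apply: (le_trans (ler_norm _)). mbl.
move=> j jJ; rewrite ge_max; apply/andP; split; last first.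
 nneg.
have l1 : partial i (moll H v) x<=fdiff i k (moll H v) x+S2*k.
 apply: (partial_le_fdiff sm k0 xr)=> y yr; apply: (hS2 d eps mu g b F v d1' D av i i y).
 by apply: le_ball yr; rewrite lerD2l.
have l2 := moll_trunc i x H0 lt017 (ltW k0) (tj0 j) sv vv.
rewrite -addrA addrC; apply: (le_trans l1); exact: lerD l2 kS.
Qed.

Lemma moment_step m: p<=m -> moment (n:=n) p La m -> moment (n:=n) p La (m+gain (n:=n) p/2).
move=> pm Pm r r0 r13; have [C C0 hC] := moment_pos pm Pm r0 r13. exists (C+C); first nneg.
move=> H H0 rH; have [d0 d00 hd] := hC H H0 rH; exists d0=> //.
move=> d eps mu g b F v dd D av i; have lt017 : (0: R)<17 by lra.
have [sv vv _] := av; have iv : itg v := smooth_itg lt017 sv vv.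
have sm : smooth (moll H v) := smooth_moll H0 iv. have u1 := hd _ _ _ _ _ _ _ dd D av i.
have u2 := hd _ _ _ _ _ _ _ dd (cell_data_neg p1 La1 D) (apx_neg av) i.
apply: (ub_fle _ _ _ (ubD u1 u2))=> [|x|x].
- mbl.
- nneg. rewrite moll_neg// -mulrDr; apply: ler_wpM2l; first nneg.
have ->: partial i (fun x=> - moll H v x) x = - partial i (moll H v) x.
 have ->: (fun x=> - moll H v x) = (fun x=> -1 * moll H v x) by apply: funext=> y; rewrite mulN1r.
 by rewrite partialZ// mulN1r.
set y:= partial i (moll H v) x; have [y0|y0] := leP 0 y.
 by rewrite ger0_norm// lerDl powR_ge0.
have ->: Num.max (- y) 0 = - y by apply: max_l; rewrite oppr_ge0 ltW.
by rewrite ltr0_norm// -[X in X<=_]add0r lerD2r powR_ge0.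
Qed.

(** The increment of the exponent does not depend on [m], so finitely many steps pass any [M]. *)
Lemma moment_all M: exists2 m, M<=m & p<=m /\ moment (n:=n) p La m.
have gm0: 0<gain (n:=n) p/2 by rewrite divr_gt0// gain_gt0.
suff h j: p<=p+j%:R*(gain (n:=n) p/2) /\ moment (n:=n) p La (p+j%:R*(gain (n:=n) p/2)).
 have [j hj]: exists j: nat, M<=j%:R*(gain (n:=n) p/2).
  exists (Num.bound (`|M| / (gain (n:=n) p/2))); apply: (le_trans (ler_norm M)).
  rewrite -ler_pdivrMr//; apply: ltW; apply: archi_boundP. nneg.
 exists (p+j%:R*(gain (n:=n) p/2))=> //. by apply: (le_trans hj); rewrite lerDr (le_trans ler01)// ltW.
elim: j=> [|j [IH1 IH2]].
 by rewrite mul0r addr0; split=> //; apply: moment_base.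
split; first by rewrite lerDl mulr_ge0// ltW. rewrite -addn1 natrD mulrDl mul1r addrA; exact: moment_step.
Qed.

End MomentStep.

(** * Vitali covering by cubes *)

Section Covering.
Context {R: realType} {n: nat}.
Notation E := 'rV[R]_n.
Notation leb := (@lebesgue R n).
Implicit Types (S: set E) (r: E -> R) (s: seq E) (c M k: R).

(** Disjointness of the cubes, in the form that integrates to a bound on the sum of their
    volumes. *)
Definition packed r s:= forall z, \sum_(x <- s) (\1_(ball x (r x)) z: R)<=1.

Lemma packed_count r s k M: 0<k -> 0<M -> (forall x, x \in s -> k<=r x) ->
 (forall x, x \in s -> ball x (r x) `<=` ball (0: E) M) -> packed r s -> (size s)%:R*(2*k)^+n<=(2*M)^+n.
move=> k0 M0 hr hM hp. have hs : ub (fun z=> \sum_(x <- s) \1_(ball x k) z) ((2*M)^+n).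
 apply: (ub_fle _ _ _ (ub_ball (0: E) M0))=> [|z|z].
 - mbl.
 - nneg. have [zM|zM] := pselect (ball (0: E) M z).
  rewrite [leRHS]indic_in//; apply: (le_trans _ (hp z)). rewrite !big_seq; apply: ler_sum=> x xs.
  have [zx|zx] := pselect (ball x k z); last by rewrite [leLHS]indic_out// indic_ge0.
  by rewrite [leRHS]indic_in ?indic_le1//; apply: le_ball zx; exact: hr.
 rewrite [leRHS]indic_out// big_seq big1// => x xs; apply: indic_out=> zx.
 by apply: zM; apply: (hM x xs); apply: le_ball zx; exact: hr.
have e : (\int[leb]_z (\sum_(x <- s) \1_(ball x k) z)%:E = ((size s)%:R*(2*k)^+n)%:E)%E.
 elim: s {hr hM hp hs} => [|x s IH].
  under eq_integral do rewrite big_nil. by rewrite mul0r integral0.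
 under eq_integral do rewrite big_cons. rewrite intEFD.
 - pose V: R := (2*k)^+n.
  have ->: (size (x :: s))%:R*V = V+(size s)%:R*V by rewrite -natr1 mulrDl mul1r addrC.
  rewrite IH EFinD; congr (_+_)%E. have mb := mbl_lball x k.
  rewrite (integral_indic (@lebesgue R n) measurableT mb) setIT; exact: (leb_ball x k0).
 - exact: mble_ball.
 - by apply: mble_sum=> y; mbl.
 - by [].
 - by move=> z; apply: sumr_ge0=> y _; nneg.
by case: hs=> _ _; rewrite e lee_fin.
Qed.

(* Greedy selection: the first ball chosen has at least half of the largest
  radius, so that its triple covers every ball meeting it. *)
Lemma greedy_cover (N: nat) S r M: (forall x, S x -> 0<r x<=M) ->
 (forall s, (forall x, x \in s -> S x) -> packed r s -> (size s<=N)%N) ->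
 exists s, [/\ forall x, x \in s -> S x, packed r s & forall y, S y -> exists2 x, x \in s & ball x (3*r x) y].
elim: N S=> [|N IH] S hr hN.
 exists [::]; split=> // [z|y Sy]; first by rewrite big_nil. suff: (1<=0)%N by [].
 apply: (hN [:: y])=> [x|z]; first by rewrite inE=> /eqP ->. by rewrite big_seq1 indic_le1.
have [[x0 Sx0]|nS] := pselect (exists x, S x); last first.
 by exists [::]; split=> // [z|y Sy]; [rewrite big_nil|case: nS; exists y].
have hsup : has_sup (r @` S).
 split; first by exists (r x0), x0. by exists M=> _ [x Sx <-]; case/andP: (hr x Sx).
have s0: 0<sup (r @` S).
 have /andP[rx0 _] := hr _ Sx0; apply: (lt_le_trans rx0). by apply: ub_le_sup; [exact: hsup.2|exists x0].
have [_ [x Sx <-] xs]: exists2 y, (r @` S) y & sup (r @` S)/2<y.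
 by apply: sup_gt; [exact: hsup.1 | rewrite ltr_pdivrMr// ltr_pMr// ltr1n].
have half y : S y -> r y<=2*r x.
 move=> Sy; have: r y<=sup (r @` S) by apply: ub_le_sup; [exact: hsup.2|exists y].
 by move: xs; rewrite ltr_pdivrMr// => xs hy; lra.
pose S' := [set y | S y /\ ball x (r x) `&` ball y (r y) = set0]. have [||s [h1 h2 h3]] := IH S'.
- by move=> y [Sy _]; exact: hr.
- move=> s hs ps; have := hN (x :: s); rewrite /= ltnS; apply.
  by move=> y; rewrite inE=> /orP[/eqP->//|/hs[]].
 move=> z; rewrite big_cons; have [zx|zx] := pselect (ball x (r x) z).
  rewrite [X in X+_]indic_in// big_seq big1 ?addr0// => y /hs[_ dy].
  by apply: indic_out=> zy; have: set0 z by rewrite -dy.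
 by rewrite [X in X+_]indic_out// add0r.
exists (x :: s); split.
- by move=> y; rewrite inE=> /orP[/eqP->//|/h1[]].
- move=> z; rewrite big_cons; have [zx|zx] := pselect (ball x (r x) z).
  rewrite [X in X+_]indic_in// big_seq big1 ?addr0// => y /h1[_ dy].
  by apply: indic_out=> zy; have: set0 z by rewrite -dy.
 by rewrite [X in X+_]indic_out// add0r; exact: h2.
move=> y Sy; have [d|d] := pselect (ball x (r x) `&` ball y (r y) = set0).
 by have [z zs hz] := h3 y (conj Sy d); exists z=> //; rewrite inE zs orbT.
exists x; first by rewrite inE eqxx.
have [z [zx zy]]: ball x (r x) `&` ball y (r y) !=set0 by apply/set0P/eqP.
have: ball x (r x+r y) y by apply: ball_triangle zx _; exact: ball_sym.
by apply: le_ball; have := half y Sy; lra.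
Qed.

(** With radii at least [k] in a bounded region, comparison of volumes bounds the number of disjoint
    cubes, so the greedy selection stops. *)
Lemma finite_cover S r k M: 0<k -> 0<M -> (forall x, S x -> k<=r x<=M) ->
 (forall x, S x -> ball x (r x) `<=` ball (0: E) M) -> exists s, [/\ forall x, x \in s -> S x, packed r s &
  forall y, S y -> exists2 x, x \in s & ball x (3*r x) y].
move=> k0 M0 hr hM. apply: (@greedy_cover (Num.bound ((M/k)^+n)) S r M)=> [x /hr/andP[h1 h2]|s hs ps].
 by rewrite h2 (lt_le_trans k0).
have := packed_count k0 M0 (fun x xs=> proj1 (andP (hr x (hs x xs)))) (fun x xs=> hM x (hs x xs)) ps.
rewrite -ler_pdivlMr ?exprn_gt0 ?mulr_gt0// -expr_div_n -mulf_div divff ?mul1r// => h.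
rewrite -(ler_nat R); apply: (le_trans h); apply: ltW; apply: archi_boundP. nneg.
Qed.

(* [leb] is an outer measure on all subsets, so no measurability is needed. *)
Lemma leb_cover (I: eqType) (s: seq I) (T: I -> set E) (A: set E) (c: I -> R) :
 (forall y, A y -> exists2 x, x \in s & T x y) ->
 (forall x, x \in s -> (leb (T x)<=(c x)%:E)%E) -> (leb A<=(\sum_(x <- s) c x)%:E)%E.
elim: s A=> [|x s IH] A hA hT.
 rewrite big_nil (_: A = set0) ?measure0//; apply/seteqP; split=> // y /hA[]. by [].
rewrite big_cons EFinD; pose A' := A `\` T x. have l1 : (leb A' <= (\sum_(x <- s) c x)%:E)%E.
 apply: IH=> [y [Ay nT]|y ys]; last by apply: hT; rewrite inE ys orbT.
 have [z] := hA y Ay; rewrite inE=> /orP[/eqP -> //|zs Tz]; by exists z.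
apply: (@le_trans _ _ (leb (T x)+leb A')%E); last first.
 by apply: leeD=> //; apply: hT; rewrite inE eqxx.
apply: (@le_trans _ _ (lebesgue_outer (T x `|` A'))).
 apply: le_lebesgue_outer=> y Ay. by have [h|h] := pselect (T x y); [left|right].
exact: (outer_measureU2 (@lebesgue_outer R n)).
Qed.

End Covering.

(** * Gradient differences along small lattice vectors *)

Section NikolskiiReal.
Context {R: realType}.

Lemma nik_alg (C2 La f0 eta mq D D1 D2 Dphi DF Sp ep FF k1 C1 k2 C3 q c2 dg: R) : 0<=eta -> 0<La -> 0<=C2 ->
 eta*dg<=C2*(eta * mq)+c2*Sp -> mq<=La*D -> eta*D = Dphi-D1-D2 -> Dphi = f0+DF ->
 `|D1| + `|D2|<=2*La*(k1*Sp+C1*ep) -> `|DF|<=k2*(q*Sp+ep)+C3*FF ->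
 eta*dg<=C2*La*f0+(C2*La*(2*La*(k1*Sp+C1*ep)+(k2*(q*Sp+ep)+C3*FF))+c2*Sp).
move=> e0 L0 C20 h1 h2 h3 h4 h5 h6.
have n1 := ler_norm (- D1); have n2 := ler_norm (- D2); have n3 := ler_norm DF.
rewrite normrN in n1; rewrite normrN in n2.
have l1 : eta * mq<=La*(f0+(2*La*(k1*Sp+C1*ep)+(k2*(q*Sp+ep)+C3*FF))).
 apply: (le_trans (ler_wpM2l e0 h2)); rewrite mulrCA h3 h4; apply: ler_wpM2l; first exact: ltW.
 move: h5 h6 n1 n2 n3; move: `|D1| `|D2| `|DF| (2*La*_) (k2*_+_)=> z1 z2 z3 z4 z5; lra.
have l2 := ler_wpM2l C20 l1. apply: (le_trans h1); rewrite addrA lerD2r -mulrDr -mulrA; exact: l2.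
Qed.

Lemma nik_sum (A0 La k1 k2 q SS th c2 C1 C3 EE e0 e1 t H qF d: R) :
 A0*(2*La)*SS*k1<=th/8 -> A0*q*SS*k2<=th/8 -> SS*c2<=th/8 -> EE<=e0*t+e1*H ->
 (A0*(2*La*C1+k2))*e0*t<=th/8 -> (A0*(2*La*C1+k2))*e1*H<=th/8 ->
 0<=A0*(2*La*C1+k2) -> A0*(C3*qF)*d<=th/8 -> 0<th ->
 A0*(2*La*(k1*SS+C1*EE)+(k2*(q*SS+EE)+C3*(qF*d)))+c2*SS<=th.
move=> h1 h2 h3 h4 h5 h6 h7 h8 t0; have := ler_wpM2l h7 h4; lra.
Qed.

End NikolskiiReal.

Section Nikolskii.
Context {R: realType} {n: nat} (n0: (0<n)%N) (p La: R) (p1: 1<p) (La1: 1<=La).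
Notation E := 'rV[R]_n.
Notation B0 r := (\1_(ball (0 : E) r) : E -> R).
Implicit Types (v w: E -> R) (g b F: E -> E) (i: 'I_n) (d eps mu t H K c r th k: R).

Let dot_lin (x y z k: E) (a c: R) : a*dot x y = dot x (a *: (y+z)+c *: k)-a*dot x z-c*dot x k.
Proof. by rewrite dotDr !dotZr dotDr; ring. Qed.

(* Differences of the gradient over small lattice vectors: the monotonicity of
  the flux is tested with the corresponding difference of the solution. *)
Lemma lattice_differences th: 0<th -> exists2 h1: R, 0<h1 /\ h1<=1 & exists2 d0: R, 0<d0 /\ d0<=1 &
 forall d eps mu g b F, d<=d0 -> cell_data p La d eps mu g b F ->
 forall z: 'rV[int]_n, let h := eps *: map_mx intr z in `|h|<=h1 ->
 ub (fun x=> B0 12 x*enorm (g (x+h)-g x)`^p) th.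
have p1' := p1; have La1' := La1; move=> th0; have p0: 0<=p by lra.
have L0: 0<La by lra. have lt017 : (0: R)<17 by lra.
have lt1316 : (13: R)<16 by lra. have lt1416 : (14: R)<16 by lra.
have le1315 : (13: R)<=15 by lra. have le1415 : (14: R)<=15 by lra.
have le1316 : (13: R)<=16 by lra. have le1416 : (14: R)<=16 by lra.
have n1413: 1<=14-13 :> R by lra. have n1613: 1<=16-13 :> R by lra. have p10: 0<=p-1 by lra.
have th8: 0<th/8 by nneg. have lt1213 : (12: R)<25/2 by lra. have lt013 : (0: R)<25/2 by lra.
have le2513 : (25/2: R)<=13 by lra. have lt2513 : (25/2: R)<13 by lra.
have [eta [seta veta' eta0 eta1]] := exists_cutoff (n:=n) lt013 lt1213. have veta := vanishW le2513 veta'.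
have [K [K0 etaA etaK _]] := smooth_bounds seta veta.
pose NN:= n%:R`^p: R; have NN0: 0<=NN by exact: powR_ge0.
pose P2:= 2`^p: R; have P20: 0<=P2 by exact: powR_ge0.
pose SS:= P2*(1+1): R; have SS0: 0<=SS by apply: mulr_ge0. pose c2:= th/8/(K*SS+1); have KS0: 0<=K*SS by nneg.
have c20: 0<c2 by exact: frac_gt0. have [C2 C20 hC2] := monq_bound2 p1 c20.
pose A0:= C2*La; have A00: 0<A0 by exact: mulr_gt0. pose q1:= A0*(2*La)*SS. have q10: 0<=q1 by nneg.
pose k1:= th/8/(q1+1); have k10: 0<k1 by exact: frac_gt0. have [C1 C10 hC1] := @young1 R p k1 p1 k10.
pose qq:= (K*n%:R)`^p. have qq0: 0<=qq by exact: powR_ge0. pose q2:= A0*qq*SS. have q20: 0<=q2 by nneg.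
pose k2:= th/8/(q2+1); have k20: 0<k2 by exact: frac_gt0.
pose k2' := k2/P2; have P2g: 0<P2 by exact: powR_gt0. have k2'0: 0<k2' by exact: divr_gt0.
have [C3 C30 hC3] := @young R p k2' p1 k2'0.
pose pc:= p/(p-1). have pc0: 0<=pc by apply: ltW; exact: conj_pos.
pose qF:= 2`^pc*2: R. have qF0: 0<=qF by rewrite mulr_ge0 ?powR_ge0. pose eA:= P2*(K`^p*(P2*(NN*(n%:R*2)))).
have eA0: 0<=eA by do ![apply: mulr_ge0|exact: powR_ge0|done].
pose eB:= P2*((n%:R*K)`^p*(NN*(n%:R*(P2*(P2*2))))).
have eB0: 0<=eB by do ![apply: mulr_ge0|exact: powR_ge0|done].
pose Ec:= A0*(2*La*C1+k2). have Ec0: 0<=Ec by nneg. have EeA: 0<=Ec*eA by exact: mulr_ge0.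
(* [t] controls the approximation of [g] and [h1] the product of the cutoff slope with
   [v(x+h) - v(x)], which is of order [|h|] in [L^p]; each is allotted an eighth of [th]. *)
have EeB: 0<=Ec*eB by exact: mulr_ge0. pose t:= Num.min 1 (th/8/(Ec*eA+1)).
have t0: 0<t by rewrite lt_min ltr01 frac_gt0. pose Hp:= th/8/(Ec*eB+1); have Hp0: 0<Hp by exact: frac_gt0.
pose h1:= Num.min 1 (Hp`^p^-1). have h10: 0<h1 by rewrite lt_min ltr01 powR_gt0. have h1p : h1`^p<=Hp.
 apply: (@le_trans _ _ ((Hp`^p^-1)`^p)).
  by apply: le_pow=> //; [exact: ltW|rewrite /h1 ge_min lexx orbT].
 by rewrite -powRrM mulVf ?powRr1 ?(ltW Hp0)// gt_eqF//; lra.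
have qd0: 0<=A0*(C3*qF) by nneg. exists h1; first by split=> //; rewrite /h1 ge_min lexx.
exists (Num.min 1 (th/8/(A0*(C3*qF)+1))).
 by rewrite lt_min ltr01 frac_gt0// ge_min lexx.
move=> d eps mu g b F; rewrite le_min=> /andP[d1 dq] D z h hh.
have [v av] := cd_apx D t0; have [sv vv apv] := av. have t1 : t<=1 by rewrite /t ge_min lexx.
have hle1 : `|h|<=1 by apply: (le_trans hh); rewrite /h1 ge_min lexx. pose w x:= v (x+h)-v x.
have svh : smooth (fun x=> v (x+h)) := smooth_shift h sv. have sw : smooth w := smoothB svh sv.
pose phi x:= eta x*w x. have sphi : smooth phi := smoothM seta sw.
have vphi : vanish 13 phi by move=> x nx; rewrite /phi veta// mul0r. pose phi' x:= phi (x + - h).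
have sphi' : smooth phi' := smooth_shift (- h) sphi. have vphi' : vanish 14 phi'.
 move=> x nx; apply: vphi=> hx; apply: nx; rewrite -(subrK h x). by apply: (ballD hx); exact: le_trans n1413.
pose W x:= dot (b x) (grad phi x)-dot (F x) (grad phi x).
pose W' x:= dot (b x) (grad phi' x)-dot (F x) (grad phi' x).
have iW : itg W := data_itg p1 La1 D sphi lt1316 vphi.
have iW' : itg W' := data_itg p1 La1 D sphi' lt1416 vphi'.
have iWh : itg (fun x=> W' (x+h)) := itg_shift h iW'. pose f0 x:= W' (x+h)-W x.
have if0 : itg f0 := itgB iWh iW. have zf0 : integ f0 = 0.
 have e1 : integ f0 = integ (fun x=> W' (x+h))-integ W := integB iWh iW.
 have e2 : integ (fun x=> W' (x+h)) = integ W' := integ_shift h iW'.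
 have e3 : integ W' = 0 := cd_eq D sphi' lt1416 vphi'. have e4 : integ W = 0 := cd_eq D sphi lt1316 vphi.
 exact: (etrans e1 (etrans (f_equal2 (fun a1 a2=> a1-a2) (etrans e2 e3) e4) (subr0 (0: R)))).
have gphi' x : grad phi' (x+h) = grad phi x.
 by apply/rowP=> j; rewrite !mxE (partial_shift _ _ _ sphi) addrK.
have f0E x : dot (b (x+h)-b x) (grad phi x) = f0 x+dot (F (x+h)-F x) (grad phi x).
 rewrite /f0 /W /W' gphi' !dotBl; set z1:= dot _ _; set z2:= dot _ _; set z3:= dot _ _; set z4:= dot _ _.
 by ring.
pose gw x:= grad v (x+h)-grad v x. have gphiE x : grad phi x = eta x *: gw x+w x *: grad eta x.
 apply/rowP=> j; rewrite !mxE /phi (partialM j x seta sw) addrC [RHS]addrC; congr (_+_).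
 by rewrite /w (partialB j x svh sv) (partial_shift _ _ _ sv).
pose G x:= (mu+enorm (g x))`^p. have mG : mble G by apply: mble_powR; exact: mbleG D.
have G0 x: 0<=G x by exact: powR_ge0. have mvg j : mble (fun x=> `|partial j v x-g x 0 j| `^ p).
 apply: mble_powR; apply: mble_norm; apply: mbleB; last exact: cd_mg D j.
 by apply: mble_cont; exact: smooth_cont (smooth_d j sv).
have vg0 j x: 0<=`|partial j v x-g x 0 j| `^ p by exact: powR_ge0.
have hr : `|h|<=14-13 := le_trans hle1 n1413.
pose EE x:= \sum_j (`|partial j v x-g x 0 j| `^ p + `|partial j v (x+h)-g (x+h) 0 j| `^ p).
have uEE : ub (fun x=> B0 13 x*EE x) (n%:R*(t+t)).
 rewrite -sum_cst; apply: (@ub_eq _ _ (fun x=> \sum_j (B0 13 x * `|partial j v x-g x 0 j| `^ p +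
   B0 13 x * `|partial j v (x+h)-g (x+h) 0 j| `^ p))).
  by move=> x; rewrite /EE mulr_sumr; apply: eq_bigr=> j _; rewrite mulrDr.
 apply: ub_sum=> j; apply: ubD; first exact: (ubBW le1315 (mvg j) (vg0 j) (apv j)).
 exact: (ub_ballD hr (vg0 j) (mvg j) (ubBW le1415 (mvg j) (vg0 j) (apv j))).
have EE0 x: 0<=EE x by rewrite sumr_ge0// => j _; rewrite addr_ge0. pose Sp x:= P2*(G x+G (x+h)).
have uS : ub (fun x=> B0 13 x*Sp x) SS.
 apply: (@ub_eq _ _ (fun x=> P2*(B0 13 x*G x+B0 13 x*G (x+h)))).
  by move=> x; rewrite /Sp -mulrDr mulrCA.
 apply: (ubZ P20); apply: ubD; first exact: (ubBW le1316 mG G0 (cd_G D)).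
 exact: (ub_ballD hr G0 mG (ubBW le1416 mG G0 (cd_G D))).
pose FF x:= enorm (F x)`^pc. have mFF : mble FF by apply: mble_powR; exact: mble_enorm (cd_mF D).
have FF0 x: 0<=FF x by exact: powR_ge0. have uFF : ub (fun x=> B0 13 x*(2`^pc*(FF x+FF (x+h)))) (qF*d).
 have ->: qF*d = 2`^pc*(d+d) by rewrite /qF; ring.
 apply: (@ub_eq _ _ (fun x=> 2`^pc*(B0 13 x*FF x+B0 13 x*FF (x+h)))).
  by move=> x; rewrite -mulrDr mulrCA.
 apply: (ubZ (powR_ge0 _ _)); apply: ubD; first exact: (ubBW le1316 mFF FF0 (cd_FF D)).
 exact: (ub_ballD hr FF0 mFF (ubBW le1416 mFF FF0 (cd_FF D))).
have uw : ub (fun x=> B0 13 x * `|w x| `^ p) (NN*(n%:R*(P2*(`|h| `^ p*(P2*2))))).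
 apply: (@translate_ball R n v 17 p 13 14 h (P2*2))=> //; first exact: ltW.
 move=> i; apply: (ubBW le1415 _ _ (apx_bound p1 D av t1 i))=> [|x]; last exact: powR_ge0.
 by apply: mble_powR; apply: mble_norm; apply: mble_cont; exact: smooth_cont (smooth_d i sv).
pose ep x:= P2*(K`^p*(P2*(NN*EE x))+(n%:R*K)`^p * `|w x| `^ p).
have Kp0: 0<=K`^p := powR_ge0 _ _. have nKp0: 0<=(n%:R*K)`^p := powR_ge0 _ _.
have uep : ub (fun x=> B0 13 x*ep x) (eA*t+eB*h1`^p).
 have u := ubZ P20 (ubD (ubZ Kp0 (ubZ P20 (ubZ NN0 uEE))) (ubZ nKp0 uw)).
 apply: (ub_cle _ (ub_eq _ u))=> [|x]; last first.
  rewrite /ep; move: (B0 13 x) (EE x) (`|w x| `^ p)=> z1 z2 z3; ring.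
 have hp : `|h| `^ p<=h1`^p by apply: le_pow.
 have l := ler_wpM2l eB0 hp; apply: le_trans (lerD (lexx (eA*t)) l).
 by rewrite le_eqVlt; apply/orP; left; apply/eqP; rewrite /eA /eB; ring.
pose rest x:= A0*(2*La*(k1*Sp x+C1*ep x)+(k2*(qq*Sp x+ep x)+C3*(2`^pc*(FF x+FF (x+h))))) + K*c2*Sp x.
have urest : ub (fun x=> B0 13 x*rest x) th.
 have uL := ubZ (mulr_ge0 (ler0n R 2) (ltW L0)) (ubD (ubZ (ltW k10) uS) (ubZ (ltW C10) uep)).
 have uR := ubD (ubZ (ltW k20) (ubD (ubZ qq0 uS) uep)) (ubZ (ltW C30) uFF).
 have u := ubD (ubZ (ltW A00) (ubD uL uR)) (ubZ (mulr_ge0 K0 (ltW c20)) uS).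
 apply: (ub_cle _ (ub_eq _ u))=> [|x]; last first.
  rewrite /rest; move: (B0 13 x) (Sp x) (ep x) (FF x) (FF (x+h))=> z1 z2 z3 z4 z5; ring.
 apply: (nik_sum (e0 := eA) (e1 := eB) (t := t) (H := h1`^p))=> //.
 - exact: frac_le.
 - exact: frac_le.
 - by rewrite (mulrC SS) mulrAC; exact: frac_le.
 - apply: (@le_trans _ _ (Ec*eA*(th/8/(Ec*eA+1)))); last exact: frac_le.
  by apply: ler_wpM2l=> //; rewrite /t ge_min lexx orbT.
 - apply: (@le_trans _ _ (Ec*eB*(th/8/(Ec*eB+1)))); last exact: frac_le.
  exact: ler_wpM2l.
 - apply: (@le_trans _ _ (A0*(C3*qF)*(th/8/(A0*(C3*qF)+1)))); last exact: frac_le.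
  exact: ler_wpM2l.
have pt x : eta x*enorm (g (x+h)-g x)`^p<=A0*f0 x+B0 13 x*rest x.
 have [xa|xa] := pselect (ball (0: E) 13 x); last first.
  have z0 (y: E): dot y 0 = 0 :> R by rewrite /dot big1// => j _; rewrite mxE mulr0. have f00 : f0 x = 0.
   have etan : eta x = 0 by exact: veta. have gz : grad phi x = 0.
    by apply/rowP=> j; rewrite gphiE etan scale0r add0r !mxE (vanish_d j lt2513 veta') ?mulr0.
   by have := f0E x; rewrite gz !z0 addr0.
  by rewrite veta// mul0r f00 mulr0 add0r indic_out// mul0r.
 have xk : ball (0: E) 16 (x+h) by apply: (ballD xa); exact: le_trans n1613.
 have x16 : ball (0: E) 16 x by apply: le_ball xa. rewrite [X in X*rest _]indic_in// mul1r.
 have mono := cd_mono D x16 xk. pose db:= b (x+h)-b x; pose dg:= g (x+h)-g x.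
 pose y1:= grad v (x+h)-g (x+h); pose y0:= grad v x-g x. have gwE : gw x = dg+(y1-y0).
  rewrite /gw /dg /y1 /y0; move: (g (x+h)) (g x) (grad v (x+h)) (grad v x)=> z1 z2 z3 z4.
  by apply/rowP=> j; rewrite !mxE; ring.
 have DE : eta x*dot db dg = dot db (grad phi x)-eta x*dot db (y1-y0)-w x*dot db (grad eta x).
  rewrite gphiE gwE; exact: dot_lin.
 pose S:= mu+enorm (g x)+enorm (g (x+h)). have /andP[mu0 mu1] := cd_mu D.
 have S0: 0<=S by rewrite !addr_ge0 ?enorm_ge0. have S1 : mu+enorm (g x)<=S by rewrite lerDl enorm_ge0.
 have S2 : mu+enorm (g (x+h))<=S by rewrite /S addrAC lerDl enorm_ge0. have SSp : S`^p<=Sp x.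
  apply: (@le_trans _ _ (((mu+enorm (g x))+(mu+enorm (g (x+h))))`^p)).
   by apply: le_pow=> //; rewrite /S lerD2l lerDr.
  by apply: pow_add=> //; exact: (G_ge0 D).
 have Sp0: 0<=S`^p := powR_ge0 _ _. pose e1:= K * l1 (y1-y0); pose e2:= n%:R*K * `|w x|.
 have e10: 0<=e1 by rewrite mulr_ge0 ?l1_ge0. have nK0: 0<=n%:R*K by rewrite mulr_ge0.
 have e20: 0<=e2 by rewrite mulr_ge0. have l1p : l1 (y1-y0)`^p<=P2*(NN*EE x).
  apply: (@le_trans _ _ ((l1 y1+l1 y0)`^p)); first by apply: le_pow (l1B _ _)=> //; exact: l1_ge0.
  apply: (le_trans (pow_add p0 (l1_ge0 _) (l1_ge0 _))); apply: ler_wpM2l=> //.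
  have ->: EE x = \sum_j `|partial j v (x+h)-g (x+h) 0 j| `^ p + \sum_j `|partial j v x-g x 0 j| `^ p.
   by rewrite addrC -big_split.
  rewrite mulrDr; apply: lerD; apply: (le_trans (l1_pow n0 _ p0)); rewrite ler_wpM2l//; apply: ler_sum=> j _;
   by rewrite !mxE.
 have eep : (e1+e2)`^p<=ep x.
  apply: (le_trans (pow_add p0 e10 e20)); apply: ler_wpM2l=> //; apply: lerD.
   by rewrite /e1 powRM ?l1_ge0//; exact: ler_wpM2l.
  by rewrite /e2 powRM.
 have flx y z': 0<=z' -> l1 y<=z' -> `|dot db y|<=2*La*(S`^(p-1)*z').
  move=> z0 yz; have fl u : mu+enorm (g u)<=S -> `|dot (b u) y|<=La*(S`^(p-1)*z').
   move=> uS'; apply: (le_trans (flux_le D _ _)); apply: (ler_wpM2l (ltW L0)).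
   exact: (ler_pM (powR_ge0 _ _) (l1_ge0 _) (le_pow p10 (G_ge0 D _) uS') yz).
  rewrite dotBl; apply: (le_trans (ler_normB _ _)).
  have ->: 2*La*(S`^(p-1)*z') = La*(S`^(p-1)*z')+La*(S`^(p-1)*z').
   by move: (S`^_)=> s; ring.
  exact: lerD (fl _ S2) (fl _ S1).
 have l1eta : l1 (grad eta x)<=n%:R*K.
  by rewrite l1_grad -sum_cst; apply: ler_sum=> j _; exact: etaK.
 have etale : eta x<=K by have := etaA x; rewrite ger0_norm.
 have young_e : S`^(p-1)*e1+S`^(p-1)*e2<=k1*Sp x+C1*ep x.
  rewrite -mulrDr; apply: (le_trans (hC1 _ _ S0 (addr_ge0 e10 e20))).
  by apply: lerD; apply: ler_wpM2l=> //; exact: ltW.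
 have hD : `|eta x*dot db (y1-y0)| + `|w x*dot db (grad eta x)|<=2*La*(k1*Sp x+C1*ep x).
  apply: (@le_trans _ _ (2*La*(S`^(p-1)*e1+S`^(p-1)*e2))); last first.
   by apply: ler_wpM2l=> //; apply: mulr_ge0=> //; exact: ltW.
  rewrite mulrDr; apply: lerD.
   rewrite -dotZr; apply: flx=> //; rewrite l1Z (ger0_norm (eta0 x)). by apply: ler_wpM2r=> //; exact: l1_ge0.
  rewrite -dotZr; apply: flx=> //; rewrite l1Z mulrC; exact: ler_wpM2r.
 have l1dg : l1 dg<=n%:R*S.
  apply: (le_trans (l1B _ _)); apply: (le_trans (lerD (l1_le_enorm _) (l1_le_enorm _))).
  rewrite -mulrDr; apply: ler_wpM2l=> //; rewrite /S addrC -addrA lerDr//.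
 have l1phi : l1 (grad phi x)<=K*n%:R*S+(e1+e2).
  rewrite gphiE gwE scalerDr -addrA; apply: (le_trans (l1D _ _)); apply: lerD.
   rewrite l1Z (ger0_norm (eta0 x)) -mulrA; apply: ler_pM=> //; exact: l1_ge0.
  apply: (le_trans (l1D _ _)); apply: lerD.
   by rewrite l1Z (ger0_norm (eta0 x)); apply: ler_wpM2r=> //; exact: l1_ge0.
  by rewrite l1Z mulrC; exact: ler_wpM2r.
 have KnS0: 0<=K*n%:R*S by nneg. have KnS : (K*n%:R*S)`^p<=qq*Sp x.
  rewrite powRM ?mulr_ge0//; exact: ler_wpM2l.
 have hF : `|dot (F (x+h)-F x) (grad phi x)|<=k2*(qq*Sp x+ep x)+C3*(2`^pc*(FF x+FF (x+h))).
  rewrite dotBl; apply: (le_trans (ler_normB _ _)); apply: (le_trans (lerD (dot_le _ _) (dot_le _ _))).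
  rewrite -mulrDl mulrC. have F0 := addr_ge0 (enorm_ge0 (F (x+h))) (enorm_ge0 (F x)).
  apply: (le_trans (hC3 _ _ (l1_ge0 _) F0)); apply: lerD.
   apply: (@le_trans _ _ (k2'*(P2*(qq*Sp x+ep x)))); last first.
    by rewrite /k2' mulrA divfK ?gt_eqF.
   apply: ler_wpM2l; first exact: ltW. apply: (le_trans (le_pow p0 (l1_ge0 _) l1phi)).
   apply: (le_trans (pow_add p0 KnS0 (addr_ge0 e10 e20))); apply: ler_wpM2l=> //. exact: lerD.
  apply: ler_wpM2l; first exact: ltW. by rewrite (addrC (FF x)); apply: pow_add=> //; exact: enorm_ge0.
 have S00 : S = 0 -> enorm dg = 0.
  move=> Sz; have x1 : enorm (g x) = 0.
   by apply/eqP; rewrite eq_le enorm_ge0 andbT -Sz (le_trans _ S1)// lerDr.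
  have x2 : enorm (g (x+h)) = 0.
   by apply/eqP; rewrite eq_le enorm_ge0 andbT -Sz (le_trans _ S2)// lerDr.
  apply/eqP; rewrite eq_le enorm_ge0 andbT; apply: (le_trans (enorm_le_l1 _)).
  apply: (le_trans (l1B _ _)); apply: (le_trans (lerD (l1_le_enorm _) (l1_le_enorm _))).
  by rewrite x1 x2 mulr0 addr0.
 have hmq : eta x*enorm dg`^p<=C2*(eta x * monq p S (enorm dg))+K*c2*Sp x.
  apply: (le_trans (ler_wpM2l (eta0 x) (hC2 S (enorm dg) S0 (enorm_ge0 _) S00))).
  rewrite mulrDr [eta x*(C2*_)]mulrCA lerD2l.
  rewrite -mulrA; apply: ler_pM=> //; first by rewrite mulr_ge0// ltW. by apply: ler_wpM2l=> //; exact: ltW.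
 have mono' : monq p S (enorm dg)<=La*dot db dg := mono.
 have f0E' : dot db (grad phi x) = f0 x+dot (F (x+h)-F x) (grad phi x) := f0E x.
 have final := nik_alg (eta0 x) L0 (ltW C20) hmq mono' DE f0E' hD hF. exact: final.
have mg := cd_mg D. have mdg : mble (fun x=> enorm (g (x+h)-g x)`^p).
 by apply: mble_powR; exact: mble_enorm (mblevB (mblev_shift h mg) mg).
have LaW0: \int[@lebesgue R n]_x (A0*f0 x) = 0.
 by have := integZ A0 if0; rewrite zf0 mulr0.
have mlhs := mbleM (mble_cont (smooth_cont seta)) mdg.
have lhs0 x: 0<=eta x*enorm (g (x+h)-g x)`^p by rewrite mulr_ge0 ?powR_ge0.
have u := ub_of_eq0 (itgZ A0 if0) LaW0 mlhs lhs0 pt urest. apply: (ub_fle _ _ _ u)=> [|x|x].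
- by apply: mbleM mdg; exact: mble_ball.
- by rewrite mulr_ge0 ?indic_ge0 ?powR_ge0. have [xr|xr] := pselect (ball (0: E) 12 x); last first.
 by rewrite [X in X*_]indic_out// mul0r lhs0.
by rewrite [X in X*_]indic_in//; apply: ler_wpM2r (eta1 x xr); exact: powR_ge0.
Qed.

End Nikolskii.

(** * Weak-type bound and averages over lattice translates *)

Section FiniteSums.
Context {R: realType} {n: nat}.
Notation E := 'rV[R]_n.
Notation leb := (@lebesgue R n).
Notation B0 r := (\1_(ball (0 : E) r) : E -> R).
Implicit Types (f: E -> R) (c k r M N h: R) (x y z: E).

Lemma ub_integ_self f c: ub f c -> ub f (integ f) /\ integ f<=c.
move=> u; have e := ub_integ u; case: u=> mf f0 h; split.
 by split=> //; rewrite e.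
by move: h; rewrite e lee_fin.
Qed.

Lemma itg_ub0 f c: ub f c -> itg f.
Proof. exact: ub_integrable. Qed.

Lemma integ_sum (I: Type) (s: seq I) (F: I -> E -> R): (forall i, itg (F i)) ->
 itg (fun z=> \sum_(i <- s) F i z) /\ integ (fun z=> \sum_(i <- s) F i z) = \sum_(i <- s) integ (F i).
move=> hF; elim: s=> [|i s [IH1 IH2]].
 have e : (fun z: E=> \sum_(i <- [::]) F i z) = (fun=> 0) by apply: funext=> z; rewrite big_nil.
 rewrite e big_nil; split; first exact: itg_ub0 ub0.
 by have [_ l] := ub_integ_self (@ub0 R n); apply/eqP; rewrite eq_le l integ_ge0.
have e : (fun z: E=> \sum_(j <- i :: s) F j z) = (fun z=> F i z + \sum_(j <- s) F j z).
 by apply: funext=> z; rewrite big_cons.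
by rewrite e big_cons -IH2; split; [exact: itgD|exact: integD].
Qed.

(** Every term is shifted by its own vector, so the two sums are not comparable pointwise; their
    integrals agree term by term. *)
Lemma ub_sum_shift (I: finType) (F: I -> E -> R) (h: I -> E) c :
 (forall i, mble (F i)) -> (forall i x, 0<=F i x) ->
 ub (fun x=> \sum_i F i x) c -> ub (fun x=> \sum_i F i (x+h i)) c.
move=> mF F0 u. have uF i : ub (F i) c.
 apply: (ub_fle (mF i) (F0 i) _ u)=> x; rewrite (bigD1 i)//= lerDl. nneg.
have [_ e] := integ_sum (index_enum I) (fun i=> itg_ub0 (uF i)).
have [_ l] := ub_integ_self u; rewrite e in l.
apply: (ub_cle l); apply: ub_sum=> i; apply: ub_shift; exact: (ub_integ_self (uF i)).1.
Qed.

(** The selected cubes are disjoint and each carries mass above [N] times its volume, so their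
    volumes sum to at most [c / N]; the tripled cubes cover [S]. *)
Lemma weak_type f (S: set E) k M c N: 0<k -> 0<M -> 0<N -> mble f -> (forall x, 0<=f x) ->
 ub (fun x=> B0 M x*f x) c -> (forall x, S x -> exists r, [/\ k<=r, r<=M, ball x r `<=` ball (0: E) M &
   ~ ub (fun y=> \1_(ball x r) y*f y) (N*(2*r)^+n)]) -> (leb S<=(3^+n*(N^-1*c))%:E)%E.
move=> k0 M0 N0 mf f0 u hS. pose r x:= xget k [set r | [/\ k<=r, r<=M, ball x r `<=` ball (0: E) M &
   ~ ub (fun y=> \1_(ball x r) y*f y) (N*(2*r)^+n)]].
have hr x : S x -> [/\ k<=r x, r x<=M, ball x (r x) `<=` ball (0: E) M &
   ~ ub (fun y=> \1_(ball x (r x)) y*f y) (N*(2*r x)^+n)].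
 move=> /hS ex; rewrite /r; case: xgetP=> [y _ //|nP]; case: ex=> t ht; by case: (nP t ht).
have [s [sS pk cov]]: exists s, [/\ forall x, x \in s -> S x, packed r s &
  forall y, S y -> exists2 x, x \in s & ball x (3*r x) y].
 by apply: (finite_cover k0 M0)=> x /hr[h1 h2 h3 _]; rewrite ?h1.
pose F x z:= \1_(ball x (r x)) z*(B0 M z*f z). have g0 z: 0<=B0 M z*f z by nneg. have mF x : mble (F x).
 by apply: mbleM; [mbl|apply: mbleM=> //; mbl].
have uF x : ub (F x) c.
 apply: (ub_fle (mF x) _ _ u)=> z; first by rewrite mulr_ge0. by rewrite ler_piMl.
have [_ e] := integ_sum s (fun x=> itg_ub0 (uF x)). have le_c: \sum_(x <- s) integ (F x)<=c.
 rewrite -e; have us : ub (fun z=> \sum_(x <- s) F x z) c.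
  apply: (ub_fle _ _ _ u)=> [|z|z].
  - mbl.
  - by apply: sumr_ge0=> x _; rewrite mulr_ge0 ?indic_ge0.
  - by rewrite -mulr_suml ler_piMl.
 exact: (ub_integ_self us).2.
have each x : x \in s -> N*(2*r x)^+n<=integ (F x).
 move=> /sS /hr[_ _ sub nub]; rewrite leNgt; apply/negP=> lt; apply: nub.
 apply: (ub_cle (ltW lt)); apply: (ub_eq _ (ub_integ_self (uF x)).1)=> z.
 rewrite /F; have [zx|zx] := pselect (ball x (r x) z); last by rewrite indic_out// !mul0r.
 by rewrite (indic_in (sub z zx)) mul1r.
apply: (@le_trans _ _ (\sum_(x <- s) (2*(3*r x))^+n)%:E).
 apply: (leb_cover cov)=> x /sS/hr[h1 _ _ _]. by rewrite leb_ball// mulr_gt0// (lt_le_trans k0).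
rewrite lee_fin. have ->: \sum_(x <- s) (2*(3*r x))^+n = 3^+n*\sum_(x <- s) (2*r x)^+n.
 by rewrite mulr_sumr; apply: eq_bigr=> x _; rewrite -exprMn; congr (_^+n); ring.
apply: ler_wpM2l; first nneg. rewrite mulrC ler_pdivlMr// mulrC mulr_sumr; apply: le_trans le_c.
by rewrite !big_seq; apply: ler_sum=> x xs; exact: each.
Qed.

End FiniteSums.

Section LatticeCount.
Context {R: realType}.

Lemma count_line (c r: R) (N: nat): 0<=r -> \sum_(j<N) ((`|j%:R-c|<r)%R%:R: R)<=2*r+1.
move=> r0. have hA M: \sum_(j<M) ((`|j%:R-c|<r)%R%:R: R)<=Num.max 0 (M%:R-c+r).
 elim: M=> [|M IH]; first by rewrite big_ord0 le_max lexx.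
 rewrite big_ord_recr /=; case: ltP=> hM; rewrite ?mulr1n ?mulr0n.
  move: hM; rewrite ltr_norml=> /andP[h1 h2]; rewrite -natr1.
  have e : Num.max 0 (M%:R-c+r) = M%:R-c+r by apply: max_r; lra.
  by rewrite e in IH; rewrite le_max; apply/orP; right; lra.
 rewrite addr0; apply: (le_trans IH); rewrite ge_max le_max lexx /= le_max -natr1. by apply/orP; right; lra.
elim: N=> [|N IH]; first by rewrite big_ord0; lra.
rewrite big_ord_recr /=; case: ltP=> hM; rewrite ?mulr1n ?mulr0n; last by rewrite addr0.
move: hM; rewrite ltr_norml=> /andP[h1 h2]; have := hA N.
have ->: Num.max 0 (N%:R-c+r) = N%:R-c+r by apply: max_r; lra. lra.
Qed.

End LatticeCount.

Section LatticeAverage.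
Context {R: realType} {n: nat}.
Notation E := 'rV[R]_n.
Implicit Types (r N eps h A: R) (x y z: E) (M: nat).

Definition latv M (f: {ffun 'I_n -> 'I_M}): 'rV[int]_n := \row_i (f i: nat)%:Z.

Definition lat eps M (f: {ffun 'I_n -> 'I_M}): E := eps *: map_mx intr (latv f).

Lemma latE eps M (f: {ffun 'I_n -> 'I_M}) i: lat eps f 0 i = eps*(f i)%:R.
Proof. by rewrite !mxE. Qed.

Lemma norm_lat eps M (f: {ffun 'I_n -> 'I_M}) h: 0<eps -> 0<h -> eps*M%:R<=h -> `|lat eps f|<h.
move=> e0 h0 eh; apply: norm_lt_coord=> // i; rewrite latE ger0_norm ?mulr_ge0 ?(ltW e0)//.
by apply: lt_le_trans eh; rewrite ltr_pM2l// ltr_nat.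
Qed.

Lemma indic_ball_prod x r y: 0<r -> \1_(ball x r) y = \prod_(i<n) ((`|x 0 i-y 0 i|<r)%R%:R: R).
move=> r0; have [h|h] := pselect (ball x r y).
 rewrite indic_in//; move: h; rewrite ballE// => h. by rewrite big1// => i _; rewrite h.
rewrite indic_out//; apply/esym/eqP; rewrite prodf_seq_eq0; apply/hasP.
apply: contra_notP h=> nh; rewrite ballE// => i; apply: contrapT=> hi; apply: nh.
by exists i; rewrite ?mem_index_enum//=; move/negP/negbTE: hi=> ->.
Qed.

(** The count factorises over coordinates, and an interval of length [2 r] meets at most
    [2 r/eps + 1 <= 3 r/eps] points of spacing [eps]. *)
Lemma lattice_count eps M x r z: 0<eps -> eps<=r ->
 \sum_(f: {ffun 'I_n -> 'I_M}) (\1_(ball x r) (z-lat eps f): R)<=(3*(r/eps))^+n.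
move=> e0 er; have r0: 0<r by exact: lt_le_trans er.
pose T (i: 'I_n) (j: 'I_M): R := (`|x 0 i-(z 0 i-eps*j%:R)|<r)%R%:R.
have ->: \sum_(f: {ffun 'I_n -> 'I_M}) (\1_(ball x r) (z-lat eps f): R) =
  \sum_(f: {ffun 'I_n -> 'I_M}) \prod_i T i (f i).
 by apply: eq_bigr=> f _; rewrite indic_ball_prod//; apply: eq_bigr=> i _; rewrite /T !mxE.
rewrite -bigA_distr_bigA /=.
have ->: (3*(r/eps))^+n = \prod_(i<n) (3*(r/eps)) by rewrite prodr_const card_ord.
apply: ler_prod=> i _; rewrite sumr_ge0//=. have re: 1<=r/eps by rewrite ler_pdivlMr// mul1r.
have re0: 0<=r/eps by nneg. apply: (@le_trans _ _ (2*(r/eps)+1)); last by lra.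
apply: le_trans (count_line ((z 0 i-x 0 i)/eps) M re0). apply: ler_sum=> j _; rewrite /T ler_nat.
suff ->: (`|x 0 i-(z 0 i-eps*j%:R)|<r) = (`|j%:R-(z 0 i-x 0 i)/eps|<r/eps) by [].
have ->: x 0 i-(z 0 i-eps*j%:R) = eps*(j%:R-(z 0 i-x 0 i)/eps).
 by field; rewrite gt_eqF.
by rewrite normrM gtr0_norm// mulrC -ltr_pdivlMr.
Qed.

(** Averaging over [M^n] lattice translates replaces the mass in the small cube by mass in the cube
    of radius [2h], whose points are hit at most [(3 r/eps)^n] times. As [M] is of order [h/eps],
    the factor becomes [(6 r/h)^n]. [D] accounts for the change of [G] under the translations. *)
Lemma lattice_average (G: E -> R) (D: forall M, {ffun 'I_n -> 'I_M} -> E -> R) eps M x r h P A N :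
 0<eps -> (0<M)%N -> eps*M%:R<=h -> h<=2*(eps*M%:R) -> eps<=r -> r<=h ->
 0<=P -> mble G -> (forall y, 0<=G y) -> (forall f, mble (D M f)) -> (forall f y, 0<=D M f y) ->
 (forall f y, ball x r y -> G y<=P*(G (y+lat eps f)+D M f y)) -> ub (fun y=> \1_(ball x (2*h)) y*G y) A ->
 ub (fun y=> \1_(ball x r) y*((M%:R^+n)^-1*\sum_f D M f y)) N ->
 ub (fun y=> \1_(ball x r) y*G y) (P*((6*(r/h))^+n*A+N)).
move=> e0 M0 eMh hM er rh P0 mG G0 mD D0 hG uG uD. have r0: 0<r by exact: lt_le_trans er.
have h0: 0<h by exact: lt_le_trans rh. have MR0: 0<M%:R^+n :> R by nneg.
pose Phi f z:= \1_(ball x r) (z-lat eps (M:=M) f)*G z. have mPhi f : mble (Phi f).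
 by apply: mbleM=> //; apply: (mble_shift (- lat eps f)); mbl.
have Phi0 f z: 0<=Phi f z by rewrite mulr_ge0. have uPhi : ub (fun z=> \sum_f Phi f z) ((3*(r/eps))^+n*A).
 have re0: 0<=(3*(r/eps))^+n by nneg. apply: (ub_fle _ _ _ (ubZ re0 uG))=> [|z|z].
 - mbl.
 - nneg. have [zx|zx] := pselect (ball x (2*h) z).
  have i1: \1_(ball x (2*h)) z = 1 :> R := indic_in zx. rewrite i1 mul1r -mulr_suml; apply: ler_wpM2r=> //.
  exact: lattice_count.
 have i0: \1_(ball x (2*h)) z = 0 :> R := indic_out zx. rewrite i0 mul0r mulr0 big1// => f _.
 rewrite /Phi indic_out ?mul0r// => hz; apply: zx. have nl := norm_lat f e0 h0 eMh. have: ball x (r+h) z.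
  apply: (ball_triangle hz). by rewrite -ball_normE /ball_ /= addrAC subrr add0r normrN.
 by apply: le_ball; lra.
have uS : ub (fun y=> \sum_(f: {ffun 'I_n -> 'I_M}) \1_(ball x r) y*G (y+lat eps f)) ((3*(r/eps))^+n*A).
 apply: (ub_eq _ (ub_sum_shift (fun f: {ffun 'I_n -> 'I_M} => lat eps f) mPhi Phi0 uPhi))=> y.
 by apply: eq_bigr=> f _; rewrite /Phi addrK.
have u := ubZ P0 (ubD (ubZ (ltW (_: 0<(M%:R^+n)^-1)) uS) uD). have A0: 0<=A by exact: ub_ge0 uG.
apply: (ub_cle _ (ub_fle _ _ _ (u _)))=> [||y|y|]; last nneg.
- apply: ler_wpM2l=> //; rewrite lerD2r mulrA; apply: ler_wpM2r=> //.
 rewrite -exprVn -exprMn; apply: lerXn2r; rewrite ?nnegrE.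
 + by nneg.
 + by nneg. have eM: 0<eps*M%:R by nneg. have ->: M%:R^-1*(3*(r/eps)) = 3*r*(eps*M%:R)^-1.
  by field; rewrite !gt_eqF ?ltr0n.
 have ->: 6*(r/h) = 3*r*(2/h) by field; rewrite gt_eqF. apply: ler_wpM2l; first nneg.
 by rewrite ler_pdivlMr// mulrC ler_pdivrMr.
- mbl.
- nneg. have [yx|yx] := pselect (ball x r y); last first.
 have i0: \1_(ball x r) y = 0 :> R := indic_out yx. rewrite i0 !mul0r addr0.
 apply: (mulr_ge0 P0); apply: mulr_ge0; first nneg. nneg.
have i1: \1_(ball x r) y = 1 :> R := indic_in yx. rewrite i1 !mul1r.
rewrite -mulrDr mulrCA mulrC -ler_pdivrMr ?invr_gt0// invrK.
have ->: G y*M%:R^+n = \sum_(f: {ffun 'I_n -> 'I_M}) G y.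
 by rewrite -natrX mulr_natr sumr_const card_ffun !card_ord.
rewrite -big_split /= mulr_sumr; apply: ler_sum=> f _. by rewrite mul1r; exact: hG.
Qed.

End LatticeAverage.

(** * Decay of the maximal function on the unit cube *)

Section MaximalTail.
Context {R: realType} {n: nat} (n0: (0<n)%N) (p La: R) (p1: 1<p) (La1: 1<=La).
Notation E := 'rV[R]_n.
Notation leb := (@lebesgue R n).
Notation B0 r := (\1_(ball (0 : E) r) : E -> R).
Implicit Types (f v w: E -> R) (g b F: E -> E) (i: 'I_n) (d eps mu H K c r th k m N s: R).

(** For measurable [f >= 0]: the mean of [f] over the cube exceeds [N]. *)
Definition bad f (x: E) r N := ~ ub (fun y=> \1_(ball x r) y*f y) (N*(2*r)^+n).

Definition bad_set f k K N:= [set x: E | ball (0: E) 1 x /\ exists r, [/\ k<=r, r<=K & bad f x r N]].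

Lemma leb_union (A A1 A2: set E) c c': (forall x, A x -> A1 x \/ A2 x) ->
 (leb A1<=c%:E)%E -> (leb A2<=c'%:E)%E -> (leb A<=(c+c')%:E)%E.
move=> h h1 h2; rewrite EFinD; apply: (@le_trans _ _ (lebesgue_outer (A1 `|` A2))).
 exact: le_lebesgue_outer.
apply: (le_trans (outer_measureU2 (@lebesgue_outer R n) A1 A2)); exact: leeD.
Qed.

Lemma bad_le f x r N N': N' <= N -> 0<=r -> bad f x r N -> bad f x r N'.
move=> h r0 hb u; apply: hb; apply: ub_cle u; apply: ler_wpM2r=> //. nneg.
Qed.

Lemma sub_ball0 (x: E) r k M: ball (0: E) k x -> k+r<=M -> ball x r `<=` ball (0: E) M.
Proof. by move=> xk h y xy; apply: le_ball h _ _; exact: ball_triangle xk xy. Qed.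

Lemma ball_affine (x y: E) r k: 0<r -> ball (0: E) k (- (r^-1 *: x)+r^-1 *: y) <-> ball x (r*k) y.
move=> r0; rewrite ball0E -scalerN -scalerDr normrZ gtr0_norm ?invr_gt0//.
rewrite -ball_normE /ball_ /= -[X in X<_ <-> _]/(r^-1*_) distrC (addrC (- x)).
by rewrite mulrC ltr_pdivrMr// (mulrC k).
Qed.

(** Dividing a fixed cutoff by a constant makes its slope at most [1/r]; the price is that on the
    cube it is only at least [1/A]. *)
Lemma scaled_cutoff: exists2 A: R, 0<A & forall (x: E) r, 0<r -> exists chi: E -> R,
 [/\ smooth chi, forall y, ~ ball x (2*r) y -> chi y = 0, forall y, 0<=chi y<=1,
   forall i y, `|partial i chi y|<=r^-1 & forall y, ball x r y -> 1<=A*chi y].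
have l12 : (1: R)<2 by lra. have l02 : (0: R)<2 by lra.
have [eta [seta veta eta0 eta1]] := exists_cutoff (n:=n) l02 l12.
have [K [K0 etaA etaK _]] := smooth_bounds seta veta. have K1: 0<K+1 by lra. exists (K+1)=> // x r r0.
pose z: E := - (r^-1 *: x). have sz : smooth (fun y=> eta (z+r^-1 *: y)) := smooth_aff z r^-1 seta.
exists (fun y=> (K+1)^-1*eta (z+r^-1 *: y)); split.
- exact: smoothZ.
- by move=> y hy; rewrite veta ?mulr0// => /(ball_affine x y 2 r0); rewrite mulrC.
- move=> y; have e0 := eta0 (z+r^-1 *: y); have := etaA (z+r^-1 *: y); rewrite ger0_norm// => h.
 rewrite mulr_ge0 ?invr_ge0 ?(ltW K1)//= mulrC ler_pdivrMr// mul1r; lra.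
- move=> i y; rewrite (partialZ _ _ _ sz) (partial_aff i z _ _ seta) normrM gtr0_norm ?invr_gt0//.
 rewrite normrM (gtr0_norm (_: 0<r^-1)) ?invr_gt0// mulrCA ler_piMr ?invr_ge0 ?(ltW r0)//.
 by rewrite mulrC ler_pdivrMr// mul1r (le_trans (etaK _ _))// lerDl.
- move=> y hy; rewrite mulrA divff ?gt_eqF// mul1r; apply: eta1.
 by apply/(ball_affine x y 1 r0); rewrite mulr1.
Qed.

Let jensen_split (S a w: R): 1<=S -> 0<a -> 0<=w -> w<=a+a`^(1-S)*w`^S.
move=> S1 a0 w0; have := pow_above_or ler01 S1 a0 w0. by rewrite !powRr1// ltW.
Qed.

Lemma bad_pow f S x r N: 1<=S -> 0<N -> 0<r -> mble f -> (forall y, 0<=f y) ->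
 bad f x r N -> bad (fun y=> f y`^S) x r ((N/2)`^S).
move=> S1 N0 r0 mf f0 hb u; apply: hb; have N2: 0<N/2 by nneg.
have v := ubD (ubZ (ltW N2) (ub_ball x r0)) (ubZ (powR_ge0 (N/2) (1-S)) u).
apply: (ub_cle _ (ub_fle _ _ _ v))=> [||y|y].
- rewrite mulrA -powRD ?(gt_eqF N2) ?implybT// (_: 1-S+S = 1); last by ring.
 rewrite powRr1 ?(ltW N2)//; lra.
- mbl.
- nneg. rewrite mulrCA [N/2*_]mulrC -mulrDr; apply: ler_wpM2l; first nneg. nneg.
Qed.

Let prod_rot (x y z w: R): x*(y*z*w) = x*(z*w)*y.
Proof. ring. Qed.

(** By the Caccioppoli inequality on a cube, a large mean of the energy forces a large mean of [w],
    which is built from the mollified gradient. Since [w] has a bounded moment of order [S], the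
    weak-type bound for [w^S] gives the decay. Radii below [k] are excluded because the cutoff has
    slope up to [1/k]. *)
Lemma large_scales s: exists S C: R, [/\ s<=S, 0<C & forall N k, 0<N -> 0<k -> exists2 d0: R, 0<d0 &
 forall d eps mu g b F, d<=d0 -> cell_data p La d eps mu g b F ->
 (leb (bad_set (fun y=> (mu+enorm (g y))`^p)%R k 2 N)<=(C*N`^(- S))%:E)%E].
have p1' := p1; have p0: 0<p by lra. have [m hm [pm Pm]] := moment_all n0 p1 La1 (p*(`|s| + 1)). pose S:= m/p.
have sS : `|s| + 1<=S by rewrite /S ler_pdivlMr// mulrC. have S1: 1<=S by apply: le_trans sS; rewrite lerDr.
have S0: 0<=S by lra. have l8 : (0: R)<8 by lra. have l813 : (8: R)<13 by lra.
have [Cm Cm0 hCm] := Pm 8 l8 l813. have [Cc Cc0 hCc] := caccioppoli n0 p1 La1.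
have [A A0 hA] := scaled_cutoff. pose al:= (2*A*Cc*2^+n)^-1.
have al0: 0<al by rewrite invr_gt0 !mulr_gt0// exprn_gt0. pose cw:= 2`^S*((2*8)^+n+n%:R`^S*(n%:R*Cm)).
have cw0: 0<cw.
 apply: mulr_gt0; first nneg. apply: ltr_pwDl; first by apply: exprn_gt0; lra. nneg.
pose C:= 3^+n*(((al/2)`^S)^-1*cw). exists S, C; split.
- by apply: le_trans sS; rewrite (le_trans (ler_norm s))// lerDl.
- apply: mulr_gt0; first nneg.
 nneg.
(* After multiplication by [A], the error is half of [N (2k)^n], the smallest mass that a bad cube
   can carry. *)
move=> N k N0 k0. pose th:= N*(2*k)^+n/(2*A).
have th0: 0<th by rewrite divr_gt0 ?mulr_gt0 ?exprn_gt0 ?mulr_gt0. have kV0: 0<k^-1 by nneg.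
have [dc dc0 hdc] := hCc k^-1 th kV0 th0. pose H:= Num.min 20^-1 dc.
have H0: 0<H by rewrite lt_min dc0 invr_gt0 ltr0n. have H20 : H<=20^-1 by rewrite /H ge_min lexx.
have Hdc : H<=dc by rewrite /H ge_min lexx orbT. have H8: 8+50*H<=13 by lra. have [dm dm0 hdm] := hCm H H0 H8.
exists (Num.min dc dm); first by rewrite lt_min dc0. move=> d eps mu g b F; rewrite le_min=> /andP[ddc ddm] D.
have [/andP[mu0 mu1] /andP[e0 ed]] := (cd_mu D, cd_eps D). have d0: 0<d by exact: lt_le_trans ed.
have [v av] := cd_apx D d0; have [sv vv _] := av. have lt017 : (0: R)<17 by lra.
have sm : smooth (moll H v) := smooth_moll H0 (smooth_itg lt017 sv vv).
pose si x:= \sum_i `|partial i (moll H v) x| `^ p. pose w x:= 1+si x. have msi : mble si.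
 mbl.
have si0 x: 0<=si x by apply: sumr_ge0=> i _; nneg. have mw : mble w by mbl.
have w0 x: 0<=w x by rewrite addr_ge0. have mwS : mble (fun x=> w x`^S) by mbl.
have uw : ub (fun x=> B0 8 x*w x`^S) cw.
 have hm' i := hdm _ _ _ _ _ _ _ ddm D av i. have u1 := ub_sum (index_enum 'I_n) xpredT hm'.
 rewrite sum_cst in u1. have u := ubZ (powR_ge0 2 S) (ubD (ub_ball (0: E) l8) (ubZ (powR_ge0 n%:R S) u1)).
 apply: (ub_fle _ _ _ u)=> [|x|x].
 - mbl.
 - by rewrite mulr_ge0 ?powR_ge0.
 rewrite -mulr_sumr [n%:R`^S*_]mulrCA -[X in _*(X+_)]mulr1 -mulrDr [leRHS]mulrCA.
 apply: ler_wpM2l; first nneg. apply: (le_trans (pow_add S0 ler01 (si0 x))); apply: ler_wpM2l; first nneg.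
 rewrite powR1 lerD2l; apply: (le_trans (sum_pow n0 S0 _))=> [i|]; first nneg. apply: ler_wpM2l; first nneg.
 apply: ler_sum=> i _; rewrite -powRrM /S mulrC divfK ?gt_eqF//.
pose a:= N*al; have a0: 0<a by rewrite mulr_gt0.
have step x r : ball (0: E) 1 x -> k<=r -> r<=2 -> bad (fun y=> (mu+enorm (g y))`^p) x r N ->
  bad (fun y=> w y`^S) x (2*r) ((a/2)`^S).
 move=> x1 kr r2 hb; have r0: 0<r by exact: lt_le_trans kr. apply: bad_pow=> //; first nneg.
 move=> u; apply: hb; have [chi [schi vchi chi01 dchi chiA]] := hA x r r0.
 have mchi : mble chi := mble_cont (smooth_cont schi). have chi0 y: 0<=chi y by have /andP[] := chi01 y.
 have vchi13 : vanish 13 chi.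
  move=> y hy; apply: vchi=> hxy; apply: hy. by apply: (sub_ball0 x1 _ hxy); lra.
 have u1 : ub (fun y=> chi y*(mu`^p+si y)) (a*(2*(2*r))^+n).
  apply: (ub_fle _ _ _ u)=> [|y|y].
  - by apply: mbleM=> //; mbl.
  - by rewrite mulr_ge0// addr_ge0 ?powR_ge0.
  have [hy|hy] := pselect (ball x (2*r) y); last by rewrite vchi// mul0r mulr_ge0.
  have i1: \1_(ball x (2*r)) y = 1 :> R := indic_in hy.
  rewrite i1; apply: ler_pM=> //; first by rewrite addr_ge0 ?powR_ge0.
   by have /andP[] := chi01 y.
  by rewrite lerD2r; have := le_pow (ltW p0) mu0 mu1; rewrite powR1.
 have dchi' i y : `|partial i chi y|<=k^-1.
  by apply: (le_trans (dchi i y)); rewrite lef_pV2.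
 have u2 := hdc d eps mu g b F v H chi _ ddc D (apx_mono ddc av) H0 Hdc schi vchi13 chi01 dchi' u1.
 apply: (ub_cle _ (ub_fle _ _ _ (ubZ (ltW A0) u2)))=> [||y|y].
 - have e1 : A*(Cc*(a*(2*(2*r))^+n)) = N/2*(2*r)^+n.
   have ->: (2*(2*r))^+n = 2^+n*(2*r)^+n by rewrite exprMn. rewrite /a /al.
   by move: (2^+n) (exprn_gt0 n (ltr0Sn R 1)) ((2*r)^+n)=> z1 z10 z2; field; rewrite !gt_eqF.
  have e2 : A*th = N/2*(2*k)^+n by rewrite /th; field; rewrite gt_eqF. rewrite mulrDr e1 e2.
  have l : (2*k)^+n<=(2*r)^+n.
   by apply: lerXn2r; rewrite ?nnegrE ?mulr_ge0 ?(ltW k0) ?(ltW r0)// ler_pM2l.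
  have N2: 0<=N/2 by nneg. have l2 := ler_wpM2l N2 l. move: l2; move: ((2*k)^+n) ((2*r)^+n)=> z1 z2 l2; lra.
 - by apply: mbleM; [mbl|apply: mble_powR; mbl].
 - by rewrite mulr_ge0 ?powR_ge0. rewrite mulrA; apply: ler_wpM2r; first exact: powR_ge0.
 have [hy|hy] := pselect (ball x r y).
  by have i1: \1_(ball x r) y = 1 :> R := indic_in hy; rewrite i1 chiA.
 have i0: \1_(ball x r) y = 0 :> R := indic_out hy. by rewrite i0 mulr_ge0// ltW.
have aS0: 0<(a/2)`^S by nneg. apply: (@le_trans _ _ (3^+n*(((a/2)`^S)^-1*cw))%:E); last first.
 have e : (a/2)`^S = N`^S*(al/2)`^S.
  by rewrite -powRM ?(ltW N0) ?divr_ge0 ?(ltW al0)// /a mulrA.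
 by rewrite lee_fin e invfM /C powRN prod_rot.
apply: (weak_type k0 l8 aS0 mwS (fun x=> powR_ge0 _ _) uw)=> x [x1 [r [kr r2 hb]]].
have r0: 0<r by exact: lt_le_trans kr. exists (2*r); split; [lra|lra| |exact: step].
by apply: (sub_ball0 x1); lra.
Qed.

(** Radii of at least [h] fall under [large_scales]. If a smaller radius [r] is bad, then either the
    mean over the cube of radius [2h] is large already, or the mean of the lattice differences over
    the cube of radius [r] is large. Those differences have total mass at most [th], and choosing
    [th] proportional to [N^(-s)] makes the plain weak-type bound sufficient. *)
Lemma maximal_tail s: exists2 C: R, 0<C & forall N, 1<=N -> exists2 d0: R, 0<d0 &
 forall d eps mu g b F, d<=d0 -> cell_data p La d eps mu g b F ->
 (leb (bad_set (fun y=> (mu+enorm (g y))`^p)%R eps 1 N)<=(C*N`^(- s))%:E)%E.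
have p1' := p1; have p0: 0<=p by lra. have [S [C [sS C0 hC]]] := large_scales s. pose P:= n%:R`^p*2`^p: R.
have nR: 1<=n%:R :> R by rewrite ler1n. have P0: 0<P by rewrite mulr_gt0 ?powR_gt0// (lt_le_trans ltr01).
(* The thresholds [be N] at radius [2h] and [N/(2P)] for the differences are such that
   [lattice_average] returns exactly [N]. *)
pose be:= (2*P*12^+n)^-1. have P12: 1<=2*P*12^+n.
 have a1: 1<=P.
  have n1: 1<=n%:R`^p by exact: one_le_pow. have n2: 1<=2`^p :> R by apply: one_le_pow=> //; lra.
  exact: mulr_ege1.
 have a2: 1<=12^+n :> R by apply: exprn_ege1; lra. by apply: mulr_ege1=> //; lra.
have be0: 0<be by rewrite invr_gt0 (lt_le_trans ltr01).
have be1 : be<=1 by rewrite invf_le1// (lt_le_trans ltr01). exists (C*be`^(- S)+1); first nneg.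
move=> N N1; have N0: 0<N by exact: lt_le_trans N1.
pose N2:= N/(2*P). have N20: 0<N2 by rewrite divr_gt0// mulr_gt0. pose th:= N2/3^+n*N`^(- s).
have th0: 0<th by rewrite mulr_gt0 ?powR_gt0// divr_gt0.
have [h [h0 h1] [dn [dn0 dn1] hn]] := lattice_differences n0 p1 La1 th0.
pose N1' := be*N. have N1'0: 0<N1' by rewrite mulr_gt0. have [dl dl0 hl] := hC N1' h N1'0 h0.
exists (Num.min dn (Num.min dl (h/2))); first by rewrite !lt_min dn0 dl0 divr_gt0.
move=> d eps mu g b F; rewrite !le_min=> /andP[ddn /andP[ddl dh]] D. have /andP[e0 ed] := cd_eps D.
have [M M0 [hM1 hM2]] := lattice_scale e0 (le_trans ed dh). have eMh : eps*M%:R<=h by lra.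
have hM : h<=2*(eps*M%:R) by lra. pose G y:= (mu+enorm (g y))`^p. have mG : mble G by apply: mble_powR; mbl.
pose Df (M: nat) (f: {ffun 'I_n -> 'I_M}) y := enorm (g (y+lat eps f)-g y)`^p. have mg := cd_mg D.
have mD (f: {ffun 'I_n -> 'I_M}): mble (Df M f).
 by apply: mble_powR; exact: mble_enorm (mblevB (mblev_shift _ mg) mg).
have D0 (f: {ffun 'I_n -> 'I_M}) y: 0<=Df M f y by exact: powR_ge0.
pose Dav y:= (M%:R^+n)^-1*\sum_(f: {ffun 'I_n -> 'I_M}) Df M f y. have MR0: 0<M%:R^+n :> R by nneg.
have mDav : mble Dav by apply: mbleM; [mbl|mbl].
have Dav0 y: 0<=Dav y by rewrite mulr_ge0 ?invr_ge0 ?(ltW MR0)//; apply: sumr_ge0.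
have l12 : (0: R)<12 by lra. have uD : ub (fun y=> B0 12 y*Dav y) th.
 have hf (f: {ffun 'I_n -> 'I_M}): ub (fun y=> B0 12 y*Df M f y) th.
  by apply: (hn _ _ _ _ _ _ ddn D (latv f)); apply: ltW; exact: norm_lat.
 have u := ub_sum (index_enum {ffun 'I_n -> 'I_M}) xpredT hf. have MV0: 0<=(M%:R^+n)^-1 :> R by nneg.
 apply: (ub_cle _ (ub_eq _ (ubZ MV0 u)))=> [|y]; last by rewrite -mulr_sumr mulrCA.
 by rewrite sumr_const card_ffun !card_ord -[th *+ _]mulr_natl natrX mulrA mulVf ?mul1r// gt_eqF.
have hG (f: {ffun 'I_n -> 'I_M}) y: G y<=P*(G (y+lat eps f)+Df M f y).
 set hh:= lat eps f. have /andP[mu0 _] := cd_mu D.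
 have l : mu+enorm (g y)<=n%:R*((mu+enorm (g (y+hh)))+enorm (g (y+hh)-g y)).
  have l1' : enorm (g y)<=n%:R*enorm (g (y+hh))+n%:R*enorm (g (y+hh)-g y).
   apply: (le_trans (enorm_le_l1 _)); apply: (@le_trans _ _ (l1 (g (y+hh))+l1 (g (y+hh)-g y))).
    by apply: le_trans (l1B _ _); rewrite opprB addrC subrK.
   by apply: lerD; exact: l1_le_enorm.
  have l2' := ler_wpM2r mu0 nR; rewrite mul1r in l2'. by rewrite !mulrDr -addrA; exact: lerD.
 have t0: 0<=mu+enorm (g (y+hh)) := G_ge0 D _. have G0: 0<=mu+enorm (g y) := G_ge0 D _.
 apply: (le_trans (le_pow p0 G0 l)).
 rewrite powRM ?addr_ge0 ?enorm_ge0// /P -mulrA; apply: ler_wpM2l; first nneg. by apply: pow_add=> //; nneg.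
pose S1:= bad_set G h 2 N1'. pose S2:= bad_set Dav eps 1 N2.
have b1 : (leb S1<=(C*N1'`^(- S))%:E)%E := hl _ _ _ _ _ _ ddl D. have b2 : (leb S2<=(3^+n*(N2^-1*th))%:E)%E.
 apply: (weak_type e0 l12 N20 mDav Dav0 uD)=> x [x1 [r [er r1 hb]]].
 by exists r; split=> //; [lra|apply: (sub_ball0 x1); lra].
apply: (@le_trans _ _ (C*N1'`^(- S)+3^+n*(N2^-1*th))%:E).
 apply: (leb_union _ b1 b2)=> x [x1 [r [er r1 hb]]]. have r0: 0<r by exact: lt_le_trans er.
 have N1N : N1' <= N by rewrite /N1' ler_piMl// ltW. have [hr|hr] := leP h r.
  left; split=> //; exists r; split=> //; first lra. exact: bad_le N1N (ltW r0) hb.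
 have [b2h|nb2h] := pselect (bad G x (2*h) N1').
  by left; split=> //; exists (2*h); split=> //; lra.
 right; split=> //; exists r; split=> // uDr; apply: hb. move/contrapT: nb2h=> uG2.
 have u := lattice_average e0 M0 eMh hM er (ltW hr) (ltW P0) mG (fun y=> powR_ge0 _ _) mD D0 (fun (f: {ffun 'I_n -> 'I_M}) y _=> hG f y) uG2 uDr.
 apply: (ub_cle _ u). have ->: (6*(r/h))^+n*(N1'*(2*(2*h))^+n) = 12^+n*N1'*(2*r)^+n.
  have e1 : (6*(r/h))^+n*(2*(2*h))^+n = 12^+n*(2*r)^+n.
   by rewrite -!exprMn; congr (_^+n); field; rewrite gt_eqF.
  by rewrite mulrCA e1 mulrCA mulrA.
 rewrite -mulrDl mulrA; apply: ler_wpM2r; first nneg.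
 rewrite le_eqVlt; apply/orP; left; apply/eqP; rewrite /N1' /be /N2. move: (12^+n) (exprn_gt0 n l12)=> z z0.
 by field; rewrite !gt_eqF.
rewrite lee_fin mulrDl mul1r; apply: lerD.
 rewrite /N1' powRM ?(ltW be0) ?(ltW N0)// mulrA; apply: ler_wpM2l.
  nneg.
 by apply: ler_powR=> //; rewrite lerN2.
rewrite le_eqVlt; apply/orP; left; apply/eqP; rewrite /th.
have := exprn_gt0 n (ltr0Sn R 2); move: (3^+n) (N`^(- s))=> z1 z2 z10. by field; rewrite !gt_eqF.
Qed.

End MaximalTail.

(** * From a local solution to the unit cube *)

Section Rescaling.
Context {R: realType} {n: nat}.
Notation E := 'rV[R]_n.
Notation B0 r := (\1_(ball (0 : E) r) : E -> R).
Implicit Types (f u phi psi: E -> R) (g b F: E -> E) (i: 'I_n) (d eps mu t r k M s p La lam: R) (c x y: E).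

(** The unscaled counterpart of [cell_data]. Equation and weak gradient are tested only with
    functions supported in a cube with a margin inside [U], the form in which rescaled cubes call
    for them. *)
Record loc_data p La eps mu (U: set E) u g b F: Prop := LocData {
 ld_mg: mblev g; ld_mb: mblev b; ld_mF: mblev F; ld_growth: forall x, enorm (b x)<=La*(mu+enorm (g x))`^(p-1);
 ld_coer: forall x, U x -> (mu+enorm (g x))`^p<=La*(dot (b x) (g x)+mu`^p);
 ld_mono: forall x (z: 'rV[int]_n), let h := eps *: map_mx intr z in U x -> U (x+h) ->
  monq p (mu+enorm (g x)+enorm (g (x+h))) (enorm (g (x+h)-g x)) <= La*dot (b (x+h)-b x) (g (x+h)-g x);
 ld_u: itg u; ld_g: forall i, itg (fun x=> g x 0 i);
 ld_eq: forall c r M phi, ball c r `<=` U -> M<r -> smooth phi -> (forall x, ~ ball c M x -> phi x = 0) ->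
  itg (fun x=> dot (b x) (grad phi x)-dot (F x) (grad phi x)) /\
  integ (fun x=> dot (b x) (grad phi x)-dot (F x) (grad phi x)) = 0;
 ld_weak: forall c r M phi i, ball c r `<=` U -> M<r -> smooth phi -> (forall x, ~ ball c M x -> phi x = 0) ->
  integ (fun x=> u x * partial i phi x) = - integ (fun x=> g x 0 i * phi x) }.

Lemma enormZ k x: 0<=k -> enorm (k *: x) = k*enorm x.
move=> k0; rewrite /enorm; have ->: dot (k *: x) (k *: x) = k^+2*dot x x.
 by rewrite /dot mulr_sumr; apply: eq_bigr=> i _; rewrite !mxE; ring.
by rewrite sqrtrM ?sqr_ge0// sqrtr_sqr ger0_norm.
Qed.

Lemma monqZ p k S t: 0<k -> 0<=S -> 0<=t -> 1<p -> monq p (k*S) (k*t) = k`^p * monq p S t.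
move=> k0 S0 t0 p1; rewrite /monq; case: ifP=> _; first by rewrite powRM// ltW.
rewrite powRM ?(ltW k0)// exprMn. have ->: k`^p = k`^(p-2)*k^+2.
 by rewrite -powR_mulrn ?(ltW k0)// -powRD ?(gt_eqF k0) ?implybT//; congr (_ `^ _); ring.
by move: (k`^_) (S`^_)=> z1 z2; ring.
Qed.

Lemma ball_aff c r M x: 0<r -> ball (0: E) M x <-> ball c (r*M) (c+r *: x).
move=> r0; rewrite ball0E -ball_normE /ball_ /= opprD addrA subrr add0r normrN normrZ (gtr0_norm r0).
by rewrite ltr_pM2l.
Qed.

Lemma affK c r x: 0<r -> - (r^-1 *: c)+r^-1 *: (c+r *: x) = x.
Proof. by move=> r0; rewrite scalerDr addrA addNr add0r scalerA mulVf ?scale1r// gt_eqF. Qed.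

Lemma mblev_aff g c r: r != 0 -> mblev g -> mblev (fun x=> g (c+r *: x)).
Proof. by move=> r0 mg i; exact: (mble_aff c r0 (mg i)). Qed.

Let ball_pull c r M y: 0<r -> ~ ball c (r*M) y -> ~ ball (0: E) M (- (r^-1 *: c)+r^-1 *: y).
move=> r0 h; move=> /(ball_aff c M _ r0); apply: contra_not h.
by rewrite scalerDr scalerN !scalerA divff ?gt_eqF// !scale1r addrA subrr add0r.
Qed.

Lemma dotZZ (k k': R) x y: dot (k *: x) (k' *: y) = k*k'*dot x y :> R.
Proof. by rewrite /dot mulr_sumr; apply: eq_bigr=> i _; rewrite !mxE; ring. Qed.

(** With [x -> c + r x], gradients are multiplied by [k = lam^(-1/p)] and fluxes by [k^(p-1)]. The
    structure conditions are homogeneous under this scaling, with [mu] replaced by [k mu]. The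
    energy becomes at most [1], the period [eps/r], and [mu^p <= lam] keeps [k mu] at most [1]. *)
Lemma rescale p La eps mu (U: set E) u g b F c r d lam :
 1<p -> 1<=La -> 0<=mu -> 0<eps -> loc_data p La eps mu U u g b F ->
 0<r -> 0<lam -> mu`^p<=lam -> eps<=d*r -> ball c (r*16) `<=` U ->
 ub (fun x=> \1_(ball c (r*16)) x*(mu+enorm (g x))`^p) (lam*r^+n) ->
 ub (fun x=> \1_(ball c (r*16)) x*enorm (F x)`^(p/(p-1))) (d*(lam*r^+n)) -> let k := lam`^(- p^-1) in
 cell_data p La d (eps/r) (k * mu) (fun x=> k *: g (c+r *: x))
  (fun x=> k`^(p-1) *: b (c+r *: x)) (fun x=> k`^(p-1) *: F (c+r *: x)).
move=> p1 La1 mu0 e0 D r0 l0 mul er BU uG uF k.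
have p0: 0<p by lra. have p0': 0<=p by lra. have pn0 : p != 0 by rewrite gt_eqF.
have k0: 0<k by exact: powR_gt0. have k0' := ltW k0.
have kp : k`^p = lam^-1 by rewrite /k -powRrM mulNr mulVf// powR_inv1// ltW.
have r0' : r != 0 by rewrite gt_eqF. have q0: 0<=k`^(p-1) by nneg.
have kk : k`^(p-1)*k = k`^p by exact: powRB1. have rn0 : r^+n != 0 by rewrite expf_neq0.
have mg := ld_mg D; have mb := ld_mb D; have mF := ld_mF D.
have mgk : mblev (fun x=> k *: g (c+r *: x)) by apply: mblevZ (mble_cst _) _; exact: mblev_aff.
have Gk x : k * mu+enorm (k *: g x) = k*(mu+enorm (g x)) by rewrite enormZ// mulrDr.
have G0 x: 0<=mu+enorm (g x) by rewrite addr_ge0// enorm_ge0.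
have in16 x : ball (0: E) 16 x -> U (c+r *: x) by move=> /(ball_aff c 16 x r0); exact: BU.
have indE x : B0 16 x = \1_(ball c (r*16)) (c+r *: x) :> R.
 have [h|h] := pselect (ball (0: E) 16 x).
  by rewrite !indic_in//; apply/(ball_aff c 16 x r0).
 by rewrite !indic_out// => /(ball_aff c 16 x r0).
have uG' : ub (fun x=> B0 16 x*(k * mu+enorm (k *: g (c+r *: x)))`^p) 1.
 have u1 := ubZ (powR_ge0 k p) (ub_aff c r0' uG). apply: (ub_cle _ (ub_eq _ u1))=> [|x].
  by rewrite kp gtr0_norm//; move: (r^+n) rn0=> z z0; rewrite le_eqVlt; apply/orP; left; apply/eqP; field; rewrite z0 gt_eqF.
 by rewrite Gk powRM// indE mulrCA.
split=> //.
- rewrite mulr_ge0//= -(powRr1 (mulr_ge0 k0' mu0)).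
 have h : (k * mu)`^p<=1.
  by rewrite powRM// kp mulrC ler_pdivrMr// mul1r.
 have := le_pow (_: 0<=p^-1) (powR_ge0 _ _) h. rewrite -powRrM divff// powR1; apply; nneg.
- by rewrite divr_gt0//= ler_pdivrMr.
- by apply: mblevZ (mble_cst _) _; exact: mblev_aff.
- by apply: mblevZ (mble_cst _) _; exact: mblev_aff.
- move=> x; rewrite Gk enormZ// powRM// mulrCA; apply: ler_wpM2l=> //; exact: ld_growth D _.
- move=> x /in16 xU; rewrite Gk dotZZ kk !powRM// -mulrDr mulrCA.
 by apply: ler_wpM2l; [nneg|exact: ld_coer D _ xU].
- move=> x z h /in16 xU /in16 xhU.
 have e1 : c+r *: (x+h) = c+r *: x+eps *: map_mx intr z.
  by rewrite scalerDr addrA /h scalerA mulrCA divff// mulr1.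
 rewrite e1 in xhU *. have := ld_mono D xU xhU; move: (c+r *: x) xU xhU=> y yU yhU.
 move: (y+_) yhU=> y' y'U hm. rewrite -!scalerBr dotZZ kk Gk !enormZ// -mulrDr monqZ//; last 2 first.
 + by rewrite addr_ge0 ?enorm_ge0.
 + by nneg. by rewrite mulrCA; apply: ler_wpM2l=> //; nneg.
- have u1 := ubZ (powR_ge0 k p) (ub_aff c r0' uF).
 apply: (ub_cle _ (ub_eq _ u1))=> [|x].
  by rewrite kp gtr0_norm//; move: (r^+n) rn0=> z z0; rewrite le_eqVlt; apply/orP; left; apply/eqP; field; rewrite z0 gt_eqF.
 by rewrite enormZ// powRM ?enorm_ge0// powB1_conj// indE mulrCA.
- move=> phi M sphi M16 vphi.
 pose psi y:= phi (- (r^-1 *: c)+r^-1 *: y). have spsi : smooth psi := smooth_aff _ _ sphi.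
 have vpsi y: ~ ball c (r*M) y -> psi y = 0 by move=> /(ball_pull r0); exact: vphi.
 have rM : r*M<r*16 by rewrite ltr_pM2l. have [iW zW] := ld_eq D BU rM spsi vpsi.
 have gE x : grad phi x = r *: grad psi (c+r *: x).
  apply/rowP=> j; rewrite !mxE (partial_aff _ _ _ _ sphi) mulrA divff// mul1r. by rewrite affK.
 pose W y:= dot (b y) (grad psi y)-dot (F y) (grad psi y).
 have e : integ (fun x=> k`^(p-1)*r*W (c+r *: x)) = 0.
  have i1 : itg (fun x=> W (c+r *: x)) := itg_aff c r0' iW.
  rewrite (integZ _ i1) (integ_aff c r0' iW) [integ W]zW !mulr0//.
 rewrite -[RHS]e; apply: integ_eq=> x; rewrite gE !dotZZ /W mulrBr//.
- move=> t t0.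
 (* [uh] is the rescaled solution with a sharp cutoff. Its mollifications serve as approximations;
    only their gradients in the cube of radius [15], away from the jump, are compared with [wh]. *)
 pose uh x:= B0 16 x*(k*r^-1*u (c+r *: x)). pose wh i x:= B0 16 x*(k*g (c+r *: x) 0 i).
 have iu : itg (fun x=> u (c+r *: x)) := itg_aff c r0' (ld_u D).
 have cut f : itg f -> itg (fun x=> B0 16 x*f x).
  move=> fi; have := itg_mulb (C := 1) fi (mble_ball (0: E) 16).
  have h1 : forall x, `|B0 16 x|<=1 by move=> x; rewrite ger0_norm ?indic_ge0// indic_le1.
  by move=> /(_ h1); congr (itg _); apply: funext=> x; rewrite mulrC.
 have iuh : itg uh by apply: cut; exact: itgZ. have mwh i : mble (wh i).
  by apply: mbleM; [mbl|apply: mbleM (mble_cst _) _; exact: (mblev_aff c r0' mg i)].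
 have vwh i : vanish 16 (wh i) by move=> x hx; rewrite /wh indic_out ?mul0r.
 have uwh i : ub (fun x=> `|wh i x| `^ p) 1.
  apply: (ub_fle _ _ _ uG')=> [|x|x].
  - mbl.
  - nneg. have [hx|hx] := pselect (ball (0: E) 16 x); last first.
   by rewrite vwh// normr0 powR0// mulr_ge0 ?powR_ge0.
  have i1 : B0 16 x = 1 := indic_in hx.
  rewrite /wh i1 !mul1r; apply: le_pow=> //; rewrite Gk normrM (ger0_norm k0').
  by apply: ler_wpM2l=> //; rewrite (le_trans (coord_le_enorm _ _))// lerDr.
 have wk i phi M' : smooth phi -> M' < 16 -> vanish M' phi ->
   integ (fun y=> uh y * partial i phi y) = - integ (fun y=> wh i y * phi y).
  move=> sphi M16 vphi. pose psi y:= phi (- (r^-1 *: c)+r^-1 *: y).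
  have spsi : smooth psi := smooth_aff _ _ sphi.
  have vpsi y: ~ ball c (r*M') y -> psi y = 0 by move=> /(ball_pull r0); exact: vphi.
  have rM : r*M' < r*16 by rewrite ltr_pM2l. have eqW := ld_weak D i BU rM spsi vpsi.
  have [C [C0 hC1 hC2 _]] := smooth_bounds sphi vphi.
  have pE y : partial i psi y = r^-1 * partial i phi (- (r^-1 *: c)+r^-1 *: y) := partial_aff i _ _ _ sphi.
  have i1 : itg (fun y=> u y * partial i psi y).
   apply: (itg_mulb (C := r^-1*C) (ld_u D)); first mbl.
   move=> y; rewrite pE normrM gtr0_norm ?invr_gt0//; apply: ler_wpM2l=> //. nneg.
  have i2 : itg (fun y=> g y 0 i * psi y).
   apply: (itg_mulb (C := C) (ld_g D i))=> [|y]; first mbl. exact: hC1.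
  have j1 := itg_aff c r0' i1. have j2 := itg_aff c r0' i2.
  have e1 : integ (fun y=> uh y * partial i phi y) = k*(`|r| ^- n * integ (fun y=> u y * partial i psi y)).
   rewrite -(integ_aff c r0' i1) -(integZ k j1); apply: integ_eq=> y.
   have [hy|hy] := pselect (ball (0: E) 16 y).
    have b1 : B0 16 y = 1 := indic_in hy.
    by rewrite /uh b1 mul1r pE affK//; move: (u _) (partial i phi y) (r^-1)=> z1 z2 z3; ring.
   by rewrite /uh indic_out// mul0r mul0r pE affK// (vanish_d i M16 vphi)// !mulr0.
  have e2 : integ (fun y=> wh i y * phi y) = k*(`|r| ^- n * integ (fun y=> g y 0 i * psi y)).
   rewrite -(integ_aff c r0' i2) -(integZ k j2); apply: integ_eq=> y; rewrite /psi affK//.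
   have [hy|hy] := pselect (ball (0: E) 16 y).
    by have b1 : B0 16 y = 1 := indic_in hy; rewrite /wh b1 mul1r mulrA.
   have ->: phi y = 0 by apply: (vanishW (ltW M16) vphi). by rewrite !mulr0.
  by rewrite e1 e2 eqW !mulrN.
 (* [C] is the reciprocal of a threshold for [s]: an upper bound common to all coordinates is what
    [fin_bound] provides. *)
 have lt015 : (0: R)<15 by lra. have lt1516 : (15: R)<16 by lra. pose P i C:= forall s, 0<s -> s*C<1 ->
  ub (fun x=> B0 15 x * `|partial i (moll s uh) x-wh i x| `^ p) t.
 have [C C0 hC]: exists2 C, 0<=C & forall i, P i C.
  apply: fin_bound=> [i C C' hP CC s s0 sC|i].
   by apply: hP=> //; apply: le_lt_trans sC; rewrite ler_pM2l.
  have [k1 k10 hk] := smooth_approx p1 lt015 lt1516 iuh (mwh i) (vwh i) (uwh i) (wk i) t0.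
  exists k1^-1; first nneg. by move=> s s0; rewrite ltr_pdivrMr// mul1r; exact: hk.
 have C1: 0<C+1 by lra. pose s:= (C+1)^-1. have s0: 0<s by rewrite invr_gt0. have lt016 : (0: R)<16 by lra.
 have s1: 16+s<=17.
  have: s<=1 by rewrite invf_le1//; lra. lra.
 exists (moll s uh); split; first exact: smooth_moll.
  apply: (vanishW s1); apply: vanish_moll=> // x hx; by rewrite /uh indic_out ?mul0r.
 move=> i; have := hC i s s0; rewrite mulrC ltr_pdivrMr// mul1r=> /(_ (ltr_pwDr ltr01 (lexx C))).
 apply: ub_eq=> x; have [hx|hx] := pselect (ball (0: E) 15 x); last by rewrite indic_out// !mul0r.
 have b1 : B0 16 x = 1 by apply: indic_in; apply: le_ball hx; exact: ltW. by rewrite /wh b1 mul1r !mxE.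
Qed.

End Rescaling.

#[local] Hint Resolve ld_mg: mble.

(** * Exit radii and the inequality between consecutive levels *)

Section LevelSets.
Context {R: realType} {n: nat}.
Notation E := 'rV[R]_n.
Notation L := (lebesgueType R n).
Notation leb := (@lebesgue R n).
Implicit Types (f: E -> R) (A: set E) (k r c t N M: R) (x y z: E).

Definition lev f k t:= [set x: E | exists r, k<=r /\ bad f x r t].

Lemma badP f x r N c: mble f -> (forall y, 0<=f y) -> ub f c -> bad f x r N -> N*(2*r)^+n<c.
move=> mf f0 u hb; rewrite ltNge; apply/negP=> h; apply: hb; apply: (ub_cle h).
apply: (ub_fle _ _ _ u)=> [|y|y].
- mbl.
- nneg.
- by rewrite ler_piMl.
Qed.

Lemma ub_sub f x y r r' c: mble f -> (forall y, 0<=f y) -> ball x r `<=` ball y r' ->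
 ub (fun z=> \1_(ball y r') z*f z) c -> ub (fun z=> \1_(ball x r) z*f z) c.
move=> mf f0 h u; apply: (ub_fle _ _ _ u)=> [|z|z].
- mbl.
- nneg. apply: ler_wpM2r=> //; have [hz|hz] := pselect (ball x r z).
 by rewrite !indic_in//; exact: h.
by rewrite [leLHS]indic_out// indic_ge0.
Qed.

Lemma ball_shift_sub x y r r' M: ball x M y -> M+r<=r' -> ball y r `<=` ball x r'.
Proof. by move=> xy h z yz; apply: le_ball h _ _; exact: ball_triangle xy yz. Qed.

(** The mass of a bad cube still exceeds [t] times the volume of a slightly larger cube, and the
    larger cube contains the bad one even when centred at a nearby point. Openness is the source of
    measurability for the level sets. *)
Lemma open_lev f k t: mble f -> (forall y, 0<=f y) -> 0<=k -> 0<=t -> open (lev f k t).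
move=> mf f0 k0 t0; rewrite openE=> x [r [kr hb]]. have [d d0 hd]: exists2 d: R, 0<d &
  ~ ub (fun z=> \1_(ball x r) z*f z) (t*(2*(r+d))^+n).
 apply: contrapT=> hn; apply: hb; apply: ub_lim=> e e0. have hc : continuous (fun s: R=> t*(2*s)^+n).
  move=> s; apply: cvgM; first exact: cvg_cst.
  apply: (@continuous_comp _ _ _ (fun s: R=> 2*s) (fun s: R=> s^+n)).
   by apply: cvgM; [exact: cvg_cst|nneg].
  exact: exprn_continuous.
 have /cvgr_dist_lt /(_ e e0) := hc r. move=> /nbhs_ballP[d /= d0 hd]. have d2: 0<d/2 by nneg.
 have bd : ball r d (r+d/2).
  by rewrite /ball /= opprD addrA subrr add0r normrN gtr0_norm// ltr_pdivrMr// ltr_pMr// ltr1n.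
 have /= := hd _ bd; rewrite distrC=> /ltW /(le_trans (ler_norm _)). rewrite lerBlDl=> h; apply: (ub_cle h).
 by apply: contrapT=> hu; apply: hn; exists (d/2).
apply/nbhs_ballP; exists d=> //= y xy; exists (r+d); split; first by rewrite (le_trans kr)// lerDl ltW.
move=> u; apply: hd; apply: ub_sub u=> //. by apply: (ball_shift_sub (ball_sym xy)); rewrite addrC.
Qed.

Lemma packed_sum (r: E -> R) (s: seq E) A: packed r s -> (forall x, x \in s -> 0<r x) ->
 (forall x, x \in s -> ball x (r x) `<=` A) -> ((\sum_(x <- s) (2*r x)^+n)%:E<=leb A)%E.
move=> ps r0 sA. pose V: set E:= [set z | exists2 x, x \in s & ball x (r x) z].
have mV : measurable (V: set L).
 apply: open_lmbl; rewrite (_: V = \bigcup_(x in [set` s]) ball x (r x)).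
  by apply: bigcup_open=> x _; exact: ball_open.
 by [].
apply: (@le_trans _ _ (leb V)); last by apply: le_lebesgue_outer=> z [x /sA]; exact.
have ->: ((\sum_(x <- s) (2*r x)^+n)%:E = \int[leb]_z (\sum_(x <- s) \1_(ball x (r x)) z)%:E)%E.
 elim: s {ps sA V mV} r0=> [|x s IH] r0.
  by rewrite big_nil; under eq_integral do rewrite big_nil; rewrite integral0.
 rewrite big_cons EFinD IH; last by move=> y ys; apply: r0; rewrite inE ys orbT.
 have x0: 0<r x by apply: r0; rewrite inE eqxx. under [RHS]eq_integral do rewrite big_cons.
 rewrite intEFD; last 4 first.
 - exact: mble_ball.
 - by apply: mble_sum=> y; mbl.
 - by [].
 - by move=> z; apply: sumr_ge0=> y _; nneg. congr (_+_)%E; have mb := mbl_lball x (r x).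
 rewrite (integral_indic leb measurableT mb) setIT; exact/esym/leb_ball.
have ->: leb V = (\int[leb]_z (\1_V z)%:E)%E.
 by rewrite (integral_indic leb measurableT mV) setIT.
apply: intEF_le.
- by apply: mble_sum=> y; mbl.
- nneg.
- by move=> z; apply: sumr_ge0=> y _; nneg.
move=> z; have [hz|hz] := pselect (V z); first by rewrite [leRHS]indic_in//; exact: ps.
rewrite [leRHS]indic_out// big_seq big1// => x xs; apply: indic_out=> hx. by apply: hz; exists x.
Qed.

Lemma enormD_l1 x y: enorm (x+y)<=enorm x+l1 y.
have e0: 0<=enorm x+l1 y by rewrite addr_ge0 ?enorm_ge0 ?l1_ge0.
rewrite -(ler_sqr (enorm_ge0 _) e0) {1}/enorm sqr_sqrtr ?dot_ge0//.
rewrite dotDl !dotDr sqrrD -[X in _<=X+_+_]/(enorm x^+2) {1 2}/enorm sqr_sqrtr ?dot_ge0//.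
have h1 := le_trans (ler_norm _) (dot_le x y). have h2 : dot y y<=l1 y^+2.
 rewrite -[dot y y](sqr_sqrtr (dot_ge0 y)) ler_sqr ?nnegrE ?l1_ge0 ?sqrtr_ge0//. exact: enorm_le_l1.
have h3 : dot y x = dot x y by rewrite /dot; apply: eq_bigr=> i _; rewrite mulrC.
rewrite h3 -/(enorm x) mulr2n.
move: h1 h2; move: (enorm x * l1 y) (dot x x) (dot x y) (dot y y) (l1 y^+2)=> z1 z2 z3 z4 z5 h1 h2; lra.
Qed.

Lemma eball_add x y z r k t: eball x r y -> ball y k z -> 0<=k -> r+n%:R*k<=t -> eball x t z.
move=> h1 h2 k0 h3; rewrite /eball /=; apply: lt_le_trans h3.
have ->: z-x = (y-x)+(z-y) by rewrite [RHS]addrC addrA subrK.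
apply: (le_lt_trans (enormD_l1 _ _)); apply: ltr_leD=> //.
rewrite -sum_cst; apply: ler_sum=> i _; apply: (le_trans (coord_le_norm _ i)).
by move: h2; rewrite -ball_normE /ball_ /= distrC=> /ltW.
Qed.

End LevelSets.

Section GoodLambda.
Context {R: realType} {n: nat} (n0: (0<n)%N) (p La: R) (p1: 1<p) (La1: 1<=La).
Notation E := 'rV[R]_n.
Notation leb := (@lebesgue R n).
Implicit Types (f u: E -> R) (g b F: E -> E) (d eps mu rad c r k N s t lam: R) (x y: E) (j: nat).

(** Radii decreasing from [3/4 rad] towards [rad/2]. Consecutive ones differ by [rad/(8 2^j)], which
    leaves room for the exit cubes of level [j]. *)
Definition shrunk rad j: R := rad*(2^-1+4^-1*(2^+j)^-1).

(** The lowest level. If [c] is the total mass, a cube of radius [r] that is bad at this level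
    satisfies [96 n r < rad]. *)
Definition height c rad: R := c*(48*n%:R/rad)^+n.

(** The ratio of consecutive levels is an [n]-th power, so that the radii of bad cubes decrease at
    least like [J^(-j)]. *)
Definition level (J: nat) lam j: R := (J%:R^+n)^+j * lam.

Definition Alev (J: nat) f (x0: E) rad k lam j: set E := eball x0 (shrunk rad j) `&` lev f k (level J lam j).

Definition Plev (J: nat) f (x0: E) rad k lam d j: set E := eball x0 rad `&` lev f k (d * level J lam j).

(* A radius at which [f] exceeds the level while it does not at radii twice as
  large. *)
Lemma exit_radius f x k t c r: mble f -> (forall y, 0<=f y) -> ub f c -> 0<t -> 0<k -> k<=r ->
 (* Bad radii are bounded because the mass is finite: for [s >= 1] one has [(2s)^n >= 2s], which
    makes the bound explicit. The exit radius is then a bad radius above half of the supremum. *)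
 bad f x r t -> exists r', [/\ k<=r', bad f x r' t & forall r'', 2*r' <= r'' -> ~ bad f x r'' t].
move=> mf f0 uf t0 k0 kr hb. pose S:= [set r | k<=r /\ bad f x r t]. have Sle s : S s -> s<=Num.max 1 (c/t).
 move=> [ks hs]; have := badP mf f0 uf hs; rewrite mulrC -ltr_pdivlMr// => h.
 rewrite le_max; apply/orP; have [s1|s1] := leP s 1; [by left|right].
 apply: le_trans (ltW h); apply: (@le_trans _ _ (2*s)); first by rewrite ler_peMl ?ler1n// ltW// (lt_trans ltr01).
 have s2: 1<=2*s by lra. by rewrite -[leLHS]expr1 ler_weXn2l.
have hS : has_sup S by split; [exists r|exists (Num.max 1 (c/t))=> s; exact: Sle]. have sp: 0<sup S.
 by apply: (lt_le_trans k0); apply: (le_trans kr); apply: ub_le_sup; [exact: hS.2|].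
have [r' [kr' hr'] lt']: exists2 y, S y & sup S/2<y.
 by apply: sup_gt; [exact: hS.1 | rewrite ltr_pdivrMr// ltr_pMr// ltr1n].
exists r'; split=> // r'' h hb''. have: r'' <= sup S.
 apply: ub_le_sup; first exact: hS.2.
 by split=> //; apply: le_trans h; apply: (le_trans kr'); rewrite ler_peMl ?ler1n// (le_trans (ltW k0)).
by move: lt'; rewrite ltr_pdivrMr// => a1 a2; lra.
Qed.

Lemma shrunk_le rad j: 0<rad -> shrunk rad j<=rad*(3/4).
move=> r0; rewrite /shrunk ler_pM2l//; have h : (2^+j)^-1<=1 :> R.
 by rewrite invf_le1// exprn_ege1// ler1n.
lra.
Qed.

Lemma shrunk_step rad j: shrunk rad j.+1+rad*(8*2^+j)^-1 = shrunk rad j.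
rewrite /shrunk exprS; have: 2^+j != 0 :> R by []. by move: (2^+j)=> z z0; field; rewrite z0.
Qed.

Let pow4 (c x y z: R): 2^+n*(x^+n*(c*y^+n))*z^+n = c*(x*(y*(2*z)))^+n.
Proof. by rewrite !exprMn; ring. Qed.

(** A bad cube carries at most the total mass [c], and the levels grow at least like [2^(n j)]. The
    exit radii therefore fit into the gaps left by [shrunk]. *)
Lemma exit_small (J j: nat) rad c r: 0<rad -> 0<c -> 0<r -> (2<=J)%N ->
 2^+n * level J (height c rad) j*(2*r)^+n<c -> 192*n%:R*r*2^+j<=rad.
move=> R0 c0 r0 J2 h. have nR: 0<n%:R :> R by nneg.
have e: 2^+n * level J (height c rad) j*(2*r)^+n = c*(192*n%:R*r*J%:R^+j/rad)^+n.
 rewrite /level /height -exprM mulnC exprM. rewrite pow4. by congr (_*_^+n); field; rewrite gt_eqF.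
have Jj: 2^+j<=J%:R^+j :> R by apply: lerXn2r; rewrite ?nnegrE// ler_nat.
rewrite e -[X in _<X]mulr1 ltr_pM2l// in h. have y0: 0<=192*n%:R*r*J%:R^+j/rad.
 nneg.
have: 192*n%:R*r*J%:R^+j/rad<1.
 by rewrite -(expr_lt1 (n := n))// .
rewrite ltr_pdivrMr// mul1r=> /ltW; apply: le_trans; apply: ler_wpM2l=> //. nneg.
Qed.

Let canc (l i z: R): l != 0 -> l*(i*(l^-1*z)) = i*z.
Proof. by move=> l0; field. Qed.

Let vol64 (l r: R): 64^+n * l*r^+n = l*(64*r)^+n.
Proof. by rewrite exprMn; ring. Qed.

Let vol_scale (l N' r z: R): l*(r^+n*(N'*z^+n)) = l*N'*(r*z)^+n.
Proof. by rewrite exprMn; ring. Qed.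

(** Exit cubes are taken at level [2^n lj]: all concentric cubes of at least twice the radius have
    means below it, and every point of the exit cube belongs to the level set [j]. If such a cube
    contains a point where the forcing is small relative to [lj], rescaling and [maximal_tail] make
    the next level set a small fraction of the tripled cube; otherwise the cube lies in the level
    set of the forcing. *)
Lemma level_step sig: 0<sig -> exists (J: nat) (d: R), [/\ (2<=J)%N, 0<d, d<=1 &
 forall eps mu (x0: E) rad u g b F c, 0<rad -> 0<=mu -> 0<eps -> 0<c ->
 loc_data p La eps mu (eball x0 rad) u g b F -> let f x := \1_(eball x0 rad) x*(mu+enorm (g x))`^p in
 let h x := \1_(eball x0 rad) x*enorm (F x)`^(p/(p-1)) in mble f -> mble h ->
 mu`^p<=height c rad -> ub f c -> forall j, (leb (Alev J f x0 rad (d^-1*eps) (height c rad) j.+1) <=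
  (2^-1*(J%:R^+n)`^(- sig))%:E * leb (Alev J f x0 rad (d^-1*eps) (height c rad) j) +
  (3^+n)%:E * leb (Plev J h x0 rad (d^-1*eps) (height c rad) d j))%E].
have p1' := p1; move=> sig0. have [C C0 hC] := maximal_tail n0 p1 La1 (sig+1).
(* The factor [64^n] between [N] and [N'] is the cost of the rescaling. The decay exponent was taken
   to be [sig + 1], and [2 c1 <= N] lets the surplus power of [N] beat the constant. *)
pose c1:= 2^+n*C*(64^+n)`^(sig+1). have c10: 0<c1 by rewrite !mulr_gt0. pose J:= maxn 64 (Num.bound (2*c1)).
have J64 : (64<=J)%N by rewrite leq_maxl. have J2 : (2<=J)%N by exact: leq_trans J64. pose N: R := J%:R^+n.
have N64: 64^+n<=N by apply: lerXn2r; rewrite ?nnegrE// ler_nat. have z640: 0<64^+n :> R by nneg.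
have N0: 0<N by exact: lt_le_trans N64. pose N' := N/64^+n. have N'1: 1<=N' by rewrite ler_pdivlMr// mul1r.
have [d1 d10 hd1] := hC N' N'1. pose d:= Num.min 1 d1. have d0: 0<d by rewrite lt_min ltr01.
have dle1 : d<=1 by rewrite /d ge_min lexx. have dd1 : d<=d1 by rewrite /d ge_min lexx orbT.
have Nsmall: 2^+n*(C*N'`^(- (sig+1)))<=2^-1*N`^(- sig).
 have ->: N'`^(- (sig+1)) = (64^+n)`^(sig+1)*(N`^(- sig)*N^-1).
  rewrite /N' powRM ?invr_ge0 ?(ltW N0) ?(ltW z640)// mulrC; congr (_*_).
   by rewrite -powR_inv1// -powRrM mulrNN mul1r.
  by rewrite opprD powRD ?(gt_eqF N0) ?implybT// powR_inv1// ltW.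
 have NJ: 2*c1<=N.
  apply: (@le_trans _ _ J%:R).
   apply: (le_trans (ltW (archi_boundP _))); first nneg. by rewrite ler_nat leq_maxr.
  rewrite /N -[leLHS]expr1 ler_weXn2l ?ler1n//; exact: leq_trans J2.
 have ->: 2^+n*(C*((64^+n)`^(sig+1)*(N`^(- sig)*N^-1))) = c1/N*N`^(- sig).
  by rewrite /c1; ring.
 apply: ler_wpM2r; first nneg. by rewrite ler_pdivrMr// mulrC ler_pdivlMr// mulrC.
exists J, d; split=> // eps mu x0 rad u g b F c R0 mu0 e0 c0 D f h mf mh mulam uf j.
set lam:= height c rad in mulam *. have nR: 0<n%:R :> R by nneg.
have lam0: 0<lam by rewrite /lam /height mulr_gt0// exprn_gt0// divr_gt0// mulr_gt0.
have f0 x: 0<=f x by rewrite mulr_ge0 ?powR_ge0. have h0 x: 0<=h x by rewrite mulr_ge0 ?powR_ge0.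
pose k:= d^-1*eps; have k0: 0<k by rewrite mulr_gt0 ?invr_gt0.
have epsk : eps<=k by rewrite /k ler_peMl ?(ltW e0)// invf_ge1. pose lj:= level J lam j.
have lj0: 0<lj by rewrite mulr_gt0// exprn_gt0// exprn_gt0 ltr0n (leq_trans _ J2). have lamlj : lam<=lj.
 rewrite /lj /level ler_peMl ?(ltW lam0)// exprn_ege1// exprn_ege1// ler1n; exact: leq_trans J2.
have ljS : level J lam j.+1 = N * lj by rewrite /lj /level exprS -mulrA.
pose sk:= 2^+n * lj; have sk0: 0<sk by rewrite mulr_gt0// exprn_gt0. have l24: 2^+n*2^+n<=N.
 apply: le_trans N64; rewrite -exprMn; apply: lerXn2r; rewrite ?nnegrE ?mulr_ge0//; lra.
have skN : sk<=N * lj.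
 rewrite /sk ler_pM2r//; apply: le_trans l24; rewrite ler_peMl ?exprn_ge0//.
 by apply: exprn_ege1; rewrite ler1n.
set A1:= Alev J f x0 rad k lam j.+1.
pose P x r:= [/\ k<=r, bad f x r sk & forall r'', 2*r<=r'' -> ~ bad f x r'' sk].
pose rho x:= xget k [set r | P x r]. have hrho x : A1 x -> P x (rho x).
 move=> [_ [r [kr hb]]]; rewrite /rho; case: xgetP=> [y _ //|nP].
 rewrite ljS in hb; have hb' := bad_le skN (le_trans (ltW k0) kr) hb.
 have [r' hr'] := exit_radius mf f0 uf sk0 k0 kr hb'. by case: (nP r').
have rho0 x : A1 x -> 0<rho x by move=> /hrho[h1 _ _]; exact: lt_le_trans h1.
have small x : A1 x -> 192*n%:R*rho x*2^+j<=rad.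
 move=> hx; have [_ hb _] := hrho x hx. have := badP mf f0 uf hb; apply: exit_small=> //; exact: rho0.
have small48 x : A1 x -> shrunk rad j.+1+n%:R*(48*rho x)<=rad.
 move=> hx; have := small x hx; have := shrunk_le j.+1 R0; have r0 := rho0 x hx.
 have: 192*n%:R*rho x<=192*n%:R*rho x*2^+j.
  by rewrite ler_peMr ?exprn_ege1 ?ler1n//; rewrite !mulr_ge0// ltW.
 move: (192*n%:R*rho x*2^+j)=> z; lra.
have in48 x : A1 x -> ball x (48*rho x) `<=` eball x0 rad.
 move=> hx y xy; apply: (eball_add _ xy (mulr_ge0 (ler0n _ 48) (ltW (rho0 x hx))) (small48 x hx)).
 by case: hx.
have inA x : A1 x -> ball x (rho x) `<=` Alev J f x0 rad k lam j.
 move=> hx y xy; have [kr hb _] := hrho x hx; have r0 := rho0 x hx; split.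
  apply: (eball_add _ xy (ltW r0) (_: shrunk rad j.+1+_<=_)); first by case: hx.
  rewrite -(shrunk_step rad j) lerD2l. have z0: 0<8*2^+j :> R by nneg.
  rewrite ler_pdivlMr//; apply: le_trans (small x hx). have: 0<=n%:R*rho x*2^+j by nneg. lra.
 exists (2*rho x); split; first by apply: (le_trans kr); rewrite ler_peMl ?ler1n// ltW.
 move=> v; apply: hb; have := ub_sub mf f0 (_: ball x (rho x) `<=` ball y (2*rho x)) v.
 have ->: lj*(2*(2*rho x))^+n = sk*(2*rho x)^+n.
  by rewrite (exprMn _ 2 (2*rho x)) /sk; ring.
 apply; apply: (ball_shift_sub (ball_sym xy)); lra.
pose M:= `|x0| + rad+1. have M0: 0<M by rewrite /M; have := normr_ge0 x0; lra.
have normA x : A1 x -> `|x|<=`|x0| + rad.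
 move=> [hx _]; have ->: x = x0+(x-x0) by rewrite addrC subrK.
 apply: (le_trans (ler_normD _ _)); rewrite lerD2l; apply: ltW. have hs : shrunk rad j.+1<=rad.
  by apply: (le_trans (shrunk_le _ R0)); rewrite ler_piMr ?(ltW R0)//; lra.
 apply: norm_lt_coord=> // i; apply: (le_lt_trans (coord_le_enorm _ i)). exact: lt_le_trans hx hs.
pose M' := M+rad. have rad48 x : A1 x -> rho x<=rad.
 move=> hx; have := small48 x hx; have r0 := rho0 x hx. have: rho x<=n%:R*(48*rho x).
  rewrite mulrA ler_peMl ?(ltW r0)//; have: 1<=n%:R :> R by rewrite ler1n. lra.
 have: 0<=shrunk rad j.+1.
  by rewrite /shrunk mulr_ge0 ?(ltW R0)// addr_ge0 ?mulr_ge0 ?invr_ge0 ?exprn_ge0.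
 lra.
have M'0: 0<M' by rewrite addr_gt0.
have [s [sA ps cov]]: exists s: seq E, [/\ forall x, x \in s -> A1 x, packed rho s &
  forall y, A1 y -> exists2 x, x \in s & ball x (3*rho x) y].
 apply: (finite_cover k0 M'0)=> x hx.
  have [kr _ _] := hrho x hx; rewrite kr /= (le_trans (rad48 x hx))//. by rewrite /M' lerDr ltW.
 move=> y; rewrite -!ball_normE /ball_ /= sub0r normrN=> xy.
 have ->: y = x-(x-y) by rewrite opprB addrC subrK.
 apply: (le_lt_trans (ler_normB _ _)); have h1 := normA x hx; have h2 := rad48 x hx. by rewrite /M' /M; lra.
pose good x:= `[< exists y, ball x (rho x) y /\ ~ lev h k (d * lj) y >].
have each x : x \in s -> (leb (A1 `&` ball x (3*rho x)) <=
  (if good x then (3*rho x)^+n*(C*N'`^(- (sig+1))) else (2*(3*rho x))^+n)%:E)%E.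
 move=> /sA hx; have r0 := rho0 x hx; rewrite /good; case: asboolP=> [[y [xy gy]]|_]; last first.
  apply: (@le_trans _ _ (leb (ball x (3*rho x)))).
   by apply: le_lebesgue_outer=> z [].
  by rewrite leb_ball// mulr_gt0.
 pose r:= 3*rho x; have rr0: 0<r by rewrite mulr_gt0. have [kr hb hnb] := hrho x hx.
 have e48 : r*16 = 48*rho x by rewrite /r; ring.
 have BU : ball x (r*16) `<=` eball x0 rad by rewrite e48; exact: in48.
 have eqf z: \1_(ball x (r*16)) z*f z = \1_(ball x (r*16)) z*(mu+enorm (g z))`^p.
  have [hz|hz] := pselect (ball x (r*16) z); last by rewrite indic_out// !mul0r.
  by rewrite /f (indic_in (BU z hz)) mul1r.
 have eqh z: \1_(ball x (r*16)) z*h z = \1_(ball x (r*16)) z*enorm (F z)`^(p/(p-1)).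
  have [hz|hz] := pselect (ball x (r*16) z); last by rewrite indic_out// !mul0r.
  by rewrite /h (indic_in (BU z hz)) mul1r.
 (* The exit bound on the cube of radius [16 r] is exactly the normalisation of [rescale], as
    [2^n lj (32 r)^n = 64^n lj r^n]. *)
 pose lam' := 64^+n * lj. have lam'0: 0<lam' by rewrite mulr_gt0. have vol : sk*(2*(r*16))^+n = lam'*r^+n.
  have e1 : (2*(r*16))^+n = 32^+n*r^+n by rewrite -exprMn; congr (_^+n); ring.
  have e2: 64^+n = 2^+n*32^+n :> R by rewrite -exprMn; congr (_^+n); ring. by rewrite e1 /lam' /sk e2; ring.
 have uG : ub (fun z=> \1_(ball x (r*16)) z*(mu+enorm (g z))`^p) (lam'*r^+n).
  rewrite -vol; apply: (ub_eq eqf); apply: contrapT; apply: hnb. by rewrite e48; lra.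
 have uF : ub (fun z=> \1_(ball x (r*16)) z*enorm (F z)`^(p/(p-1))) (d*(lam'*r^+n)).
  have u49 : ub (fun z=> \1_(ball y (49*rho x)) z*h z) (d * lj*(2*(49*rho x))^+n).
   apply: contrapT=> nu; apply: gy; exists (49*rho x); split=> //.
   by apply: (le_trans kr); rewrite ler_peMl ?ler1n// ltW.
  apply: (ub_eq eqh). have sub : ball x (r*16) `<=` ball y (49*rho x).
   by apply: (ball_shift_sub (ball_sym xy)); rewrite e48; lra.
  apply: ub_cle (ub_sub mh h0 sub u49). rewrite -mulrA; apply: ler_wpM2l; first exact: ltW.
  have ->: lam'*r^+n = lj*(64*r)^+n by mbl. apply: ler_wpM2l; first exact: ltW.
  apply: lerXn2r; rewrite ?nnegrE ?mulr_ge0 ?(ltW r0) ?(ltW rr0)//. by rewrite /r; lra.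
 have lamlam' : lam<=lam'.
  apply: (le_trans lamlj); rewrite /lam' ler_peMl ?(ltW lj0)// exprn_ege1// ler1n//.
 have er : eps<=d*r.
  have: eps<=d*rho x.
   by rewrite mulrC -ler_pdivrMr// mulrC; exact: kr.
  move=> h1; apply: (le_trans h1); rewrite ler_pM2l// /r; lra.
 have cd := rescale p1 La1 mu0 e0 D rr0 lam'0 (le_trans mulam lamlam') er BU uG uF.
 have bs := hd1 d (eps/r) _ _ _ _ dd1 cd.
 pose pre: set E:= (fun z: E=> x+r *: z) @^-1` (A1 `&` ball x (3*rho x)). set kap:= lam'`^(- p^-1) in cd bs.
 have kap0: 0<=kap by exact: powR_ge0. have kapp : kap`^p = lam'^-1.
  by rewrite /kap -powRrM mulNr mulVf ?powR_inv1 ?gt_eqF ?(ltW lam'0)//; lra.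
 have Gk z : (kap * mu+enorm (kap *: g (x+r *: z)))`^p = lam'^-1*(mu+enorm (g (x+r *: z)))`^p.
  by rewrite enormZ// -mulrDr powRM ?addr_ge0 ?enorm_ge0// kapp.
 have sub : pre `<=` bad_set (fun z=> (kap * mu+enorm (kap *: g (x+r *: z)))`^p) (eps/r) 1 N'.
  move=> z [[_ [t [kt ht]]] xz]; split.
   by apply/(ball_aff x 1 z rr0); rewrite mulr1.
  (* A radius [t >= r] cannot be bad for the next level: the cube lies in [ball x (2 t)], beyond
     twice the exit radius, and [2^n 2^n lj] is at most the next level. So only radii below [r]
     remain, those covered by [bad_set]. *)
  have t0: 0<t by exact: lt_le_trans kt. have tr : t<r.
   rewrite ltNge; apply/negP=> rt; apply: ht.
   have u2 : ub (fun z=> \1_(ball x (2*t)) z*f z) (sk*(2*(2*t))^+n).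
    apply: contrapT; apply: hnb; move: rt; rewrite /r; lra.
   have sub : ball (x+r *: z) t `<=` ball x (2*t).
    by apply: (ball_shift_sub xz); move: rt; rewrite /r; lra.
   apply: (ub_cle _ (ub_sub mf f0 sub u2)). have ->: (2*(2*t))^+n = 2^+n*(2*t)^+n by rewrite exprMn.
   rewrite ljS mulrA; apply: ler_wpM2r; first nneg. by rewrite /sk mulrAC ler_pM2r.
  exists (t/r); split.
  - by rewrite ler_pM2r ?invr_gt0//; exact: le_trans kt.
  - by rewrite ler_pdivrMr// mul1r ltW. move=> v; apply: ht. pose w a:= - (r^-1 *: x)+r^-1 *: a.
  have rV0 : r^-1 != 0 by rewrite invr_eq0 gt_eqF. have wK a : x+r *: w a = a.
   by rewrite /w scalerDr scalerN !scalerA divff ?gt_eqF// !scale1r addrA subrr add0r.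
  have v1 := ubZ (ltW lam'0) (ub_aff (- (r^-1 *: x)) rV0 v). apply: (ub_cle _ (ub_fle _ _ _ v1))=> [||a|a].
  - rewrite ljS gtr0_norm ?invr_gt0// -exprVn invrK.
   have ->: lam'*(r^+n*(N'*(2*(t/r))^+n)) = lam'*N'*(r*(2*(t/r)))^+n.
    nneg.
   have ->: r*(2*(t/r)) = 2*t by field; rewrite gt_eqF.
   have ->: lam'*N' = N * lj by rewrite /lam' /N'; move: (64^+n) z640=> z' z'0; field; rewrite gt_eqF. by [].
  - by apply: mbleM=> //; mbl.
  - nneg. rewrite -/(w a) Gk wK canc ?gt_eqF//. have [hy|hy] := pselect (ball (x+r *: z) t a); last first.
   by rewrite [X in X*f a]indic_out// mul0r mulr_ge0 ?indic_ge0 ?powR_ge0.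
  have hw : ball z (t/r) (w a).
   move: hy; rewrite -{1}(wK a) -!ball_normE /ball_ /= opprD addrACA subrr add0r -scalerBr normrZ gtr0_norm//.
   by rewrite ltr_pdivlMr// mulrC.
  rewrite (indic_in hy) (indic_in hw) !mul1r /f ler_piMl ?powR_ge0 ?indic_le1//.
 have lp : (leb pre<=(C*N'`^(- (sig+1)))%:E)%E.
  by apply: le_trans bs; apply: le_lebesgue_outer.
 have := mu_ext_affine x (A1 `&` ball x (3*rho x)) (lt0r_neq0 rr0). rewrite gtr0_norm// => ea.
 have lp' : ((r ^- n)%:E * leb (A1 `&` ball x (3*rho x))<=(C*N'`^(- (sig+1)))%:E)%E.
  by rewrite /leb -ea.
 have rn0: 0<r^+n by nneg. have := lee_wpmul2l (_: 0<=(r^+n)%:E)%E lp'.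
 rewrite muleA -!EFinM divff ?gt_eqF// mul1e; apply; nneg.
have tot : (leb A1<=(\sum_(x <- s) (if good x then (3*rho x)^+n*(C*N'`^(- (sig+1))) else (2*(3*rho x))^+n))%:E)%E.
 apply: (leb_cover (T := fun x=> A1 `&` ball x (3*rho x)))=> [y hy|x xs]; last exact: each.
 by have [x xs hxy] := cov y hy; exists x.
apply: (le_trans tot). pose s1:= [seq x <- s | good x]; pose s2:= [seq x <- s | ~~ good x].
have packF (Q: pred E): packed rho [seq x <- s | Q x].
 move=> z; rewrite big_filter; apply: le_trans (ps z); rewrite [leRHS](bigID Q)/= lerDl. nneg.
have b1 : ((\sum_(x <- s1) (2*rho x)^+n)%:E<=leb (Alev J f x0 rad k lam j))%E.
 apply: packed_sum=> [|x|x]; first exact: packF.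
  by rewrite /s1 mem_filter=> /andP[_ /sA]; exact: rho0.
 by rewrite /s1 mem_filter=> /andP[_ /sA]; exact: inA.
have b2 : ((\sum_(x <- s2) (2*rho x)^+n)%:E<=leb (Plev J h x0 rad k lam d j))%E.
 apply: packed_sum=> [|x|x]; first exact: packF.
  by rewrite /s2 mem_filter=> /andP[_ /sA]; exact: rho0.
 rewrite /s2 mem_filter=> /andP[gx /sA hx].
 move=> y xy; split; first by apply: (in48 x hx); apply: le_ball xy; have := rho0 x hx; lra.
 apply: contrapT=> ny; move/asboolP: gx; apply; by exists y.
have ->: \sum_(x <- s) (if good x then (3*rho x)^+n*(C*N'`^(- (sig+1))) else (2*(3*rho x))^+n) =
  (2^+n)^-1*3^+n*(C*N'`^(- (sig+1)))*\sum_(x <- s1) (2*rho x)^+n + 3^+n*\sum_(x <- s2) (2*rho x)^+n.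
 rewrite /s1 /s2 !big_filter (bigID good) /=; congr (_+_); rewrite mulr_sumr; apply: eq_bigr=> x.
  move=> ->; rewrite !exprMn; have: 2^+n != 0 :> R by [].
  by move: (2^+n) (3^+n) (rho x^+n) (C*_)=> z1 z2 z3 z4 z10; field; rewrite z10.
 by move=> /negbTE ->; rewrite !exprMn; ring.
rewrite EFinD; apply: leeD; last first.
 by rewrite EFinM; apply: lee_wpmul2l=> //; rewrite lee_fin exprn_ge0.
rewrite EFinM; apply: lee_pmul=> //.
- by rewrite lee_fin; apply: mulr_ge0; [apply: mulr_ge0; rewrite ?invr_ge0 exprn_ge0|apply: mulr_ge0=> //; [exact: ltW|exact: powR_ge0]].
- rewrite lee_fin /s1 big_seq; apply: sumr_ge0=> x; rewrite mem_filter=> /andP[_ /sA /rho0 h1].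
 nneg.
rewrite lee_fin; apply: le_trans Nsmall; apply: ler_wpM2r.
 by apply: mulr_ge0; [exact: ltW|exact: powR_ge0].
have h2n: 0<2^+n :> R by nneg.
rewrite mulrC ler_pdivrMr// -exprMn; apply: lerXn2r; rewrite ?nnegrE ?mulr_ge0//; lra.
Qed.

End GoodLambda.

(** * Summation over levels *)

Section LevelSums.
Context {R: realType}.
Implicit Types (a b q w N s M: R) (j m: nat).

(** Summing the recursion absorbs half of the sum into the left-hand side; the extra [b m]
    strengthens the induction. *)
Lemma decay_sum (b q: nat -> R) m: (forall j, b j.+1<=2^-1*b j+q j) ->
 \sum_(j<m.+1) b j+b m<=2*b 0%N+2*\sum_(j<m) q j.
move=> h; elim: m=> [|m IH]; first by rewrite big_ord_recl !big_ord0; lra.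
rewrite big_ord_recr /= [\sum_(j<m.+1) q j]big_ord_recr /=; have := h m.
move: IH; move: (\sum_(_<m.+1) _) (\sum_(_<m) _)=> x y; lra.
Qed.

Lemma geometric_top (w: nat -> R) m: (forall j, 0<=w j) -> (forall j, 2*w j<=w j.+1) ->
 \sum_(j<m.+1) w j<=2*w m.
move=> w0 h; elim: m=> [|m IH]; first by rewrite big_ord_recl big_ord0; have := w0 0%N; lra.
by rewrite big_ord_recr /=; have := h m; move: IH; move: (\sum_(_<_) _)=> x; lra.
Qed.

(* [P] is a decreasing family of level sets. *)
Lemma sum_active (w: nat -> R) (P: nat -> Prop) (M: R) m: 0<=M -> (forall j, 0<=w j) ->
 (forall j, 2*w j<=w j.+1) -> (forall j, P j -> w j<=M) -> \sum_(j<m) w j*(`[< P j >])%:R<=2*M.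
move=> M0 w0 h hP; elim: m=> [|m IH]; first by rewrite big_ord0; lra.
have [Pm|nPm] := pselect (P m); last first.
 by rewrite big_ord_recr /= (asboolF nPm) mulr0 addr0.
apply: (@le_trans _ _ (\sum_(j<m.+1) w j)).
 by apply: ler_sum=> j _; rewrite ler_piMr// lern1 leq_b1.
by apply: (le_trans (geometric_top _ w0 h)); rewrite ler_pM2l// hP.
Qed.

(** If [j] is the last index below [m] at which [P] holds, then [P] fails at [j + 1] and the term of
    index [j] alone dominates; hence the exponent [j + 1]. If there is no such index, the summand
    [1] does. *)
Lemma level_cover (M s D N: R) (P: nat -> Prop) m: 0<=s -> 0<=M -> 0<=D -> 0<=N ->
 (forall j, ~ P j -> M<=D*N^+j) -> ~ P m -> M`^s<=D`^s*(1 + \sum_(j<m) (N^+j.+1)`^s*(`[< P j >])%:R).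
move=> s0 M0 D0 N0 hP; have pos k: 0 <= \sum_(j<k) (N^+j.+1)`^s*(`[< P j >])%:R.
 by apply: sumr_ge0=> j _; rewrite mulr_ge0 ?powR_ge0.
have Ds: 0<=D`^s := powR_ge0 _ _. elim: m=> [|m IH] nP.
 rewrite big_ord0 addr0 mulr1; apply: le_pow=> //. by have := hP _ nP; rewrite expr0 mulr1.
have [Pm|nPm] := pselect (P m); last first.
 apply: (le_trans (IH nPm)); apply: ler_wpM2l=> //; rewrite lerD2l big_ord_recr /=.
 by rewrite lerDl mulr_ge0 ?powR_ge0.
apply: (@le_trans _ _ ((D*N^+m.+1)`^s)); first by apply: le_pow=> //; exact: hP.
rewrite powRM ?exprn_ge0//; apply: ler_wpM2l=> //. rewrite big_ord_recr /= (asboolT Pm) mulr1 addrA lerDr.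
exact: addr_ge0 ler01 (pos m).
Qed.

End LevelSums.

(** * The maximal function against means over cubes *)

Section Maximal.
Context {R: realType} {n: nat} (n0: (0<n)%N) (p La: R) (p1: 1<p) (La1: 1<=La).
Notation E := 'rV[R]_n.
Notation L := (lebesgueType R n).
Notation leb := (@lebesgue R n).
Implicit Types (f h u: E -> R) (eps r k N t: R) (x y: E) (U: set E).

Let nR: 0<(n%:R: R). Proof. nneg. Qed.

(** Used for powers of [maximal], whose measurability is never established: the integral of a
    non-negative function is a supremum over simple functions below it, which is monotone in any
    case. *)
Lemma le_integral_ge0 (D: set L) (f1 f2: E -> \bar R): (forall x, D x -> (0<=f1 x)%E) ->
 (forall x, D x -> (f1 x<=f2 x)%E) -> (\int[leb]_(x in D) f1 x <= \int[leb]_(x in D) f2 x)%E.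
move=> f10 f12; have f20 x : D x -> (0<=f2 x)%E by move=> Dx; apply: le_trans (f12 x Dx); exact: f10.
rewrite !ge0_integralE//; apply: le_ereal_sup=> _ [h hf <-]; exists h=> // x.
apply: (le_trans (hf x)); rewrite /patch; case: ifPn=> // /set_mem; exact: f12.
Qed.

Lemma eball_sub_ball x r: 0<r -> eball x r `<=` ball x r.
move=> r0 y xy; rewrite -ball_normE /ball_ /= distrC; apply: norm_lt_coord=> // i.
exact: le_lt_trans (coord_le_enorm _ i) xy.
Qed.

Lemma ball_sub_eball x r: 0<r -> ball x r `<=` eball x (n%:R*r).
move=> r0 y; rewrite -ball_normE /ball_ /= distrC=> xy; rewrite /eball /=.
apply: (le_lt_trans (enorm_le_l1 _)). apply: (@le_lt_trans _ _ (n%:R * `|y-x|)); last by rewrite ltr_pM2l.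
by rewrite -sum_cst; apply: ler_sum=> i _; exact: coord_le_norm.
Qed.

Lemma open_eball x r: open (eball x r).
rewrite openE=> y xy; pose k:= (r-enorm (y-x))/n%:R. have k0: 0<k by rewrite divr_gt0// subr_gt0.
apply/nbhs_ballP; exists k=> //= z yz.
have e : enorm (y-x)+n%:R*(k/1)<=r by rewrite divr1 /k mulrC divfK ?gt_eqF// addrC subrK.
rewrite /eball /=; have ->: z-x = (y-x)+(z-y) by rewrite [RHS]addrC addrA subrK.
apply: (le_lt_trans (enormD_l1 _ _)). rewrite -ltrBrDl; apply: (@le_lt_trans _ _ (n%:R * `|z-y|)).
 by rewrite -sum_cst; apply: ler_sum=> i _; exact: coord_le_norm.
by move: yz; rewrite -ball_normE /ball_ /= distrC /k ltr_pdivlMr// mulrC.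
Qed.

Lemma leb_eball x r: 0<r -> (((2*(r/n%:R))^+n)%:E<=leb (eball x r))%E /\ (leb (eball x r)<=((2*r)^+n)%:E)%E.
move=> r0; have rn: 0<r/n%:R by nneg. split.
 rewrite -(leb_ball x rn); apply: le_lebesgue_outer.
 have ->: r = n%:R*(r/n%:R) by rewrite mulrC divfK ?gt_eqF.
 by rewrite [X in ball x (X/_)]mulrC mulfK ?gt_eqF//; exact: ball_sub_eball.
by rewrite -(leb_ball x r0); apply: le_lebesgue_outer; exact: eball_sub_ball.
Qed.

Lemma fine_leb_eball x r: 0<r -> [/\ leb (eball x r) = (fine (leb (eball x r)))%:E,
 (2*(r/n%:R))^+n<=fine (leb (eball x r)), fine (leb (eball x r))<=(2*r)^+n & 0<fine (leb (eball x r))].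
move=> r0; have [h1 h2] := leb_eball x r0. have e : leb (eball x r) = (fine (leb (eball x r)))%:E.
 rewrite fineK// ge0_fin_numE//; exact: le_lt_trans h2 (ltry _).
rewrite e !lee_fin in h1 h2; split=> //; apply: lt_le_trans h1. nneg.
Qed.

Lemma integral_indicE U f: measurable (U: set L) -> (forall x, 0<=f x) ->
 (\int[leb]_(x in U) (f x)%:E = \int[leb]_x (\1_U x*f x)%:E)%E.
move=> mU f0; rewrite integral_mkcond; apply: eq_integral=> x _.
rewrite /patch indicE; case: ifPn=> xU; first by rewrite mul1r. by rewrite mul0r.
Qed.

(* Off the superlevel sets of cube averages at radii [k >= eps] the maximal
  function is controlled, and conversely. *)
Lemma maximal_le f x eps k t: 0<eps -> eps<=k -> mble f -> (forall y, 0<=f y) -> 0<=t ->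
 (* Balls of radius [r >= eps] are enlarged by the factor [k/eps] so as to reach radii of at least
    [k]; the constant is the resulting ratio of volumes, with [n] from comparing balls and cubes. *)
 ~ lev f k t x -> (maximal eps f x<=(((n%:R*(k/eps))^+n)*t)%:E)%E.
move=> e0 ek mf f0 t0 nl; apply: ge_ereal_sup=> _ [r /= er <-]. have r0: 0<r by exact: lt_le_trans er.
have [e v1 v2 v0] := fine_leb_eball x r0; set V:= fine _ in e v1 v2 v0 *. pose r' := k/eps*r.
have ke1: 1<=k/eps by rewrite ler_pdivlMr// mul1r.
have kr : k<=r' by rewrite /r' mulrAC -mulrA ler_peMr ?(le_trans (ltW e0))// ler_pdivlMr// mul1r.
have rr' : r<=r' by rewrite /r' ler_peMl// ltW. have u : ub (fun y=> \1_(ball x r') y*f y) (t*(2*r')^+n).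
 by apply: contrapT=> nu; apply: nl; exists r'.
have mE : measurable (eball x r: set L) by apply: open_lmbl; exact: open_eball.
rewrite (integral_indicE mE f0). apply: (@le_trans _ _ (V^-1%:E*(t*(2*r')^+n)%:E)%E).
 apply: lee_wpmul2l; first by rewrite lee_fin invr_ge0 ltW. case: u=> mu' u0 hu; apply: le_trans hu.
 have me : mble (fun y=> \1_(eball x r) y*f y) := mbleM (mble_indic mE) mf.
 have e00 y: 0 <= \1_(eball x r) y*f y by nneg.
 apply: (intEF_le leb me mu' e00)=> y; apply: ler_wpM2r=> //; have [hy|hy] := pselect (eball x r y).
  by rewrite [leRHS]indic_in ?indic_le1//; apply: le_ball rr' _ _; exact: eball_sub_ball.
 by rewrite [leLHS]indic_out// indic_ge0.
rewrite -EFinM lee_fin mulrC ler_pdivrMr// mulrAC [leRHS]mulrC; apply: ler_wpM2l=> //.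
apply: (@le_trans _ _ ((n%:R*(k/eps))^+n*(2*(r/n%:R))^+n)).
 rewrite -exprMn le_eqVlt; apply/orP; left; apply/eqP; congr (_^+n); rewrite /r'. by field; rewrite !gt_eqF.
apply: ler_wpM2l=> //; rewrite exprn_ge0// mulr_ge0// divr_ge0 ?(ltW e0)//; exact: le_trans (ltW e0) ek.
Qed.

Lemma maximal_ge f x eps k t: 0<eps -> eps<=k -> mble f -> (forall y, 0<=f y) -> 0<=t ->
 lev f k t x -> (((n%:R^+n)^-1*t)%:E<=maximal eps f x)%E.
move=> e0 ek mf f0 t0 [r [kr hb]]. have r0: 0<r by apply: lt_le_trans kr; exact: lt_le_trans ek.
have nr0: 0<n%:R*r by nneg. have [e v1 v2 v0] := fine_leb_eball x nr0; set V:= fine _ in e v1 v2 v0.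
apply: (@le_trans _ _ (V^-1%:E*\int[leb]_(y in eball x (n%:R*r)) (f y)%:E)%E); last first.
 apply: ereal_sup_ubound; exists (n%:R*r)=> //=.
 by apply: (le_trans ek); apply: (le_trans kr); rewrite ler_peMl ?(ltW r0)// ler1n.
have mE : measurable (eball x (n%:R*r): set L) by apply: open_lmbl; exact: open_eball.
rewrite (integral_indicE mE f0). have mb : mble (fun y=> \1_(ball x r) y*f y) by apply: mbleM=> //; mbl.
have b0 y: 0 <= \1_(ball x r) y*f y by nneg.
have big : ((t*(2*r)^+n)%:E <= \int[leb]_y (\1_(ball x r) y*f y)%:E)%E.
 by rewrite leNgt; apply/negP=> lt; apply: hb; split=> //; exact: ltW.
apply: (@le_trans _ _ (V^-1%:E*(t*(2*r)^+n)%:E)%E); last first.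
 apply: lee_wpmul2l; first by rewrite lee_fin invr_ge0 ltW. apply: (le_trans big).
 have me : mble (fun y=> \1_(eball x (n%:R*r)) y*f y) := mbleM (mble_indic mE) mf.
 apply: (intEF_le leb mb me b0)=> y; apply: ler_wpM2r=> //; have [hy|hy] := pselect (ball x r y).
  by rewrite [leRHS]indic_in ?indic_le1//; exact: ball_sub_eball.
 by rewrite [leLHS]indic_out// indic_ge0.
rewrite -EFinM lee_fin mulrC [leRHS]mulrC. rewrite -mulrA; apply: ler_wpM2l=> //.
rewrite ler_pdivlMr// mulrC ler_pdivrMr ?exprn_gt0// -exprMn.
by apply: (le_trans v2); rewrite le_eqVlt; apply/orP; left; apply/eqP; congr (_^+n); ring.
Qed.

End Maximal.

Section MaximalEstimate.
Context {R: realType} {n: nat} (n0: (0<n)%N) (p La: R) (p1: 1<p) (La1: 1<=La).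
Notation E := 'rV[R]_n.
Notation L := (lebesgueType R n).
Notation leb := (@lebesgue R n).
Implicit Types (f h u: E -> R) (g b F: E -> E) (d eps mu rad c r k N s lam: R) (x y: E) (j: nat) (U: set E).

Let nR: 0<(n%:R: R). Proof. nneg. Qed.

Lemma indic_asbool U x: \1_U x = (`[< U x >])%:R :> R.
by [].
Qed.

Lemma leb_fin U a: (leb U<=a%:E)%E -> leb U = (fine (leb U))%:E /\ 0<=fine (leb U)<=a.
move=> h; have h0 : (0<=leb U)%E := lebesgue_outer_ge0 U. have e : leb U = (fine (leb U))%:E.
 by rewrite fineK// ge0_fin_numE//; exact: le_lt_trans h (ltry _).
by split=> //; rewrite -!lee_fin -e h0.
Qed.

Lemma ub_indic U a: measurable (U: set L) -> leb U = a%:E -> ub (\1_U) a /\ integ (\1_U: E -> R) = a.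
move=> mU e; have i : (\int[leb]_x (\1_U x)%:E = a%:E)%E by rewrite (integral_indic leb measurableT mU) setIT.
split; last by rewrite /integ /Rintegral i. by split; [mbl|move=> x; nneg|rewrite i].
Qed.

Lemma maximal_ge0 f eps x: (forall y, 0<=f y) -> 0<eps -> (0<=maximal eps f x)%E.
move=> f0 e0; have [_ _ _ v0] := fine_leb_eball n0 x e0.
apply: (@le_trans _ _ ((fine (leb (eball x eps)))^-1%:E*\int[leb]_(y in eball x eps) (f y)%:E)%E).
 apply: mule_ge0; first by rewrite lee_fin invr_ge0 ltW. by apply: integral_ge0=> y _; rewrite lee_fin.
by apply: ereal_sup_ubound; exists eps=> /=.
Qed.

Let step_alg (Ns w a a' q z: R): 0<Ns -> 0<=w -> a' <= 2^-1*Ns^-1*a+z*q -> Ns*w*a' <= 2^-1*(w*a)+z*Ns*(w*q).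
move=> N0 w0 h; have e: 0<=Ns*w by nneg.
apply: (le_trans (ler_wpM2l e h)); rewrite le_eqVlt; apply/orP; left; apply/eqP. by field; rewrite gt_eqF.
Qed.

Let final_alg (Dn lam V Ns z S I ka B: R): 0<=Dn -> 0<=Ns -> 0<=z -> 0<ka -> 0<=V -> 0<=lam -> 0<=I ->
 ka * lam*S<=2*I -> B<=2*V+2*(z*Ns*S) -> Dn * lam*(V+Ns*B)<=Dn*(1+2*Ns+4*z*Ns^+2/ka)*(lam*V+I).
move=> D0 N0 z0 k0 V0 l0 I0 h1 h2; have h3 : lam*S<=2*I/ka by rewrite ler_pdivlMr// mulrC mulrA.
rewrite -2!(mulrA Dn); apply: ler_wpM2l=> //. have h4 := ler_wpM2l (mulr_ge0 l0 N0) h2.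
have zN: 0<=2*(z*Ns^+2) by nneg. have h5 := ler_wpM2l zN h3. have c1: 0<=4*z*Ns^+2/ka*(lam*V).
 nneg.
have c2: 0<=(1+2*Ns)*I by nneg. have e5: 2*(z*Ns^+2)*(2*I/ka) = 4*z*Ns^+2/ka*I by field; rewrite gt_eqF.
rewrite e5 in h5; move: h4 h5 c1 c2; move: (4*z*Ns^+2/ka)=> X h4 h5 c1 c2.
have ->: lam*(V+Ns*B) = lam*V+lam*Ns*B by ring.
have ->: (1+2*Ns+X)*(lam*V+I) = lam*V+2*Ns*(lam*V)+X*(lam*V)+(1+2*Ns)*I+X*I by ring.
have e4 : lam*Ns*(2*V+2*(z*Ns*S)) = 2*Ns*(lam*V)+2*(z*Ns^+2)*(lam*S) by ring. rewrite e4 in h4; lra.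
Qed.

(** Weighted by [Ns^j], the measures of the level sets halve from one level to the next up to
    forcing terms, so their sum is bounded by the bottom level and the weighted level sets of [h].
    The latter are bounded by the integral of the maximal function of [h], because the weights at
    least double and the highest level reached dominates. *)
Lemma maximal_estimate sig: 1<=sig -> exists2 C: R, 0<C &
 forall eps mu (x0: E) rad u g b F c, 0<rad -> 0<=mu -> 0<eps -> 0<c ->
 loc_data p La eps mu (eball x0 rad) u g b F -> let f x := \1_(eball x0 rad) x*(mu+enorm (g x))`^p in
 let h x := \1_(eball x0 rad) x*enorm (F x)`^(p/(p-1)) in
 mble f -> mble h -> mu`^p<=height (n:=n) c rad -> ub f c ->
 (\int[leb]_(x in eball x0 (rad/2)) (maximal eps f x`^sig) <= C%:E*((height (n:=n) c rad`^sig*(2*rad)^+n)%:E +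
      \int[leb]_(x in eball x0 rad) (maximal eps h x`^sig)))%E.
move=> sig1; have sig0: 0<sig by exact: lt_le_trans sig1. have sig0': 0<=sig := ltW sig0.
have [J [d [J2 d0 d1 hstep]]] := level_step n0 p1 La1 sig0. pose N: R := J%:R^+n. have N2: 2<=N.
 apply: (@le_trans _ _ J%:R); first by rewrite ler_nat. by rewrite /N -[leLHS]expr1 ler_weXn2l// ler1n ltnW.
have N0: 0<N by exact: lt_le_trans N2. pose Ns:= N`^sig. have Ns2: 2<=Ns.
 apply: (le_trans N2); rewrite /Ns -[leLHS](powRr1 (ltW N0)); apply: ler_powR=> //.
 by apply: le_trans N2; rewrite ler1n.
have Ns0: 0<Ns by exact: lt_le_trans Ns2. have Nsj j : (N^+j)`^sig = Ns^+j.
 by rewrite -powR_mulrn ?(ltW N0)// -powRrM mulrC powRrM powR_mulrn// powR_ge0.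
pose Dn:= (n%:R*d^-1)^+n. have Dn0: 0<Dn by rewrite exprn_gt0// mulr_gt0// invr_gt0.
pose ka:= ((n%:R^+n)^-1*d). have ka0: 0<ka by rewrite mulr_gt0// invr_gt0 exprn_gt0.
have kas0: 0<ka`^sig by nneg. pose C:= Dn`^sig*(1+2*Ns+4*3^+n*Ns^+2/ka`^sig). have C0: 0<C.
 rewrite mulr_gt0 ?powR_gt0// ltr_pwDl//; last first.
  nneg.
 nneg.
exists C=> // eps mu x0 rad u g b F c R0 mu0 e0 c0 D f h mf mh mulam uf. set lam:= height c rad in mulam *.
have lam0: 0<lam by rewrite /lam /height mulr_gt0// exprn_gt0// divr_gt0// mulr_gt0.
have f0 x: 0<=f x by rewrite mulr_ge0 ?powR_ge0. have h0 x: 0<=h x by rewrite mulr_ge0 ?powR_ge0.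
have st := hstep eps mu x0 rad u g b F c R0 mu0 e0 c0 D mf mh mulam uf.
set k:= d^-1*eps in st; have k0: 0<k by rewrite mulr_gt0 ?invr_gt0.
have epsk : eps<=k by rewrite /k ler_peMl ?(ltW e0)// invf_ge1. rewrite -/lam -/N in st.
have kE : k/eps = d^-1 by rewrite /k mulfK// gt_eqF. pose lj j:= level (n:=n) J lam j.
have ljE j : lj j = N^+j * lam by []. have lj0 j: 0<lj j by rewrite ljE mulr_gt0// exprn_gt0.
pose U: set E:= eball x0 rad. pose U2: set E:= eball x0 (rad/2).
pose A j:= Alev J f x0 rad k lam j. pose P j:= Plev J h x0 rad k lam d j.
pose V:= (2*rad)^+n. have V0: 0<=V by rewrite exprn_ge0// mulr_ge0// ltW. have [_ UV] := leb_eball n0 x0 R0.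
have shr j : shrunk rad j<=rad by apply: (le_trans (shrunk_le j R0)); rewrite ler_piMr ?(ltW R0)//; lra.
have AV j : (leb (A j)<=V%:E)%E.
 apply: le_trans UV; apply: le_lebesgue_outer=> x [hx _]; exact: lt_le_trans hx (shr j).
have PV j : (leb (P j)<=V%:E)%E by apply: le_trans UV; apply: le_lebesgue_outer=> x [].
have mA j : measurable (A j: set L).
 apply: open_lmbl; apply: openI; first exact: open_eball. by apply: open_lev=> //; exact: ltW.
have mP j : measurable (P j: set L).
 apply: open_lmbl; apply: openI; first exact: open_eball.
 by apply: open_lev=> //; [exact: ltW|rewrite mulr_ge0 ?(ltW d0)// (ltW (lj0 j))].
pose a j:= fine (leb (A j)). pose q j:= fine (leb (P j)).
have aE j : leb (A j) = (a j)%:E by have [] := leb_fin (AV j).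
have qE j : leb (P j) = (q j)%:E by have [] := leb_fin (PV j).
have a0 j: 0<=a j by have [_ /andP[]] := leb_fin (AV j).
have aV j : a j<=V by have [_ /andP[]] := leb_fin (AV j).
have q0 j: 0<=q j by have [_ /andP[]] := leb_fin (PV j). have astep j : a j.+1<=2^-1*Ns^-1*a j+3^+n*q j.
 have s := st j; rewrite -/(A j.+1) -/(A j) -/(P j) !aE qE -!EFinM -EFinD lee_fin powRN in s. exact: s.
pose bb j:= Ns^+j*a j. pose qq j:= 3^+n*Ns*(Ns^+j*q j). have Nj0 j: 0<=Ns^+j by nneg.
have bstep j : bb j.+1<=2^-1*bb j+qq j by rewrite /bb exprS; mbl.
have bsum mm: \sum_(j<mm) bb j<=2*V+2*(3^+n*Ns*\sum_(j<mm) Ns^+j*q j).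
 have := decay_sum mm bstep; rewrite big_ord_recr /= -mulr_sumr.
 have b0 : bb 0%N<=V by rewrite /bb expr0 mul1r. have bm: 0<=bb mm by apply: mulr_ge0.
 move: b0 bm; move: (bb 0%N) (bb mm) (\sum_(_<_) _) (3^+n*Ns*_)=> z1 z2 z3 z4; lra.
have [Ih|Ih] := eqVneq (\int[leb]_(x in U) (maximal eps h x`^sig))%E +oo%E.
 rewrite -/U Ih addey// ?gt0_muley ?lte_fin// ?leey//.
have I0 : (0 <= \int[leb]_(x in U) (maximal eps h x`^sig))%E.
 by apply: integral_ge0=> x _; exact: poweR_ge0.
have [IR IE]: exists r: R, (\int[leb]_(x in U) (maximal eps h x`^sig))%E = r%:E.
 by exists (fine (\int[leb]_(x in U) (maximal eps h x`^sig))%E); rewrite fineK// ge0_fin_numE// lt_neqAle Ih leey.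
(* Beyond level [mm] a bad cube, of radius at least [k], would carry more than the total mass [c];
   the layer-cake sum for [f] is therefore finite. *)
have IR0: 0<=IR by rewrite -lee_fin -IE. have [mm hmm]: exists mm: nat, c<=lj mm*(2*k)^+n.
 have z0: 0<lam*(2*k)^+n by nneg. exists (Num.bound (c/(lam*(2*k)^+n))).
 rewrite ljE -mulrA -ler_pdivrMr//; apply: (le_trans (ltW (archi_boundP _))).
  nneg.
 apply: (@le_trans _ _ (2^+Num.bound (c/(lam*(2*k)^+n)))).
  by rewrite -natrX ler_nat ltnW// ltn_expl.
 by apply: lerXn2r; rewrite ?nnegrE// ltW.
have empty x: ~ lev f k (lj mm) x.
 move=> [r [kr hb]]; have := badP mf f0 uf hb; rewrite ltNge=> /negP; apply.
 apply: (le_trans hmm); apply: ler_wpM2l; first exact: ltW. have r0: 0<r by exact: lt_le_trans kr.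
 have k20: 0<=2*k by nneg. have kr2: 2*k<=2*r by rewrite ler_pM2l. by apply: lerXn2r; rewrite ?nnegrE//; nneg.
have ls0: 0<=lam`^sig := powR_ge0 _ _. have hS : ka`^sig * lam`^sig*(\sum_(j<mm) Ns^+j*q j)<=2*IR.
 pose W j:= 2^-1*((ka * lam)`^sig*Ns^+j). have W0 j: 0<=W j by rewrite !mulr_ge0 ?powR_ge0.
 pose T2 x:= \sum_(j<mm) W j*\1_(P j) x.
 have uP j : ub (fun x=> W j*\1_(P j) x) (W j*q j) by apply: ubZ=> //; exact: (ub_indic (mP j) (qE j)).1.
 have [iT eT] := integ_sum (index_enum 'I_mm) (fun j: 'I_mm=> itg_ub0 (uP j)).
 have uT : ub T2 (\sum_(j<mm) W j*q j) by apply: ub_sum=> j; exact: uP. have T20 x: 0<=T2 x := ub_pos uT x.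
 have le1 : (\int[leb]_x (T2 x)%:E<=IR%:E)%E.
  rewrite -IE; have mU : measurable (U: set L) by apply: open_lmbl; exact: open_eball.
  have ->: (\int[leb]_x (T2 x)%:E = \int[leb]_(x in U) (T2 x)%:E)%E.
   rewrite (integral_indicE mU T20); apply: eq_integral=> x _; congr EFin.
   have [hx|hx] := pselect (U x); first by rewrite indic_in// mul1r.
   by rewrite indic_out// mul0r /T2 big1// => j _; rewrite indic_out ?mulr0// => -[].
  apply: le_integral_ge0=> x xU; first by rewrite lee_fin. have M0 := maximal_ge0 x h0 e0.
  have [My|My] := eqVneq (maximal eps h x) +oo%E; first by rewrite My poweRyr ?leey// gt_eqF.
  have [Mr ME]: exists r: R, maximal eps h x = r%:E.
   by exists (fine (maximal eps h x)); rewrite fineK// ge0_fin_numE// lt_neqAle My leey.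
  rewrite ME lee_fin in M0; rewrite ME poweR_EFin lee_fin. pose w j:= (ka * lam)`^sig*Ns^+j.
  have w0 j: 0<=w j by rewrite mulr_ge0 ?powR_ge0. have w2 j: 2*w j<=w j.+1.
   rewrite /w exprS mulrCA; apply: ler_wpM2l; first nneg. exact: ler_wpM2r.
  have wP j : P j x -> w j<=Mr`^sig.
   move=> [_ hl]; have := maximal_ge n0 e0 epsk mh h0 (mulr_ge0 (ltW d0) (ltW (lj0 j))) hl.
   rewrite ME lee_fin=> hM. have kl0: 0<=ka * lam := mulr_ge0 (ltW ka0) (ltW lam0).
   have Nj: 0<=N^+j := exprn_ge0 j (ltW N0).
   have ->: w j = (ka * lam*N^+j)`^sig by rewrite (powRM sig kl0 Nj) Nsj.
   apply: (le_pow sig0' (mulr_ge0 kl0 Nj)).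
   apply: le_trans hM; rewrite le_eqVlt; apply/orP; left; apply/eqP; rewrite ljE /ka.
   by move: (N^+j) (n%:R^+n)^-1=> z1 z2; ring.
  have sa := sum_active mm (powR_ge0 Mr sig) w0 w2 wP.
  have eT2 : T2 x = 2^-1*\sum_(j<mm) w j*(`[< P j x >])%:R.
   rewrite mulr_sumr /T2; apply: eq_bigr=> j _; rewrite indic_asbool /W -mulrA; congr (_*_).
  by rewrite eT2 mulrC ler_pdivrMr// mulrC.
 have e2 : integ T2 = 2^-1*(ka`^sig * lam`^sig*(\sum_(j<mm) Ns^+j*q j)).
  have eT' : integ T2 = \sum_(j<mm) integ (fun x=> W j*\1_(P j) x) := eT.
  rewrite eT' !mulr_sumr; apply: eq_bigr=> j _.
  rewrite (integZ (W j) (itg_ub0 (ub_indic (mP j) (qE j)).1)) (ub_indic (mP j) (qE j)).2 /W.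
  by rewrite powRM ?(ltW ka0) ?(ltW lam0)// !mulrA.
 by move: le1; rewrite (ub_integ uT) lee_fin e2 mulrC ler_pdivrMr// [IR*_]mulrC.
have U2sub x : U2 x -> forall j, eball x0 (shrunk rad j) x.
 move=> hx j; apply: (lt_le_trans hx); rewrite /shrunk ler_pM2l// lerDl. nneg.
have mU2 : measurable (U2: set L) by apply: open_lmbl; exact: open_eball.
pose T1 x:= (Dn * lam)`^sig*(1 + \sum_(j<mm) (N^+j.+1)`^sig*\1_(A j) x). have T10 x: 0<=T1 x.
 rewrite mulr_ge0 ?powR_ge0// addr_ge0//; apply: sumr_ge0=> j _. nneg.
apply: (@le_trans _ _ (\int[leb]_(x in U2) (T1 x)%:E)%E).
 apply: le_integral_ge0=> x xU; first exact: poweR_ge0. have M0 := maximal_ge0 x f0 e0.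
 have hM j: ~ lev f k (lj j) x -> (maximal eps f x<=(Dn * lj j)%:E)%E.
  by move=> hl; have := maximal_le n0 e0 epsk mf f0 (ltW (lj0 j)) hl; rewrite kE.
 have [Mr ME]: exists r: R, maximal eps f x = r%:E.
  exists (fine (maximal eps f x)); rewrite fineK// ge0_fin_numE//.
  exact: le_lt_trans (hM mm (empty x)) (ltry _).
 rewrite ME lee_fin in M0; rewrite ME poweR_EFin lee_fin /T1.
 have DL0: 0<=Dn * lam := mulr_ge0 (ltW Dn0) (ltW lam0). have hM' j: ~ lev f k (lj j) x -> Mr<=Dn * lam*N^+j.
  by move=> /hM; rewrite ME lee_fin ljE mulrA mulrAC.
 apply: (le_trans (level_cover sig0' M0 DL0 (ltW N0) hM' (empty x))). apply: ler_wpM2l; first nneg.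
 rewrite lerD2l; apply: ler_sum=> j _; apply: ler_wpM2l; first nneg.
 rewrite indic_asbool ler_nat; case: (asboolP (lev f k (lj j) x))=> // hl.
 by rewrite asboolT//; split=> //; exact: U2sub.
rewrite (integral_indicE mU2 T10). have R20: 0<rad/2 by nneg. have [_ U2V] := leb_eball n0 x0 R20.
have U2V' : (leb U2<=V%:E)%E.
 apply: (le_trans U2V); rewrite lee_fin; apply: lerXn2r; rewrite ?nnegrE ?mulr_ge0 ?(ltW R20) ?(ltW R0)//.
 by rewrite ler_pM2l// ler_pdivrMr// ler_peMr ?(ltW R0)// ler1n.
have [U2E /andP[_ U2le]] := leb_fin U2V'. have uU2 := (ub_indic mU2 U2E).1.
have uAj j : ub (fun x=> (N^+j.+1)`^sig*\1_(A j) x) ((N^+j.+1)`^sig*a j).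
 by apply: ubZ; [nneg|exact: (ub_indic (mA j) (aE j)).1].
have uAll : ub (fun x=> \sum_(j<mm) (N^+j.+1)`^sig*\1_(A j) x) (\sum_(j<mm) (N^+j.+1)`^sig*a j).
 by apply: ub_sum=> j; exact: uAj.
have uT1 := ubZ (powR_ge0 (Dn * lam) sig) (ubD uU2 uAll).
have uT1' : ub (fun x=> \1_U2 x*T1 x) ((Dn * lam)`^sig*(V+Ns*\sum_(j<mm) bb j)).
 apply: (ub_cle _ (ub_fle _ _ _ uT1))=> [||x|x].
 - apply: ler_wpM2l; first nneg.
  apply: lerD=> //; rewrite mulr_sumr; apply: ler_sum=> j _. by rewrite Nsj exprS mulrA.
 - apply: mbleM; first mbl.
  apply: mbleM; first mbl. mbl.
 - nneg. rewrite /T1 mulrCA; apply: ler_wpM2l; first nneg. rewrite mulrDr mulr1 lerD2l ler_piMl ?indic_le1//.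
 nneg.
case: uT1'=> _ _ hT; apply: (le_trans hT); rewrite -/U IE -EFinD -EFinM lee_fin powRM ?(ltW Dn0) ?(ltW lam0)//.
exact: final_alg (powR_ge0 Dn sig) (ltW Ns0) (exprn_ge0 n (ler0n R 3)) kas0 V0 ls0 IR0 hS (bsum mm).
Qed.

End MaximalEstimate.

(** * From the structure conditions to local data *)

Section Coercivity.
Context {R: realType} {n: nat}.
Notation E := 'rV[R]_n.

Lemma enorm0: enorm (0: E) = 0.
apply/eqP; rewrite eq_le enorm_ge0 andbT; apply: (le_trans (enorm_le_l1 _)).
by rewrite /l1 big1// => i _; rewrite mxE normr0.
Qed.

Let absorb_half (t D m Mq X La C1: R): t<=m+2*Mq -> Mq<=La*(D+X) ->
 2*La*X<=2^-1*t+C1 * m -> t<=4*La*D+(2+2*C1) * m.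
Proof. move=> h1 h2 h3; lra. Qed.

(* Replacing [mu] by a large multiple absorbs the lower order term in the
  coercivity estimate. *)
Lemma coercive_of_monotone (p Lam: R): 1<p -> 1<=Lam -> exists A kap: R,
 [/\ Lam<=A, 1<=kap & forall mu (a: E -> E -> E), 0<=mu -> monotone_growth p mu Lam a ->
 forall x xi, (kap * mu+enorm xi)`^p<=A*(dot (a x xi) xi+(kap * mu)`^p)].
move=> p1 L1; have p0: 0<=p by lra. have L0: 0<Lam by lra.
(* [k] is such that, after Young's inequality, the term with the flux at [0] takes up only half of
   [|xi|^p]. *)
have p10: 0<=p-1 by lra. have pp : p-2+2 = p by ring. pose k:= (4*(n%:R+1)*Lam^+2)^-1: R.
have z0: 0<4*(n%:R+1)*Lam^+2 :> R by nneg. have k0: 0<k by rewrite invr_gt0. have [C C0 hC] := young p1 k0.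
pose C1:= 2*Lam^+2*(n%:R+1)*C. have C10: 0<=C1 by rewrite !mulr_ge0 ?(ltW L0) ?(ltW C0)// addr_ge0.
pose C2:= 2+2*C1. have P20: 0<2`^p :> R by nneg. have P21: 1<=2`^p :> R by apply: one_le_pow=> //; lra.
pose kap:= 1+2`^p*C2. have C20: 0<=C2 by rewrite /C2; lra.
have kap1: 1<=kap by rewrite /kap lerDl mulr_ge0// ltW. exists (2`^p*4*Lam), kap; split=> //.
 have h: 1<=2`^p*4 :> R by apply: mulr_ege1=> //; lra. by rewrite ler_peMl// ltW.
move=> mu a mu0 [mono gr] x xi; set t:= enorm xi; have t0: 0<=t := enorm_ge0 _. set D:= dot (a x xi) xi.
have mp0: 0<=mu`^p := powR_ge0 _ _. have := mono x xi 0; rewrite subr0 enorm0 addr0 dotBl -/D -/t.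
set Mq:= if _ then _ else _; set X0:= dot (a x 0) xi=> hM. have tM : t`^p<=mu`^p+2*Mq.
 rewrite /Mq; case: ifPn=> hp.
  have tp0: 0<=t`^p := powR_ge0 _ _; lra.
 have [tm|mt] := leP t mu.
  apply: (@le_trans _ _ (mu`^p)); first exact: le_pow. by rewrite lerDl !mulr_ge0 ?powR_ge0.
 (* For [p < 2] and [t > mu], the sum [mu + t] is at most [2 t], so the weight [(mu + t)^(p-2)] is
    comparable with [t^(p-2)]. *)
 have tpos: 0<t by exact: le_lt_trans mt. have e1 : t`^p = t`^(p-2)*t^+2.
  by rewrite -powR_mulrn// -powRD ?pp// (gt_eqF tpos) implybT.
 have p2: 0<=2-p by move: hp; rewrite -ltNge=> hp; rewrite subr_ge0 ltW.
 have e2 : (2*t)`^(p-2)<=(mu+t)`^(p-2).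
  have := le_pow_neg p2 (_: 0<mu+t) (_: mu+t<=2*t). rewrite opprB; apply; [by rewrite ltr_wpDl|lra].
 have e3 : t`^(p-2)<=2*(2*t)`^(p-2).
  rewrite powRM//; rewrite mulrA ler_peMl ?powR_ge0//.
  rewrite -[X in X*_](powRr1 (ler0n R 2)) -powRD; last by rewrite pnatr_eq0 implybT.
  by apply: one_le_pow; lra.
 rewrite e1; apply: (@le_trans _ _ (2*(mu+t)`^(p-2)*t^+2)).
  apply: ler_wpM2r; first nneg. by apply: (le_trans e3); rewrite ler_pM2l.
 by rewrite -mulrA lerDr.
have X0l : `|X0|<=Lam*(n%:R+1)*(t * mu`^(p-1)).
 apply: (le_trans (dot_le _ _)). have g0 := gr x 0; rewrite enorm0 addr0 in g0. have l : l1 xi<=(n%:R+1)*t.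
  by apply: (le_trans (l1_le_enorm _)); rewrite ler_wpM2r// lerDl.
 apply: (le_trans (ler_pM (enorm_ge0 _) (l1_ge0 _) g0 l)).
 by rewrite le_eqVlt; apply/orP; left; apply/eqP; move: (mu`^_)=> z; ring.
have hy := hC t (mu`^(p-1)) t0 (powR_ge0 _ _); rewrite powB1_conj// in hy.
have X1: 2*Lam * `|X0|<=2^-1*t`^p+C1 * mu`^p.
 have c0: 0<=2*Lam^+2*(n%:R+1) by nneg. have h1 := ler_wpM2l c0 hy.
 have h2 := ler_wpM2l (mulr_ge0 (ler0n R 2) (ltW L0)) X0l.
 apply: (le_trans h2); apply: (@le_trans _ _ (2*Lam^+2*(n%:R+1)*(t * mu`^(p-1)))).
  by rewrite le_eqVlt; apply/orP; left; apply/eqP; move: (t * mu`^_)=> z; ring.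
 have nz : (n%:R+1: R) != 0 by []. have e: 2*Lam^+2*(n%:R+1)*(k*t`^p+C * mu`^p) = 2^-1*t`^p+C1 * mu`^p.
  by rewrite /k /C1; move: (t`^p) (mu`^p)=> z1 z2; field; rewrite nz gt_eqF.
 by rewrite -e.
have hM' : Mq<=Lam*(D + `|X0|).
 apply: (le_trans hM); apply: ler_wpM2l; first exact: ltW. by rewrite lerD2l (le_trans (ler_norm _))// normrN.
have tfin := absorb_half tM hM' X1. have km0: 0<=kap * mu by rewrite mulr_ge0// (le_trans ler01).
apply: (le_trans (pow_add p0 km0 t0)). have kp: 2`^p*C2 * mu`^p<=(kap * mu)`^p.
 rewrite (powRM p (le_trans ler01 kap1) mu0); apply: (ler_wpM2r mp0).
 apply: (@le_trans _ _ kap); first by rewrite /kap lerDr.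
 by rewrite -[leLHS](powRr1 (le_trans ler01 kap1)); apply: ler_powR=> //; exact: ltW.
set K:= (kap * mu)`^p in kp *; have K0: 0<=K by exact: powR_ge0.
have h1 := ler_wpM2l (ltW P20) tfin; rewrite -/C2 in h1. have h2 : (2`^p+1)*K<=2`^p*4*Lam*K.
 apply: ler_wpM2r=> //; have: 2`^p*4<=2`^p*4*Lam.
  by rewrite ler_peMr// mulr_ge0 ltW.
 lra.
move: h1 h2 kp; rewrite mulrDr; move: (2`^p)=> z; move: (mu`^p) (t`^p)=> m tp. move=> h1 h2 kp; lra.
Qed.

End Coercivity.

Section Composition.
Context {R: realType} {n: nat}.
Notation E := 'rV[R]_n.
Notation L := (lebesgueType R n).
Implicit Types (g: E -> E) (f phi: E -> R) (c x: E) (r M s: R) (U: set E) (i: 'I_n).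

Lemma mble_cut U f: measurable (U: set L) -> measurable_fun (U: set L) (f: L -> R) ->
 mble (fun x=> \1_U x*f x).
move=> mU mf; rewrite /mble; have ->: (fun x=> \1_U x*f x) = (f: L -> R) \_ (U: set L); last first.
 exact/(measurable_restrictT _ mU).
apply: funext=> x; rewrite /patch indicE; case: ifPn=> _; first by rewrite mul1r. by rewrite mul0r.
Qed.

(* Superposition: approximate [g] by maps with values in finer and finer
  lattices. *)
Lemma mblev_caratheodory (a: E -> E -> E) s g: Caratheodory_fun a -> s != 0 -> mblev g ->
 mblev (fun x=> a (s *: x) (g x)).
move=> [ma ca] s0 mg i. pose q (k: nat) (z: 'rV[int]_n): E := k.+1%:R^-1 *: map_mx intr z.
pose m (k: nat) (x: E): 'rV[int]_n := \row_j Num.floor (k.+1%:R*g x 0 j).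
pose h (k: nat) (x: E): R := a (s *: x) (q k (m k x)) 0 i. have mz (xi: E): mble (fun x=> a (s *: x) xi 0 i).
 have := mble_aff (0: E) s0 (ma xi i); congr (mble _). by apply: funext=> x; rewrite add0r.
have mS k z : measurable ([set x | m k x = z]: set L).
 have ->: [set x | m k x = z] = \bigcap_(j in [set: 'I_n]) [set x | Num.floor (k.+1%:R*g x 0 j) = z 0 j].
  apply/seteqP; split=> x /= hx; first by move=> j _ /=; rewrite -hx mxE.
  by apply/rowP=> j; rewrite mxE; exact: hx.
 apply: fin_bigcap_measurable; first nneg. move=> j _.
 have mj : mble (fun x=> k.+1%:R*g x 0 j) := mbleM (mble_cst _) (mg j).
 have ->: [set x | Num.floor (k.+1%:R*g x 0 j) = z 0 j] =
   [set x | (z 0 j)%:~R<=k.+1%:R*g x 0 j] `&` ~` [set x | (z 0 j+1)%:~R<=k.+1%:R*g x 0 j].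
  apply/seteqP; split=> x /=.
   move=> <-; split; first exact: ge_floor. by apply/negP; rewrite -ltNge; exact: lt_succ_floor.
  by move=> [h1 /negP]; rewrite -ltNge=> h2; apply: floor_def; rewrite h1 h2.
 by apply: measurableI; [|apply: measurableC]; exact: measurable_superlevel.
have mh k : mble (h k).
 move=> _ Y mY; rewrite setTI.
 have ->: h k @^-1` Y = \bigcup_(z: 'rV[int]_n) ([set x | m k x = z] `&` (fun x=> a (s *: x) (q k z) 0 i) @^-1` Y).
  apply/seteqP; split=> x /=; first by move=> hx; exists (m k x). by move=> [z _ [/= <-]].
 apply: countable_bigcupT_measurable; first nneg. move=> z; apply: measurableI=> //.
 by have := mz (q k z) measurableT Y mY; rewrite setTI.
apply: (measurable_fun_cvg mh)=> x _. have cq : (fun k=> q k (m k x)) @ \oo --> g x.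
 apply/cvgrPdist_le=> e e0; near=> k. apply: ltW; apply: norm_lt_coord=> // j.
 have k0: 0<k.+1%:R :> R by nneg.
 apply: (@le_lt_trans _ _ k.+1%:R^-1); last by near: k; exact: near_infty_natSinv_lt (PosNum e0).
 rewrite !mxE; set y:= g x 0 j.
 have ->: y-k.+1%:R^-1*(Num.floor (k.+1%:R*y))%:~R = k.+1%:R^-1*(k.+1%:R*y-(Num.floor (k.+1%:R*y))%:~R).
  by rewrite mulrBr mulrA mulVf ?mul1r// gt_eqF.
 rewrite normrM gtr0_norm ?invr_gt0// ler_piMr ?invr_ge0 ?(ltW k0)//.
 have h1 := ge_floor (k.+1%:R*y); have h2 := lt_succ_floor (k.+1%:R*y).
 rewrite ger0_norm ?subr_ge0// lerBlDl; apply: ltW. by rewrite intrD in h2.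
have c1 : (fun k=> a (s *: x) (q k (m k x))) @ \oo --> a (s *: x) (g x).
 exact: (continuous_cvg _ (ca (s *: x) (g x)) cq).
have cc : continuous (fun y: E=> y 0 i) := smooth_cont (smooth_coord i).
exact: (cvg_comp _ _ c1 (cc (a (s *: x) (g x)))). Unshelve. all: by end_near. Qed.

Lemma test_of_vanish U c r M phi: ball c r `<=` U -> M<r -> smooth phi ->
 (forall x, ~ ball c M x -> phi x = 0) -> test_function U phi.
move=> cU Mr sphi vphi. pose A: set E:= [set x | `|c-x|<=M].
have clA : closed A by exact: (@closed_closed_ball_ R E c M). have sA : Defs.support phi `<=` A.
 have h: [set x | phi x != 0] `<=` A.
  move=> x /= /eqP hx; apply: contrapT=> nx; apply: hx; apply: vphi=> hb; apply: nx.
  by move: hb; rewrite -ball_normE /ball_ /= => /ltW.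
 by rewrite ((closure_id A).1 clA); exact: closureS h.
split=> //.
- apply: (subclosed_compact (@closed_closure _ _) _ sA).
 apply: bounded_closed_compact=> //. exists (M + `|c|); split; first exact: num_real.
 move=> y My x Ax; apply: le_trans (ltW My); rewrite -(subrK c x).
 by apply: (le_trans (ler_normD _ _)); rewrite lerD2r distrC.
- move=> x /sA Ax; apply: cU; rewrite -ball_normE /ball_ /=; exact: le_lt_trans Ax Mr.
Qed.

Lemma Lp_cut (p: R) U f: measurable (U: set L) -> Lp p U f ->
 mble (fun x=> \1_U x*f x) /\ exists k: R, ub (fun x=> \1_U x * `|f x| `^ p) k.
move=> mU [mf hf]; have m1 := mble_cut mU mf; split=> //.
have mp : measurable_fun (U: set L) (fun x: L=> `|f x| `^ p).
 apply: (@measurableT_comp _ _ _ _ _ _ (fun x: R=> x`^p)); first nneg. by apply: measurableT_comp.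
have m2 := mble_cut mU mp. have e := @integral_indicE R n U (fun x=> `|f x| `^ p) mU (fun x=> powR_ge0 _ _).
exists (fine (\int[@lebesgue R n]_(x in U) (`|f x| `^ p)%:E)%E); split; first exact: m2.
 by [].
rewrite -e fineK// ge0_fin_numE//; apply: integral_ge0=> x _; rewrite lee_fin; nneg.
Qed.

Lemma Rintegral_cut U f: \int[@lebesgue R n]_(x in U) f x = integ (fun x=> \1_U x*f x).
rewrite Rintegral_mkcond /integ; congr (Rintegral _ _ _); apply: funext=> x.
by rewrite /patch indicE; case: ifPn=> _; rewrite ?mul1r ?mul0r.
Qed.

End Composition.

Section LocalSolution.
Context {R: realType} {n: nat} (n0: (0<n)%N).
Notation E := 'rV[R]_n.
Notation L := (lebesgueType R n).
Notation leb := (@lebesgue R n).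
Implicit Types (f u phi: E -> R) (g F: E -> E) (p mu eps rad c r s M: R) (x: E) (U: set E) (i: 'I_n).

Let dot_cut U x (y z: E): dot (\1_U x *: y) z = \1_U x*dot y z :> R.
Proof. by rewrite -[z in LHS]scale1r dotZZ mulr1. Qed.

Let cut_pow U x (t s: R): 0<s -> `|\1_U x*t| `^ s = \1_U x * `|t| `^ s.
move=> s0; have [h|h] := pselect (U x); first by rewrite indic_in// !mul1r.
by rewrite indic_out// !mul0r normr0 powR0// gt_eqF.
Qed.

Lemma Lp_vec_cut p U F: measurable (U: set L) -> 0<p -> Lp_vec p U F ->
 mblev (fun x=> \1_U x *: F x) /\ exists c, ub (fun x=> \1_U x*enorm (\1_U x *: F x)`^p) c.
move=> mU p0 hF; have m i : mble (fun x=> (\1_U x *: F x) 0 i).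
 have [h _] := Lp_cut mU (hF i); move: h; congr (mble _); apply: funext=> x; by rewrite mxE.
split=> //. have hb i : exists c, ub (fun x=> \1_U x * `|F x 0 i| `^ p) c by have [] := Lp_cut mU (hF i).
have [c hc] := choice hb. exists (n%:R`^p*\sum_i c i).
apply: (ub_fle _ _ _ (ubZ (powR_ge0 n%:R p) (ub_sum (index_enum 'I_n) xpredT hc)))=> [|x|x].
- mbl.
- by rewrite mulr_ge0 ?powR_ge0. have [h|h] := pselect (U x); last first.
 rewrite [leLHS](_: _ = 0) ?mulr_ge0 ?powR_ge0//; last by rewrite indic_out// mul0r. nneg.
have i1: \1_U x = 1 :> R := indic_in h. rewrite i1 scale1r mul1r; under eq_bigr do rewrite mul1r.
apply: (le_trans (le_pow (ltW p0) (enorm_ge0 _) (enorm_le_l1 _))). exact: (l1_pow n0 _ (ltW p0)).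
Qed.

Let monq_shift p mu mu' (xi xi0: E): 0<=mu -> mu<=mu' -> monq p (mu' + enorm xi0+enorm xi) (enorm (xi-xi0)) <=
 (if 2<=p then enorm (xi-xi0)`^p else (mu+enorm xi+enorm xi0)`^(p-2)*enorm (xi-xi0)^+2).
move=> mu0 mm; rewrite /monq; case: ifPn=> hp; first exact: lexx. rewrite -ltNge in hp.
have [z0|nz0] := eqVneq (enorm (xi-xi0)) 0.
 by rewrite z0 expr2 mul0r !mulr0.
apply: ler_wpM2r; first by rewrite exprn_ge0 ?enorm_ge0. have S0: 0<mu+enorm xi+enorm xi0.
 rewrite lt_neqAle !addr_ge0 ?enorm_ge0// andbT; apply/negP=> /eqP s0.
 have h1 := enorm_ge0 xi; have h2 := enorm_ge0 xi0. have x1 : enorm xi = 0 by lra.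
 have x2 : enorm xi0 = 0 by lra.
 move/negP: nz0; apply; rewrite eq_le enorm_ge0 andbT; apply: (le_trans (enorm_le_l1 _)).
 apply: (le_trans (l1B _ _)); apply: (le_trans (lerD (l1_le_enorm _) (l1_le_enorm _))).
 by rewrite x1 x2 mulr0 addr0.
have p2: 0<=2-p by rewrite subr_ge0 ltW. have := le_pow_neg p2 S0 (_: _<=mu' + enorm xi0+enorm xi).
by rewrite opprB; apply; rewrite addrAC lerD2r lerD2r.
Qed.

(** All functions are extended by zero outside [B], and [mu] is replaced by [kap mu], for which the
    flux is coercive. Periodicity enters here: a translation by [eps] times an integer vector leaves
    the coefficients unchanged, so the flux is monotone between the two points. *)
Lemma local_solution p Lam A kap mu eps rad (x0: E) (a: E -> E -> E) u F :
 1<p -> 1<=Lam -> Lam<=A -> 1<=kap -> 0<=mu -> 0<eps -> 0<rad ->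
 Caratheodory_fun a -> (forall xi, Zperiodic (a ^~ xi)) -> monotone_growth p mu Lam a ->
 (forall x xi, (kap * mu+enorm xi)`^p<=A*(dot (a x xi) xi+(kap * mu)`^p)) -> let B := eball x0 rad in
 W1p p B u -> Lp_vec (p/(p-1)) B F -> weak_div_eq B (fun x=> a (eps^-1 *: x) (wgrad B u x)) F ->
 let g x := \1_B x *: wgrad B u x in loc_data p A eps (kap * mu) B (fun x=> \1_B x*u x) g
  (fun x=> \1_B x *: a (eps^-1 *: x) (g x)) (fun x=> \1_B x *: F x) /\
 exists c, ub (fun x=> \1_B x*(kap * mu+enorm (g x))`^p) c.
move=> p1 L1 LA k1 mu0 e0 R0 Car per [mono gr] coer B [Lu exg Lg] LF eqn g.
have p0: 0<p by lra. have p0': 0<=p := ltW p0. have p10: 0<=p-1 by lra. have p1p : p-1<p by lra.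
have q1: 1<p/(p-1) by rewrite ltr_pdivlMr; lra. have q0: 0<p/(p-1) by exact: lt_trans q1.
have A1: 1<=A by exact: le_trans LA.
have wg : weak_gradient B u (wgrad B u) by have [g' hg] := exg; rewrite /wgrad; case: xgetP=> [y _ //|nP]; case: (nP g').
have mB : measurable (B: set L) by apply: open_lmbl; exact: open_eball.
have mu1: 0<=kap * mu by rewrite mulr_ge0// (le_trans ler01). have mumu : mu<=kap * mu by rewrite ler_peMl.
have [mg [cg ug]] := Lp_vec_cut mB p0 Lg. have [mF [cF uF]] := Lp_vec_cut mB q0 LF.
have eV0 : eps^-1 != 0 by rewrite invr_eq0 gt_eqF. have mb : mblev (fun x=> \1_B x *: a (eps^-1 *: x) (g x)).
 by apply: mblevZ; [mbl|exact: mblev_caratheodory].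
pose M0:= `|x0| + rad. have M00: 0<M0 by rewrite ltr_wpDl. have BM x : B x -> ball (0: E) M0 x.
 move=> hx; rewrite ball0E; have := eball_sub_ball R0 hx; rewrite -ball_normE /ball_ /= distrC=> h.
 by rewrite -(subrK x0 x) (le_lt_trans (ler_normD _ _))// addrC ltrD2l.
have cutM f : vanish M0 (fun x=> \1_B x*f x).
 by move=> x nx; rewrite indic_out ?mul0r// => /BM.
have itgc f : Lp p B f -> itg (fun x=> \1_B x*f x).
 move=> hf; have [mf [c uc]] := Lp_cut mB hf.
 by apply: (@ub_itg_pow R n _ M0 p c p1 M00 mf (cutM f)); apply: (ub_eq _ uc)=> x; rewrite cut_pow.
have ubB : ub (\1_B) (fine (leb B)).
 have [e _ _ _] := fine_leb_eball n0 x0 R0; exact: (ub_indic mB e).1.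
have mG : mble (fun x=> kap * mu+enorm (g x)) by apply: mbleD; [mbl|mbl].
have G0 x: 0<=kap * mu+enorm (g x) by rewrite addr_ge0 ?enorm_ge0.
have [cf uf]: exists c, ub (fun x=> \1_B x*(kap * mu+enorm (g x))`^p) c.
 have u1 := ubZ (powR_ge0 2 p) (ubD (ubZ (powR_ge0 (kap * mu) p) ubB) ug).
 eexists; apply: (ub_fle _ _ _ u1)=> [|x|x].
 - mbl.
 - by rewrite mulr_ge0 ?powR_ge0.
 rewrite [_ `^ p*\1_B x]mulrC -mulrDr [leRHS]mulrCA; apply: ler_wpM2l; first nneg.
 exact: (pow_add p0' mu1 (enorm_ge0 _)).
split; last by exists cf.
have grad_bound (c: E) r M phi: ball c r `<=` B -> M<r -> smooth phi -> (forall x, ~ ball c M x -> phi x = 0) ->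
  exists K, [/\ 0<=K, forall x, `|phi x|<=K & forall x, l1 (grad phi x)<=K].
 move=> cB Mr sphi vphi; have v0 : vanish (`|c| + M) phi.
  move=> x nx; apply: vphi=> hx; apply: nx; rewrite ball0E.
  move: hx; rewrite -ball_normE /ball_ /= distrC=> h.
  by rewrite -(subrK c x) (le_lt_trans (ler_normD _ _))// addrC ltrD2l.
 have [K [K0 h1 h2 _]] := smooth_bounds sphi v0. exists (K+n%:R*K); split; first nneg.
  by move=> x; apply: (le_trans (h1 x)); rewrite lerDl mulr_ge0.
 move=> x; apply: (@le_trans _ _ (n%:R*K)); last by rewrite lerDr.
 by rewrite l1_grad -sum_cst; apply: ler_sum=> j _; exact: h2.
have growth x : enorm (\1_B x *: a (eps^-1 *: x) (g x))<=A*(kap * mu+enorm (g x))`^(p-1).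
 have rhs0: 0<=A*(kap * mu+enorm (g x))`^(p-1).
  by rewrite mulr_ge0 ?powR_ge0// (le_trans ler01).
 rewrite enormZ ?indic_ge0//; have [h|h] := pselect (B x); last by rewrite indic_out// mul0r.
 have i1: \1_B x = 1 :> R := indic_in h.
 rewrite i1 mul1r; apply: (le_trans (gr _ _)); apply: ler_pM=> //; first exact: le_trans L1.
  exact: powR_ge0.
 by apply: le_pow=> //; [rewrite addr_ge0 ?enorm_ge0|rewrite lerD2r].
have gB x : B x -> g x = wgrad B u x by move=> h; rewrite /g (indic_in h) scale1r. split=> //.
- move=> x h; rewrite dot_cut; have i1: \1_B x = 1 :> R := indic_in h.
 by rewrite i1 mul1r.
- move=> x z h xU xhU.
 have i1: \1_B x = 1 :> R := indic_in xU. have i2: \1_B (x+h) = 1 :> R := indic_in xhU.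
 rewrite i1 i2 !scale1r. have e1 : eps^-1 *: (x+h) = eps^-1 *: x+map_mx intr z.
  by rewrite scalerDr /h scalerA mulVf ?scale1r// gt_eqF.
 have := mono (eps^-1 *: x) (g (x+h)) (g x). rewrite e1 (per (g (x+h)) (eps^-1 *: x) z).
 set xi:= g (x+h); set xi0:= g x; set D:= dot _ _=> hm. have LD : Lam*D<=A*D.
  have D0: 0<=D.
   rewrite -(pmulr_rge0 _ (lt_le_trans ltr01 L1)); apply: le_trans hm.
   by case: ifP=> _; rewrite ?mulr_ge0 ?powR_ge0 ?exprn_ge0 ?enorm_ge0.
  exact: ler_wpM2r.
 apply: le_trans LD; apply: le_trans hm; nneg.
- exact: itgc.
- move=> i; have := itgc _ (Lg i); congr (itg _); apply: funext=> x; by rewrite /g mxE.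
- move=> c r M phi cB Mr sphi vphi.
 have [K [K0 _ hK]] := grad_bound c r M phi cB Mr sphi vphi. have T := test_of_vanish cB Mr sphi vphi.
 have mgr := mble_grad sphi. have [C1 C10 hC1] := pow_absorb p1p p10 ltr01.
 have [C2 C20 hC2] := pow_absorb q1 ler01 ltr01.
 have i1 : itg (fun x=> dot (\1_B x *: a (eps^-1 *: x) (g x)) (grad phi x)).
  have AK: 0<=A*K by rewrite mulr_ge0// (le_trans ler01). have v := ubZ AK (ubD uf (ubZ (ltW C10) ubB)).
  apply: (itg_le _ _ v)=> [|x]; first mbl. have [h|h] := pselect (B x); last first.
   by rewrite dot_cut indic_out// !mul0r mulr0 addr0 mulr0 normr0.
  have i1: \1_B x = 1 :> R := indic_in h. apply: (le_trans (dot_le _ _)); rewrite {2 3}i1 mulr1 mul1r.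
  apply: (le_trans (ler_pM (enorm_ge0 _) (l1_ge0 _) (growth x) (hK x))).
  rewrite mulrAC; apply: ler_wpM2l=> //. by have := hC1 _ (G0 x); rewrite mul1r.
 have i2 : itg (fun x=> dot (\1_B x *: F x) (grad phi x)).
  have v := ubZ K0 (ubD uF (ubZ (ltW C20) ubB)). apply: (itg_le _ _ v)=> [|x]; first mbl.
  have [h|h] := pselect (B x); last first.
   by rewrite dot_cut indic_out// !mul0r mulr0 addr0 mulr0 normr0.
  have j1: \1_B x = 1 :> R := indic_in h.
  apply: (le_trans (dot_le _ _)); rewrite j1 scale1r mulr1 mul1r mulrC.
  apply: (@le_trans _ _ (K*enorm (F x))); first by apply: ler_wpM2r (hK x); exact: enorm_ge0.
  apply: ler_wpM2l=> //; have := hC2 _ (enorm_ge0 (F x)). by rewrite mul1r powRr1 ?enorm_ge0.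
 split; first exact: itgB. rewrite integB//; apply/eqP; rewrite subr_eq0; apply/eqP.
 have := eqn phi T; rewrite !Rintegral_cut.
 have ->: (fun x=> dot (\1_B x *: F x) (grad phi x)) = (fun x=> \1_B x*dot (F x) (grad phi x)).
  by apply: funext=> x; rewrite dot_cut.
 move=> <-; apply: integ_eq=> x; rewrite dot_cut. have [h|h] := pselect (B x); first by rewrite gB.
 by rewrite indic_out// !mul0r.
- move=> c r M phi i cB Mr sphi vphi.
 have T := test_of_vanish cB Mr sphi vphi.
 have [_ _ hw] := wg; have := hw phi i T; rewrite !Rintegral_cut=> e.
 have ->: integ (fun x=> \1_B x*u x * partial i phi x) = integ (fun x=> \1_B x*(u x * partial i phi x)).
  by apply: integ_eq=> x; rewrite mulrA.
 rewrite e; congr (- _); apply: integ_eq=> x; by rewrite /g mxE mulrA.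
Qed.

End LocalSolution.

(** * Normalised norms and the conclusion *)

Section Averages.
Context {R: realType} {n: nat} (n0: (0<n)%N).
Notation E := 'rV[R]_n.
Notation L := (lebesgueType R n).
Notation leb := (@lebesgue R n).
Implicit Types (f h: E -> R) (rad eps sig lam C: R) (x: E).

Lemma indic_cut (U: set E) x (G: E -> R) (y: E): \1_U x*G (\1_U x *: y) = \1_U x*G y.
have [hx|hx] := pselect (U x); last by rewrite indic_out// !mul0r. by rewrite indic_in// scale1r.
Qed.

Lemma poweR_mono (r: R) (X Y: \bar R): 0<=r -> (0<=X)%E -> (X<=Y)%E -> (X`^r<=Y`^r)%E.
move=> r0 X0 XY; apply: (gt0_ler_poweR r0 _ _ XY); rewrite in_itv/= leey andbT//. exact: le_trans XY.
Qed.

Lemma maximal_mono f h eps x: (forall y, 0<=f y) -> (forall y, f y<=h y) -> 0<eps ->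
 (maximal eps f x<=maximal eps h x)%E.
move=> f0 fh e0; apply: ge_ereal_sup=> _ [r /= er <-]. have r0: 0<r by exact: lt_le_trans er.
have [_ _ _ v0] := fine_leb_eball n0 x r0.
apply: (@le_trans _ _ ((fine (leb (eball x r)))^-1%:E*\int[leb]_(y in eball x r) (h y)%:E)%E).
 apply: lee_wpmul2l; first by rewrite lee_fin invr_ge0 ltW. by apply: le_integral_ge0=> y _; rewrite lee_fin.
by apply: ereal_sup_ubound; exists r.
Qed.

Lemma maximal_eq0 f eps x: ub f 0 -> 0<eps -> maximal eps f x = 0%E.
move=> [mf f0 hf] e0; apply/eqP; rewrite eq_le (maximal_ge0 n0 x f0 e0) andbT.
apply: ge_ereal_sup=> _ [r /= er <-]. have r0: 0<r by exact: lt_le_trans er.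
have [_ _ _ v0] := fine_leb_eball n0 x r0. rewrite (_: \int[leb]_(y in eball x r) (f y)%:E = 0)%E ?mule0//.
apply/eqP; rewrite eq_le; apply/andP; split; last by apply: integral_ge0=> y _; rewrite lee_fin.
have mE : measurable (eball x r: set L) by apply: open_lmbl; exact: open_eball.
apply: le_trans hf; rewrite (integral_indicE mE f0).
have me : mble (fun y=> \1_(eball x r) y*f y) := mbleM (mble_indic mE) mf.
have e00 y: 0 <= \1_(eball x r) y*f y by rewrite mulr_ge0 ?indic_ge0.
by apply: (intEF_le leb me mf e00)=> y; rewrite ler_piMl ?indic_le1.
Qed.

(** Divide by the volume of the half ball and take the root of order [sig]. The factor [(2n)^n]
    bounds the volume of the cube around the whole ball by that of the half ball. *)
Lemma root_bound sig C rad (x0: E) lam (I2 I: \bar R): 1<=sig -> 0<C -> 0<rad -> 0<=lam ->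
 (0<=I2)%E -> (0<=I)%E -> (I2<=C%:E*((lam`^sig*(2*rad)^+n)%:E+I))%E ->
 (((fine (leb (eball x0 (rad/2%R))))^-1%:E*I2)`^sig^-1 <= (2`^sig^-1*(C*(2*n%:R)^+n)`^sig^-1)%:E *
  (lam%:E+((fine (leb (eball x0 rad)))^-1%:E*I)`^sig^-1))%E.
move=> s1 C0 R0 l0 I20 I0 hI. have s0: 0<sig by exact: lt_le_trans s1. have sV0: 0<sig^-1 by rewrite invr_gt0.
have nR: 0<n%:R :> R by rewrite ltr0n. have R20: 0<rad/2 by rewrite divr_gt0.
have [_ v1 _ v0] := fine_leb_eball n0 x0 R20; set v:= fine _ in v1 v0 *.
have [_ _ V2 V0] := fine_leb_eball n0 x0 R0; set V:= fine _ in V2 V0 *.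
set K:= C*(2*n%:R)^+n; have K0: 0<K by rewrite mulr_gt0// exprn_gt0// mulr_gt0.
have D0: 0<2`^sig^-1*K`^sig^-1 :> R by rewrite mulr_gt0 ?powR_gt0. have [Iy|Iy] := eqVneq I +oo%E.
 rewrite Iy gt0_muley ?lte_fin ?invr_gt0// poweRyr ?gt_eqF// addey// gt0_muley ?lte_fin// leey//.
have [i IE]: exists r: R, I = r%:E.
 by exists (fine I); rewrite fineK// ge0_fin_numE// lt_neqAle Iy leey.
rewrite IE in hI I0 *; rewrite lee_fin in I0. have [i2 I2E]: exists r: R, I2 = r%:E.
 by exists (fine I2); rewrite fineK// ge0_fin_numE//; apply: le_lt_trans hI _; rewrite -EFinD -EFinM ltry.
rewrite I2E in hI I20 *; rewrite lee_fin in I20. rewrite -EFinD -EFinM lee_fin in hI.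
rewrite (_: ((V^-1)%:E * i%:E)%E = (V^-1 * i)%:E)// (_: ((v^-1)%:E * i2%:E)%E = (v^-1 * i2)%:E)//.
rewrite !poweR_EFin -(EFinD lam) -EFinM lee_fin.
pose y:= V^-1 * i; have y0: 0<=y by rewrite mulr_ge0// invr_ge0 ltW. have vV : v^-1*(2*rad)^+n<=(2*n%:R)^+n.
 rewrite mulrC ler_pdivrMr//; apply: (@le_trans _ _ ((2*n%:R)^+n*(2*(rad/2/n%:R))^+n)).
  by rewrite -exprMn le_eqVlt; apply/orP; left; apply/eqP; congr (_^+n); field; rewrite gt_eqF.
 by apply: ler_wpM2l=> //; rewrite exprn_ge0// mulr_ge0.
have vi : v^-1 * i<=(2*n%:R)^+n*y.
 rewrite /y mulrA; apply: ler_wpM2r=> //; rewrite ler_pdivlMr//.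
 by apply: le_trans vV; apply: ler_wpM2l V2; rewrite invr_ge0 ltW.
have ls0: 0<=lam`^sig := powR_ge0 _ _. have h1 : v^-1 * i2<=K*(lam`^sig+y).
 have vV0: 0<=v^-1 by rewrite invr_ge0 ltW.
 apply: (le_trans (ler_wpM2l vV0 hI)); rewrite mulrCA /K -mulrA; apply: ler_wpM2l; first exact: ltW.
 rewrite !mulrDr; apply: lerD=> //. by rewrite mulrCA [leRHS]mulrC; exact: ler_wpM2l.
apply: (le_trans (le_pow (ltW sV0) _ h1)); first by rewrite mulr_ge0// invr_ge0 ltW.
rewrite (powRM _ (ltW K0) (addr_ge0 ls0 y0)) [2`^_*_]mulrC -mulrA. apply: ler_wpM2l; first exact: powR_ge0.
have := pow_add (ltW sV0) ls0 y0. by rewrite -powRrM divff ?gt_eqF// powRr1.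
Qed.

End Averages.

Theorem theorem5p1 (R : realType) (n : nat) (p Lam q : R) :
  (0 < n)%N -> 1 < p -> 1 <= Lam -> p < q ->
  exists2 C : R, 1 <= C &
  forall (mu : R) (a : 'rV[R]_n -> 'rV[R]_n -> 'rV[R]_n),
    0 <= mu <= 1 ->
    Caratheodory_fun a ->
    (forall xi, Zperiodic (a ^~ xi)) ->
    monotone_growth p mu Lam a ->
    monotone_growth p mu Lam (fun=> homogenized p a) ->
    continuity_bound p mu Lam a (homogenized p a) ->
  forall (x0 : 'rV[R]_n) (rad eps : R) (u : 'rV[R]_n -> R)
         (F : 'rV[R]_n -> 'rV[R]_n),
    0 < rad -> 0 < eps ->
    let B := eball x0 rad in
    let p' := p / (p - 1) in
    W1p p B u ->
    Lp_vec p' B F ->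
    weak_div_eq B (fun x => a (eps^-1 *: x) (wgrad B u x)) F ->
    (avg_norm (q / p) (eball x0 (rad / 2))
       (maximal eps (fun x => (\1_B x * (mu + enorm (wgrad B u x)) `^ p)%R))
     <= C%:E *
        (avg_norm p B (fun x => (mu + enorm (wgrad B u x))%R%:E) `^ p +
         avg_norm (q / p) B
           (maximal eps (fun x => (\1_B x * enorm (F x) `^ p')%R))))%E.
move=> n0 p1 L1 pq. have p0: 0<p by lra. have nR: 0<n%:R :> R by rewrite ltr0n.
pose sig:= q/p; have s1: 1<=sig by rewrite ler_pdivlMr// mul1r ltW. have s0: 0<sig by exact: lt_le_trans s1.
have [A [kap [LA k1 hco]]] := @coercive_of_monotone R n p Lam p1 L1. have k0: 0<kap by exact: lt_le_trans k1.
have A1: 1<=A by exact: le_trans LA. have [Cm Cm0 hm] := maximal_estimate n0 p1 A1 s1.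
pose D1:= 2`^sig^-1*(Cm*(2*n%:R)^+n)`^sig^-1. have D10: 0<=D1 by rewrite mulr_ge0 ?powR_ge0.
(* [(96 n)^n] compares the level [height c rad] with the mean energy over the ball, and [kap^p]
   undoes the enlargement of [mu]. *)
pose K2:= kap`^p*(96*n%:R)^+n. have K20: 0<=K2 by rewrite mulr_ge0 ?powR_ge0 ?exprn_ge0// mulr_ge0.
exists (1+D1*(K2+1)); first by rewrite lerDl mulr_ge0// addr_ge0.
move=> mu a /andP[mu0 _] Car per mono _ _ x0 rad eps u F R0 e0 B p' Wu LF eqn.
pose g x:= \1_B x *: wgrad B u x. have co := hco mu a mu0 mono.
have [D [cf uf]] := local_solution n0 p1 L1 LA k1 mu0 e0 R0 Car per mono co Wu LF eqn.
rewrite -/B -/g in D uf.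
have mB : measurable (B: set (lebesgueType R n)) by apply: open_lmbl; exact: open_eball.
have pp0: 0<p' by rewrite divr_gt0//; lra. pose f x:= \1_B x*(kap * mu+enorm (g x))`^p.
pose h x:= \1_B x*enorm (\1_B x *: F x)`^p'. pose f1 x:= \1_B x*(mu+enorm (wgrad B u x))`^p.
have hE : h = (fun x=> \1_B x*enorm (F x)`^p').
 by apply: funext=> x; exact: (indic_cut B x (fun y=> enorm y`^p')).
have mh : mble h.
 have [mF _] := Lp_vec_cut n0 mB pp0 LF.
 by apply: mbleM; [exact: mble_indic|apply: mble_powR; exact: mble_enorm].
have mumu : mu<=kap * mu by rewrite ler_peMl. have f10 x: 0<=f1 x by rewrite mulr_ge0 ?indic_ge0 ?powR_ge0.
have f1E x : f1 x = \1_B x*(mu+enorm (g x))`^p.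
 by symmetry; exact: (indic_cut B x (fun y=> (mu+enorm y)`^p)).
have f1f x : f1 x<=f x.
 rewrite f1E; apply: ler_wpM2l; first exact: indic_ge0.
 by apply: le_pow; [exact: ltW|rewrite addr_ge0 ?enorm_ge0|rewrite lerD2r].
have ff1 x : f x<=kap`^p*f1 x.
 rewrite f1E mulrCA; apply: ler_wpM2l; first exact: indic_ge0.
 rewrite -powRM ?(ltW k0) ?addr_ge0 ?enorm_ge0//; apply: le_pow; first exact: ltW.
  by rewrite addr_ge0 ?enorm_ge0 ?mulr_ge0 ?(ltW k0).
 by rewrite mulrDr lerD2l ler_peMl ?enorm_ge0.
have mf1 : mble f1.
 have ->: f1 = (fun x=> \1_B x*(mu+enorm (g x))`^p) by apply: funext. apply: mbleM; first exact: mble_indic.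
 by apply: mble_powR; apply: mbleD; [exact: mble_cst|apply: mble_enorm; exact: (ld_mg D)].
have [uc cle] := ub_integ_self uf; rewrite -/f in uc. set c:= integ f in uc.
have uf1 : ub f1 cf by apply: (ub_fle mf1 f10 f1f uf).
have [uc1 _] := ub_integ_self uf1; set c1:= integ f1 in uc1. have c10: 0<=c1 by exact: ub_ge0 uc1.
have ck : c<=kap`^p*c1 by have [] := ub_integ_self (ub_fle (ub_mble uf) (ub_pos uf) ff1 (ubZ (powR_ge0 kap p) uc1)).
rewrite -/f1 -hE /avg_norm -/sig. set I1:= integral (@lebesgue R n) (eball x0 (rad/2)) _.
set IB:= integral (@lebesgue R n) B (fun x=> (`|_| `^ p)%E).
set IH:= (\int[@lebesgue R n]_(x in B) (`|maximal eps h x| `^ sig))%E.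
have [VE V1 V2 V0] := fine_leb_eball n0 x0 R0; rewrite -/B in VE V1 V2 V0 *; set V:= fine _ in VE V1 V2 V0 *.
have IBE : IB = c1%:E.
 rewrite /IB -(ub_integ uf1) -/c1. have m0 x: 0<=(mu+enorm (wgrad B u x))`^p := powR_ge0 _ _.
 rewrite -(integral_indicE mB m0); apply: eq_integral=> x _.
 by rewrite gee0_abs ?poweR_EFin// lee_fin addr_ge0 ?enorm_ge0.
have avgE : ((V^-1%:E*IB)`^p^-1`^p)%E = (V^-1*c1)%:E.
 rewrite -poweRrM mulVf ?gt_eqF// IBE -EFinM poweRe1// lee_fin mulr_ge0// invr_ge0 ltW//.
rewrite avgE; clearbody V c c1. have V'0: 0<V^-1 by rewrite invr_gt0.
have W0: 0<=V^-1*c1 := mulr_ge0 (ltW V'0) c10. have h0 x: 0<=h x by rewrite mulr_ge0 ?indic_ge0 ?powR_ge0.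
have IH0 : (0<=IH)%E by apply: integral_ge0=> x _; exact: poweR_ge0.
have I10 : (0<=I1)%E by apply: integral_ge0=> x _; exact: poweR_ge0.
have sV0 : sig^-1 != 0 by rewrite invr_eq0 gt_eqF.
have CC0: 0<=1+D1*(K2+1) by rewrite addr_ge0// mulr_ge0// addr_ge0. have c0: 0<=c by exact: ub_ge0 uc.
(* [maximal_estimate] asks for a positive mass. If [c = 0], the integral of [f1] vanishes, hence its
   maximal function and the left-hand side. *)
have [cz|cnz] := eqVneq c 0.
 have I1z : I1 = 0%E.
  apply: integral0_eq=> x _. have M0 : maximal eps f1 x = 0%E.
   apply: (maximal_eq0 n0 _ _ e0); apply: (ub_fle mf1 f10 f1f); by rewrite -cz.
  by rewrite M0 abse0 poweR0r// gt_eqF.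
 rewrite I1z mule0 poweR0r//; apply: mule_ge0; first (rewrite lee_fin; exact: CC0).
 apply: adde_ge0; last exact: poweR_ge0. by rewrite lee_fin; exact: W0.
have cpos: 0<c by rewrite lt_neqAle eq_sym cnz. pose lam:= height (n:=n) c rad.
(* On [B] the constant [(kap mu)^p] lies below the integrand, so its integral is at most [c]; a cube
   inscribed in the ball bounds the volume from below. *)
have mulam : (kap * mu)`^p<=lam.
 have km0: 0<=(kap * mu)`^p := powR_ge0 _ _. have lo : (kap * mu)`^p*(2*(rad/n%:R))^+n<=c.
  have [uB iB] := ub_indic mB VE. have le1 : ub (fun x=> (kap * mu)`^p*\1_B x) c.
   apply: (ub_fle _ _ _ uc)=> [|x|x].
   - by apply: mbleM; [exact: mble_cst|exact: mble_indic].
   - by rewrite mulr_ge0 ?indic_ge0. rewrite /f mulrC; apply: ler_wpM2l; first exact: indic_ge0.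
   by apply: le_pow; [exact: ltW|rewrite mulr_ge0 ?(ltW k0)|rewrite lerDl enorm_ge0].
  have [_] := ub_integ_self le1; rewrite (integZ _ (itg_ub0 uB)) iB.
  by apply: le_trans; apply: (ler_wpM2l km0 V1).
 have r1 : (2*(rad/n%:R))^+n*(48*n%:R/rad)^+n = 96^+n.
  by rewrite -exprMn; congr (_^+n); field; rewrite !gt_eqF.
 have q0: 0<=(48*n%:R/rad)^+n by rewrite exprn_ge0// divr_ge0 ?mulr_ge0 ?(ltW R0).
 have lq := ler_wpM2r q0 lo; rewrite -(mulrA (_ `^ _)) r1 in lq; apply: le_trans lq.
 by rewrite (ler_peMr km0)// exprn_ege1//; lra.
have km0: 0<=kap * mu by rewrite mulr_ge0 ?(ltW k0).
have main := hm eps (kap * mu) x0 rad _ _ _ _ c R0 km0 e0 cpos D (ub_mble uf) mh mulam uc.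
have lam0: 0<=lam by rewrite /lam /height mulr_ge0 ?exprn_ge0// divr_ge0 ?mulr_ge0 ?(ltW R0).
have IHE : (\int[@lebesgue R n]_(x in eball x0 rad) (maximal eps h x`^sig) = IH)%E.
 by apply: eq_integral=> x _; rewrite (gee0_abs (maximal_ge0 n0 x h0 e0)).
have I1le : (I1<=Cm%:E*((lam`^sig*(2*rad)^+n)%:E+IH))%E.
 apply: le_trans; last by rewrite -IHE; exact: main. apply: le_integral_ge0=> x _; first exact: poweR_ge0.
 have m0 := maximal_ge0 n0 x f10 e0. have mm := maximal_mono n0 x f10 f1f e0.
 rewrite (gee0_abs m0); exact: (poweR_mono (ltW s0) m0 mm).
have rb := root_bound n0 x0 s1 Cm0 R0 lam0 I10 IH0 I1le. rewrite -/B VE -/D1 /= in rb; apply: (le_trans rb).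
set X:= (_ `^ sig^-1)%E; have X0 : (0<=X)%E by exact: poweR_ge0. have lamle : lam<=K2*(V^-1*c1).
 have r1 : (48*n%:R/rad)^+n*(2*rad)^+n = (96*n%:R)^+n.
  by rewrite -exprMn; congr (_^+n); field; rewrite gt_eqF.
 have q0: 0<=(48*n%:R/rad)^+n by rewrite exprn_ge0// divr_ge0 ?mulr_ge0 ?(ltW R0).
 apply: (le_trans (ler_wpM2r q0 ck)). have cV : c1<=(2*rad)^+n*(V^-1*c1).
  by rewrite mulrA (ler_peMl c10)// ler_pdivlMr// mul1r V2.
 rewrite [leLHS]mulrAC; apply: (le_trans (ler_wpM2l (mulr_ge0 (powR_ge0 kap p) q0) cV)).
 by rewrite /K2 -r1 !mulrA.
have l1 : (lam%:E<=K2%:E*(V^-1*c1)%:E)%E by rewrite -EFinM lee_fin.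
have y0 : (0<=(V^-1*c1)%:E)%E by rewrite lee_fin; exact: W0.
apply: (@le_trans _ _ (D1%:E*((K2+1)%:E*((V^-1*c1)%:E+X)))%E).
 apply: lee_wpmul2l; first by rewrite lee_fin. rewrite (ge0_muleDr _ y0 X0); apply: leeD.
  by apply: (le_trans l1); apply: (lee_wpmul2r y0); rewrite lee_fin lerDl.
 by rewrite -[leLHS]mul1e; apply: (lee_wpmul2r X0); rewrite lee_fin lerDr.
rewrite muleA -EFinM; apply: lee_wpmul2r; first exact: adde_ge0. by rewrite lee_fin lerDr.
Qed.
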